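(* Assume that $\eta$ is finitely degenerate and let $g\in L^p(\Omega,(\hat w_p)^{p-1})$ be a radial function. For $u\in W$ let $$H(u)=\overline F(u)+\|u-g\|_{L^p(\Omega,(\hat w_p)^{p-1})}.$$ Then there exists a unique minimizer $u_0$ for the problem $\min_W H(u)$; i.e. there is a unique $u_0\in W$ such that $H(u_0)\le H(z)$ for every $z\in W$.
   Context: Setting. Let $d\ge 1$ be an integer, $1<p<\infty$. Let $0\le a<b<\infty$ and let $\Omega=\{x\in\mathbb R^d:|x|<b\}$ or $\Omega=\{x\in\mathbb R^d: a<|x|<b\}$. Let $\eta\ge 0$ a.e., $\eta\in L^1_{\rm loc}([0,+\infty))$ with compact support, and let $w(x)=\eta(|x|)$. The support $\mathrm{supp}(\eta)$ is identified with the bounded open interval $(a,b)$. Let $$I_{p,\mathrm{supp}(\eta)}=\{r\in(\mathrm{supp}(\eta))^\circ:\ \exists\,\epsilon>0,\ \eta^{-1/(p-1)}\in L^1((r-\epsilon,r+\epsilon))\},$$ an open set, written as the disjoint union of its components $(a_i,b_i)$, $i=1,\dots,N_\eta$, $N_\eta\le+\infty$ ($N_\eta=0$ if the set is empty). $\eta$ (or $w$) is called finitely degenerate if $1\le N_\eta<+\infty$. Put $I_{\Omega,w}=\{x\in\Omega:|x|\in I_{p,\mathrm{supp}(\eta)}\}$ and, for $a_i\le\alpha<\beta\le b_i$, $I_{\alpha,\beta}=\{x\in I_{\Omega,w}:\alpha<|x|<\beta\}$. Auxiliary weight. Write $k(y)=[|y|^{(d-1)p}w(y)]^{-1/(p-1)}$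 and $m_i=\frac{a_i+b_i}{2}$. The radial weight $\hat w_p:\Omega\to[0,\infty)$ is: $\hat w_p(x)=\big(\int_{I_{|x|,m_i}}k\,dy\big)^{-1}$ if $a_i<|x|\le\frac{3a_i+b_i}{4}$; $\hat w_p(x)=\big(\int_{I_{(3a_i+b_i)/4,(a_i+3b_i)/4}}k\,dy\big)^{-1}$ if $\frac{3a_i+b_i}{4}<|x|<\frac{a_i+3b_i}{4}$; $\hat w_p(x)=\big(\int_{I_{m_i,|x|}}k\,dy\big)^{-1}$ if $\frac{a_i+3b_i}{4}\le|x|<b_i$; at $|x|=a_i$ (resp. $|x|=b_i$) it is the limit of the first (resp. third) expression as $|x|\to a_i^+$ (resp. $|x|\to b_i^-$); $\hat w_p=0$ on $\Omega\setminus\overline{I_{\Omega,w}}$. $X=L^p(\Omega,(\hat w_p)^{p-1})$ is the space of measurable $u$ with $\int_\Omega|u|^p(\hat w_p)^{p-1}dx<\infty$, with its usual norm, functions being identified when they agree a.e. with respect to $(\hat w_p)^{p-1}dx$. Spaces. $\mathrm{Dom}_\eta$ is the set of $v:\mathrm{supp}(\eta)\to\mathbb R$ with $v\in W^{1,1}_{\rm loc}(I_{p,\mathrm{supp}(\eta)})$ and $\int_{I_{p,\mathrm{supp}(\eta)}}r^{d-1}|v'(r)|^p\eta(r)\,dr<\infty$. $\mathrm{Dom}_{r,w}$ is the set of measurable $u:\Omega\to\mathbb R$ with $u(x)=v(|x|)$ for some $v\in\mathrm{Dom}_\eta$ (equality being for $x\in\Omega$ with $|x|\in\mathrm{supp}(\eta)$).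 $W=\mathrm{Dom}_{r,w}\cap X$. $AC^d_r(\Omega)$ is the set of measurable $u:\Omega\to\mathbb R$ with $u\in W^{1,1}_{\rm loc}(I_{\Omega,w})$ and $u(x)=v(|x|)$ in $I_{\Omega,w}$ for some $v$ absolutely continuous on $\mathrm{supp}(\eta)$; when $\int_\Omega|\nabla u|^pw\,dx$ is written for such $u$, it is understood that $u(x)=v(|x|)$ for all $x\in\Omega$ with $|x|\in\mathrm{supp}(\eta)$, so $\nabla u(x)=v'(|x|)x/|x|$ a.e. there, while $w=0$ elsewhere. Relaxed functional. $F:X\to[0,+\infty]$ is $F(u)=\int_\Omega|\nabla u|^pw\,dx$ if $u\in AC^d_r(\Omega)$ and $F(u)=+\infty$ if $u\in X\setminus AC^d_r(\Omega)$. $\overline F$ is the lower semicontinuous envelope of $F$ with respect to the norm topology of $X$ (the largest lower semicontinuous functional on $X$ that is $\le F$). *)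

(* Defs.v *)
From HB Require Import structures.
From mathcomp Require Import all_boot all_order all_algebra.
From mathcomp Require Import all_classical all_reals all_analysis.

Set Implicit Arguments.
Unset Strict Implicit.
Unset Printing Implicit Defensive.

Import Order.TTheory GRing.Theory Num.Theory.
Import numFieldNormedType.Exports.

Local Open Scope classical_set_scope.
Local Open Scope ring_scope.

(* The library has no Lebesgue measure on R^d: rows
   'rV[R]_d get the sigma-algebra generated by the coordinates (the Borel one,
   the topology of 'rV[R]_d being the product topology), and rV_lebesgue below
   is the d-fold product of the Lebesgue measure of R. *)

Fact rV_display : measure_display. Proof. exact. Qed.

Section rV_measurable.
Context {R : realType} (d : nat).

Definition rV_coord (i : 'I_d) (x : 'rV[R]_d) : measurableTypeR R := x ord0 i.

Let rV_set0 : g_sigma_preimage rV_coord set0.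
Proof. exact: sigma_algebra0. Qed.

Let rV_setC A : g_sigma_preimage rV_coord A -> g_sigma_preimage rV_coord (~` A).
Proof. exact: sigma_algebraC. Qed.

Let rV_bigcup (F : _^nat) : (forall i, g_sigma_preimage rV_coord (F i)) ->
  g_sigma_preimage rV_coord (\bigcup_i (F i)).
Proof. exact: sigma_algebra_bigcup. Qed.

HB.instance Definition _ := @isMeasurable.Build rV_display 'rV[R]_d
  (g_sigma_preimage rV_coord) rV_set0 rV_setC rV_bigcup.

End rV_measurable.

Section rV_lebesgue.
Context {R : realType}.

Definition rV_cons n (z : measurableTypeR R * 'rV[R]_n) : 'rV[R]_n.+1 :=
  \row_i oapp (z.2 ord0) z.1 (unlift ord0 i).

Lemma rV_cons0 n z : @rV_cons n z ord0 ord0 = z.1.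
Proof. by rewrite mxE unlift_none. Qed.

Lemma rV_consS n z j : @rV_cons n z ord0 (lift ord0 j) = z.2 ord0 j.
Proof. by rewrite mxE liftK. Qed.

Lemma measurable_rV_coord n (i : 'I_n) :
  measurable_fun [set: 'rV[R]_n] (@rV_coord R n i).
Proof.
move=> _ Y mY; rewrite setTI; apply: sub_sigma_algebra => /=.
rewrite -bigcup_seq/=; exists i => /=; first by rewrite mem_index_enum.
by exists Y => //; rewrite setTI.
Qed.

Lemma measurable_fun_rV d' (T : measurableType d') n (f : T -> 'rV[R]_n) :
  (forall i, measurable_fun setT (rV_coord i \o f)) -> measurable_fun setT f.
Proof.
move=> mf _ A mA; rewrite setTI.
suff : <<s \big[setU/set0]_(i < n)
    preimage_set_system setT (@rV_coord R n i) measurable >> `<=`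
    [set B | measurable (f @^-1` B)] by exact.
apply: smallest_sub.
  split => /=.
  - by rewrite preimage_set0.
  - by move=> B mB; rewrite setTD preimage_setC; exact: measurableC.
  - by move=> F mF; rewrite preimage_bigcup; exact: bigcup_measurable.
case: n => [|n] in f mf A mA *; first by rewrite big_ord0.
rewrite -bigcup_mkord_ord; apply: bigcup_sub => i Ii.
move=> B [C mC <-] /=; rewrite setTI -comp_preimage -[X in measurable X]setTI.
exact: mf.
Qed.

Lemma measurable_rV_cons n : measurable_fun setT (@rV_cons n).
Proof.
apply: measurable_fun_rV => i; case: (unliftP ord0 i) => [j ->|->].
- rewrite (_ : _ \o _ = @rV_coord R n j \o snd).
    exact: measurableT_comp (measurable_rV_coord j) measurable_snd.
  by apply/funext => z; rewrite /= /rV_coord rV_consS.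
- rewrite (_ : _ \o _ = fst); first exact: measurable_fst.
  by apply/funext => z; rewrite /= /rV_coord rV_cons0.
Qed.

Section step.
Variables (n : nat) (m : {sigma_finite_measure set 'rV[R]_n -> \bar R}).
Local Open Scope ereal_scope.

Definition rV_lebesgueS : set 'rV[R]_n.+1 -> \bar R :=
  pushforward (@lebesgue_measure R \x m) (@rV_cons n).

Let measurable_preimage A : measurable A -> measurable (@rV_cons n @^-1` A).
Proof.
by move=> mA; rewrite -[X in measurable X]setTI; exact: measurable_rV_cons.
Qed.

Let rV_lebesgueS0 : rV_lebesgueS set0 = 0.
Proof. by rewrite /rV_lebesgueS /pushforward preimage_set0 measure0. Qed.

Let rV_lebesgueS_ge0 A : 0 <= rV_lebesgueS A.
Proof. by rewrite /rV_lebesgueS /pushforward measure_ge0. Qed.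

Let rV_lebesgueS_sigma_additive : semi_sigma_additive rV_lebesgueS.
Proof.
move=> F mF tF mUF; rewrite /rV_lebesgueS /pushforward preimage_bigcup.
apply: measure_semi_sigma_additive.
- by move=> k; exact: measurable_preimage.
- apply/trivIsetP => /= i j _ _ ij; rewrite -preimage_setI.
  by move/trivIsetP : tF => /(_ _ _ _ _ ij) ->//; rewrite preimage_set0.
- by rewrite -preimage_bigcup; exact: measurable_preimage.
Qed.

HB.instance Definition _ := isMeasure.Build _ _ _ rV_lebesgueS
  rV_lebesgueS0 rV_lebesgueS_ge0 rV_lebesgueS_sigma_additive.

Let rV_lebesgueS_sigma_finite : sigma_finite setT rV_lebesgueS.
Proof.
have [F [TF mF]] : sigma_finite setT (@lebesgue_measure R \x m).
  have /sigma_finiteP[F [TF ndF Foo]] := sigma_finiteT (@lebesgue_measure R).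
  have /sigma_finiteP[G [TG ndG Goo]] := sigma_finiteT m.
  exists (fun k => F k `*` G k).
    rewrite -setXTT TF TG predeqE => -[x y]; split.
      move=> [/= [k _ Fkx] [l _ Gly]]; exists (maxn k l) => //; split.
      - by move: x Fkx; exact/subsetPset/ndF/leq_maxl.
      - by move: y Gly; exact/subsetPset/ndG/leq_maxr.
    by move=> [k _ []/= ? ?]; split; exists k.
  move=> k; have [? ?] := Foo k; have [? ?] := Goo k.
  split; first exact: measurableX.
  by rewrite product_measure1E// lte_mul_pinfty// ge0_fin_numE.
pose hd (x : 'rV[R]_n.+1) : measurableTypeR R := rV_coord ord0 x.
pose tl (x : 'rV[R]_n.+1) : 'rV[R]_n := \row_j x ord0 (lift ord0 j).
have Kcons : cancel (@rV_cons n) (fun x => (hd x, tl x)).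
  move=> [t x]; congr pair; rewrite /hd /tl /rV_coord ?rV_cons0 //.
  by apply/rowP => j; rewrite mxE rV_consS.
pose G k := (fun x => (hd x, tl x)) @^-1` F k.
have mh : measurable_fun setT (fun x => (hd x, tl x)).
  apply/measurable_fun_pairP; split; first exact: measurable_rV_coord.
  apply: measurable_fun_rV => j.
  rewrite (_ : _ \o _ = @rV_coord R _ (lift ord0 j)).
    exact: measurable_rV_coord.
  by apply/funext => x /=; rewrite /rV_coord mxE.
exists G; first by rewrite /G -preimage_bigcup -TF preimage_setT.
move=> k; have [mFk Fk] := mF k; split.
  by rewrite -[X in measurable X]setTI; exact: mh.
rewrite /rV_lebesgueS /pushforward /G -comp_preimage.
by rewrite (_ : _ \o _ = id) // funeqE => z /=; exact: Kcons.
Qed.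

HB.instance Definition _ := Measure_isSigmaFinite.Build _ _ _ rV_lebesgueS
  rV_lebesgueS_sigma_finite.

End step.

Fixpoint rV_lebesgue n : {sigma_finite_measure set 'rV[R]_n -> \bar R} :=
  if n is m.+1 then rV_lebesgueS (rV_lebesgue m)
  else \d_ (0 : 'rV[R]_0).

End rV_lebesgue.

(* The library norm of 'rV[R]_d is the sup norm. *)
Definition enorm {R : realType} {d : nat} (x : 'rV[R]_d) : R :=
  Num.sqrt (\sum_i x ord0 i ^+ 2).

Section one_dim.
Context {R : realType}.
Notation mu := (@lebesgue_measure R).
Implicit Types (eta v dv phi : R -> R) (U : set R).

(* Support, in [0, +oo[, of the a.e. class of eta: the complement of the
   largest relatively open set on which eta vanishes a.e. *)
Definition ess_support eta : set R :=
  [set r | 0 <= r /\ ~ exists2 e, 0 < e &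
    {ae mu, forall s, 0 <= s -> `|s - r| < e -> eta s = 0}].

(* eta >= 0 a.e., eta in L^1_loc([0, +oo[), with support the closure of the
   interval ]a, b[ with which it is identified. *)
Definition radial_weight (a b : R) eta :=
  [/\ {ae mu, forall r, 0 <= r -> 0 <= eta r},
      forall K : set R, K `<=` `[0, +oo[ -> compact K -> mu.-integrable K (EFin \o eta) &
      ess_support eta = `[a, b]%classic].

(* eta^(-1/(p-1)), equal to +oo where eta = 0: since powR 0 (- c) = 0, the
   inverse has to be taken in \bar R. *)
Definition inv_weight (p : R) eta (r : R) : \bar R :=
  ((eta r `^ (p - 1)^-1)%:E^-1)%E.

Definition Ip (p a b : R) eta : set R :=
  [set r | a < r < b /\ exists2 e, 0 < e &
    mu.-integrable `]r - e, r + e[%classic (inv_weight p eta)].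

Definition components (p a b : R) eta : set (R * R) :=
  [set c | exists2 r, Ip p a b eta r &
    connected_component (Ip p a b eta) r = `]c.1, c.2[%classic].

Definition finitely_degenerate (p a b : R) eta :=
  components p a b eta !=set0 /\ finite_set (components p a b eta).

Definition test_fun U phi :=
  (forall n x, derivable (derive1n n phi) x 1) /\
  exists2 K, compact K & K `<=` U /\ forall x, ~ K x -> phi x = 0.

Definition weak_derivative U v dv :=
  forall phi, test_fun U phi ->
    (\int[mu]_(r in U) (v r * derive1 phi r) = - \int[mu]_(r in U) (dv r * phi r))%R.

(* v belongs to W^{1,1}_loc(U) and dv is its weak derivative. *)
Definition W11loc U v dv :=
  [/\ locally_integrable U v, locally_integrable U dv & weak_derivative U v dv].

Definition abs_continuous (a b : R) v :=
  forall e, 0 < e -> exists2 delta, 0 < delta &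
    forall n (s t : 'I_n -> R),
      (forall i, [/\ a < s i, s i <= t i & t i < b]) ->
      (forall i j, i != j -> t i <= s j \/ t j <= s i) ->
      \sum_i (t i - s i) < delta ->
      \sum_i `|v (t i) - v (s i)| < e.

End one_dim.

Section several_dim.
Context {R : realType} {d : nat}.
Notation mu := (@rV_lebesgue R d).
Implicit Types (u phi : 'rV[R]_d -> R) (U : set 'rV[R]_d).

Definition partial (i : 'I_d) u : 'rV[R]_d -> R := 'D_(delta_mx ord0 i) u.

Definition rV_test_fun U phi :=
  (forall (s : seq 'I_d) x, differentiable (foldr partial phi s) x) /\
  exists2 K, compact K & K `<=` U /\ forall x, ~ K x -> phi x = 0.

Definition rV_locally_integrable U u :=
  [/\ measurable_fun U u, open U &
      forall K, K `<=` U -> compact K -> (\int[mu]_(x in K) `|u x|%:E < +oo)%E].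

Definition rV_W11loc U u :=
  rV_locally_integrable U u /\
  exists Du : 'I_d -> 'rV[R]_d -> R, forall i,
    rV_locally_integrable U (Du i) /\
    forall phi, rV_test_fun U phi ->
      (\int[mu]_(x in U) (u x * partial i phi x) =
       - \int[mu]_(x in U) (Du i x * phi x))%R.

End several_dim.

(* Functions on Omega are represented by total functions on 'rV[R]_d; only
   their values on Omega are ever used. *)
Section radial_problem.
Context {R : realType} {d : nat}.
Variables (p a b : R) (eta : R -> R) (Omega : set 'rV[R]_d).
Notation mu := (@rV_lebesgue R d).
Notation I := (Ip p a b eta).
Implicit Types (u z g : 'rV[R]_d -> R) (v : R -> R) (G : ('rV[R]_d -> R) -> \bar R).

Definition weight (x : 'rV[R]_d) : R := eta (enorm x).

Definition I_Omega : set 'rV[R]_d := [set x | Omega x /\ I (enorm x)].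

Definition shell (alpha beta : R) : set 'rV[R]_d :=
  [set x | I_Omega x /\ alpha < enorm x < beta].

Definition kfun (y : 'rV[R]_d) : \bar R :=
  (((enorm y `^ ((d%:R - 1) * p) * weight y) `^ (p - 1)^-1)%:E^-1)%E.

Definition inv_kint (alpha beta : R) : R :=
  fine ((\int[mu]_(y in shell alpha beta) kfun y)^-1)%E.

(* Radial profile of the auxiliary weight at t = |x|.  At an endpoint shared by
   two components the two one-sided limits may differ; the right-hand one is
   used (this concerns a null set of x only). *)
Definition aux_profile (t : R) : R :=
  let C := components p a b eta in
  if `[< exists2 c, C c & c.1 < t < c.2 >] then
    let c := get [set c | C c /\ c.1 < t < c.2] in
    let m := (c.1 + c.2) / 2 in
    let q1 := (3 * c.1 + c.2) / 4 in
    let q3 := (c.1 + 3 * c.2) / 4 in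
    if t <= q1 then inv_kint t m
    else if t < q3 then inv_kint q1 q3
    else inv_kint m t
  else if `[< exists r, C (t, r) >] then
    let r := get [set r | C (t, r)] in
    lim (inv_kint s ((t + r) / 2) @[s --> t^'+])
  else if `[< exists l, C (l, t) >] then
    let l := get [set l | C (l, t)] in
    lim (inv_kint ((l + t) / 2) s @[s --> t^'-])
  else 0.

Definition aux_weight (x : 'rV[R]_d) : R := aux_profile (enorm x).

Definition Xint u : \bar R :=
  (\int[mu]_(x in Omega) (`|u x| `^ p * aux_weight x `^ (p - 1))%:E)%E.

Definition Xspace : set ('rV[R]_d -> R) :=
  [set u | measurable_fun Omega u /\ (Xint u < +oo)%E].

Definition Xnorm u : \bar R := (Xint u `^ p^-1)%E.

(* Equality in X: the set where u and z differ is null for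
   (aux_weight)^(p-1) dx. *)
Definition Xeq u z :=
  (\int[mu]_(x in Omega `&` [set x | u x != z x])
     (aux_weight x `^ (p - 1))%:E = 0)%E.

Definition Dom_eta : set (R -> R) :=
  [set v | exists2 dv, W11loc I v dv &
    (\int[lebesgue_measure]_(r in I)
       (r ^+ d.-1 * `|dv r| `^ p * eta r)%:E < +oo)%E].

Definition Dom_rw : set ('rV[R]_d -> R) :=
  [set u | measurable_fun Omega u /\
    exists2 v, Dom_eta v &
      forall x, Omega x -> a < enorm x < b -> u x = v (enorm x)].

Definition Wspace := Dom_rw `&` Xspace.

Definition profile u v :=
  abs_continuous a b v /\ forall x, I_Omega x -> u x = v (enorm x).

Definition ACdr : set ('rV[R]_d -> R) :=
  [set u | [/\ measurable_fun Omega u, rV_W11loc I_Omega u &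
               exists v, profile u v]].

(* The integral of |grad u|^p w for u(x) = v(|x|), for which
   |grad u(x)| = |v'(|x|)|. *)
Definition energy v : \bar R :=
  (\int[mu]_(x in Omega) (`|derive1 v (enorm x)| `^ p * weight x)%:E)%E.

(* The profile of u in ACdr is determined on I only.  As elements of X do not
   see the values at |x| outside the closure of I, the energy of u is the
   infimum over its profiles; it is energy v when the profile v is unique. *)
Definition Ffun u : \bar R :=
  if `[< ACdr u >] then ereal_inf [set energy v | v in profile u] else +oo%E.

(* Lower semicontinuity for the norm topology of X.  Such a G takes equal
   values at functions at distance 0, so it is a functional on the quotient. *)
Definition Xlsc G :=
  forall u (c : R), Xspace u -> (c%:E < G u)%E ->
    exists2 e : R, 0 < e &
      forall z, Xspace z -> (Xnorm (z \- u)%R < e%:E)%E -> (c%:E < G z)%E.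

Definition relaxedF u : \bar R :=
  ereal_sup [set G u | G in
    [set G | Xlsc G /\ forall z, Xspace z -> (G z <= Ffun z)%E]].

Definition Hfun g u : \bar R := (relaxedF u + Xnorm (u \- g)%R)%E.

End radial_problem.

(* Main.v *)
(* Let I be the union of the components, E the energy int_I |v'|^p rho dr of a
   radial profile v, with rho(r) = omega r^(d-1) eta(r), and J = E + ||. - g||.

   On W the relaxed functional is the least energy of a profile: it is at most
   that because every profile in W is approximated by absolutely continuous ones.
   One truncates it near the endpoints of the components, where Hoelder's
   inequality and the definition of the auxiliary weight give a Hardy type bound
   on |v(s) - v(r)|^p hat_w(r)^(p-1) that makes dominated convergence work, and
   joins the components by steep bumps; these cost no energy in the limit, since
   eta^(-1/(p-1)) is not integrable around an interior endpoint.  It is at least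
   that because the least energy is lower semicontinuous: along a sequence
   converging in X, near-minimal weak derivatives are Cauchy in L^p(rho) by
   uniform convexity, and convergence in X or in L^p(rho) implies convergence in
   L^1_loc(I), which preserves weak derivatives.

   Midpoints of a minimizing sequence of J have almost minimal J, so the
   convexity gaps of the energy and of the norm both tend to 0.  Uniform
   convexity of L^p(rho) makes the energies converge, hence also the norms
   ||u_n - g||, and then uniform convexity of X makes u_n Cauchy.  Its limit is a
   minimizer, and alternating two minimizers gives uniqueness. *)

Require Import Defs.
From HB Require Import structures.
From mathcomp Require Import all_boot all_order all_algebra.
From mathcomp Require Import all_classical all_reals all_analysis.
From mathcomp Require Import measurable_realfun ring lra zify.

Set Implicit Arguments.
Unset Strict Implicit.
Unset Printing Implicit Defensive.

Import Order.TTheory GRing.Theory Num.Theory.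
Import numFieldNormedType.Exports.

Local Open Scope classical_set_scope.
Local Open Scope ring_scope.

(** The penalty in H is a norm, not a p-th power: it is affine on the half-lines issued from g, so
    it gives no strict convexity by itself. This is why the energy, a p-th power, is handled first.
    Once the energies of a minimizing sequence converge, the norms converge too, and between nearly
    equal norms a small convexity gap of the norm is a small gap of its p-th power, to which uniform
    convexity applies.

    Weak compactness is replaced throughout by one device: near-minimizers in a convex set have
    nearly minimal midpoints, hence are Cauchy. This calls for a convex relation that is closed
    under strong limits, and [has_profile u f] is that relation: f is a weak derivative on I of a
    profile of u.

    The definitions involve test functions, pointwise derivatives of absolutely continuous functions
    and integrals over R^d. Hence the need for smooth cut-offs, for the passage between primitives
    and weak derivatives in both directions, for the Radon-Nikodym density of an absolutely
    continuous function, and for polar coordinates. *)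

Section power_inequalities.
Context {R : realType}.
Implicit Types (p s t x y z e : R).

Lemma ler_powR_norm p x y : 0 <= p -> `|x| <= `|y| -> `|x| `^ p <= `|y| `^ p.
Proof. by move=> p0; apply: ge0_ler_powR => //; rewrite nnegrE. Qed.

Lemma powR_normD p s t : 0 <= p ->
  `|s + t| `^ p <= 2 `^ p * (`|s| `^ p + `|t| `^ p).
Proof.
move=> p0; wlog st : s t / `|s| <= `|t|.
  move=> h; have [/h//|/ltW/h] := leP `|s| `|t|.
  by rewrite addrC [X in _ * X]addrC.
apply: (@le_trans _ _ ((2 * `|t|) `^ p)).
  apply: ge0_ler_powR => //; rewrite ?nnegrE ?mulr_ge0//.
  by rewrite (le_trans (ler_normD _ _))// mulr2n mulrDl !mul1r lerD2r.
by rewrite powRM// ler_wpM2l ?powR_ge0// lerDr powR_ge0.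
Qed.

(** The midpoint convexity gap of the p-th power at the pair (1, y), to which homogeneity reduces
    pairs of positive numbers. *)
Let h p y := (1 + y `^ p) / 2 - ((1 + y) / 2) `^ p.

Let h_derive p z : 0 < z ->
  is_derive z 1 (h p) (p * z `^ (p - 1) / 2 - p * ((1 + z) / 2) `^ (p - 1) / 2).
Proof.
move=> z0; have z1 : 0 < (1 + z) / 2 by rewrite divr_gt0// addr_gt0.
have H1 : is_derive z 1 (fun y => (1 + y `^ p) / 2) (p * z `^ (p - 1) / 2).
  have := is_derive1_powR p z0 => ?.
  by apply: is_derive_eq; rewrite /GRing.scale/=; ring.
have H2 : is_derive z 1 (fun y => ((1 + y) / 2) `^ p)
    (p * ((1 + z) / 2) `^ (p - 1) / 2).
  have Hi : is_derive z 1 (fun y => (1 + y) / 2) (2^-1).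
    by apply: is_derive_eq; rewrite /GRing.scale/=; ring.
  have := is_derive1_powR p z1 => Ho.
  exact: (@is_derive1_comp _ (fun y => y `^ p) (fun y => (1 + y) / 2) z _ _ Ho Hi).
exact: is_deriveB.
Qed.

(** The derivative has the sign of z^(p-1) - ((1+z)/2)^(p-1), which is negative for z < 1. *)
Let h_sdecr p x y : 1 < p -> 0 < x -> x < y -> y <= 1 -> h p y < h p x.
Proof.
move=> p1 x0 xy y1.
have [c /[!in_itv]/= /andP[xc cy] hc] : exists2 c, c \in `]x, y[ & h p y - h p x =
    (p * c `^ (p - 1) / 2 - p * ((1 + c) / 2) `^ (p - 1) / 2) * (y - x).
  apply: MVT => //.
  - by move=> z /[!in_itv]/= /andP[xz _]; apply: h_derive; exact: lt_trans xz.
  - apply: derivable_within_continuous => z /[!in_itv]/= /andP[xz _].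
    by have [] := @h_derive p z (lt_le_trans x0 xz).
rewrite -subr_lt0 hc pmulr_llt0 ?subr_gt0//.
have c0 : 0 < c by exact: lt_trans xc.
rewrite -mulrBl pmulr_llt0// -mulrBr pmulr_rlt0 ?(lt_trans _ p1)// subr_lt0.
by apply: gt0_ltr_powR; rewrite ?nnegrE ?subr_gt0 ?(ltW c0)//; lra.
Qed.

Let h_decr p x y : 1 < p -> 0 < x -> x <= y -> y <= 1 -> h p y <= h p x.
Proof.
by move=> p1 x0; rewrite le_eqVlt => /predU1P[->//|xy y1]; exact/ltW/h_sdecr.
Qed.

Let h_gt0 p y : 1 < p -> 0 < y -> y < 1 -> 0 < h p y.
Proof.
move=> p1 y0 y1; have := h_sdecr p1 y0 y1 (lexx _).
by rewrite /h powR1 -[1 + 1]/2 divff// powR1 subrr.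
Qed.

Let gap_pos p tau : 1 < p -> 0 < tau -> tau <= 1 ->
  0 <= (1 + `|tau| `^ p) / 2 - `|(1 + tau) / 2| `^ p.
Proof.
move=> p1 t0 t1.
rewrite !ger0_norm ?(ltW t0)//; last by lra.
move: t1; rewrite le_eqVlt => /predU1P[->|t1].
  by rewrite powR1 -[1 + 1]/2 divff// powR1 subrr.
exact/ltW/h_gt0.
Qed.

(** For tau <= 0 the midpoint (1 + tau)/2 is at most 1/2; the bound is the gap at tau = 0. *)
Let gap_neg p tau : 1 < p -> -1 <= tau -> tau <= 0 ->
  2^-1 - 2^-1 `^ p <= (1 + `|tau| `^ p) / 2 - `|(1 + tau) / 2| `^ p.
Proof.
move=> p1 t0 t1; apply: lerB.
  by have := powR_ge0 `|tau| p; lra.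
rewrite ger0_norm; last by lra.
by apply: ge0_ler_powR; rewrite ?nnegrE; lra.
Qed.

Let half_lt p : 1 < p -> 0 < 2^-1 - 2^-1 `^ p.
Proof.
move=> p1; rewrite subr_gt0.
have := @gt0_ltr_powR _ (p - 1) _ 2^-1 1.
rewrite !nnegrE subr_gt0 p1 powR1 => /(_ isT).
rewrite invr_ge0 ler0n ler01 => /(_ isT isT).
have -> : (2^-1 < 1 :> R) by lra.
move=> /(_ isT) H.
by rewrite -(@mulr_powRB1 _ 2^-1)//; lra.
Qed.

(* By homogeneity and symmetry one may take s = 1 and t in [-1, 1]; away from
   t = 1 the gap in the convexity inequality is bounded below. *)
Lemma powR_uniform_convexity p e : 1 < p -> 0 < e -> exists2 C, 0 <= C &
  forall s t, `|s - t| `^ p <= e * (`|s| `^ p + `|t| `^ p) +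
    C * ((`|s| `^ p + `|t| `^ p) / 2 - `|(s + t) / 2| `^ p).
Proof.
move=> p1 e0; have p0 : 0 < p by lra.
(* [et] is the distance of tau to 1 below which |1 - tau|^p <= e holds at once. Farther away the gap
   is at least [m], and the crude bound |1 - tau|^p <= 2^p is absorbed by the constant 2^p / m. *)
pose et := Num.min (e `^ p^-1) 2^-1.
have et0 : 0 < et by rewrite lt_min powR_gt0//=.
have et1 : et <= 2^-1 by rewrite ge_min lexx orbT.
have etp : et `^ p <= e.
  apply: (@le_trans _ _ ((e `^ p^-1) `^ p)).
    by apply: ge0_ler_powR; rewrite ?nnegrE ?powR_ge0 ?(ltW p0) ?(ltW et0)// ge_min lexx.
  by rewrite -powRrM mulVf ?gt_eqF// powRr1// ltW.
pose m := Num.min (2^-1 - 2^-1 `^ p) (h p (1 - et)).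
have m0 : 0 < m by rewrite lt_min half_lt//= h_gt0//; lra.
have key tau : -1 <= tau -> tau <= 1 ->
  `|1 - tau| `^ p <= e * (1 + `|tau| `^ p) +
    2 `^ p / m * ((1 + `|tau| `^ p) / 2 - `|(1 + tau) / 2| `^ p).
  move=> t1 t2.
  have [tle|tgt] := leP tau (1 - et); last first.
    have gp : 0 <= (1 + `|tau| `^ p) / 2 - `|(1 + tau) / 2| `^ p.
      by apply: gap_pos => //; lra.
    have [tp0 Cp0] : 0 <= `|tau| `^ p /\ 0 <= 2 `^ p / m.
      by split; [exact: powR_ge0|rewrite divr_ge0 ?powR_ge0// ltW].
    rewrite (@le_trans _ _ e)//; last first.
      by have := mulr_ge0 Cp0 gp; have := mulr_ge0 (ltW e0) tp0; lra.
    apply: le_trans etp; apply: ge0_ler_powR; rewrite ?nnegrE ?(ltW p0) ?(ltW et0)//.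
    by rewrite ger0_norm; lra.
  have gm : m <= (1 + `|tau| `^ p) / 2 - `|(1 + tau) / 2| `^ p.
    have [tn|tp] := leP tau 0.
      by apply: le_trans (gap_neg p1 t1 tn); rewrite ge_min lexx.
    apply: (@le_trans _ _ (h p (1 - et))); first by rewrite ge_min lexx orbT.
    rewrite !ger0_norm ?(ltW tp)//; last by lra.
    by apply: h_decr => //; lra.
  have h2 : `|1 - tau| `^ p <= 2 `^ p.
    by apply: ge0_ler_powR; rewrite ?nnegrE ?(ltW p0)// ger0_norm; lra.
  rewrite (le_trans h2)// -[leLHS]add0r lerD//.
    by rewrite mulr_ge0 ?addr_ge0 ?powR_ge0 ?ltW.
  by rewrite -mulrA ler_peMr ?powR_ge0// ler_pdivlMl// mulr1.
exists (2 `^ p / m); first by rewrite divr_ge0 ?powR_ge0// ltW.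
move=> s t; wlog st : s t / `|t| <= `|s|.
  move=> H; have [/H//|/ltW/H] := leP `|t| `|s|.
  by rewrite distrC (addrC (`|t| `^ p)) (addrC t s).
have [s0|s0] := eqVneq s 0.
  move: st; rewrite s0 normr0 normr_le0 => /eqP ->.
  by rewrite addr0 subrr normr0 powR0 ?gt_eqF// addr0 mulr0 !mul0r normr0 powR0 ?gt_eqF// subrr mulr0 addr0.
pose tau := t / s.
have tE : t = s * tau by rewrite /tau mulrC divfK.
have nt : `|tau| <= 1 by rewrite normrM normfV ler_pdivrMr ?normr_gt0// mul1r.
move: nt; rewrite ler_norml => /andP[t1 t2].
have /(ler_wpM2l (powR_ge0 `|s| p)) := key tau t1 t2.
have -> : s - t = s * (1 - tau) by rewrite tE; ring.
have -> : (s + t) / 2 = s * ((1 + tau) / 2) by rewrite tE; ring.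
by rewrite tE !normrM !powRM//; lra.
Qed.

Lemma powR_midpoint p s t : 1 < p ->
  `|(s + t) / 2| `^ p <= (`|s| `^ p + `|t| `^ p) / 2.
Proof.
move=> p1; wlog st : s t / `|t| <= `|s|.
  move=> H; have [/H//|/ltW/H] := leP `|t| `|s|.
  by rewrite (addrC (`|t| `^ p)) (addrC t s).
have [s0|s0] := eqVneq s 0.
  move: st; rewrite s0 normr0 normr_le0 => /eqP ->.
  by rewrite add0r mul0r normr0 powR0 ?addr0 ?mul0r// gt_eqF//; lra.
pose tau := t / s.
have tE : t = s * tau by rewrite /tau mulrC divfK.
have nt : `|tau| <= 1 by rewrite normrM normfV ler_pdivrMr ?normr_gt0// mul1r.
move: nt; rewrite ler_norml => /andP[t1 t2].
have : 0 <= (1 + `|tau| `^ p) / 2 - `|(1 + tau) / 2| `^ p.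
  have [tn|tp] := leP tau 0; last exact: gap_pos.
  exact/(le_trans _ (gap_neg p1 t1 tn))/ltW/half_lt.
move=> /(mulr_ge0 (powR_ge0 `|s| p)).
have -> : (s + t) / 2 = s * ((1 + tau) / 2) by rewrite tE; ring.
by rewrite tE !normrM !powRM//; lra.
Qed.

Lemma continuous_powR_norm p : 0 < p -> continuous (fun y : R => `|y| `^ p).
Proof.
move=> p0 y; have [->|y0] := eqVneq y 0.
  rewrite /continuous_at normr0 powR0 ?gt_eqF//.
  apply/cvgrPdist_le => e e0; near=> z.
  rewrite sub0r normrN ger0_norm ?powR_ge0//.
  rewrite -[leRHS](@powRr1 _ e) ?(ltW e0)// -(@mulVf _ p) ?gt_eqF// powRrM.
  apply: ge0_ler_powR; rewrite ?nnegrE ?powR_ge0 ?(ltW p0)//.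
  near: z; exists (e `^ p^-1) => /=; first exact: powR_gt0.
  by move=> z /=; rewrite sub0r normrN => /ltW.
apply: (@continuous_comp R R R (fun z => `|z|) (fun z => z `^ p)).
  exact: norm_continuous.
apply: differentiable_continuous; apply/derivable1_diffP.
by apply: derivable_powR; rewrite in_itv/= andbT normr_gt0.
Unshelve. all: by end_near. Qed.

End power_inequalities.

(** One definition serves both L^p(rho) on the line and X on R^d. It is locked, so that the integral
    stays folded until an explicit [unlock]. *)
HB.lock Definition wint d (T : measurableType d) (R : realType)
    (mu : {measure set T -> \bar R}) (D : set T) (w : T -> R) (p : R)
    (f : T -> R) : \bar R :=
  (\int[mu]_(x in D) (`|f x| `^ p * w x)%:E)%E.
Canonical wint_unlockable := Unlockable wint.unlock.

(** * Weighted Lebesgue spaces *)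

Section weighted_Lp.
Context d (T : measurableType d) (R : realType) (mu : {measure set T -> \bar R}).
Variables (D : set T) (w : T -> R) (p : R).
Hypotheses (mD : measurable D) (mw : measurable_fun D w)
  (w0 : forall x, D x -> 0 <= w x) (p1 : 1 < p).
Implicit Types f g h m : T -> R.

Let p_gt0 : 0 < p. Proof. exact: lt_trans p1. Qed.
Let p_ge0 : 0 <= p. Proof. exact: ltW. Qed.

Local Notation wint := (wint mu D w p).

Definition inLp f := measurable_fun D f /\ (wint f < +oo)%E.

Definition wNp f : R := fine (wint f).

Lemma measurable_wint f : measurable_fun D f ->
  measurable_fun D (fun x => (`|f x| `^ p * w x)%:E).
Proof.
move=> mf; apply/measurable_EFinP/measurable_funM => //.
apply: (measurableT_comp (@measurable_powR R p)).
exact: measurableT_comp.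
Qed.

Lemma wint_ge0 f : (0 <= wint f)%E.
Proof. by rewrite unlock; apply: integral_ge0 => x Dx; rewrite lee_fin mulr_ge0 ?powR_ge0// w0. Qed.

Lemma wNp_ge0 f : 0 <= wNp f. Proof. by rewrite fine_ge0// wint_ge0. Qed.

Lemma wint_fin f : inLp f -> wint f = (wNp f)%:E.
Proof. by move=> [_ ?]; rewrite fineK// ge0_fin_numE// wint_ge0. Qed.

Let wint_comb f g (a b : R) : measurable_fun D f -> measurable_fun D g ->
  0 <= a -> 0 <= b ->
  (\int[mu]_(x in D) ((a * `|f x| `^ p + b * `|g x| `^ p) * w x)%:E =
   a%:E * wint f + b%:E * wint g)%E.
Proof.
move=> mf mg a0 b0.
have nn h (k : R) x : 0 <= k -> D x -> (0 <= k%:E * (`|h x| `^ p * w x)%:E)%E.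
  by move=> k0 Dx; rewrite -EFinM lee_fin !mulr_ge0 ?powR_ge0 ?w0.
have mz h (k : R) : measurable_fun D h ->
    measurable_fun D (fun x => k%:E * (`|h x| `^ p * w x)%:E)%E.
  by move=> mh; apply: emeasurable_funM => //; exact: measurable_wint.
have Z h k : measurable_fun D h -> 0 <= k ->
    (\int[mu]_(x in D) (k%:E * (`|h x| `^ p * w x)%:E) = k%:E * wint h)%E.
  move=> mh k0; rewrite unlock; apply: ge0_integralZl_EFin => //.
  - by move=> x Dx; rewrite lee_fin mulr_ge0 ?powR_ge0 ?w0.
  - exact: measurable_wint.
rewrite -(Z f a mf a0) -(Z g b mg b0).
rewrite -(ge0_integralD mu mD (fun x => nn f a x a0) (mz f a mf)
  (fun x => nn g b x b0) (mz g b mg)).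
by apply: eq_integral => x _; rewrite -!EFinM -EFinD !mulrA -mulrDl.
Qed.

(** Two terms on each side: the negative term of the uniform convexity inequality is moved to the
    left, so that integrating it involves no subtraction in [\bar R]. *)
Let wint_le22 f g h m (a b c : R) : measurable_fun D f -> measurable_fun D g ->
  measurable_fun D h -> measurable_fun D m -> 0 <= a -> 0 <= b -> 0 <= c ->
  (forall x, D x -> `|h x| `^ p + c * `|m x| `^ p <=
                    a * `|f x| `^ p + b * `|g x| `^ p) ->
  (wint h + c%:E * wint m <= a%:E * wint f + b%:E * wint g)%E.
Proof.
move=> mf mg mh mm a0 b0 c0 H.
rewrite -[X in (X + _ <= _)%E]mul1e -(wint_comb mh mm ler01 c0) -(wint_comb mf mg a0 b0).
have mc f' g' (k l : R) : measurable_fun D f' -> measurable_fun D g' ->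
    measurable_fun D (fun x => ((k * `|f' x| `^ p + l * `|g' x| `^ p) * w x)%:E).
  move=> mf' mg'; apply/measurable_EFinP/measurable_funM => //.
  by apply: measurable_funD; apply: measurable_funM => //;
    apply: (measurableT_comp (@measurable_powR R p)); exact: measurableT_comp.
apply: ge0_le_integral => //.
- by move=> x Dx; rewrite lee_fin mulr_ge0 ?w0// addr_ge0 ?mulr_ge0 ?powR_ge0.
- exact: mc.
- exact: mc.
- by move=> x Dx; rewrite lee_fin ler_wpM2r ?w0// mul1r H.
Qed.

Lemma wint_le2 f g h (a b : R) : measurable_fun D f -> measurable_fun D g ->
  measurable_fun D h -> 0 <= a -> 0 <= b ->
  (forall x, D x -> `|h x| `^ p <= a * `|f x| `^ p + b * `|g x| `^ p) ->
  (wint h <= a%:E * wint f + b%:E * wint g)%E.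
Proof.
move=> mf mg mh a0 b0 H.
have := @wint_le22 f g h h a b 0 mf mg mh mh a0 b0 (lexx _).
by rewrite mul0e adde0; apply => x Dx; rewrite mul0r addr0 H.
Qed.

Lemma inLpD f g : inLp f -> inLp g -> inLp (f \+ g).
Proof.
move=> f1 g1; have [[mf _] [mg _]] := (f1, g1).
have mfg : measurable_fun D (f \+ g) by exact: measurable_funD.
split=> //; apply: le_lt_trans (@wint_le2 f g (f \+ g) (2 `^ p) (2 `^ p)
  mf mg mfg (powR_ge0 _ _) (powR_ge0 _ _) _) _.
  by move=> x Dx; rewrite -mulrDr; exact: powR_normD.
by rewrite wint_fin// (wint_fin g1) -!EFinM -EFinD ltry.
Qed.

Lemma inLpZ f (k : R) : inLp f -> inLp (fun x => k * f x).
Proof.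
move=> f1; have [mf _] := f1.
have mkf : measurable_fun D (fun x => k * f x) by exact: measurable_funM.
split=> //; apply: le_lt_trans (@wint_le2 f f _ (`|k| `^ p) 0
  mf mf mkf (powR_ge0 _ _) (lexx _) _) _.
  by move=> x Dx; rewrite normrM powRM// mul0r addr0.
by rewrite wint_fin// -!EFinM -EFinD ltry.
Qed.

Lemma eq_wint f g : (forall x, D x -> f x = g x) -> wint f = wint g.
Proof.
by move=> fg; rewrite !unlock; apply: eq_integral => x /[!inE] Dx; rewrite fg.
Qed.

Lemma eq_inLp f g : (forall x, D x -> f x = g x) -> inLp f -> inLp g.
Proof.
move=> fg [mf fy]; split; last by rewrite -(eq_wint fg).
by apply: eq_measurable_fun mf => x /[!inE]; exact: fg.
Qed.

Lemma inLpB f g : inLp f -> inLp g -> inLp (f \- g).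
Proof.
move=> f1 /(inLpZ (-1)) g1; apply: eq_inLp (inLpD f1 g1) => x _ /=.
by rewrite mulN1r.
Qed.

Lemma inLp_mid f g : inLp f -> inLp g -> inLp (fun x => (f x + g x) / 2).
Proof.
move=> f1 g1; apply: eq_inLp (inLpZ 2^-1 (inLpD f1 g1)) => x _ /=.
by rewrite mulrC.
Qed.

Lemma wint_sym f g : wint (f \- g) = wint (g \- f).
Proof. by rewrite !unlock; apply: eq_integral => x _ /=; rewrite distrC. Qed.

Lemma wint_midpoint f g : measurable_fun D f -> measurable_fun D g ->
  (wint (fun x => (f x + g x) / 2)%R <= 2^-1%:E * wint f + 2^-1%:E * wint g)%E.
Proof.
move=> mf mg; apply: wint_le2 => //.
- by apply: measurable_funM => //; exact: measurable_funD.
- by move=> x _; have := powR_midpoint (f x) (g x) p1; lra.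
Qed.

Lemma wNp_midpoint f g : inLp f -> inLp g ->
  wNp (fun x => (f x + g x) / 2) <= (wNp f + wNp g) / 2.
Proof.
move=> f1 g1; have := wint_midpoint f1.1 g1.1.
rewrite (wint_fin (inLp_mid f1 g1)) (wint_fin f1) (wint_fin g1).
by rewrite -!EFinM -EFinD lee_fin -mulrDr mulrC.
Qed.

Lemma wNpD_le f g : inLp f -> inLp g ->
  wNp (f \+ g) <= 2 `^ p * (wNp f + wNp g).
Proof.
move=> f1 g1; have := @wint_le2 f g (f \+ g) (2 `^ p) (2 `^ p)
  f1.1 g1.1 (inLpD f1 g1).1 (powR_ge0 _ _) (powR_ge0 _ _).
rewrite (wint_fin (inLpD f1 g1)) (wint_fin f1) (wint_fin g1).
rewrite -!EFinM -EFinD lee_fin mulrDr; apply => x Dx.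
by rewrite -mulrDr; exact: powR_normD.
Qed.

Lemma wNp_uniform_convexity (e : R) : 0 < e -> exists2 C, 0 <= C &
  forall f g, inLp f -> inLp g ->
    wNp (f \- g) <= e * (wNp f + wNp g) +
      C * ((wNp f + wNp g) / 2 - wNp (fun x => (f x + g x) / 2)).
Proof.
move=> e0; have [C C0 HC] := powR_uniform_convexity p1 e0.
exists C => // f g f1 g1.
have fg1 := inLpB f1 g1; have m1 := inLp_mid f1 g1.
pose a := e + C / 2.
have a0 : 0 <= a by rewrite addr_ge0 ?divr_ge0 ?(ltW e0).
suff : (wint (f \- g)%R + C%:E * wint (fun x => (f x + g x) / 2)%R <=
    a%:E * wint f + a%:E * wint g)%E.
  rewrite (wint_fin m1) (wint_fin f1) (wint_fin g1) (wint_fin fg1).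
  by rewrite -!EFinM -!EFinD lee_fin /a; lra.
apply: (wint_le22 f1.1 g1.1 fg1.1 m1.1 a0 a0 C0).
by move=> x Dx; have := HC (f x) (g x); rewrite /a /=; lra.
Qed.

Definition wnorm f : R := wNp f `^ p^-1.

Lemma wnorm_ge0 f : 0 <= wnorm f. Proof. exact: powR_ge0. Qed.

Lemma wnormK f : wnorm f `^ p = wNp f.
Proof. by rewrite -powRrM mulVf ?gt_eqF// powRr1// wNp_ge0. Qed.

Lemma wnorm_le f g : wNp f <= wNp g -> wnorm f <= wnorm g.
Proof.
move=> fg; apply: ge0_ler_powR => //; rewrite ?nnegrE ?wNp_ge0//.
by rewrite invr_ge0.
Qed.

(** Multiplication by w^(1/p), followed by extension by 0, is an isometry into the unweighted
    L^p(mu); Minkowski's inequality is transported through it. *)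
Let emb f : T -> R := (fun x => f x * w x `^ p^-1) \_ D.

Let memb f : inLp f -> measurable_fun setT (emb f).
Proof.
move=> [mf _]; apply/(measurable_restrictT _ mD); apply: measurable_funM => //.
exact: (measurableT_comp (@measurable_powR R p^-1)).
Qed.

Let embE f : inLp f -> Lnorm mu p%:E (EFin \o emb f) = (wnorm f)%:E.
Proof.
move=> f1; rewrite unlock /Lnorm /wnorm -poweR_EFin; congr poweR.
rewrite -wint_fin// [in RHS]unlock [RHS]integral_mkcond; apply: eq_integral => x _.
rewrite /emb /= /patch; case: ifPn => [/[!inE] Dx|_]; last first.
  by rewrite normr0 powR0// gt_eqF.
rewrite normrM powRM// (ger0_norm (powR_ge0 _ _)) -powRrM.
by rewrite mulVf ?gt_eqF// powRr1// w0.
Qed.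

Lemma wnormD f g : inLp f -> inLp g -> wnorm (f \+ g) <= wnorm f + wnorm g.
Proof.
move=> f1 g1; have := minkowski_EFin mu (memb f1) (memb g1) (ltW p1).
rewrite (_ : Lnorm _ _ _ = Lnorm mu p%:E (EFin \o emb (f \+ g))); last first.
  congr Lnorm; apply/funext => x; rewrite /emb/= /patch.
  by case: ifPn => _; rewrite ?addr0// mulrDl.
by rewrite (embE f1) (embE g1) (embE (inLpD f1 g1)) -EFinD lee_fin.
Qed.

Lemma wnormZ f (k : R) : inLp f -> wnorm (fun x => k * f x) = `|k| * wnorm f.
Proof.
move=> f1; rewrite /wnorm /wNp.
rewrite (_ : wint (fun x => k * f x)%R = (`|k| `^ p)%:E * wint f)%E; last first.
  rewrite !unlock -ge0_integralZl_EFin ?powR_ge0//.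
  - by apply: eq_integral => x _; rewrite normrM powRM// -EFinM mulrA.
  - by move=> x Dx; rewrite lee_fin mulr_ge0 ?powR_ge0 ?w0.
  - exact: measurable_wint f1.1.
rewrite (wint_fin f1) -EFinM/= powRM ?powR_ge0 ?wNp_ge0// -powRrM mulfV ?gt_eqF//.
by rewrite powRr1.
Qed.

Lemma wnorm_midpoint f g : inLp f -> inLp g ->
  wnorm (fun x => (f x + g x) / 2) <= (wnorm f + wnorm g) / 2.
Proof.
move=> f1 g1; have := wnormD (inLpZ 2^-1 f1) (inLpZ 2^-1 g1).
rewrite !wnormZ// ger0_norm// -mulrDr [leRHS]mulrC; apply: le_trans.
apply: wnorm_le; rewrite /wNp (@eq_wint _ (fun x => (f x + g x) / 2))// => x _ /=.
by rewrite -mulrDr mulrC.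
Qed.

Lemma wnorm_dist f g : inLp f -> inLp g -> `|wnorm f - wnorm g| <= wnorm (f \- g).
Proof.
have H f' g' : inLp f' -> inLp g' -> wnorm f' <= wnorm (f' \- g') + wnorm g'.
  move=> f1 g1; apply: le_trans (wnormD (inLpB f1 g1) g1).
  apply: wnorm_le; rewrite /wNp (@eq_wint _ f')// => x _ /=.
  by rewrite subrK.
move=> f1 g1; rewrite ler_norml lerBlDr H// andbT lerNl opprB lerBlDr.
rewrite (_ : wnorm (f \- g) = wnorm (g \- f)); first exact: H.
by rewrite /wnorm /wNp wint_sym.
Qed.

(* Riesz-Fischer: a fast Cauchy subsequence converges pointwise where the weight
   is positive, and Fatou's lemma gives the convergence of the whole sequence. *)
Lemma wNp_complete (f_ : nat -> T -> R) : (forall n, inLp (f_ n)) ->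
  (forall e : R, 0 < e -> exists N, forall n m : nat, (N <= n)%N -> (N <= m)%N ->
     wNp (f_ n \- f_ m) <= e) ->
  exists2 f, inLp f & forall e : R, 0 < e ->
    exists N, forall n, (N <= n)%N -> wNp (f_ n \- f) <= e.
Proof.
move=> f1 cf.
(* The factor 2^k sits inside the p-th power: once the integrals of |2^k (g_(k+1) - g_k)|^p w are
   summable, the sum of the integrands is finite almost everywhere and bounds each of them, so the
   increments of the subsequence are geometric where w > 0. *)
pose ep (k : nat) : R := 2^-1 ^+ k.+1 / (2 ^+ k) `^ p.
have ep0 k : 0 < ep k by rewrite divr_gt0 ?exprn_gt0 ?powR_gt0 ?exprn_gt0.
have [N HN] := choice (fun k => cf (ep k) (ep0 k)).
pose s := fix s k := if k is k'.+1 then maxn (s k').+1 (N k) else N 0%N.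
have sN k : (N k <= s k)%N by case: k => [|k] //=; rewrite leq_maxr.
have sS k : (s k <= s k.+1)%N by rewrite /= (leq_trans (leqnSn _))// leq_maxl.
have ks k : (k <= s k)%N by elim: k => // k ih; rewrite /= leq_max ltnS ih.
pose g k := f_ (s k).
have g1 k : inLp (g k) by exact: f1.
pose a k x : \bar R := (`|2 ^+ k * (g k.+1 x - g k x)| `^ p * w x)%:E.
have mg1 k : inLp (fun x => 2 ^+ k * (g k.+1 x - g k x)).
  exact/inLpZ/(inLpB (g1 _) (g1 _)).
have ma k : measurable_fun D (a k) by exact: measurable_wint (mg1 k).1.
have a0 k x : D x -> (0 <= a k x)%E.
  by move=> Dx; rewrite lee_fin mulr_ge0 ?powR_ge0 ?w0.
have inta k : (\int[mu]_(x in D) a k x <= (2^-1 ^+ k.+1)%:E)%E.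
  have -> : (\int[mu]_(x in D) a k x = wint (fun x => 2 ^+ k * (g k.+1 x - g k x))%R)%E.
    by rewrite unlock.
  rewrite wint_fin// lee_fin -wnormK (wnormZ _ (inLpB (g1 _) (g1 _))).
  rewrite powRM ?wnorm_ge0// wnormK ger0_norm ?exprn_ge0//.
  rewrite -ler_pdivlMl ?powR_gt0 ?exprn_gt0// mulrC.
  by apply: HN; rewrite (leq_trans (sN _)).
have sumfin : (\int[mu]_(x in D) (\sum_(k <oo) a k x) < +oo)%E.
  rewrite integral_nneseries//.
  apply: (@le_lt_trans _ _ (\sum_(k <oo) (1 / (2 ^ k.+1)%:R : R)%:E)%E).
    apply: lee_nneseries => [k _ _|k _]; first by apply: integral_ge0 => x; exact: a0.
    by rewrite div1r natrX -exprVn; exact: inta.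
  by apply: le_lt_trans (@epsilon_trick0 R 1 xpredT ler01) _; rewrite ltry.
have ms : measurable_fun D (fun x => \sum_(k <oo) a k x)%E.
  by apply: (@ge0_emeasurable_sum _ _ _ _ _ xpredT) => [k x Dx _|//]; exact: a0.
have aefin : {ae mu, forall x, D x -> (\sum_(k <oo) a k x)%E \is a fin_num}.
  apply: integrable_ae => //; apply/integrableP; split=> //.
  rewrite (eq_integral (fun x => \sum_(k <oo) a k x)%E)// => x /[!inE] Dx.
  by rewrite gee0_abs// nneseries_ge0// => k _ _; exact: a0.
(* A limsup is measurable whether or not the subsequence converges. Convergence holds for almost
   every x with w x > 0, and where w x = 0 the value of f does not enter the integrals. *)
pose f x := fine (limn_esup (fun k => (g k x)%:E)).
have mf : measurable_fun D f.
  apply: (@measurableT_comp _ _ _ _ _ _ fine) => //.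
  by apply: measurable_fun_limn_esup => k; apply/measurable_EFinP; exact: (g1 k).1.
have gf x : D x -> (\sum_(k <oo) a k x)%E \is a fin_num -> 0 < w x ->
    g k x @[k --> \oo] --> f x.
  move=> Dx sx wx.
  pose M := (fine (\sum_(k <oo) a k x) / w x) `^ p^-1.
  have gM k : `|g k.+1 x - g k x| <= geometric M 2^-1 k.
    have : (a k x <= \sum_(k <oo) a k x)%E.
      rewrite (@nneseriesD1 _ (fun i => a i x) k xpredT)//; last by move=> *; exact: a0.
      by rewrite leeDl// nneseries_ge0// => *; exact: a0.
    rewrite -(fineK sx) lee_fin -ler_pdivlMr// => h.
    have : (`|2 ^+ k * (g k.+1 x - g k x)| `^ p) `^ p^-1 <= M.
      apply: ge0_ler_powR => //; rewrite ?nnegrE ?powR_ge0 ?invr_ge0//.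
      by rewrite (le_trans _ h)// powR_ge0.
    rewrite -powRrM mulfV ?gt_eqF// powRr1// normrM ger0_norm ?exprn_ge0//.
    by rewrite /= exprVn mulrC ler_pdivlMr ?exprn_gt0.
  have cg : cvgn (g^~ x).
    rewrite (_ : g^~ x = (fun k => g 0%N x + series (telescope (g ^~ x)) k)); last first.
      by apply/funext => k; exact: (eq_sum_telescope (g ^~ x)).
    apply: is_cvgD; first exact: is_cvg_cst.
    apply: normed_cvg; apply: (@series_le_cvg _ _ (geometric M 2^-1)) => //.
    - by move=> n /=; exact: normr_ge0.
    - by move=> n; rewrite /geometric /= mulr_ge0 ?powR_ge0// exprn_ge0// invr_ge0.
    - apply: is_cvg_geometric_series; rewrite ger0_norm ?invr_ge0//; lra.
  move/cvg_ex : cg => [l gl].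
  suff -> : f x = l by [].
  rewrite /f; have /cvg_limn_einf_sup[_ ->//] : (g k x)%:E @[k --> \oo] --> l%:E.
  by apply: cvg_EFin; [exact: nearW|exact: gl].
have key n (e : R) : (\forall k \near \oo, wNp (f_ n \- g k) <= e) ->
    (wint (f_ n \- f)%R <= e%:E)%E.
  move=> ne; rewrite unlock.
  have mfg k : measurable_fun D (fun x => (`|(f_ n \- g k) x| `^ p * w x)%:E).
    by apply: measurable_wint; exact: (inLpB (f1 n) (g1 k)).1.
  rewrite (ae_eq_integral (fun x => limn_einf
      (fun k => (`|(f_ n \- g k) x| `^ p * w x)%:E)))//.
  - apply: le_trans (fatou mu mD mfg _) _ => [k x Dx|].
      by rewrite lee_fin mulr_ge0 ?powR_ge0 ?w0.
    rewrite (_ : (fun k => _) = (fun k => (wNp (f_ n \- g k))%:E)); last first.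
      by apply/funext => k; rewrite -wint_fin ?unlock//; exact: inLpB.
    rewrite limn_einf_lim; apply: lime_le; first exact: is_cvg_einfs.
    apply: nearW => k; case: ne => K _ HK.
    apply: (@le_trans _ _ (wNp (f_ n \- g (maxn k K)))%:E).
      by apply: ereal_inf_lbound; exists (maxn k K) => //=; rewrite leq_maxl.
    by rewrite lee_fin; apply: HK; rewrite /= leq_maxr.
  - by apply: measurable_wint; apply: measurable_funB => //; exact: (f1 n).1.
  - rewrite (_ : (fun _ => _) = (fun x => - limn_esup
        (fun k => - (`|(f_ n \- g k) x| `^ p * w x)%:E))%E); last first.
      by apply/funext => x; rewrite (limn_esupN (fun k => (`|(f_ n \- g k) x| `^ p * w x)%:E)) oppeK.
    apply: measurableT_comp => //; apply: measurable_fun_limn_esup => k.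
    exact: measurableT_comp.
  - apply: filterS aefin => x + Dx => /(_ Dx) sx.
    have [wx|wx] := eqVneq (w x) 0.
      rewrite wx mulr0 (_ : (fun k => _) = cst 0%E); last first.
        by apply/funext => k; rewrite mulr0.
      by have [-> _] := cvg_limn_einf_sup (@cvg_cst _ (0 : \bar R)%E _ \oo _).
    have wx0 : 0 < w x by rewrite lt_neqAle eq_sym wx w0.
    have /cvg_limn_einf_sup[-> //] : (`|(f_ n \- g k) x| `^ p * w x)%:E
        @[k --> \oo] --> (`|(f_ n \- f) x| `^ p * w x)%:E.
    apply: cvg_EFin; first exact: nearW.
    have hs : (f_ n x - g k x) @[k --> \oo] --> f_ n x - f x.
      by apply: cvgB; [exact: cvg_cst|exact: gf].
    have hp : `|f_ n x - g k x| `^ p @[k --> \oo] --> `|f_ n x - f x| `^ p.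
      exact: (cvg_comp _ _ hs (@continuous_powR_norm _ _ p_gt0 (f_ n x - f x))).
    by apply: cvgM; [exact: hp|exact: cvg_cst].
have nearg n (e : R) : (exists N, (forall m : nat, (N <= m)%N -> wNp (f_ n \- f_ m) <= e)) ->
    \forall k \near \oo, wNp (f_ n \- g k) <= e.
  move=> [K HK]; exists K => // k /= Kk.
  by apply: HK; rewrite (leq_trans Kk).
have lef e : 0 < e -> exists N, forall n, (N <= n)%N -> (wint (f_ n \- f)%R <= e%:E)%E.
  move=> e0; have [K HK] := cf e e0; exists K => n Kn.
  by apply: key; apply: nearg; exists K => m Km; exact: HK.
have f1' : inLp f.
  have [K /(_ K (leqnn _)) HK] := lef 1 ltr01.
  have h : inLp (f_ K \- f).
    split; first by apply: measurable_funB => //; exact: (f1 K).1.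
    by rewrite (le_lt_trans HK)// ltry.
  by apply: eq_inLp (inLpB (f1 K) h) => x _ /=; rewrite opprB addrC subrK.
exists f => // e /lef[K HK]; exists K => n /HK.
by rewrite wint_fin ?lee_fin//; exact: inLpB.
Qed.

End weighted_Lp.

(** * Polar coordinates *)

Section density.
Context d (T : measurableType d) (R : realType) (mu : {measure set T -> \bar R}).
Variable g : T -> R.
Hypotheses (mg : measurable_fun setT g) (g0 : forall x, 0 <= g x).
Local Open Scope ereal_scope.

(** Used to turn omega r^(n-1) dr into a measure, which is then identified with the image of the
    Lebesgue measure of R^n under [enorm]. *)
Definition density_measure (A : set T) : \bar R := \int[mu]_(x in A) (g x)%:E.

Let mgA A : measurable_fun A (EFin \o g).
Proof. exact/measurable_EFinP/measurable_funTS. Qed.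

Let density0 : density_measure set0 = 0.
Proof. exact: integral_set0. Qed.

Let density_ge0 A : 0 <= density_measure A.
Proof. by apply: integral_ge0 => x _; rewrite lee_fin. Qed.

Let density_sigma_additive : semi_sigma_additive density_measure.
Proof.
move=> F mF tF mUF; rewrite /density_measure.
have g0' x : (\bigcup_k F k) x -> 0 <= (EFin \o g) x by rewrite lee_fin.
rewrite (@ge0_integral_bigcup _ _ _ mu F (EFin \o g) mF (@mgA _) g0' tF).
by apply: is_cvg_nneseries => n _ _; exact: density_ge0.
Qed.

Definition density : {measure set T -> \bar R} := HB.pack density_measure
  (isMeasure.Build _ _ _ density_measure density0 density_ge0 density_sigma_additive).

Import HBNNSimple.

Lemma integral_density (f : T -> \bar R) : measurable_fun setT f ->
  (forall x, 0 <= f x) ->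
  \int[density]_x f x = \int[mu]_x (f x * (g x)%:E).
Proof.
move=> mf f0; pose h := nnsfun_approx measurableT mf.
have hf x : (EFin \o h n) x @[n --> \oo] --> f x.
  exact: (@cvg_nnsfun_approx _ _ _ _ measurableT _ mf).
have ndh x a b : (a <= b)%N -> ((h a x)%:E <= (h b x)%:E :> \bar R).
  by move=> ab; rewrite lee_fin; exact/lefP/nd_nnsfun_approx.
have -> : \int[density]_x f x =
    lim (\int[density]_x (EFin \o h n) x @[n --> \oo]).
  rewrite -monotone_convergence//.
  - by apply: eq_integral => x _; apply/esym/cvg_lim.
  - by move=> n; exact/measurable_EFinP.
  - by move=> n x _; rewrite lee_fin.
  - by move=> x _ a b; exact: ndh.
have -> : \int[mu]_x (f x * (g x)%:E) =
    lim (\int[mu]_x ((EFin \o h n) x * (g x)%:E) @[n --> \oo]).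
  rewrite -monotone_convergence//.
  - apply: eq_integral => x _; apply/esym/cvg_lim => //.
    by apply: cvgeZr => //; exact: hf.
  - by move=> n; apply/emeasurable_funM => //; exact/measurable_EFinP.
  - by move=> n x _; rewrite mule_ge0 ?lee_fin.
  - by move=> x _ a b ab; rewrite lee_wpmul2r ?lee_fin//; exact: ndh.
suff H n : \int[density]_x (EFin \o h n) x =
  \int[mu]_x ((EFin \o h n) x * (g x)%:E) by under eq_fun do rewrite H.
have hE x : (EFin \o h n) x = \sum_(y \in range (h n)) (y * \1_(h n @^-1` [set y]) x)%:E.
  by rewrite /= fimfunE -fsumEFin.
have indich r : measurable_fun setT (fun x => (r * \1_(h n @^-1` [set r]) x)%:E).
  by apply/measurable_EFinP/measurable_funM.
transitivity (\int[density]_x (\sum_(y \in range (h n))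
    (y * \1_(h n @^-1` [set y]) x)%:E)); first by apply: eq_integral.
rewrite ge0_integral_fsum//; last by move=> m y Ey; exact: nnfun_muleindic_ge0.
transitivity (\int[mu]_x (\sum_(y \in range (h n))
    (y * \1_(h n @^-1` [set y]) x)%:E * (g x)%:E)); last first.
  apply: eq_integral => x _; rewrite hE -ge0_mule_fsuml// => y.
  exact: nnfun_muleindic_ge0.
rewrite ge0_integral_fsum//; last 2 first.
  - by move=> y; apply: emeasurable_funM => //; exact/measurable_EFinP.
  - by move=> m y Ey; rewrite mule_ge0 ?lee_fin ?g0// -lee_fin nnfun_muleindic_ge0.
apply: eq_fsbigr => r rhn.
rewrite integralZl_indic_nnsfun// integral_indic// setIT.
under [RHS]eq_integral do rewrite EFinM -muleA.
rewrite ge0_integralZl//.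
- under [in RHS]eq_integral do rewrite muleC.
  rewrite (eq_integral ((EFin \o g) \_ (h n @^-1` [set r])))//; last first.
    by move=> x xE; rewrite epatch_indic.
  by rewrite -integral_mkcond.
- by apply: emeasurable_funM; [exact/measurable_EFinP|exact/measurable_EFinP].
- by move=> t Et; rewrite mule_ge0 ?lee_fin.
- by move: rhn; rewrite inE => -[t _ <-]; rewrite lee_fin.
Qed.

End density.

Section lebesgue_scaling.
Context {R : realType}.
Notation mu := (@lebesgue_measure R).

Let mulm (r : R) (t : measurableTypeR R) : measurableTypeR R := r * t.

Let m_mulm r : measurable_fun setT (mulm r).
Proof. exact: mulrl_measurable. Qed.

(** r times the image measure gives every interval its length, so it is the Lebesgue measure. *)
Lemma lebesgue_measureZ (r : R) (A : set R) : 0 < r -> measurable A ->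
  pushforward mu (mulm r) A = (r^-1%:E * mu A)%E.
Proof.
move=> r0 mA.
pose m := mscale (NngNum (ltW r0))
  (measure_function_pushforward__canonical__measure_function_Measure mu (m_mulm r)).
have H : mu A = m A.
  apply: lebesgue_measure_unique => //= _ [[a b]] _ <- /=.
  rewrite /m /mscale /= /pushforward.
  rewrite (_ : _ @^-1` _ = `]r^-1 * a, r^-1 * b]%classic); last first.
    apply/seteqP; split => x /=; rewrite /mulm !in_itv/=.
      by rewrite ltr_pdivrMl// ler_pdivlMl.
    by rewrite ltr_pdivrMl// ler_pdivlMl.
  rewrite !lebesgue_measure_itv/= !lte_fin ltr_pM2l ?invr_gt0//.
  by case: ifPn => _; rewrite ?mule0// -!EFinB -EFinM -mulrBr mulrA divff ?gt_eqF// mul1r.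
by rewrite H /m /mscale/= muleA -EFinM mulVf ?gt_eqF// mul1e.
Qed.

Lemma ge0_integral_scale (r : R) (f : R -> \bar R) : 0 < r ->
  measurable_fun setT f -> (forall x, 0 <= f x)%E ->
  (\int[mu]_x f (r * x)%R = r^-1%:E * \int[mu]_x f x)%E.
Proof.
move=> r0 mf f0.
pose ri := NngNum (ltW (eqbRL (invr_gt0 r) r0)).
have -> : (\int[mu]_x f (r * x)%R = \int[pushforward mu (mulm r)]_x f x)%E.
  by rewrite ge0_integral_pushforward//; exact: m_mulm.
rewrite (eq_measure_integral (mscale ri mu)).
  by rewrite ge0_integral_mscale.
by move=> A mA _; exact: lebesgue_measureZ.
Qed.

End lebesgue_scaling.

Section rV_borel.
Context {R : realType}.

(** The sigma-algebra is the one generated by the coordinates. An open set is the union of the cubes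
    of rational centre and radius 1/(k+1) that it contains, and there are countably many of them. *)
Lemma rV_open_measurable n (U : set 'rV[R]_n) : open U -> measurable U.
Proof.
move=> oU.
pose B (c : 'rV[rat]_n * nat) : set 'rV[R]_n :=
  \bigcap_(j in [set: 'I_n]) ((fun x : 'rV[R]_n => x ord0 j) @^-1`
     ball (ratr (c.1 ord0 j) : R) c.2.+1%:R^-1).
have -> : U = \bigcup_c (if `[< B c `<=` U >] then B c else set0).
  apply/seteqP; split => [x Ux|x [c _]]; last by case: asboolP => //; apply.
  have [e /= e0 eU] : exists2 e : R, 0 < e & ball x e `<=` U.
    by move: oU; rewrite openE => /(_ _ Ux) /nbhs_ballP[e e0]; exists e.
  have [k ke] : exists k : nat, k.+1%:R^-1 < e / 2.
    have e2 : 0 < e / 2 by rewrite divr_gt0.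
    have := near_infty_natSinv_lt (PosNum e2).
    by move=> [N _ /(_ N (leqnn N))] /=; exists N.
  have /choice[q Hq] : forall j : 'I_n, exists q : rat,
      `|ratr q - x ord0 j| < k.+1%:R^-1.
    move=> j; have k0 : (0 : R) < k.+1%:R^-1 by rewrite invr_gt0.
    have /rat_in_itvoo[q] : x ord0 j < x ord0 j + k.+1%:R^-1 by rewrite ltrDl.
    rewrite in_itv/= => /andP[q1 q2]; exists q.
    by rewrite ger0_norm ?subr_ge0 ?(ltW q1)// ltrBlDl.
  exists (\row_j q j, k) => //; rewrite asboolT.
    by move=> j _ /=; rewrite -ball_normE /= mxE.
  move=> y By; apply: eU; split=> // i j; rewrite ord1.
  have := By j Logic.I; rewrite /= -ball_normE /= mxE => yq.
  change (`|x ord0 j - y ord0 j| < e).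
  have -> : x ord0 j - y ord0 j = (ratr (q j) - y ord0 j) - (ratr (q j) - x ord0 j) by ring.
  rewrite (le_lt_trans (ler_normB _ _))// (splitr e) ltrD// ?(lt_trans yq)//.
  exact: lt_trans (Hq j) _.
apply: countable_bigcupT_measurable; first exact: countableP.
move=> c; case: ifPn => // _.
apply: fin_bigcap_measurable => // j _.
rewrite -[X in measurable X]setTI.
by apply: (@measurable_rV_coord R n j) => //; exact: measurable_ball.
Qed.

Lemma rV_closed_measurable n (U : set 'rV[R]_n) : closed U -> measurable U.
Proof.
move=> cU; rewrite -[U]setCK; apply: measurableC; apply: rV_open_measurable.
exact: closed_openC.
Qed.

Lemma rV_compact_measurable n (U : set 'rV[R]_n) : compact U -> measurable U.
Proof.
by move=> cU; apply: rV_closed_measurable; apply: compact_closed cU; exact: norm_hausdorff.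
Qed.

Lemma rV_continuous_measurable n (f : 'rV[R]_n -> R) : continuous f ->
  measurable_fun setT f.
Proof.
move=> cf; apply: (measurability _ (RGenOpens.measurableE R)) => _ [_ [a [b ->]] <-].
rewrite setTI; apply: rV_open_measurable.
by apply: open_comp => // x _; exact: cf.
Qed.

Lemma enorm_ge0 n (x : 'rV[R]_n) : 0 <= enorm x.
Proof. exact: sqrtr_ge0. Qed.

Lemma enorm_continuous n : continuous (@enorm R n).
Proof.
move=> x; apply: continuous_comp; last exact: sqrt_continuous.
have H (i : 'I_n) : true -> continuous (fun y : 'rV[R]_n => y ord0 i ^+ 2).
  move=> _ y; apply: (@continuous_comp _ _ _ (fun y : 'rV[R]_n => y ord0 i) (fun t : R => t ^+ 2)).
    exact: coord_continuous.
  exact: exprn_continuous.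
have K (r : seq 'I_n) : continuous (fun y : 'rV[R]_n => \sum_(i <- r) y ord0 i ^+ 2).
  elim: r => [|i r ih] y.
    rewrite (_ : (fun _ => _) = cst 0); first exact: cst_continuous.
    by apply/funext => z; rewrite big_nil.
  rewrite (_ : (fun _ => _) = (fun z : 'rV[R]_n => z ord0 i ^+ 2 + \sum_(j <- r) z ord0 j ^+ 2)).
    exact: (cvgD (H i isT y) (ih y)).
  by apply/funext => z; rewrite big_cons.
exact: K.
Qed.

Lemma measurable_enorm n : measurable_fun setT (@enorm R n).
Proof. by apply: rV_continuous_measurable; exact: enorm_continuous. Qed.

Lemma enormZ n (r : R) (x : 'rV[R]_n) : 0 <= r -> enorm (r *: x) = r * enorm x.
Proof.
move=> r0; rewrite /enorm.
under eq_bigr do rewrite mxE exprMn.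
by rewrite -mulr_sumr sqrtrM ?sqr_ge0// sqrtr_sqr ger0_norm.
Qed.

Lemma le_coord_enorm n (x : 'rV[R]_n) i : `|x ord0 i| <= enorm x.
Proof.
rewrite -sqrtr_sqr ler_wsqrtr// (bigD1 i)//= lerDl sumr_ge0// => j _.
exact: sqr_ge0.
Qed.

End rV_borel.

Section polar.
Context {R : realType}.
Notation leb := (@lebesgue_measure R).
Notation mu n := (@rV_lebesgue R n).
Local Open Scope ereal_scope.

Lemma rV_lebesgueSE n (A : set 'rV[R]_n.+1) : mu n.+1 A =
  \int[leb]_t mu n [set y | A (rV_cons (t, y))].
Proof.
rewrite /= /rV_lebesgueS /pushforward /product_measure1.
apply: eq_integral => t _ /=; congr (mu n _).
by apply/seteqP; split => y /=; rewrite /xsection/= inE.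
Qed.

Lemma measurable_rV_section n (A : set 'rV[R]_n.+1) : measurable A ->
  (forall t : R, measurable [set y | A (rV_cons (t, y))]) /\
  measurable_fun setT (fun t : R => mu n [set y | A (rV_cons (t, y))]).
Proof.
move=> mA.
have mA' : measurable (@rV_cons R n @^-1` A).
  by rewrite -[X in measurable X]setTI; exact: measurable_rV_cons.
have E t : [set y | A (rV_cons (t, y))] = xsection (@rV_cons R n @^-1` A) t.
  by apply/seteqP; split => y /=; rewrite /xsection/= inE.
split=> [t|]; first by rewrite E; exact: measurable_xsection.
rewrite (_ : (fun _ => _) = mu n \o xsection (@rV_cons R n @^-1` A)).
  exact: measurable_fun_xsection.
by apply/funext => t /=; rewrite E.
Qed.

Lemma rV_lebesgueZ n (r : R) (A : set 'rV[R]_n) : (0 < r)%R -> measurable A ->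
  mu n [set x | A (r *: x)%R] = (r^-1 ^+ n)%:E * mu n A.
Proof.
move=> r0; elim: n A => [|n ih] A mA.
  rewrite expr0 mul1e; congr (mu 0%N _).
  by apply/seteqP; split => x /=; rewrite [(r *: x)%R](_ : _ = x)//;
    apply/rowP => -[].
have [mAt mAf] := measurable_rV_section mA.
rewrite !rV_lebesgueSE.
pose F t := mu n [set y | A (rV_cons (t, y))].
transitivity (\int[leb]_t ((r^-1 ^+ n)%:E * F (r * t)%R)).
  apply: eq_integral => t _.
  rewrite -ih//; congr (mu n _); apply/seteqP.
  have E y : (r *: rV_cons (t, y) = rV_cons ((r * t)%R, (r *: y)%R))%R.
    apply/rowP => i; rewrite !mxE /=.
    by case: unliftP => [j _|_] /=; rewrite ?mxE.
  by split => y /=; rewrite E.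
have mF : measurable_fun setT F by [].
have F0 t : 0 <= F t by exact: measure_ge0.
rewrite ge0_integralZl//; last 2 first.
- by apply: (@measurableT_comp _ _ _ _ _ _ F _ (fun t : measurableTypeR R => r * t)%R) => //; exact: mulrl_measurable.
- by rewrite lee_fin exprn_ge0// invr_ge0 ltW.
by rewrite (@ge0_integral_scale _ r F r0 mF F0) muleA -EFinM -exprSr.
Qed.

Let eball n (r : R) := [set x : 'rV[R]_n | (enorm x < r)%R].

Let meball n r : measurable (@eball n r).
Proof.
rewrite /eball -[X in measurable X]setTI.
have := @measurable_enorm R n measurableT `]-oo, r[%classic.
rewrite (_ : _ @^-1` _ = [set x | (enorm x < r)%R]); first by apply; exact: measurable_itv.
by apply/seteqP; split => x /=; rewrite in_itv.
Qed.

Let eballE n r : (0 < r)%R -> mu n (@eball n r) = (r ^+ n)%:E * mu n (@eball n 1).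
Proof.
move=> r0; have ri : (0 < r^-1)%R by rewrite invr_gt0.
rewrite -[in RHS](invrK r) -rV_lebesgueZ//; congr (mu n _).
apply/seteqP; split => x /=; rewrite /eball/= enormZ ?(ltW ri)//.
  by rewrite ltr_pdivrMl// mulr1.
by rewrite ltr_pdivrMl// mulr1.
Qed.

Lemma rV_lebesgue_cube n (c : R) : (0 <= c)%R ->
  measurable [set x : 'rV[R]_n | forall i, (`|x ord0 i| <= c)%R] /\
  mu n [set x | forall i, (`|x ord0 i| <= c)%R] < +oo.
Proof.
move=> c0; elim: n => [|n [mC ih]].
  rewrite (_ : [set _ | _] = setT); last by apply/seteqP; split => // x _ [].
  by split=> //=; rewrite diracE ltry.
have mS : measurable [set x : 'rV[R]_n.+1 | forall i, (`|x ord0 i| <= c)%R].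
  rewrite (_ : [set _ | _] = \bigcap_(i in [set: 'I_n.+1])
      ((fun x : 'rV[R]_n.+1 => x ord0 i) @^-1` `[(- c)%R, c])); last first.
    apply/seteqP; split => x /= H i; first by move=> _ /=; rewrite in_itv/= -ler_norml.
    by have := H i Logic.I; rewrite /= in_itv/= -ler_norml.
  apply: fin_bigcap_measurable => // j _; rewrite -[X in measurable X]setTI.
  by apply: (@measurable_rV_coord R n.+1 j).
split=> //.
rewrite /= /rV_lebesgueS /pushforward.
rewrite (_ : _ @^-1` _ = (`[(- c)%R, c] : set R) `*` [set x : 'rV[R]_n | forall i, (`|x ord0 i| <= c)%R]); last first.
  apply/seteqP; split => -[t y] /=.
    move=> H; split; first by have := H ord0; rewrite rV_cons0/= in_itv/= -ler_norml.
    by move=> i; have := H (lift ord0 i); rewrite rV_consS.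
  move=> [H1 H2] i; case: (unliftP ord0 i) => [j ->|->].
    by rewrite rV_consS.
  by rewrite rV_cons0/= ler_norml; move: H1; rewrite in_itv.
rewrite product_measure1E// lte_mul_pinfty//.
change (leb `[(- c)%R, c]%classic \is a fin_num).
by rewrite lebesgue_measure_itv/=; case: ifP.
Qed.

Let rV_lebesgueT n : 0 < mu n setT.
Proof.
elim: n => [|n ih]; first by rewrite /= diracE mem_setT.
rewrite /= /rV_lebesgueS /pushforward preimage_setT -setXTT product_measure1E//.
rewrite mule_gt0//; change (0 < leb setT).
rewrite -set_itvNyy lebesgue_measure_itv/=.
by rewrite addye// ltry.
Qed.

Lemma rV_lebesgue_ball_fin n : mu n (@eball n 1) < +oo.
Proof.
have [mC] := @rV_lebesgue_cube n 1 ler01; apply: le_lt_trans.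
apply: le_measure; [by rewrite inE; exact: meball|by rewrite inE|move=> x /= x1 i].
by rewrite (le_trans (le_coord_enorm _ _))// ltW.
Qed.

(** By homogeneity, a null unit ball would make every ball null, hence the whole space. *)
Lemma rV_lebesgue_ball_gt0 n : 0 < mu n (@eball n 1).
Proof.
rewrite lt0e measure_ge0 andbT; apply/eqP => B0.
have : mu n (\bigcup_k (@eball n k.+1%:R)) = 0.
  apply/eqP; rewrite -measure_le0.
  apply: le_trans (measure_sigma_subadditive _ _ _ (@subset_refl _ _)) _ => //.
    by move=> k; exact: meball.
  by apply: bigcup_measurable => k _; exact: meball.
  rewrite eseries0// => k _ _; apply: eq_trans (eballE _ _) _ => //.
  by rewrite B0 mule0.
rewrite (_ : \bigcup_k _ = setT).
  by move=> E; have := rV_lebesgueT n; rewrite E ltxx.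
apply/seteqP; split => // x _; exists (Num.truncn (enorm x)) => //=.
by rewrite /eball/= truncnS_gt.
Qed.

(** The area of the unit sphere, obtained as the derivative at r = 1 of the volume r^n |B_1| of the
    ball of radius r. *)
Definition sphere_area n : R := n%:R * fine (mu n (@eball n 1)).

Lemma sphere_area_gt0 n : (0 < n)%N -> (0 < sphere_area n)%R.
Proof.
move=> n0; rewrite mulr_gt0 ?ltr0n// fine_gt0// rV_lebesgue_ball_gt0/=.
exact: rV_lebesgue_ball_fin.
Qed.

Let g n (r : R) : R := (if (0 <= r)%R then sphere_area n * r ^+ n.-1 else 0)%R.

Let mg n : measurable_fun setT (g n).
Proof.
apply: measurable_fun_ifT => //.
  by apply: measurable_fun_ler.
by apply: measurable_funM => //; exact: exprn_measurable.
Qed.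

Let g_ge0 n r : (0 <= g n r)%R.
Proof.
rewrite /g; case: ifPn => // r0; rewrite mulr_ge0 ?exprn_ge0//.
by rewrite mulr_ge0// fine_ge0.
Qed.

(** For radial integrands it suffices to compare two measures on the line, the image of the Lebesgue
    measure under [enorm] and the density omega r^(n-1). They agree on the half-lines []-oo, s[], a
    generating class stable under intersection: both give the volume of the ball of radius s. *)
Lemma integral_polar n (f : R -> \bar R) : (0 < n)%N -> measurable_fun setT f ->
  (forall r, 0 <= f r) ->
  \int[mu n]_x f (enorm x) =
  \int[leb]_(r in `[0%R, +oo[) (f r * (sphere_area n * r ^+ n.-1)%:E).
Proof.
move=> n0 mf f0.
pose m2 := density leb (mg n) (@g_ge0 n).
have men : measurable_fun setT (@enorm R n : 'rV[R]_n -> measurableTypeR R).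
  exact: measurable_enorm.
pose m1 := measure_function_pushforward__canonical__measure_function_Measure (mu n) men.
have E12 : \int[m1]_r f r = \int[m2]_r f r.
  apply: eq_measure_integral => A mA _.
  apply: (@measure_unique _ R (measurableTypeR R) (@RGenInftyO.G R)
    (fun k => `]-oo, k%:R[%classic)) => //.
  - exact: RGenInftyO.measurableE.
  - move=> _ _ [s ->] [t ->]; exists (Num.min s t) => //.
    by apply/seteqP; split => x /=; rewrite !in_itv/= lt_min; [case=> -> ->|move/andP].
  - by move=> k; exists k%:R.
  - apply/seteqP; split => // x _; exists (Num.truncn x).+1 => //.
    by rewrite /= in_itv/= truncnS_gt.
  - move=> _ [s ->]; rewrite /m1 /m2 /= /density_measure /pushforward.
    rewrite (_ : _ @^-1` _ = (@eball n s)); last first.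
      by apply/seteqP; split => x /=; rewrite /eball/= in_itv.
    have [s0|s0] := leP s 0%R.
      rewrite (_ : (@eball n s) = set0); last first.
        apply/seteqP; split => // x; rewrite /eball/= => xs.
        by have := le_lt_trans (enorm_ge0 x) (lt_le_trans xs s0); rewrite ltxx.
      rewrite measure0 integral0_eq// => x /=; rewrite in_itv/= /g => xs.
      by rewrite leNgt (lt_le_trans xs s0).
    rewrite eballE//.
    transitivity (\int[leb]_(x in `[0%R, s]) (sphere_area n * x ^+ n.-1)%:E).
      have D (x : R) : is_derive x (1 : R)%R (fun x : R => fine (mu n (@eball n 1)) * x ^+ n)%R
          (sphere_area n * x ^+ n.-1)%R.
        have H := @DeriveDef _ _ _ x (1 : R)%R _ _ (@exprn_derivable R n x (1 : R)%R) (exp_derive n x (1 : R)%R).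
        apply: is_derive_eq (is_deriveM (is_derive_cst (fine (mu n (@eball n 1)) : R) x (1 : R)%R) H) _.
        by rewrite /sphere_area /GRing.scale/=; ring.
      rewrite (@continuous_FTC2 _ _ (fun x => fine (mu n (@eball n 1)) * x ^+ n)%R 0%R s s0).
      - rewrite expr0n gtn_eqF// mulr0 sube0 mulrC EFinM fineK//.
        by rewrite ge0_fin_numE//; exact: rV_lebesgue_ball_fin.
      - apply: continuous_subspaceT => x; apply: cvgM; first exact: cvg_cst.
        exact: exprn_continuous.
      - split.
        + by move=> x _; case: (D x).
        + apply: cvg_at_right_filter; apply: cvgM; first exact: cvg_cst.
          exact: exprn_continuous.
        + apply: cvg_at_left_filter; apply: cvgM; first exact: cvg_cst.
          exact: exprn_continuous.
      - by move=> x _; rewrite derive1E; have := D x => ?; rewrite derive_val.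
    rewrite -integral_itv_bndo_bndc; last first.
      by apply/measurable_EFinP/measurable_funM => //; exact: exprn_measurable.
    rewrite [LHS]integral_mkcond [RHS]integral_mkcond; apply: eq_integral => x _.
    rewrite /patch !mem_setE /= !in_itv/=; case: (ltP x s) => xs; rewrite ?andbF//.
    by rewrite andbT /g; case: ifPn.
  - move=> k; rewrite /m1 /= /pushforward.
    rewrite (_ : _ @^-1` _ = @eball n k%:R); last first.
      by apply/seteqP; split => x /=; rewrite /eball/= in_itv.
    have [->|k0] := eqVneq k 0%N.
      rewrite (_ : @eball n _ = set0) ?measure0//.
      by apply/seteqP; split => // x; rewrite /eball/= ltNge enorm_ge0.
    rewrite eballE ?ltr0n ?lt0n// lte_mul_pinfty ?lee_fin ?exprn_ge0//.
    exact: rV_lebesgue_ball_fin.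
have -> : \int[mu n]_x f (enorm x) = \int[m1]_r f r.
  by rewrite /m1 ge0_integral_pushforward.
rewrite E12 integral_density// [RHS]integral_mkcond; apply: eq_integral => r _.
rewrite /patch mem_setE /= in_itv/= andbT /g.
by case: ifPn => // _; rewrite mule0.
Qed.

End polar.

(** * Smooth functions on the line and a smooth step *)

Section smooth_functions.
Context {R : realType}.
Implicit Types (f g : R -> R) (x y : R).

Definition smooth f := forall n x, derivable (derive1n n f) x 1.

(** A coinduction principle: exhibiting a class of derivable functions stable under derivation
    replaces formulas for n-th derivatives. *)
Lemma smooth_class (P : (R -> R) -> Prop) f :
  (forall g, P g -> (forall x, derivable g x 1) /\ P (derive1 g)) -> P f -> smooth f.
Proof.
move=> HP Pf n; elim: n f Pf => [|n ih] f Pf x; first exact: (HP f Pf).1.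
by rewrite derive1Sn; apply: ih; exact: (HP f Pf).2.
Qed.

Lemma smooth_derivable f : smooth f -> forall x, derivable f x 1.
Proof. by move=> sf x; exact: (sf 0%N). Qed.

Lemma smooth_derive f : smooth f -> smooth (derive1 f).
Proof. by move=> sf n x; have := sf n.+1 x; rewrite derive1Sn. Qed.

Lemma smooth_continuous f : smooth f -> continuous f.
Proof.
by move=> sf x; apply: differentiable_continuous; apply/derivable1_diffP/smooth_derivable.
Qed.

(** Sums of products of smooth functions: by Leibniz' rule the smallest class that contains the
    products and is stable under derivation. *)
Inductive smooth_prods : (R -> R) -> Prop :=
| smooth_prod f g of smooth f & smooth g : smooth_prods (fun x => f x * g x)
| smooth_prodD f g of smooth_prods f & smooth_prods g :
    smooth_prods (fun x => f x + g x).

Lemma smoothM f g : smooth f -> smooth g -> smooth (fun x => f x * g x).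
Proof.
move=> sf sg; apply: (@smooth_class smooth_prods); last exact: smooth_prod.
move=> h; elim=> {f g sf sg h} [f g sf sg|f g _ [df Pf] _ [dg Pg]].
- have df x := @smooth_derivable _ sf x; have dg x := @smooth_derivable _ sg x.
  split=> [x|]; first exact: derivableM.
  rewrite (_ : derive1 (fun x => f x * g x) = (fun x => f x * derive1 g x + (derive1 f) x * g x)).
    exact: (smooth_prodD (smooth_prod sf (smooth_derive sg)) (smooth_prod (smooth_derive sf) sg)).
  apply/funext => x; rewrite derive1E (deriveM (df x) (dg x)) /GRing.scale/=.
  by rewrite !derive1E [X in _ + X]mulrC.
- split=> [x|]; first exact: derivableD.
  rewrite (_ : derive1 (fun x => f x + g x) = (fun x => (derive1 f) x + (derive1 g) x)).
    exact: smooth_prodD.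
  by apply/funext => x; rewrite derive1E (deriveD (df x) (dg x)) !derive1E.
Qed.

Lemma smooth_cst (c : R) : smooth (cst c).
Proof.
apply: (@smooth_class (fun f => exists c : R, f = cst c)); last by exists c.
move=> _ [k ->]; split=> // ; exists 0; apply/funext => x.
by rewrite derive1_cst.
Qed.

Lemma is_derive_affine f (k l : R) x : derivable f (k * x + l) 1 ->
  is_derive x 1 (fun x => f (k * x + l)) (k * derive1 f (k * x + l)).
Proof.
move=> df; have Ha : is_derive x 1 (fun x => k * x + l) k.
  by apply: is_derive_eq; rewrite /GRing.scale/=; ring.
have Hh : is_derive (k * x + l) 1 f (derive1 f (k * x + l)).
  by rewrite derive1E; exact: derivableP.
by rewrite mulrC; exact: (@is_derive1_comp _ f (fun x => k * x + l) x _ _ Hh Ha).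
Qed.

Lemma smooth_affine f (k l : R) : smooth f -> smooth (fun x => f (k * x + l)).
Proof.
move=> sf; apply: (@smooth_class (fun g => exists2 h, smooth h &
  g = (fun x => h (k * x + l)))); last by exists f.
move=> _ [h sh ->].
have D x : is_derive x 1 (fun x => h (k * x + l)) (k * (derive1 h) (k * x + l)).
  by apply: is_derive_affine; exact: smooth_derivable.
split=> [x|]; first by case: (D x).
exists (fun y => k * (derive1 h) y).
  by apply: smoothM; [exact: smooth_cst|exact: smooth_derive].
by apply/funext => x; rewrite derive1E derive_val.
Qed.

Lemma smoothB f g : smooth f -> smooth g -> smooth (fun x => f x - g x).
Proof.
move=> sf sg; apply: (@smooth_class (fun h => exists f g,
   [/\ smooth f, smooth g & h = (fun x => f x - g x)])); last by exists f, g.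
move=> _ [{sf}f [{sg}g [sf sg ->]]].
have df x := @smooth_derivable _ sf x; have dg x := @smooth_derivable _ sg x.
split=> [x|]; first exact: derivableB.
exists (derive1 f), (derive1 g); split; [exact: smooth_derive..|].
by apply/funext => x; rewrite derive1E (deriveB (df x) (dg x)) !derive1E.
Qed.

Let is_derive0_sqr f (C : R) : 0 <= C -> (forall h, `|f h| <= C * h ^+ 2) ->
  is_derive (0 : R) (1 : R) f 0.
Proof.
move=> C0 H.
have f0 : f 0 = 0.
  by apply/eqP; rewrite -normr_le0 (le_trans (H 0))// expr0n/= mulr0.
have L : h^-1 *: ((f \o shift 0) (h *: (1 : R)) - f 0) @[h --> 0^'] --> (0 : R).
  apply/cvgr0Pnorm_le => e e0; near=> h.
  have h0 : h != 0 by near: h; exact: nbhs_dnbhs_neq.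
  rewrite f0 subr0 /= addr0 /GRing.scale/= mulr1 normrM normfV.
  rewrite ler_pdivrMl ?normr_gt0//; apply: le_trans (H h) _.
  rewrite -(real_normK (num_real h)) expr2 mulrA mulrC ler_wpM2l//.
  apply: (@le_trans _ _ ((C + 1) * `|h|)); first by rewrite ler_wpM2r// lerDl.
  rewrite -ler_pdivlMl ?ltr_wpDl// mulrC; apply: ltW.
  by near: h; apply: dnbhs0_lt; rewrite divr_gt0// ltr_wpDl.
apply: DeriveDef; first by apply/cvg_ex; exists 0.
by apply/cvg_lim => //.
Unshelve. all: by end_near. Qed.

(** The classical flat function exp(-1/x), with a polynomial factor in 1/x that makes the family
    stable under derivation: with y = 1/x, the derivative of r(y) exp(-y) is (r - r')(y) y^2
    exp(-y). *)
Let E (r : {poly R}) x : R := if 0 < x then r.[x^-1] * expR (- x^-1) else 0.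

Let expR_pow n y : 0 <= y -> y ^+ n <= n%:R ^+ n * expR y.
Proof.
move=> y0; case: n => [|n]; first by rewrite !expr0 mul1r (le_trans _ (expR_ge1Dx _))// lerDl.
have n0 : (0 : R) < n.+1%:R by rewrite ltr0n.
have -> : expR y = expR (y / n.+1%:R) ^+ n.+1.
  by rewrite -expRM_natl; congr expR; rewrite mulrC divfK ?gt_eqF.
rewrite -exprMn; apply: lerXn2r; rewrite ?nnegrE ?mulr_ge0 ?expR_ge0//.
rewrite -ler_pdivrMl// mulrC; apply: le_trans (expR_ge1Dx _).
by rewrite lerDr.
Qed.

(** Applied to r X, the bound C / y becomes |E r h| <= C h^2 for h = 1/y, which gives the derivative
    0 at the origin. *)
Let poly_exp (r : {poly R}) : exists2 C, 0 <= C &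
  forall y, 0 < y -> `|r.[y] * expR (- y)| <= C / y.
Proof.
exists (\sum_(i < size r) `|r`_i| * i.+1%:R ^+ i.+1).
  by apply: sumr_ge0 => i _; rewrite mulr_ge0 ?exprn_ge0.
move=> y y0; rewrite horner_coef mulr_suml mulr_suml.
apply: le_trans (ler_norm_sum _ _ _) _; apply: ler_sum => i _.
rewrite !normrM -!mulrA ler_wpM2l// normrX gtr0_norm// gtr0_norm ?expR_gt0//.
rewrite expRN ler_pdivrMr ?expR_gt0// -mulrA mulrCA mulrC ler_pdivlMr//.
by rewrite -exprSr; apply: expR_pow; exact: ltW.
Qed.

Let E_derive (r : {poly R}) x : is_derive x 1 (E r) (E ((r - r^`()) * 'X^2) x).
Proof.
have [x0|x0|x0] := ltgtP x 0.
- have -> : E ((r - r^`()) * 'X^2) x = 0 by rewrite /E ltNge ltW.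
  apply: near_eq_is_derive (is_derive_cst (0 : R) x (1 : R)).
  near=> y; rewrite /E ifF//=; apply/negbTE; rewrite -leNgt ltW//.
  by near: y; exact: lt_nbhsl.
- have -> : E ((r - r^`()) * 'X^2) x =
      r.[x^-1] * (expR (- x^-1) * x ^- 2) + (- x ^- 2 * r^`().[x^-1]) * expR (- x^-1).
    by rewrite /E x0 hornerM hornerXn hornerD hornerN exprVn; ring.
  apply: (@near_eq_is_derive _ _ _ (fun y => r.[y^-1] * expR (- y^-1))).
  + by near=> y; rewrite /E ifT//; near: y; exact: lt_nbhsr.
  + have xn0 : x != 0 by rewrite gt_eqF.
    have H1 : is_derive x 1 (fun y => y^-1) (- x ^- 2).
      by move: (@is_deriveV R id x 1 1 xn0 (is_derive_id x 1)); rewrite /GRing.scale/= mulr1.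
    have H2 : is_derive x 1 (fun y => r.[y^-1]) (- x ^- 2 * r^`().[x^-1]).
      by rewrite mulrC; exact: (@is_derive1_comp _ (horner r) (fun y => y^-1) x _ _ (is_derive_poly _ _) H1).
    have H3 : is_derive x 1 (fun y => expR (- y^-1)) (expR (- x^-1) * x ^- 2).
      have H4 : is_derive x 1 (fun y => - y^-1) (x ^- 2).
        by apply: is_derive_eq; rewrite opprK.
      have := @is_derive1_comp _ expR (fun y => - y^-1) x _ _ (is_derive_expR _) H4.
      by rewrite [X in is_derive _ _ _ X]mulrC.
    apply: is_derive_eq (is_deriveM H2 H3) _.
    by rewrite /GRing.scale/= [X in _ + X]mulrC.
- rewrite x0 /E ltxx.
  have [C C0 HC] := poly_exp (r * 'X).
  apply: (@is_derive0_sqr _ C C0) => h; rewrite /E; case: ifPn => h0; last first.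
    by rewrite normr0 mulr_ge0// sqr_ge0.
  have hi : 0 < h^-1 by rewrite invr_gt0.
  have := HC _ hi; rewrite !hornerE invrK mulrAC normrM (gtr0_norm hi).
  by rewrite ler_pdivrMr// -mulrA -expr2.
Unshelve. all: by end_near. Qed.

Let E_smooth r : smooth (E r).
Proof.
apply: (@smooth_class (fun f => exists r, f = E r)); last by exists r.
move=> _ [q ->]; split=> [x|]; first by case: (E_derive q x).
exists ((q - q^`()) * 'X^2); apply/funext => x.
by rewrite derive1E; have := E_derive q x => ?; rewrite derive_val.
Qed.

Let bump x : R := E 1 x * E 1 (- 1 * x + 1).

Let bump_smooth : smooth bump.
Proof. by apply: smoothM; [exact: E_smooth|apply: smooth_affine; exact: E_smooth]. Qed.

Let E1_ge0 x : 0 <= E 1 x.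
Proof. by rewrite /E; case: ifPn => // _; rewrite !hornerE ?mul1r expR_ge0. Qed.

Let E1_le1 x : E 1 x <= 1.
Proof.
rewrite /E; case: ifPn => // x0; rewrite !hornerE ?mul1r.
by rewrite -expR0 ler_expR oppr_le0 invr_ge0 ltW.
Qed.

Let bump_ge0 x : 0 <= bump x.
Proof. by rewrite mulr_ge0 ?E1_ge0. Qed.

Let bump_le1 x : bump x <= 1.
Proof. by rewrite mulr_ile1 ?E1_ge0 ?E1_le1. Qed.

Let bump_out x : x <= 0 \/ 1 <= x -> bump x = 0.
Proof.
rewrite /bump /E => -[x0|x1]; first by rewrite ltNge x0/= mul0r.
by rewrite [X in _ * X]ifF ?mulr0//; apply/negbTE; rewrite -leNgt mulN1r addrC subr_le0.
Qed.

Let E1_gt0 x : 0 < x -> 0 < E 1 x.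
Proof. by rewrite /E => ->; rewrite !hornerE ?mul1r expR_gt0. Qed.

Let bump_gt0 x : 0 < x < 1 -> 0 < bump x.
Proof.
move=> /andP[x0 x1]; rewrite mulr_gt0 ?E1_gt0// mulN1r addrC subr_gt0//.
Qed.

Let bump_cont : continuous bump. Proof. exact: smooth_continuous. Qed.

Notation mu := (@lebesgue_measure R).

Let bump_intcc a b : mu.-integrable `[a, b] (EFin \o bump).
Proof.
apply: continuous_compact_integrable; first exact: segment_compact.
exact: continuous_subspaceT.
Qed.

(** The integral starts at -1 and not at 0, where the bump begins, so that the fundamental theorem
    of calculus covers a whole neighbourhood of 0; farther to the left [step0] is locally 0. *)
Let step0 x := \int[mu]_(t in `[-1, x]) bump t.

Let step0_derive x : is_derive x 1 step0 (bump x).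
Proof.
have [x0|x0] := leP x (- 2^-1); last first.
  have x1 : -1 < x by lra.
  have xx : x < x + 1 by rewrite ltrDl.
  have [D1 D2] := @continuous_FTC1_closed _ bump (-1) x _ xx (bump_intcc _ _) x1 (@bump_cont x).
  exact: (DeriveDef D1 (etrans (esym (derive1E _ _)) D2)).
rewrite bump_out; last by left; lra.
apply: near_eq_is_derive (is_derive_cst (0 : R) x (1 : R)).
near=> y; rewrite /step0 /Rintegral integral0_eq// => t /=; rewrite in_itv/= => /andP[_ ty].
rewrite bump_out//; left; apply: le_trans ty _.
by apply: ltW; near: y; apply: lt_nbhsl; lra.
Unshelve. all: by end_near. Qed.

Let step0_MVT x y : x < y -> exists2 z, x < z < y & step0 y - step0 x = bump z * (y - x).
Proof.
move=> xy; have [z /[!in_itv]/= zxy E0] : exists2 z, z \in `]x, y[ &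
    step0 y - step0 x = bump z * (y - x).
  apply: MVT => //; apply: derivable_within_continuous => z _.
  by case: (step0_derive z).
by exists z.
Qed.

Let step0_le x y : x <= y -> step0 x <= step0 y.
Proof.
rewrite le_eqVlt => /predU1P[->//|xy]; have [z _ E0] := step0_MVT xy.
by rewrite -subr_ge0 E0 mulr_ge0 ?bump_ge0 ?subr_ge0 ?ltW.
Qed.

Let step0_0 x : x <= 0 -> step0 x = 0.
Proof.
move=> x0; rewrite /step0 /Rintegral integral0_eq// => t /=.
by rewrite in_itv/= => /andP[_ tx]; rewrite bump_out//; left; exact: le_trans x0.
Qed.

(** The normalized primitive of the bump. The bound on its derivative is what lets the rescaled
    derivatives be compared with averages at a Lebesgue point. *)
Lemma smooth_step : exists S : R -> R, [/\ smooth S,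
  (forall x, x <= 0 -> S x = 0), (forall x, 1 <= x -> S x = 1),
  (forall x, 0 <= S x <= 1) & exists2 B, 0 <= B & forall x, `|derive1 S x| <= B].
Proof.
pose c := step0 1.
have c0 : 0 < c.
  have lt : (4^-1 : R) < 3 / 4 by lra.
  have [z /andP[z1 z2] E0] := step0_MVT lt.
  have bz : 0 < bump z by apply: bump_gt0; apply/andP; split; lra.
  have : 0 < step0 (3 / 4) - step0 4^-1 by rewrite E0 mulr_gt0// subr_gt0.
  have h1 : step0 (3 / 4) <= c by apply: step0_le; lra.
  have h2 : step0 0 <= step0 4^-1 by apply: step0_le; lra.
  rewrite step0_0// in h2; lra.
have step1 x : 1 <= x -> step0 x = c.
  rewrite le_eqVlt => /predU1P[<-//|x1]; have [z /andP[z1 z2]] := step0_MVT x1.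
  rewrite (@bump_out z) ?mul0r; last by right; exact: ltW.
  by move/eqP; rewrite subr_eq0 => /eqP.
have dS x : is_derive x 1 (fun x => c^-1 * step0 x) (c^-1 * bump x).
  apply: is_derive_eq (is_deriveM (is_derive_cst (c^-1 : R) x (1 : R)) (step0_derive x)) _.
  by rewrite /GRing.scale/= mulr0 addr0.
have dSE : derive1 (fun x => c^-1 * step0 x) = (fun x => c^-1 * bump x).
  by apply/funext => x; rewrite derive1E; have := dS x => ?; rewrite derive_val.
exists (fun x => c^-1 * step0 x); split.
- apply: (@smooth_class (fun g => g = (fun x => c^-1 * step0 x) \/ smooth g)); last by left.
  move=> g [->|sg]; split.
  + by move=> x; case: (dS x).
  + by right; rewrite dSE; apply: smoothM; [exact: smooth_cst|exact: bump_smooth].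
  + by move=> x; exact: (@smooth_derivable _ sg).
  + by right; exact: smooth_derive.
- by move=> x x0; rewrite step0_0// mulr0.
- by move=> x x1; rewrite step1// mulVf// gt_eqF.
- move=> x; apply/andP; split.
    rewrite mulr_ge0 ?invr_ge0 ?(ltW c0)//.
    by have [/step0_0->//|/ltW/step0_le] := leP x 0; rewrite step0_0.
  rewrite mulrC ler_pdivrMr// mul1r.
  by have [/step1->//|/ltW/step0_le] := leP 1 x.
- exists c^-1; first by rewrite invr_ge0 ltW.
  move=> x; rewrite dSE ger0_norm; last by rewrite mulr_ge0 ?bump_ge0 ?invr_ge0 ?(ltW c0).
  by rewrite ler_piMr ?bump_le1// invr_ge0 ltW.
Qed.

End smooth_functions.

Section dominated_convergence_Rintegral.
Context d (T : measurableType d) (R : realType) (mu : {measure set T -> \bar R}).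

Lemma cvg_Rintegral (D : set T) (f_ : nat -> T -> R) (f g : T -> R) : measurable D ->
  (forall n, measurable_fun D (f_ n)) -> mu.-integrable D (EFin \o g) ->
  (forall x, D x -> f_ n x @[n --> \oo] --> f x) ->
  (forall n x, D x -> `|f_ n x| <= g x) ->
  mu.-integrable D (EFin \o f) /\
  (\int[mu]_(x in D) f_ n x @[n --> \oo] --> \int[mu]_(x in D) f x)%R.
Proof.
move=> mD mf ig ff fg.
have mf' n : measurable_fun D (EFin \o f_ n) by exact/measurable_EFinP.
have ptw x : D x -> (EFin \o f_ n) x @[n --> \oo] --> (EFin \o f) x.
  by move=> Dx; apply: cvg_EFin; [exact: nearW|exact: ff].
have mlim : measurable_fun D (EFin \o f) := emeasurable_fun_cvg _ _ mf' ptw.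
have [Hi _ HC] := @dominated_convergence _ _ _ mu D mD _ _ (EFin \o g) mf' mlim
  (aeW mu ptw) ig (aeW mu (fun x n Dx => fg n x Dx)).
split=> //; rewrite /Rintegral; apply: fine_cvg; rewrite fineK//.
exact: integrable_fin_num Hi.
Qed.

End dominated_convergence_Rintegral.

(** * Weak derivatives on the line *)

Section du_Bois_Reymond.
Context {R : realType}.
Notation mu := (@lebesgue_measure R).
Implicit Types (U : set R) (v dv phi : R -> R) (s t x : R).

Lemma derive1_out phi (K : set R) : closed K -> (forall x, ~ K x -> phi x = 0) ->
  forall x, ~ K x -> derive1 phi x = 0.
Proof.
move=> cK phi0 x Kx; rewrite derive1E.
rewrite (@near_eq_derive _ _ _ phi (cst 0)) ?derive_cst//.
have : nbhs x (~` K) by apply: open_nbhs_nbhs; split=> //; exact: closed_openC.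
by apply: filterS => y /phi0.
Qed.

Lemma Rintegral_support (A B : set R) (f : R -> R) : A `<=` B ->
  (forall x, B x -> ~ A x -> f x = 0) ->
  \int[mu]_(x in B) f x = \int[mu]_(x in A) f x.
Proof.
move=> AB f0; rewrite Rintegral_mkcond [RHS]Rintegral_mkcond.
apply: eq_Rintegral => x _; rewrite /patch.
have [xA|xA] := boolP (x \in A); first by rewrite mem_set//; apply: AB; rewrite -inE.
case: ifPn => // xB; apply: f0; first by rewrite -inE.
by move: xA; rewrite notin_setE.
Qed.

Lemma lebesgue_integrableS (E D : set R) (f : R -> R) : measurable E -> measurable D ->
  D `<=` E -> mu.-integrable E (EFin \o f) -> mu.-integrable D (EFin \o f).
Proof. exact: (@integrableS _ (measurableTypeR R) R mu E D). Qed.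

Lemma lebesgue_integrableZl (D : set R) (k : R) (f : R -> R) : measurable D ->
  mu.-integrable D (EFin \o f) -> mu.-integrable D (EFin \o (fun x => k * f x)).
Proof. by move=> mD; exact: (@integrableZl _ (measurableTypeR R) R mu D mD k (EFin \o f)). Qed.

Lemma lebesgue_integrableB (D : set R) (f g : R -> R) : measurable D ->
  mu.-integrable D (EFin \o f) -> mu.-integrable D (EFin \o g) ->
  mu.-integrable D (EFin \o (fun x => f x - g x)).
Proof. by move=> mD; exact: (@integrableB _ (measurableTypeR R) R mu D mD (EFin \o f) (EFin \o g)). Qed.

Lemma lebesgue_integrableD (D : set R) (f g : R -> R) : measurable D ->
  mu.-integrable D (EFin \o f) -> mu.-integrable D (EFin \o g) ->
  mu.-integrable D (EFin \o (fun x => f x + g x)).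
Proof. by move=> mD; exact: (@integrableD _ (measurableTypeR R) R mu D mD (EFin \o f) (EFin \o g)). Qed.

Lemma integrable_bounded_mul (A : set R) (f g : R -> R) (M : R) : measurable A ->
  mu.-integrable A (EFin \o f) -> measurable_fun A g ->
  (forall x, A x -> `|g x| <= M) -> mu.-integrable A (EFin \o (fun x => f x * g x)).
Proof.
move=> mA intf mg gM.
have mf : measurable_fun A f by apply/measurable_EFinP; exact: measurable_int intf.
have mfg : measurable_fun A (EFin \o (fun x => f x * g x)).
  by apply/measurable_EFinP; exact: measurable_funM.
have intM : mu.-integrable A (fun x => M%:E * (EFin \o f) x)%E by exact: integrableZl.
apply: (@le_integrable _ _ _ mu A mA _ _ mfg _ intM).
move=> x Ax /=; rewrite lee_fin !normrM mulrC ler_wpM2r//.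
by rewrite (le_trans (gM x Ax))// ler_norm.
Qed.

Lemma W11loc_segment U v dv (a b : R) : W11loc U v dv -> `[a, b] `<=` U ->
  mu.-integrable `[a, b] (EFin \o v) /\ mu.-integrable `[a, b] (EFin \o dv).
Proof.
move=> [[mv oU iv] [mdv _ idv] _] abU; split; apply/integrableP; split.
- by apply/measurable_EFinP; apply: measurable_funS mv => //; exact: open_measurable.
- by apply: iv => //; exact: segment_compact.
- by apply/measurable_EFinP; apply: measurable_funS mdv => //; exact: open_measurable.
- by apply: idv => //; exact: segment_compact.
Qed.

(** The test function S((x - s)/e) - S((x - t)/e) tends to the indicator of []s, t]] as e tends to
    0, and its derivative is a difference of two approximate Dirac masses at s and t. These recover
    v s and v t because s and t are Lebesgue points. *)
Let dbr_segment (S : R -> R) U v dv (a b : R) :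
  smooth S -> (forall x, x <= 0 -> S x = 0) -> (forall x, 1 <= x -> S x = 1) ->
  (forall x, 0 <= S x <= 1) -> (exists2 B, 0 <= B & forall x, `|derive1 S x| <= B) ->
  W11loc U v dv -> `[a, b] `<=` U -> forall s t,
  a < s -> s < t -> t < b ->
  lebesgue_pt (v \_ `[a, b]) s -> lebesgue_pt (v \_ `[a, b]) t ->
  v t - v s = \int[mu]_(x in `[s, t]) dv x.
Proof.
move=> sS S0 S1 S01 [B B0 SB] W abU s t as_ st tb Ls Lt.
have [intv intdv] := W11loc_segment W abU.
have [lv ldv wv] := W.
pose e0 := Num.min (t - s) (b - t).
have e0_gt0 : 0 < e0 by rewrite lt_min !subr_gt0 st.
have e0_t : e0 <= b - t by rewrite ge_min lexx orbT.
(* The denominator n + 2 keeps e n strictly below e0, hence t + e n strictly below b. *)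
pose e (n : nat) : R := e0 / n.+2%:R.
have e_gt0 n : 0 < e n by rewrite divr_gt0.
have e_lt n : e n < e0 by rewrite ltr_pdivrMr// ltr_pMr// ltr1n.
have e_cvg : e n @[n --> \oo] --> 0.
  have h := @cvg_harmonic R; rewrite -cvg_shiftS in h.
  by rewrite -(mulr0 e0); apply: cvgM; [exact: cvg_cst|exact: h].
pose A n r x := (e n)^-1 * x + (- (e n)^-1 * r).
have AE n r x : A n r x = (x - r) / e n by rewrite /A mulNr -mulrBr mulrC.
pose phi n x := S (A n s x) - S (A n t x).
pose psi n r x := (e n)^-1 * derive1 S (A n r x).
have dSA n r x : is_derive x 1 (fun x => S (A n r x)) (psi n r x).
  by apply: is_derive_affine; exact: smooth_derivable.
have dphi n x : derive1 (phi n) x = psi n s x - psi n t x.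
  by rewrite derive1E; have := is_deriveB (dSA n s x) (dSA n t x) => ?; rewrite derive_val.
have A0 n r x : x <= r -> A n r x <= 0.
  by move=> xr; rewrite AE pmulr_lle0 ?invr_gt0// subr_le0.
have A1 n r x : r + e n <= x -> 1 <= A n r x.
  by move=> xr; rewrite AE ler_pdivlMr// mul1r lerBrDl.
have phi_out n x : ~ `[s, t + e n]%classic x -> phi n x = 0.
  move=> /= /negP; rewrite in_itv/= negb_and -!ltNge => /orP[xs|xt].
    by rewrite /phi !S0 ?subrr// A0// ltW// (lt_trans xs).
  by rewrite /phi !S1 ?subrr// A1// ltW// (le_lt_trans _ xt)// lerD2r ltW.
have teb n : t + e n < b.
  by rewrite addrC -ltrBrDr (lt_le_trans (e_lt n)).
have phi_sub n : `[s, t + e n] `<=` `[a, b].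
  move=> x /=; rewrite !in_itv/= => /andP[xs xt].
  by rewrite (ltW (lt_le_trans as_ xs)) (ltW (le_lt_trans xt (teb n))).
have sphi n : smooth (phi n) by apply: smoothB; exact: smooth_affine.
have tphi n : test_fun U (phi n).
  split; first exact: sphi.
  exists `[s, t + e n]%classic; first exact: segment_compact.
  by split; [exact: subset_trans (phi_sub n) abU|exact: phi_out].
have dS0 x : ~ (0 <= x <= 1) -> derive1 S x = 0.
  move=> /negP; rewrite negb_and -!ltNge derive1E => /orP[x0|x1].
    rewrite (@near_eq_derive _ _ _ S (cst 0)) ?derive_cst//.
    by near=> y; rewrite S0//; apply: ltW; near: y; exact: lt_nbhsl.
  rewrite (@near_eq_derive _ _ _ S (cst 1)) ?derive_cst//.
  by near=> y; rewrite S1//; apply: ltW; near: y; exact: lt_nbhsr.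
have psi_out n r x : ~ `[r, r + e n]%classic x -> psi n r x = 0.
  move=> xr; rewrite /psi dS0 ?mulr0//; apply: contra_not xr.
  rewrite /= in_itv/= AE ler_pdivlMr// ler_pdivrMr// mul0r mul1r subr_ge0.
  by rewrite lerBlDl.
have psi_cont n r : continuous (psi n r).
  move=> x; apply: cvgM; first exact: cvg_cst.
  apply: (@continuous_comp _ _ _ (A n r) (derive1 S)).
    by apply: cvgD; [apply: cvgM; [exact: cvg_cst|exact: cvg_id]|exact: cvg_cst].
  by apply: smooth_continuous; exact: smooth_derive.
have psi_le n r x : `|psi n r x| <= B / e n.
  by rewrite /psi normrM gtr0_norm ?invr_gt0// mulrC ler_wpM2r// invr_ge0 ltW.
have psi_int n r : \int[mu]_(x in `[r, r + e n]) psi n r x = 1.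
  have rre : r < r + e n by rewrite ltrDl.
  rewrite /Rintegral (@continuous_FTC2 _ _ (fun x => S (A n r x)) _ _ rre).
  - by rewrite S1 ?A1// S0 ?A0//= subr0.
  - exact: continuous_subspaceT.
  - split.
    + by move=> x _; case: (dSA n r x).
    + apply: cvg_at_right_filter; apply: smooth_continuous; exact: smooth_affine.
    + apply: cvg_at_left_filter; apply: smooth_continuous; exact: smooth_affine.
  - by move=> x _; rewrite derive1E; have := dSA n r x => ?; rewrite derive_val.
have mab : measurable `[a, b]%classic by exact: measurable_itv.
have intvpsi n r (C D : R) : `[C, D] `<=` `[a, b] ->
    mu.-integrable `[C, D] (EFin \o (fun x => v x * psi n r x)).
  move=> CD; apply: (@integrable_bounded_mul _ _ _ (B / e n)) => //.
    exact: lebesgue_integrableS intv.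
  by apply: measurable_funTS; exact: continuous_measurable_fun.
have avg r : a < r -> r <= t -> lebesgue_pt (v \_ `[a, b]) r ->
    \int[mu]_(x in `[a, b]) (v x * psi n r x) @[n --> \oo] --> v r.
  move=> ar rt Lr.
  have rb n : r + e n < b by rewrite (le_lt_trans _ (teb n))// lerD2r.
  have sub n : `[r, r + e n] `<=` `[a, b].
    move=> x /=; rewrite !in_itv/= => /andP[xs xt].
    by rewrite (ltW (lt_le_trans ar xs)) (ltW (le_lt_trans xt (rb n))).
  have rab : r \in `[a, b]%classic.
    by rewrite inE/= in_itv/= (ltW ar)/= (le_trans rt)// ltW.
  pose V := v \_ `[a, b].
  (* The open ball of radius 2 e n contains [[r, r + e n]], endpoint included, and has length 4 e n.
     With the bound B / e n on [psi], this produces the constant 4 B. *)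
  have dav n : (`|\int[mu]_(x in `[a, b]) (v x * psi n r x) - v r|%:E <=
      (4 * B)%:E * davg V r (2 * e n))%E.
    rewrite (Rintegral_support (sub n)); last by move=> x _ /psi_out ->; rewrite mulr0.
    have mpsi : measurable_fun `[r, r + e n] (psi n r).
      by apply: measurable_funTS; exact: continuous_measurable_fun.
    have intpsi : mu.-integrable `[r, r + e n] (EFin \o psi n r).
      apply: continuous_compact_integrable; first exact: segment_compact.
      exact: continuous_subspaceT.
    have -> : v r = \int[mu]_(x in `[r, r + e n]) (v r * psi n r x).
      by rewrite RintegralZl// psi_int mulr1.
    have mI : measurable `[r, r + e n]%classic by exact: measurable_itv.
    have intc : mu.-integrable `[r, r + e n] (EFin \o (fun x => v r * psi n r x)).
      exact: lebesgue_integrableZl.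
    rewrite -RintegralB//; last exact: intvpsi.
    have intd : mu.-integrable `[r, r + e n] (EFin \o (fun x => v x * psi n r x - v r * psi n r x)).
      exact: (lebesgue_integrableB mI (intvpsi n r _ _ (sub n)) intc).
    have intvr : mu.-integrable `[r, r + e n] (EFin \o (fun x => v x - v r)).
      have i1 := lebesgue_integrableS mab mI (sub n) intv.
      have i2 : mu.-integrable `[r, r + e n] (EFin \o cst (v r)).
        apply: continuous_compact_integrable; first exact: segment_compact.
        by apply: continuous_subspaceT => x; exact: cvg_cst.
      exact: (lebesgue_integrableB mI i1 i2).
    apply: (@le_trans _ _ (\int[mu]_(x in `[r, r + e n]) (B / e n * `|v x - v r|)%R)%:E).
      rewrite lee_fin; apply: le_trans (le_normr_Rintegral _ intd) _ => //.
      apply: le_Rintegral => //.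
      - exact: integrable_norm.
      - exact: (lebesgue_integrableZl (B / e n) mI (integrable_norm intvr)).
      - by move=> x _; rewrite -mulrBl normrM mulrC ler_wpM2r.
    rewrite RintegralZl//; last exact: integrable_norm.
    have e4 : 0 < (2 * e n) *+ 2 by rewrite pmulrn_lgt0// mulr_gt0.
    rewrite /davg /iavg (_ : mu (ball r (2 * e n)) = ((2 * e n) *+ 2)%:E); last first.
      by apply: lebesgue_measure_ball; rewrite mulr_ge0// ltW.
    rewrite inver gt_eqF// muleA -EFinM.
    rewrite (_ : 4 * B * ((2 * e n) *+ 2)^-1 = B / e n); last first.
      by have := lt0r_neq0 (e_gt0 n) => ne0; field.
    rewrite EFinM; apply: lee_wpmul2l; first by rewrite lee_fin divr_ge0// ltW.
    rewrite /Rintegral fineK; last first.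
      by apply: integrable_fin_num => //; exact: integrable_norm.
    have subb : `[r, r + e n] `<=` ball r (2 * e n).
      move=> x /=; rewrite in_itv/= => /andP[rx xr].
      suff : `|r - x| < 2 * e n by [].
      rewrite distrC ger0_norm ?subr_ge0//.
      by rewrite (@le_lt_trans _ _ (e n)) ?lerBlDl// mulr_natl mulr2n ltrDl.
    have mV : measurable_fun setT V.
      apply/(measurable_restrictT _ _).1 => //.
      by apply/measurable_EFinP; exact: measurable_int intv.
    rewrite (_ : (\int[mu]_(x in `[r, (r + e n)%R]) `|v x - v r|%:E)%E =
      (\int[mu]_(x in `[r, (r + e n)%R]) `|((center (V r) \o V) x)%:E|)%E); last first.
      apply: eq_integral => x; rewrite inE => xr /=.
      by rewrite /V !patchE rab mem_set//; exact: (sub n).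
    apply: ge0_subset_integral => //.
    - exact: measurable_ball.
    - apply: measurableT_comp => //; apply/measurable_EFinP.
      by apply: measurable_funTS; apply: measurable_funD.
  apply/cvgrPdist_lt => z z0.
  have e2 : (2 * e n) @[n --> \oo] --> (0 : R).
    by rewrite -(mulr0 2); apply: cvgM; [exact: cvg_cst|exact: e_cvg].
  have H0 : (davg V r (2 * e n) @[n --> \oo] --> 0%:E)%E.
    by apply: ((cvge_at_rightP _ _ _).1 Lr); split=> // n; rewrite mulr_gt0.
  have H1 : ((4 * B)%:E * davg V r (2 * e n) @[n --> \oo] --> 0%:E)%E.
    have -> : 0%:E = ((4 * B)%:E * 0%:E)%E by rewrite mule0.
    exact: cvgeZl.
  have [Hfin Hc] := (fine_cvgP _ _).1 H1.
  near=> n; rewrite distrC -lte_fin; apply: le_lt_trans (dav n) _.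
  have fn : ((4 * B)%:E * davg V r (2 * e n))%E \is a fin_num by near: n.
  by rewrite -(fineK fn) lte_fin; near: n; exact: (cvgr_lt _ Hc).
have L1 : \int[mu]_(x in U) (v x * derive1 (phi n) x) @[n --> \oo] --> v s - v t.
  rewrite (_ : (fun n => _) = (fun n => \int[mu]_(x in `[a, b]) (v x * psi n s x) -
      \int[mu]_(x in `[a, b]) (v x * psi n t x))); last first.
    apply/funext => n; rewrite -RintegralB//; [|exact: intvpsi..].
    rewrite (Rintegral_support abU); last first.
      move=> x _ xab; rewrite (derive1_out _ (phi_out n)) ?mulr0//; first exact: itv_closed.
      by move=> /phi_sub.
    by apply: eq_Rintegral => x _; rewrite dphi mulrBr.
  by apply: cvgB; apply: avg => //; [exact: ltW|exact: lt_trans st].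
have L2 : \int[mu]_(x in U) (dv x * phi n x) @[n --> \oo] --> \int[mu]_(x in `[s, t]) dv x.
  rewrite (_ : (fun n => _) = (fun n => \int[mu]_(x in `[a, b]) (dv x * phi n x))); last first.
    apply/funext => n; rewrite (Rintegral_support abU)// => x _ xab.
    by rewrite phi_out ?mulr0// => /phi_sub.
  have -> : \int[mu]_(x in `[s, t]) dv x = \int[mu]_(x in `[a, b]) (dv x * (x \in `]s, t]%classic)%:R).
    have m1 : measurable `]s, t]%classic by exact: measurable_itv.
    rewrite -(Rintegral_itv_obnd_cbnd); last first.
      apply: (lebesgue_integrableS mab m1 _ intdv).
      by move=> x /= xst; apply: (phi_sub 0%N); move: xst => /=; rewrite !in_itv/= => /andP[/ltW-> xt];
        rewrite (le_trans xt)// lerDl ltW.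
    rewrite [RHS](@Rintegral_support `]s, t]%classic).
    - by apply: eq_Rintegral => x => ->; rewrite mulr1.
    - by move=> x /=; rewrite !in_itv/= => /andP[xs xt];
        rewrite (ltW (lt_trans as_ xs)) (ltW (le_lt_trans xt tb)).
    - by move=> x _ xst; rewrite memNset// mulr0.
  have mphi n : measurable_fun setT (phi n) by apply: continuous_measurable_fun; exact: smooth_continuous.
  have mdvab : measurable_fun `[a, b] dv by apply/measurable_EFinP; exact: measurable_int intdv.
  have m1 n : measurable_fun `[a, b] (fun x => dv x * phi n x).
    by apply: measurable_funM => //; exact: measurable_funTS.
  have phi_cvg x : phi n x @[n --> \oo] --> ((x \in `]s, t]%classic)%:R : R).
    have cv r : S (A n r x) @[n --> \oo] --> ((r < x)%R%:R : R).
      have [rx|xr] := ltP r x.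
        apply: cvg_near_cst; near=> n; apply: S1; apply: A1.
        rewrite -lerBrDl; apply: ltW; near: n.
        by apply: (cvgr_lt 0) => //; rewrite subr_gt0.
      apply: cvg_near_cst; near=> n; exact/S0/A0.
    rewrite (_ : (_ \in _)%:R = (s < x)%R%:R - (t < x)%R%:R :> R); first exact: cvgB.
    rewrite mem_setE in_itv/=; have [sx|sx] := ltP s x; have [tx|tx] := ltP t x => /=; rewrite ?subr0 ?subrr//.
    by have := le_lt_trans sx (lt_trans st tx); rewrite ltxx.
  have phi1 n x : `|phi n x| <= 1.
    rewrite ler_norml /phi; have /andP[] := S01 (A n s x); have /andP[] := S01 (A n t x); lra.
  have [] // := @cvg_Rintegral _ (measurableTypeR R) R mu _ _
    (fun x => dv x * (x \in `]s, t]%classic)%:R) _ mab m1 (integrable_norm intdv).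
  - by move=> x _; apply: cvgM; [exact: cvg_cst|exact: phi_cvg].
  - by move=> n x _ /=; rewrite normrM ler_piMr.
have L3 : (fun n => \int[mu]_(x in U) (dv x * phi n x)) @ \oo --> v t - v s.
  rewrite (_ : (fun n => _) = - (fun n => \int[mu]_(x in U) (v x * derive1 (phi n) x))).
    by rewrite -(opprB (v s)); exact: cvgN.
  by apply/funext => n; rewrite fctE wv// opprK.
by apply: cvg_unique L3 L2; exact: Rhausdorff.
Unshelve. all: by end_near. Qed.

(** Du Bois-Reymond's lemma. The exceptional set consists of the points that are not Lebesgue points
    of v restricted to [[a, b]]. *)
Lemma W11loc_ae_increment U v dv (a b : R) : W11loc U v dv -> `[a, b] `<=` U ->
  exists2 N : set R, mu.-negligible N &
    forall s t, a < s -> s <= t -> t < b -> ~ N s -> ~ N t ->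
      v t - v s = \int[mu]_(x in `[s, t]) dv x.
Proof.
move=> W abU; have [S [sS S0 S1 S01 SB]] := @smooth_step R.
have [intv _] := W11loc_segment W abU.
have L : {ae mu, forall x, lebesgue_pt (v \_ `[a, b]) x}.
  by apply: lebesgue_differentiation; exact: integrable_locally_restrict.
exists (~` [set x | lebesgue_pt (v \_ `[a, b]) x]) => // s t as_ + tb Ns Nt.
rewrite le_eqVlt => /predU1P[<-|st].
  by rewrite subrr set_itv1 Rintegral_set1.
by apply: (dbr_segment sS S0 S1 S01 SB W abU) => //; exact: contrapT.
Qed.

End du_Bois_Reymond.

(** * Absolutely continuous functions *)

Section absolute_continuity.
Context {R : realType}.
Notation mu := (@lebesgue_measure R).
Implicit Types (v h : R -> R) (l : seq (R * R)).

(** Lists replace the indexed families of [abs_continuous], so that intervals can be cut and moved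
    by induction. Degenerate intervals are allowed. *)
Definition disjoint_itvs (a b : R) l :=
  all (fun c => [&& a < c.1, c.1 <= c.2 & c.2 < b]) l &&
  pairwise (fun c c' => (c.2 <= c'.1) || (c'.2 <= c.1)) l.

Definition total_length l := \sum_(c <- l) (c.2 - c.1).

Lemma abs_continuous_seq (a b : R) v : abs_continuous a b v -> forall e, 0 < e ->
  exists2 delta, 0 < delta & forall l, disjoint_itvs a b l ->
    total_length l < delta -> \sum_(c <- l) `|v c.2 - v c.1| < e.
Proof.
move=> ac e e0; have [delta d0 H] := ac e e0; exists delta => // l /andP[/allP la lp] ll.
have := H (size l) (fun i => (nth (0, 0) l i).1) (fun i => (nth (0, 0) l i).2).
rewrite [in X in _ -> _ -> X -> _](_ : \sum_i _ = total_length l); last first.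
  by rewrite /total_length (big_nth (0, 0)) big_mkord.
rewrite [in X in _ -> _ -> _ -> X](_ : \sum_i _ = \sum_(c <- l) `|v c.2 - v c.1|); last first.
  by rewrite (big_nth (0, 0)) big_mkord.
apply => //.
- by move=> i; have /and3P[] := la _ (mem_nth (0, 0) (ltn_ord i)).
- move=> i j ij; have P := pairwiseP (0, 0) lp.
  have [ij'|ji|/val_inj ijE] := ltngtP i j; last by rewrite ijE eqxx in ij.
  + by have /orP[] := P _ _ (ltn_ord i) (ltn_ord j) ij'; [left|right].
  + by have /orP[] := P _ _ (ltn_ord j) (ltn_ord i) ji; [right|left].
Qed.

Lemma disjoint_itvs_split (a b x y z : R) l1 l2 : x <= z <= y ->
  disjoint_itvs a b ((x, y) :: l1 ++ l2) ->
  disjoint_itvs a b ((z, y) :: l1 ++ (x, z) :: l2).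
Proof.
move=> /andP[xz zy]; rewrite /disjoint_itvs /= !all_cat !pairwise_cat /= allrel_consr.
move=> /andP[/andP[/and3P[ax xy yb] /andP[-> ->]]].
move=> /andP[/andP[/allP Al1 /allP Al2] /and3P[-> -> ->]].
rewrite xz zy yb ax (lt_le_trans ax xz) (le_lt_trans zy yb) lexx orbT !andbT/=.
rewrite andbAC -!andbA.
apply/and3P; split; last (apply/andP; split).
all: apply/allP => -[u w] uw /=.
- have /orP[/= yu|/= ux] := Al1 _ uw; first by rewrite yu.
  by rewrite (le_trans ux xz) orbT.
- have /orP[/= yu|/= ux] := Al1 _ uw; last by rewrite ux.
  by rewrite (le_trans zy yu) orbT.
- have /orP[/= yu|/= ux] := Al2 _ uw; last by rewrite ux orbT.
  by rewrite (le_trans zy yu).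
- have /orP[/= yu|/= ux] := Al2 _ uw; first by rewrite yu.
  by rewrite (le_trans ux xz) orbT.
Qed.

Lemma partition_cells (a b x y : R) l1 l2 p : itv_partition x y p ->
  disjoint_itvs a b ((x, y) :: l1 ++ l2) ->
  exists l, [/\ disjoint_itvs a b (l1 ++ l),
    total_length (l1 ++ l) = total_length ((x, y) :: l1 ++ l2) &
    forall f, \sum_(c <- l) `|f c.2 - f c.1| = variation x y f p + \sum_(c <- l2) `|f c.2 - f c.1|].
Proof.
elim: p x l2 => [|z p ih] x l2.
  move=> /itv_partition_nil -> /andP[/= /andP[_ D1] /andP[_ D2]]; exists l2; split.
  - exact/andP.
  - by rewrite /total_length big_cons subrr add0r.
  - by move=> f; rewrite variation_nil add0r.
move=> P D; have P' := itv_partition_cons P.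
have xz : x < z by case: P => /= /andP[].
have zy := itv_partition_le P'.
have xzy : x <= z <= y by rewrite ltW.
have [l [lD ll lv]] := ih _ _ P' (disjoint_itvs_split xzy D).
exists l; split => //.
- by rewrite ll /total_length !(big_cat, big_cons)/=; ring.
- move=> f; rewrite lv big_cons /variation /= [in RHS]big_nat_recl//=; ring.
Qed.

(** The cells of partitions of disjoint intervals are again disjoint, with the same total length. In
    the induction the list is split in two: intervals whose total variation is taken come first, and
    those already cut into cells are collected in the second part. *)
Lemma total_variation_sum_le (a b e delta : R) v :
  (forall l, disjoint_itvs a b l -> total_length l < delta ->
     \sum_(c <- l) `|v c.2 - v c.1| <= e) ->
  forall l, disjoint_itvs a b l -> total_length l < delta ->
  (\sum_(c <- l) total_variation c.1 c.2 v <= e%:E)%E.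
Proof.
move=> H; suff P l1 l2 : disjoint_itvs a b (l1 ++ l2) -> total_length (l1 ++ l2) < delta ->
    (\sum_(c <- l1) total_variation c.1 c.2 v + (\sum_(c <- l2) `|v c.2 - v c.1|)%:E <= e%:E)%E.
  by move=> l Dl ll; have := P l [::]; rewrite cats0 big_nil adde0; apply.
elim: l1 l2 => [|[x y] l1 ih] l2 D ll; first by rewrite big_nil add0e lee_fin; exact: H.
have xy : x <= y by case/andP : D => /= /andP[/and3P[]].
rewrite big_cons /= -addeA.
have [S0 S1] : (0 <= \sum_(c <- l1) total_variation c.1 c.2 v)%E /\
    (0 <= (\sum_(c <- l2) `|v c.2 - v c.1|)%:E)%E.
  split; last by rewrite lee_fin sumr_ge0.
  rewrite big_seq sume_ge0// => c cl; apply: total_variation_ge0.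
  case/andP : D => /= /andP[_ /allP D] _; have : c \in l1 ++ l2 by rewrite mem_cat cl.
  by move=> /D/and3P[].
have TVle p : itv_partition x y p -> ((variation x y v p)%:E +
    (\sum_(c <- l1) total_variation c.1 c.2 v + (\sum_(c <- l2) `|v c.2 - v c.1|)%:E) <= e%:E)%E.
  move=> P; have [l [lD lL lv]] := partition_cells P D.
  have := ih _ lD; rewrite lL => /(_ ll); rewrite lv EFinD addeCA.
  by rewrite addeA [X in (X + _ <= _)%E]addeC -addeA.
set S := (\sum_(c <- l1) _ + _)%E in TVle *.
have Sfin : S \is a fin_num.
  have [p P] : exists p, itv_partition x y p.
    move: xy; rewrite le_eqVlt => /predU1P[->|xy]; first by exists [::]; split=> //=.
    by exists [:: y]; exact: itv_partition1.
  rewrite ge0_fin_numE ?adde_ge0//; apply: le_lt_trans (ltry e).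
  by apply: le_trans (TVle p P); rewrite leeDr// lee_fin variation_ge0.
rewrite -leeBrDr//; apply: ge_ereal_sup => _ [_ [p P <-] <-].
by rewrite leeBrDr//; exact: TVle.
Qed.

Definition ac_increasing h := forall e, 0 < e -> exists2 delta, 0 < delta &
  forall a b l, disjoint_itvs a b l -> total_length l < delta ->
    \sum_(c <- l) (h c.2 - h c.1) <= e.

(** An empty I is encoded as the degenerate pair (a, a). The last clause puts every degenerate pair
    at the left end, where it cannot overlap another interval. *)
Lemma open_bounded_interval (I : set R) (a b : R) : open I -> is_interval I ->
  I `<=` `[a, b] -> a <= b -> exists c, [/\ a <= c.1, c.1 <= c.2, c.2 <= b,
    I = `]c.1, c.2[%classic & c.1 = c.2 -> c.1 = a].
Proof.
move=> oI iI Iab ab; have [->|/set0P[x Ix]] := eqVneq I set0.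
  by exists (a, a); split => //=; rewrite set_itvoo0.
have hs : has_sup I.
  by split; [exists x|exists b => y /Iab /=; rewrite in_itv/= => /andP[]].
have hi : has_inf I.
  by split; [exists x|exists a => y /Iab /=; rewrite in_itv/= => /andP[]].
have IE : I = `]inf I, sup I[%classic.
  have := interval_bounded_interior iI (proj2 hi) (proj2 hs).
  by rewrite ((interior_id I).1 oI) => {1}->; apply/seteqP; split => y /=; rewrite in_itv.
exists (inf I, sup I); split => //=.
- by apply: lb_le_inf; [exists x|move=> y /Iab /=; rewrite in_itv/= => /andP[]].
- by move: Ix; rewrite {1}IE /= in_itv/= => /andP[ix xs]; exact: ltW (lt_trans ix xs).
- by apply: ge_sup; [exists x|move=> y /Iab /=; rewrite in_itv/= => /andP[]].
- by move: Ix; rewrite {1}IE /= in_itv/= => /andP[ix xs] E; have := lt_trans ix xs; rewrite E ltxx.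
Qed.

Lemma stieltjes_oc (h : cumulative R R) (x y : R) : x <= y ->
  lebesgue_stieltjes_measure h `]x, y]%classic = (h y - h x)%:E.
Proof.
move=> xy; rewrite /lebesgue_stieltjes_measure /measure_extension/=.
by rewrite measurable_mu_extE; [exact: wlength_itv_bnd|exact: is_ocitv].
Qed.

(** A null set lies in an open set of small measure, which is a countable disjoint union of
    intervals. Absolute continuity bounds the increments of h over any finitely many of them, and
    these increments bound their Stieltjes measures. *)
Lemma ac_increasing_dominates (h : cumulative R R) (a b : R) : ac_increasing h -> a < b ->
  forall E : set (measurableTypeR R), measurable E -> mu E = 0 ->
    lebesgue_stieltjes_measure h (E `&` `]a, b]%classic) = 0.
Proof.
move=> ac ab E mE E0; set nu := lebesgue_stieltjes_measure h.
apply/eqP; rewrite eq_le measure_ge0 andbT; apply/lee_addgt0Pr => e e0; rewrite add0e.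
have [delta d0 H] := ac e e0.
have [U [oU EU Ud]] := @lebesgue_regularity_outer R E delta mE (eq_ind_r (fun x => (x < +oo)%E) (ltry 0) E0) d0.
have mU : measurable (U : set (measurableTypeR R)) by exact: open_measurable.
have {}Ud : (mu U < delta%:E)%E.
  have mUE : measurable (U `\` E : set (measurableTypeR R)) by exact: measurableD.
  have H1 : mu (E `|` (U `\` E)) = (mu E + mu (U `\` E))%E.
    have D0 : E `&` (U `\` E) = set0 by apply/seteqP; split=> x // -[Ex []].
    exact: measureU.
  by rewrite setDUK// E0 add0e in H1; rewrite H1.
(* The intersection with a bounded interval gives the components finite endpoints; the margin 1
   keeps []a, b]] inside. *)
pose V := U `&` `](a - 1), (b + 1)[%classic.
have oV : open V by apply: openI => //; exact: itv_open.
have VE := @open_disjoint_itv_bigcup _ _ oV.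
have VI := @open_disjoint_itv_trivIset _ _ oV.
have oI k := @open_disjoint_itv_open _ _ oV k.
have iI k := @open_disjoint_itv_is_interval _ _ oV k.
set I := open_disjoint_itv oV in VE VI oI iI.
have IV k : I k `<=` V by rewrite VE => x Ix; exists k.
have ab1 : a - 1 <= b + 1 by lra.
have Iab k : I k `<=` `[a - 1, b + 1].
  by move=> x /IV[_] /=; rewrite !in_itv/= => /andP[/ltW -> /ltW ->].
have [c Hc] := choice (fun k => open_bounded_interval (oI k) (iI k) (Iab k) ab1).
have mI k : measurable (I k : set (measurableTypeR R)) by exact: open_measurable.
have part n : (\sum_(0 <= k < n) nu (I k) <= e%:E)%E.
  pose l := [seq c k | k <- iota 0 n].
  have Dl : disjoint_itvs (a - 2) (b + 2) l.
    apply/andP; split.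
      apply/allP => _ /mapP[k _ ->]; have [c1 c2 c3 _ _] := Hc k.
      by apply/and3P; split => //; lra.
    rewrite pairwise_map; apply: (@sub_pairwise _ (fun i j => i != j)); last first.
      by rewrite -uniq_pairwise iota_uniq.
    move=> i j ij; rewrite /relpre /=.
    have [ci1 ci2 ci3 Ii ei] := Hc i; have [cj1 cj2 cj3 Ij ej] := Hc j.
    move: ci2; rewrite le_eqVlt => /predU1P[ci2|ci2].
      by rewrite -ci2 (ei ci2) cj1.
    move: cj2; rewrite le_eqVlt => /predU1P[cj2|cj2].
      by rewrite -cj2 (ej cj2) ci1 orbT.
    rewrite !leNgt -negb_and; apply/negP => /andP[h1 h2].
    pose x := Num.max (c i).1 (c j).1; pose y := Num.min (c i).2 (c j).2.
    have xy : x < y by rewrite /x /y gt_max !lt_min ci2 cj2 h1 h2.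
    have zi : I i ((x + y) / 2).
      rewrite Ii /= in_itv/=; apply/andP; split.
        by apply: le_lt_trans (midf_lt xy).1; rewrite /x le_max lexx.
      by apply: lt_le_trans (midf_lt xy).2 _; rewrite /y ge_min lexx.
    have zj : I j ((x + y) / 2).
      rewrite Ij /= in_itv/=; apply/andP; split.
        by apply: le_lt_trans (midf_lt xy).1; rewrite /x le_max lexx orbT.
      by apply: lt_le_trans (midf_lt xy).2 _; rewrite /y ge_min lexx orbT.
    have /trivIsetP/(_ i j Logic.I Logic.I ij)/seteqP[/(_ ((x + y) / 2))] := VI.
    by move=> /(_ (conj zi zj)).
  have ll : total_length l < delta.
    rewrite -lte_fin; apply: le_lt_trans Ud.
    apply: (@le_trans _ _ (mu V)); last first.
      by apply: le_measure; rewrite ?inE//; [exact: open_measurable|exact: subIsetl].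
    have -> : mu V = (\sum_(0 <= k <oo) mu (I k))%E.
      by rewrite VE [LHS]measure_bigcup//; apply: eq_eseriesl => k; rewrite in_setT.
    rewrite /total_length big_map -sumEFin.
    apply: le_trans (nneseries_lim_ge n _) => //; rewrite /index_iota subn0.
    apply: lee_sum => k _; have [_ c12 _ -> _] := Hc k.
    rewrite [leRHS]lebesgue_measure_itv/= lte_fin; case: ltP => c21; first by rewrite EFinB.
    by rewrite lee_fin subr_le0.
  have := H _ _ _ Dl ll; rewrite -lee_fin; apply: le_trans.
  rewrite big_map -sumEFin /index_iota subn0.
  apply: lee_sum => k _; have [_ c12 _ IE _] := Hc k.
  rewrite -(stieltjes_oc _ c12); apply: le_measure; rewrite ?inE//.
  by rewrite IE => z /=; rewrite !in_itv/= => /andP[-> /ltW].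
apply: (@le_trans _ _ (nu V)).
  apply: le_measure; rewrite ?inE//; [exact: measurableI|exact: open_measurable|].
  move=> x [/EU Ux]; rewrite /= in_itv/= => /andP[ax xb]; split => //=.
  by rewrite in_itv/=; apply/andP; split; lra.
have -> : nu V = (\sum_(0 <= k <oo) nu (I k))%E.
  by rewrite VE [LHS]measure_bigcup//; apply: eq_eseriesl => k; rewrite in_setT.
apply: lime_le; first exact: is_cvg_nneseries.
exact: nearW.
Qed.

Lemma ac_increasing_density (h : cumulative R R) (a b : R) : ac_increasing h -> a < b ->
  exists g : R -> R, [/\ forall x, 0 <= g x, mu.-integrable setT (EFin \o g) &
    forall x y, a <= x -> x <= y -> y <= b ->
      (h y - h x)%:E = (\int[mu]_(z in `]x, y]) (g z)%:E)%E].
Proof.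
move=> ac ab.
have mab : measurable (`]a, b]%classic : set (measurableTypeR R)) by exact: measurable_itv.
have noo : (lebesgue_stieltjes_measure h (`]a, b]%classic : set (measurableTypeR R)) < +oo)%E.
  by rewrite stieltjes_oc ?ltW// ltry.
pose nu : {finite_measure set (measurableTypeR R) -> \bar R} :=
  @mfrestr _ (measurableTypeR R) R _ (lebesgue_stieltjes_measure h) mab noo.
have dom : nu `<< (mu : {sigma_finite_measure set (measurableTypeR R) -> \bar R}).
  apply/null_content_dominatesP => E mE E0.
  exact: ac_increasing_dominates ac ab E mE E0.
have [f [f0 ffin fint fE]] := radon_nikodym_sigma_finite dom.
have fE' : f = EFin \o (fine \o f) by apply/funext => x /=; rewrite fineK.
exists (fine \o f); split.
- by move=> x; exact: fine_ge0.
- by rewrite -fE'.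
- move=> x y ax xy yb; transitivity (nu `]x, y]%classic); last first.
    by rewrite fE; [rewrite [in LHS]fE'|exact: measurable_itv].
  rewrite /nu /= /mfrestr /mrestr setIidl ?stieltjes_oc// => z /=; rewrite !in_itv/= => /andP[xz zy].
  by rewrite (le_lt_trans ax xz) (le_trans zy yb).
Qed.

Lemma ac_increasing_continuous h : {homo h : x y / x <= y} -> ac_increasing h -> continuous h.
Proof.
move=> hnd ac x; apply/cvgrPdist_le => e e0; have [delta d0 H] := ac e e0.
have K u w : u <= w -> w - u < delta -> h w - h u <= e.
  move=> uw wu; have := H (u - 1) (w + 1) [:: (u, w)].
  rewrite /total_length !big_cons !big_nil !addr0; apply => //.
  by rewrite /disjoint_itvs /= uw !andbT; apply/andP; split; lra.
near=> y; have xy : `|x - y| < delta by near: y; exact: cvgr_dist_lt.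
have [le|/ltW le] := leP x y.
- rewrite distrC ger0_norm ?subr_ge0 ?hnd//; apply: K => //.
  by rewrite distrC ger0_norm ?subr_ge0// in xy.
- by rewrite ger0_norm ?subr_ge0 ?hnd//; apply: K => //; rewrite ger0_norm ?subr_ge0// in xy.
Unshelve. all: by end_near. Qed.

Lemma increasing_density h (a b : R) : {homo h : x y / x <= y} -> ac_increasing h -> a < b ->
  exists g : R -> R, [/\ forall x, 0 <= g x, mu.-integrable setT (EFin \o g) &
    forall x y, a <= x -> x <= y -> y <= b ->
      (h y - h x)%:E = (\int[mu]_(z in `]x, y]) (g z)%:E)%E].
Proof.
move=> hnd ac ab; have hc := ac_increasing_continuous hnd ac.
pose C := isCumulative.Build R _ R h hnd (right_continuousW hc).
pose H : cumulative R R := HB.pack h C.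
exact: (@ac_increasing_density H a b).
Qed.

(** Composing with this projection onto [[s, t]] extends a function by constants to the whole line,
    where the Stieltjes measure is defined. *)
Let clamp (s t x : R) := Num.max s (Num.min x t).

Let clamp_homo s t : {homo clamp s t : x y / x <= y}.
Proof. by move=> x y xy; rewrite /clamp le_max2 ?le_min2. Qed.

Let clamp_itv s t x : s <= t -> s <= clamp s t x <= t.
Proof. by move=> st; rewrite /clamp le_max lexx/= ge_max st ge_min lexx orbT. Qed.

Let clamp_id s t x : s <= x <= t -> clamp s t x = x.
Proof. by move=> /andP[sx xt]; rewrite /clamp (min_idPl xt) (max_idPr sx). Qed.

Let clamp_le s t x y : s <= t -> x <= y -> clamp s t y - clamp s t x <= y - x.
Proof.
move=> st xy; rewrite /clamp /Num.max /Num.min.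
by case: (ltP x t) => ?; case: (ltP y t) => ?; repeat case: ltP => ?; lra.
Qed.

Let clamp_disjoint a b s t A B l : a < s -> s <= t -> t < b -> disjoint_itvs A B l ->
  disjoint_itvs a b [seq (clamp s t c.1, clamp s t c.2) | c <- l].
Proof.
move=> as_ st tb /andP[/allP Al Pl]; apply/andP; split.
  apply/allP => _ /mapP[c cl ->] /=; have /and3P[_ c12 _] := Al _ cl.
  have /andP[h1 _] := @clamp_itv s t c.1 st; have /andP[_ h2] := @clamp_itv s t c.2 st.
  by rewrite clamp_homo// (lt_le_trans as_ h1) (le_lt_trans h2 tb).
rewrite pairwise_map; apply: sub_pairwise Pl => c c' /orP[h|h]; apply/orP; [left|right];
  exact: clamp_homo.
Qed.

Let clamp_length s t A B l : s <= t -> disjoint_itvs A B l ->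
  total_length [seq (clamp s t c.1, clamp s t c.2) | c <- l] <= total_length l.
Proof.
move=> st /andP[/allP Al _]; rewrite /total_length big_map big_seq [leRHS]big_seq.
by apply: ler_sum => c /Al/and3P[_ c12 _]; exact: clamp_le.
Qed.

(** The segment is crossed by finitely many steps of length delta / 2, each of variation at most
    1. *)
Lemma abs_continuous_bounded_variation (a b s t : R) v : abs_continuous a b v ->
  a < s -> s <= t -> t < b -> total_variation s t v \is a fin_num.
Proof.
move=> /abs_continuous_seq ac as_ st tb; have [delta d0 H] := ac 1 ltr01.
have H' l : disjoint_itvs a b l -> total_length l < delta -> \sum_(c <- l) `|v c.2 - v c.1| <= 1.
  by move=> Dl ll; exact/ltW/H.
have K := total_variation_sum_le H'.
have P n x : s <= x -> x <= t -> x <= s + n%:R * (delta / 2) -> (total_variation s x v <= n%:R%:E)%E.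
  elim: n x => [|n ih] x sx xt; first by rewrite mul0r addr0 => xs;
    rewrite (_ : x = s) ?total_variationxx//; apply/le_anti; rewrite xs.
  move=> xn; pose y := Num.min x (s + n%:R * (delta / 2)).
  have sy : s <= y by rewrite le_min sx lerDl mulr_ge0// divr_ge0// ltW.
  have yx : y <= x by rewrite ge_min lexx.
  rewrite (total_variationD v sy yx) -natr1 EFinD; apply: leeD.
    by apply: ih => //; [exact: le_trans yx xt|rewrite ge_min lexx orbT].
  have := K [:: (y, x)]; rewrite /total_length !big_cons !big_nil/= addr0 adde0; apply.
    by rewrite /disjoint_itvs /= yx (lt_le_trans as_ sy) (le_lt_trans xt tb).
  rewrite /y; case: (leP x) => h; first by rewrite subrr.
  by move: xn; rewrite -natr1 mulrDl mul1r => xn; lra.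
rewrite ge0_fin_numE ?total_variation_ge0//.
apply: le_lt_trans (P (Num.truncn ((t - s) / (delta / 2))).+1 t st (lexx t) _) (ltry _).
rewrite -lerBlDl -ler_pdivrMr ?divr_gt0//; apply: ltW; exact: truncnS_gt.
Qed.

(** Jordan's decomposition: v is the difference of its variation V and of W = V - v, both increasing
    and absolutely continuous. The Stieltjes measure of each has a Radon-Nikodym density, and g is
    the difference of the densities. *)
Lemma abs_continuous_density (a b s t : R) v : abs_continuous a b v ->
  a < s -> s < t -> t < b ->
  exists2 g : R -> R, mu.-integrable setT (EFin \o g) &
    forall x y, s <= x -> x <= y -> y <= t -> v y - v x = \int[mu]_(z in `]x, y]) g z.
Proof.
move=> ac as_ st tb; have st' := ltW st.
have BVf x y : s <= x -> x <= y -> y <= t -> total_variation x y v \is a fin_num.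
  move=> sx xy yt; apply: (abs_continuous_bounded_variation ac) => //.
    exact: lt_le_trans sx.
  exact: le_lt_trans tb.
pose V x := fine (total_variation s (clamp s t x) v).
have VE x y : x <= y -> V y - V x = fine (total_variation (clamp s t x) (clamp s t y) v).
  move=> xy; have /andP[x1 x2] := @clamp_itv s t x st'; have /andP[y1 y2] := @clamp_itv s t y st'.
  rewrite /V (total_variationD v x1 (clamp_homo s t xy)) fineD ?BVf ?clamp_homo//.
  by rewrite addrAC subrr add0r.
have Vge x y : x <= y -> `|v (clamp s t y) - v (clamp s t x)| <= V y - V x.
  move=> xy; have /andP[x1 x2] := @clamp_itv s t x st'; have /andP[y1 y2] := @clamp_itv s t y st'.
  rewrite VE// -lee_fin fineK ?BVf ?clamp_homo//; apply: total_variation_ge; exact: clamp_homo.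
pose W x := V x - v (clamp s t x).
(* The factor 2 is for W: its increments are those of V minus those of v, and the latter are bounded
   by the former. *)
have acI h : (forall x y, x <= y -> h y - h x <= 2 * (V y - V x)) -> ac_increasing h.
  move=> hV e e0; have e2 : 0 < e / 2 by rewrite divr_gt0.
  have [delta d0 H] := abs_continuous_seq ac e2; exists delta => // A B l Dl ll.
  have H' l' : disjoint_itvs a b l' -> total_length l' < delta ->
    \sum_(c <- l') `|v c.2 - v c.1| <= e / 2 by move=> D' l'l; exact/ltW/H.
  have := total_variation_sum_le H' (clamp_disjoint as_ st' tb Dl)
    (le_lt_trans (clamp_length st' Dl) ll).
  have Al : {in l, forall c, c.1 <= c.2}.
    by case/andP: Dl => /allP Al _ c /Al /and3P[].
  rewrite big_map/= [X in (X <= _)%E](_ : _ = (\sum_(c <- l) (V c.2 - V c.1))%:E); last first.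
    rewrite -sumEFin big_seq [RHS]big_seq; apply: eq_bigr => c cl.
    rewrite VE ?Al// fineK// BVf ?clamp_homo ?Al//.
      by have /andP[] := @clamp_itv s t c.1 st'.
    by have /andP[] := @clamp_itv s t c.2 st'.
  rewrite lee_fin ler_pdivlMr// mulrC => le2; apply: le_trans le2.
  rewrite big_distrr/= big_seq [leRHS]big_seq; apply: ler_sum => c cl.
  exact/hV/Al.
have V0 x y : x <= y -> 0 <= V y - V x by move=> xy; exact: le_trans (Vge _ _ xy).
have [g1 [g10 ig1 g1E]] : exists g : R -> R, [/\ forall x, 0 <= g x, mu.-integrable setT (EFin \o g) &
    forall x y, s <= x -> x <= y -> y <= t ->
      (V y - V x)%:E = (\int[mu]_(z in `]x, y]) (g z)%:E)%E].
  apply: increasing_density => //; first by move=> x y xy; rewrite -subr_ge0 V0.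
  by apply: acI => x y /V0 h; lra.
have [g2 [g20 ig2 g2E]] : exists g : R -> R, [/\ forall x, 0 <= g x, mu.-integrable setT (EFin \o g) &
    forall x y, s <= x -> x <= y -> y <= t ->
      (W y - W x)%:E = (\int[mu]_(z in `]x, y]) (g z)%:E)%E].
  apply: increasing_density => //.
    move=> x y xy; rewrite -subr_ge0 /W; have := Vge _ _ xy; rewrite ler_norml => /andP[_]; lra.
  by apply: acI => x y xy; rewrite /W; have := Vge _ _ xy; rewrite ler_norml => /andP[]; lra.
have mT : measurable (setT : set (measurableTypeR R)) by [].
exists (fun z => g1 z - g2 z); first exact: lebesgue_integrableB.
move=> x y sx xy yt.
have mxy : measurable (`]x, y]%classic : set R) by exact: measurable_itv.
have i1 := lebesgue_integrableS mT mxy (@subsetT _ _) ig1.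
have i2 := lebesgue_integrableS mT mxy (@subsetT _ _) ig2.
rewrite RintegralB// /Rintegral -g1E// -g2E//= /W !clamp_id//; first by lra.
  by rewrite sx (le_trans xy yt).
by rewrite yt (le_trans sx xy).
Qed.

End absolute_continuity.

Section ae_modification.
Context d (T : measurableType d) (R : realType) (mu : {measure set T -> \bar R}).
Local Open Scope ereal_scope.
Import HBSimple HBNNSimple.

Let le_integral_null (f g : T -> \bar R) (N : set T) : measurable N -> mu N = 0 ->
  (forall x, 0 <= f x) -> (forall x, 0 <= g x) -> (forall x, ~ N x -> f x = g x) ->
  \int[mu]_x f x <= \int[mu]_x g x.
Proof.
move=> mN N0 f0 g0 fg; rewrite ge0_integralTE//.
apply: ge_ereal_sup => _ [h /= hf <-]; rewrite -integralT_nnsfun.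
pose k (x : T) : \bar R := (h x * \1_(~` N) x)%:E.
have mk : measurable_fun setT k.
  apply/measurable_EFinP; apply: measurable_funM => //.
  exact: measurable_indic (measurableC mN).
have -> : \int[mu]_x (h x)%:E = \int[mu]_x k x.
  apply: ge0_ae_eq_integral => //.
  - exact/measurable_EFinP.
  - by move=> x _; rewrite lee_fin.
  - by move=> x _; rewrite /k lee_fin mulr_ge0// indicE.
  - exists N; split=> // x /= /not_implyP[_ hk]; apply: contrapT => Nx; apply: hk.
    by rewrite /k indicE mem_set// mulr1.
pose k' := k : T -> \bar R.
have [kn [kn1 kn2]] : exists kn : {nnsfun T >-> R}, (forall x, (kn x)%:E = k x) /\ True.
  pose ic : {nnsfun T >-> R} := indic_nnsfun R (measurableC mN).
  by exists (mul_nnsfun h ic); split.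
rewrite (_ : k = EFin \o kn); last by apply/funext => x; rewrite /= kn1.
rewrite integralT_nnsfun ge0_integralTE//; apply: ereal_sup_ubound; exists kn => //= x.
rewrite kn1 /k indicE; have [Nx|Nx] := pselect (N x).
  by rewrite memNset ?mulr0// => /(_ Nx).
by rewrite mem_set// mulr1 -fg.
Qed.

(** f and g are arbitrary nonnegative functions, not known to be measurable. The integral is a
    supremum over simple functions, and a simple function keeps its integral when it is set to 0 on
    N. Integrands that contain [derive1 v] come under this form. *)
Lemma ge0_integral_eq_null (D : set T) (f g : T -> \bar R) (N : set T) :
  measurable N -> mu N = 0 ->
  (forall x, D x -> 0 <= f x) -> (forall x, D x -> 0 <= g x) ->
  (forall x, D x -> ~ N x -> f x = g x) ->
  \int[mu]_(x in D) f x = \int[mu]_(x in D) g x.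
Proof.
move=> mN N0 f0 g0 fg; rewrite integral_mkcond [RHS]integral_mkcond.
have F0 x : 0 <= (f \_ D) x by rewrite patchE; case: ifPn => // /[!inE]; exact: f0.
have G0 x : 0 <= (g \_ D) x by rewrite patchE; case: ifPn => // /[!inE]; exact: g0.
have FG x : ~ N x -> (f \_ D) x = (g \_ D) x.
  by move=> Nx; rewrite !patchE; case: ifPn => // /[!inE] Dx; exact: fg.
apply/eqP; rewrite eq_le (le_integral_null mN)// (le_integral_null mN)// => x Nx.
by rewrite FG.
Qed.

End ae_modification.

(** * Primitives, their derivatives and weak derivatives *)

Section primitives.
Context {R : realType}.
Notation mu := (@lebesgue_measure R).
Implicit Types (f g v phi : R -> R).

Lemma lebesgue_aeS (P Q : R -> Prop) : (forall x, P x -> Q x) ->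
  {ae mu, forall x, P x} -> {ae mu, forall x, Q x}.
Proof. by move=> PQ; apply: filterS => //; exact: (ae_filter_ringOfSetsType mu). Qed.

Lemma lebesgue_ae_foralln (P : nat -> R -> Prop) :
  (forall n, {ae mu, forall x, P n x}) -> {ae mu, forall x, forall n, P n x}.
Proof. exact: (@ae_foralln _ (measurableTypeR R) R mu). Qed.

Lemma primitive_increment f (a s t : R) : mu.-integrable setT (EFin \o f) -> a <= s -> s <= t ->
  \int[mu]_(x in `]a, t]) f x - \int[mu]_(x in `]a, s]) f x = \int[mu]_(x in `]s, t]) f x.
Proof.
move=> intf as_ st; apply: Rintegral_itvB; rewrite ?bnd_simp//.
by apply: lebesgue_integrableS intf => //; exact: measurable_itv.
Qed.

Lemma abs_continuous_primitive (a b c : R) f : mu.-integrable setT (EFin \o f) ->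
  abs_continuous a b (fun x => c + \int[mu]_(y in `]a, x]) f y).
Proof.
move=> intf e e0.
have [delta [d0 H]] := @integral_normr_continuous _ (measurableTypeR R) R mu f intf e e0.
exists delta => // n s t st disj sd.
pose I (i : 'I_n) : set (measurableTypeR R) := `]s i, t i]%classic.
have mI i : measurable (I i) by exact: measurable_itv.
have tI : trivIset [set` index_enum 'I_n] I.
  apply/trivIsetP => i j _ _ ij; apply/seteqP; split => // x [].
  rewrite /I /= !in_itv/= => /andP[si ti] /andP[sj tj].
  have [ts|ts] := disj i j ij.
    by have := lt_le_trans sj (le_trans ti ts); rewrite ltxx.
  by have := lt_le_trans si (le_trans tj ts); rewrite ltxx.
pose D : set (measurableTypeR R) := \big[setU/set0]_(i <- index_enum 'I_n) I i.
have mD : measurable D by apply: bigsetU_measurable.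
have uE : uniq (index_enum 'I_n) by exact: index_enum_uniq.
have muD : (mu D < delta%:E)%E.
  rewrite -(mul1e (mu D)) -integral_cst// ge0_integral_bigsetU//.
  rewrite (eq_bigr (fun i => (t i - s i)%:E)); first by rewrite sumEFin lte_fin.
  move=> i _; rewrite integral_cst// mul1e.
  transitivity (mu `]s i, t i]%classic) => //; rewrite lebesgue_measure_itv/= lte_fin.
  have [_ + _] := st i; rewrite le_eqVlt => /predU1P[->|->]; last by rewrite EFinB.
  by rewrite ltxx subrr.
have intD : mu.-integrable D (EFin \o f) by exact: lebesgue_integrableS intf.
have := H D mD muD; apply: le_lt_trans.
rewrite -lee_fin /Rintegral fineK; last first.
  by apply: integrable_fin_num => //; exact: integrable_norm.
rewrite [leRHS]ge0_integral_bigsetU//; last first.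
  by case/integrableP : (integrable_norm intD).
rewrite -sumEFin; apply: lee_sum => i _.
have [asi sti _] := st i.
rewrite opprD addrACA subrr add0r primitive_increment ?(ltW asi)//.
have inti : mu.-integrable (I i) (EFin \o f).
  exact: (@integrableS _ (measurableTypeR R) R mu setT).
apply: (@le_trans _ _ (\int[mu]_(x in I i) `|f x|)%:E).
  by rewrite lee_fin; apply: le_normr_Rintegral.
by rewrite /Rintegral fineK//; apply: integrable_fin_num => //; exact: integrable_norm.
Qed.

Lemma abs_continuous_cts (a b : R) v : abs_continuous a b v ->
  forall x, a < x < b -> {for x, continuous v}.
Proof.
move=> /abs_continuous_seq ac x /andP[ax xb]; apply/cvgrPdist_lt => e e0.
have [delta d0 H] := ac e e0.
have K u w : a < u -> u <= w -> w < b -> w - u < delta -> `|v w - v u| < e.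
  move=> au uw wb wu; have := H [:: (u, w)].
  by rewrite /total_length !big_cons !big_nil !addr0 /disjoint_itvs/= au uw wb; exact.
near=> y.
have xy : `|x - y| < delta by near: y; exact: cvgr_dist_lt.
have ay : a < y by near: y; exact: lt_nbhsr.
have yb : y < b by near: y; exact: lt_nbhsl.
have [le|/ltW le] := leP x y.
- by rewrite distrC; apply: K => //; rewrite distrC ger0_norm ?subr_ge0// in xy.
- by apply: K => //; rewrite ger0_norm ?subr_ge0// in xy.
Unshelve. all: by end_near. Qed.

(** Increments of v are known only strictly inside []a, b[], so Lebesgue's theorem is applied from
    the base points a + 1/(n+1) and the countably many null sets are collected. *)
Lemma primitive_is_derive f (a b : R) v : mu.-integrable setT (EFin \o f) ->
  (forall x y, a < x -> x <= y -> y < b -> v y - v x = \int[mu]_(z in `]x, y]) f z) ->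
  {ae mu, forall x, a < x < b -> derivable v x 1 /\ derive1 v x = f x}.
Proof.
move=> intf vf.
have locf : locally_integrable setT f.
  by have := integrable_locally_restrict (@measurableT _ _) intf; rewrite patch_setT.
have mT : measurable (setT : set R) by [].
have intfy (m y : R) : mu.-integrable [set` Interval (BRight m) (BRight y)] (EFin \o f).
  by apply: lebesgue_integrableS intf => //; exact: measurable_itv.
have H (n : nat) : {ae mu, forall x, a + n.+1%:R^-1 < x -> x < b -> derivable v x 1 /\ derive1 v x = f x}.
  apply: lebesgue_aeS (@FTC1 R f (BRight (a + n.+1%:R^-1)) (intfy _) locf) => x Hx ax xb.
  have ax' : (BRight (a + n.+1%:R^-1) < BRight x)%O by rewrite bnd_simp.
  have [D1 D2] := Hx ax'.
  pose s := (a + n.+1%:R^-1); have as_ : a < s by rewrite ltrDl invr_gt0.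
  have DF : is_derive x 1 (fun y => \int[mu]_(t in `]s, y]) f t) (f x).
    exact: (DeriveDef D1 (etrans (esym (derive1E _ _)) D2)).
  have Dv : is_derive x 1 v (f x).
    apply: near_eq_is_derive (is_derive_eq (is_deriveD (is_derive_cst (v s) x (1 : R)) DF) (add0r _)).
    near=> y; have sy : s < y by near: y; exact: lt_nbhsr.
    have yb : y < b by near: y; exact: lt_nbhsl.
    suff : v s + \int[mu]_(z in `]s, y]) f z = v y by [].
    by rewrite -vf ?ltW//; lra.
  by split; [case: Dv|rewrite derive1E derive_val].
apply: lebesgue_aeS (lebesgue_ae_foralln H) => x Hx /andP[ax xb].
have xa : 0 < x - a by rewrite subr_gt0.
apply: (Hx (Num.truncn (x - a)^-1)) => //.
rewrite -ltrBrDl invf_plt ?posrE//; exact: truncnS_gt.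
Unshelve. all: by end_near. Qed.

Lemma Rintegral_dist_cvg (D : set R) (f h : R -> R) (g_ : nat -> R -> R) (M : R) : measurable D ->
  mu.-integrable D (EFin \o f) -> (forall n, mu.-integrable D (EFin \o g_ n)) ->
  \int[mu]_(x in D) `|f x - g_ n x| @[n --> \oo] --> 0 ->
  measurable_fun D h -> (forall x, D x -> `|h x| <= M) ->
  \int[mu]_(x in D) (g_ n x * h x) @[n --> \oo] --> \int[mu]_(x in D) (f x * h x).
Proof.
move=> mD intf intg gf mh hM.
have ifh := integrable_bounded_mul mD intf mh hM.
have igh n := integrable_bounded_mul mD (intg n) mh hM.
apply/cvgrPdist_le => e e0.
have M1 : 0 < `|M| + 1 by rewrite ltr_wpDl.
near=> n.
rewrite -RintegralB//.
have intB := lebesgue_integrableB mD intf (intg n).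
have intN := integrable_norm intB.
apply: le_trans (le_normr_Rintegral _ (lebesgue_integrableB mD ifh (igh n))) _ => //.
apply: (@le_trans _ _ (\int[mu]_(x in D) ((`|M| + 1) * `|f x - g_ n x|))).
  apply: le_Rintegral => //.
  - by apply: integrable_norm; exact: lebesgue_integrableB.
  - exact: lebesgue_integrableZl.
  - move=> x Dx; rewrite -mulrBl normrM mulrC ler_wpM2r//.
    by rewrite (le_trans (hM x Dx))// (le_trans (ler_norm M))// lerDl.
rewrite RintegralZl// -ler_pdivlMl// mulrC.
have : `|0 - \int[mu]_(x in D) `|f x - g_ n x| | <= e / (`|M| + 1).
  by near: n; apply: cvgr_dist_le => //; rewrite divr_gt0.
by rewrite sub0r normrN; apply: le_trans; exact: ler_norm.
Unshelve. all: by end_near. Qed.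

Lemma continuous_L1_approx (s t : R) f : mu.-integrable setT (EFin \o f) ->
  exists g_ : nat -> R -> R, [/\ forall n, continuous (g_ n),
    forall n, mu.-integrable `[s, t] (EFin \o g_ n) &
    \int[mu]_(x in `[s, t]) `|f x - g_ n x| @[n --> \oo] --> 0].
Proof.
move=> intf; have mI : measurable (`[s, t]%classic : set R) by exact: measurable_itv.
have intf' : mu.-integrable `[s, t] (EFin \o f) by exact: lebesgue_integrableS intf.
have fin : (mu `[s, t]%classic < +oo)%E.
  by rewrite lebesgue_measure_itv/=; case: ifP => _; rewrite -?EFinB ltry.
have [g_ [cg ig gf]] := approximation_continuous_integrable mI fin intf'.
exists g_; split => //; rewrite /Rintegral.
exact: (fine_cvg gf).
Qed.

Lemma continuous_primitive (g : R -> R) (s x : R) : continuous g -> s < x ->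
  is_derive x 1 (fun y => \int[mu]_(z in `]s, y]) g z) (g x).
Proof.
move=> cg sx; have xx : x < x + 1 by rewrite ltrDl.
have intg : mu.-integrable [set` Interval (BRight s) (BRight (x + 1))] (EFin \o g).
  have m1 : measurable (`]s, x + 1]%classic : set R) by exact: measurable_itv.
  have m2 : measurable (`[s, x + 1]%classic : set R) by exact: measurable_itv.
  apply: (lebesgue_integrableS m2 m1).
    by move=> z /=; rewrite !in_itv/= => /andP[/ltW -> ->].
  apply: continuous_compact_integrable; first exact: segment_compact.
  exact: continuous_subspaceT.
have sx' : (BRight s < BRight x)%O by rewrite bnd_simp.
have [D1 D2] := @continuous_FTC1 _ g (BRight s) x _ xx intg sx' (@cg x).
exact: (DeriveDef D1 (etrans (esym (derive1E _ _)) D2)).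
Qed.

Lemma primitive_dist_le f g (s t x : R) : s <= x -> x <= t ->
  mu.-integrable `[s, t] (EFin \o f) -> mu.-integrable `[s, t] (EFin \o g) ->
  `|\int[mu]_(y in `]s, x]) f y - \int[mu]_(y in `]s, x]) g y| <=
  \int[mu]_(y in `[s, t]) `|f y - g y|.
Proof.
move=> sx xt intf intg.
have mI : measurable (`[s, t]%classic : set R) by exact: measurable_itv.
have mJ : measurable (`]s, x]%classic : set R) by exact: measurable_itv.
have JI : `]s, x]%classic `<=` `[s, t]%classic.
  by move=> z /=; rewrite !in_itv/= => /andP[/ltW -> zx]; exact: le_trans xt.
have i1 := lebesgue_integrableS mI mJ JI intf.
have i2 := lebesgue_integrableS mI mJ JI intg.
have iB := lebesgue_integrableB mI intf intg.
rewrite -RintegralB//.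
apply: le_trans (le_normr_Rintegral _ (lebesgue_integrableB mJ i1 i2)) _ => //.
rewrite -lee_fin /Rintegral !fineK; last 2 first.
- by apply: integrable_fin_num => //; exact: integrable_norm.
- by apply: integrable_fin_num => //; apply: integrable_norm; exact: lebesgue_integrableB.
by apply: ge0_subset_integral => //; case/integrableP : (integrable_norm iB).
Qed.

Lemma segment_bounded (s t : R) (h : R -> R) : {within `[s, t], continuous h} ->
  exists M, forall x, `[s, t]%classic x -> `|h x| <= M.
Proof.
move=> ch; have [st|ts] := leP s t; last first.
  by exists 0 => x /=; rewrite in_itv/= => /andP[sx xt]; have := lt_le_trans ts (le_trans sx xt); rewrite ltxx.
have ch' : {within `[s, t], continuous (fun x => `|h x|)}.
  by move=> x; apply: cvg_norm; exact: ch.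
by have [c _ Hc] := EVT_max st ch'; exists `|h c|.
Qed.

Lemma primitive_within_continuous f (s t : R) : s <= t -> mu.-integrable setT (EFin \o f) ->
  {within `[s, t], continuous (fun x => \int[mu]_(y in `]s, x]) f y)}.
Proof.
move=> st intf; have mI : measurable (`[s, t]%classic : set R) by exact: measurable_itv.
have intf' : mu.-integrable `[s, t] (EFin \o f) by exact: lebesgue_integrableS intf.
rewrite (_ : (fun x => _) = (fun x => \int[mu]_(y in `[s, x]) f y)).
  exact: parameterized_integral_continuous.
apply/funext => x; rewrite Rintegral_itv_obnd_cbnd//.
by apply: lebesgue_integrableS intf => //; exact: measurable_itv.
Qed.

(** The classical formula for continuous approximations of f in L^1, then a limit on both sides. The
    primitive starts at s0 < s so that it is differentiable on a neighbourhood of every point of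
    [[s, t]]. *)
Lemma primitive_by_parts f phi (c s0 s t : R) : s0 < s -> s < t -> mu.-integrable setT (EFin \o f) ->
  smooth phi -> phi s = 0 -> phi t = 0 ->
  \int[mu]_(x in `[s, t]) ((c + \int[mu]_(y in `]s0, x]) f y) * derive1 phi x) =
  - \int[mu]_(x in `[s, t]) (f x * phi x).
Proof.
move=> s0s st intf sphi phis phit.
have s0t : s0 <= t by exact: ltW (lt_trans s0s st).
have mI : measurable (`[s, t]%classic : set R) by exact: measurable_itv.
have mI0 : measurable (`[s0, t]%classic : set R) by exact: measurable_itv.
have sub : `[s, t]%classic `<=` `[s0, t]%classic.
  by move=> z /=; rewrite !in_itv/= => /andP[sz ->]; rewrite (le_trans (ltW s0s) sz).
have intf0 : mu.-integrable `[s0, t] (EFin \o f) by exact: lebesgue_integrableS intf.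
have intf' : mu.-integrable `[s, t] (EFin \o f) by exact: lebesgue_integrableS intf.
have [g_ [cg ig0 gf]] := continuous_L1_approx s0 t intf.
have ig n := lebesgue_integrableS mI0 mI sub (ig0 n).
have cphi := smooth_continuous sphi.
have cdphi := smooth_continuous (smooth_derive sphi).
have [M1 HM1] := segment_bounded (continuous_subspaceT (A := `[s, t]%classic) cphi).
have [M2 HM2] := segment_bounded (continuous_subspaceT (A := `[s, t]%classic) cdphi).
have mcts (h : R -> R) : continuous h -> measurable_fun (`[s, t]%classic : set R) h.
  by move=> ch; apply: measurable_funTS; exact: continuous_measurable_fun.
pose G n x := c + \int[mu]_(y in `]s0, x]) g_ n y.
pose F x := c + \int[mu]_(y in `]s0, x]) f y.
have dG n x : s <= x -> is_derive x 1 (G n) (g_ n x).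
  move=> sx; have := is_deriveD (is_derive_cst c x (1 : R))
    (continuous_primitive (cg n) (lt_le_trans s0s sx)).
  by rewrite add0r.
have cG n x : s <= x -> {for x, continuous (G n)}.
  move=> sx; apply: differentiable_continuous; apply/derivable1_diffP.
  by case: (dG n x sx).
have parts n : \int[mu]_(x in `[s, t]) (G n x * derive1 phi x) =
    - \int[mu]_(x in `[s, t]) (g_ n x * phi x).
  rewrite (@Rintegration_by_parts _ (G n) phi (g_ n) (derive1 phi) s t) //.
  - by rewrite phis phit !mulr0 subrr sub0r.
  - exact: continuous_subspaceT.
  - split.
    + by move=> x; rewrite in_itv/= => /andP[/ltW sx _]; case: (dG n x sx).
    + by apply: cvg_at_right_filter; exact: cG.
    + by apply: cvg_at_left_filter; apply: cG; exact: ltW.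
  - move=> x; rewrite in_itv/= => /andP[/ltW sx _]; rewrite derive1E.
    by have := dG n x sx => ?; rewrite derive_val.
  - exact: continuous_subspaceT.
  - split.
    + by move=> x _; exact: smooth_derivable.
    + by apply: cvg_at_right_filter; exact: cphi.
    + by apply: cvg_at_left_filter; exact: cphi.
have FG n x : `[s, t]%classic x -> `|F x - G n x| <= \int[mu]_(y in `[s0, t]) `|f y - g_ n y|.
  rewrite /= in_itv/= => /andP[sx xt]; rewrite /F /G opprD addrACA subrr add0r.
  by apply: primitive_dist_le => //; exact: le_trans (ltW s0s) sx.
have intF : mu.-integrable `[s, t] (EFin \o F).
  apply: (lebesgue_integrableS mI0 mI sub).
  apply: continuous_compact_integrable; first exact: segment_compact.
  move=> x; apply: cvgD; first exact: cvg_cst.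
  exact: (primitive_within_continuous s0t intf).
have intG n : mu.-integrable `[s, t] (EFin \o G n).
  apply: continuous_compact_integrable; first exact: segment_compact.
  apply: continuous_in_subspaceT => x /[!inE] /=; rewrite in_itv/= => /andP[sx _].
  exact: cG.
have FGcvg : \int[mu]_(x in `[s, t]) `|F x - G n x| @[n --> \oo] --> 0.
  apply: (@squeeze_cvgr _ _ _ _ (cst 0)
    (fun n => (t - s) * \int[mu]_(y in `[s0, t]) `|f y - g_ n y|)).
  - near=> n; rewrite Rintegral_ge0//=.
    rewrite (_ : t - s = fine (mu `[s, t]%classic)); last first.
      by rewrite lebesgue_measure_itv/= lte_fin st.
    rewrite mulrC -Rintegral_cst//.
    apply: le_Rintegral => //.
    + by apply: integrable_norm; exact: lebesgue_integrableB.
    + apply: continuous_compact_integrable; first exact: segment_compact.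
      by apply: continuous_subspaceT => x; exact: cvg_cst.
    + by move=> x; exact: FG.
  - exact: cvg_cst.
  - by rewrite -(mulr0 (t - s)); apply: cvgM; [exact: cvg_cst|exact: gf].
have gfcvg : \int[mu]_(x in `[s, t]) `|f x - g_ n x| @[n --> \oo] --> 0.
  apply: (@squeeze_cvgr _ _ _ _ (cst 0)
    (fun n => \int[mu]_(y in `[s0, t]) `|f y - g_ n y|)).
  - near=> n; rewrite Rintegral_ge0//=.
    have iB := integrable_norm (lebesgue_integrableB mI0 intf0 (ig0 n)).
    have iB' := integrable_norm (lebesgue_integrableB mI intf' (ig n)).
    rewrite -lee_fin /Rintegral !fineK; [|exact: (integrable_fin_num _ iB)|exact: (integrable_fin_num _ iB')].
    by apply: ge0_subset_integral => //; case/integrableP : iB.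
  - exact: cvg_cst.
  - exact: gf.
have R1 := Rintegral_dist_cvg mI intf' ig gfcvg (mcts _ cphi) HM1.
have R2 := Rintegral_dist_cvg mI intF intG FGcvg (mcts _ cdphi) HM2.
apply: cvg_unique R2 _ => //.
rewrite (_ : (fun n => _) = (fun n => - \int[mu]_(x in `[s, t]) (g_ n x * phi x))).
  exact: (cvgN R1).
by apply/funext => n; rewrite parts.
Unshelve. all: by end_near. Qed.

Let quotient (a b : R) v n x :=
  ((v \_ `]a, b[) (x + n.+1%:R^-1) - (v \_ `]a, b[) x) / n.+1%:R^-1.

(** The limsup of the difference quotients with steps 1/(n+1) is measurable everywhere and equals
    the derivative wherever it exists. Outside []a, b[] the function is first set to 0. *)
Lemma measurable_derivative (a b : R) v : (forall x, a < x < b -> {for x, continuous v}) ->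
  exists2 f : R -> R, measurable_fun (setT : set R) f &
    forall x, a < x < b -> derivable v x 1 -> f x = derive1 v x.
Proof.
move=> cv; exists (fun x => fine (limn_esup (fun n => (quotient a b v n x)%:E))).
  have mv : measurable_fun (setT : set R) (v \_ `]a, b[).
    apply/(measurable_restrictT _ _).1; first exact: measurable_itv.
    apply: open_continuous_measurable_fun; first exact: itv_open.
    by move=> x /[!inE] /=; rewrite in_itv/=; exact: cv.
  have mq n : measurable_fun (setT : set R) (fun x => (quotient a b v n x)%:E).
    apply/measurable_EFinP.
    apply: measurable_funM => //; apply: measurable_funB => //.
    apply: (measurableT_comp mv); exact: measurable_funD.
  have mL := @measurable_fun_limn_esup _ (measurableTypeR R) R setT _ mq.
  by apply: (measurableT_comp _ mL); exact: fine_measurable.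
move=> x /andP[ax xb] dv; have bx : 0 < b - x by rewrite subr_gt0.
have Q : quotient a b v n x @[n --> \oo] --> derive1 v x.
  have h0 : (n.+1%:R^-1 : R) @[n --> \oo] --> (0 : R) by exact: cvg_harmonic.
  have hn0 n : (n.+1%:R^-1 : R) != 0 by rewrite invr_neq0.
  have := dv; rewrite /derivable derive1E /derive => cvd.
  have := (cvgr_dnbhsP _ _ _).1 cvd _ (conj hn0 h0).
  apply: cvg_trans; apply: near_eq_cvg; near=> n.
  have xI : x \in `]a, b[%classic by rewrite inE/= in_itv/= ax.
  have xnb : x + n.+1%:R^-1 \in `]a, b[%classic.
    rewrite inE/= in_itv/=; apply/andP; split.
      by rewrite (lt_trans ax)// ltrDl invr_gt0.
    rewrite addrC -ltrBrDr; near: n; exact: (cvgr_lt _ h0).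
  have E : n.+1%:R^-1 + x = x + n.+1%:R^-1 by rewrite addrC.
  by rewrite /quotient !patchE xI xnb /GRing.scale/= mulr1 E; exact: mulrC.
have L : (quotient a b v n x)%:E @[n --> \oo] --> (derive1 v x)%:E.
  by apply: cvg_EFin; [exact: nearW|].
by rewrite is_cvg_limn_esupE; [rewrite (cvg_lim _ L)|apply/cvg_ex; eexists; exact: L].
Unshelve. all: by end_near. Qed.

(** A density exists on each compact subinterval only, and depends on it. A single measurable f
    glues these densities, because each of them is almost everywhere the pointwise derivative. *)
Lemma abs_continuous_derivative (a b : R) v : abs_continuous a b v ->
  exists f : R -> R, [/\ measurable_fun (setT : set R) f,
    {ae mu, forall x, a < x < b -> f x = derive1 v x} &
    forall s t, a < s -> s < t -> t < b -> exists2 g : R -> R, mu.-integrable setT (EFin \o g) &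
     {ae mu, forall x, s < x < t -> f x = g x} /\
     forall x y, s <= x -> x <= y -> y <= t -> v y - v x = \int[mu]_(z in `]x, y]) g z].
Proof.
move=> ac; have [f mf fE] := measurable_derivative (abs_continuous_cts ac).
have Hst s t : a < s -> s < t -> t < b -> exists2 g : R -> R, mu.-integrable setT (EFin \o g) &
     {ae mu, forall x, s < x < t -> f x = derive1 v x /\ f x = g x} /\
     forall x y, s <= x -> x <= y -> y <= t -> v y - v x = \int[mu]_(z in `]x, y]) g z.
  move=> as_ st tb; have [g ig gv] := abs_continuous_density ac as_ st tb.
  exists g => //; split => //.
  apply: lebesgue_aeS (@primitive_is_derive g s t v ig (fun x y sx xy yt => gv x y (ltW sx) xy (ltW yt))) => x Hx /andP[sx xt]; have [] := Hx; first by rewrite sx.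
  move=> D1 D2; rewrite -D2; suff -> : f x = derive1 v x by [].
  by apply: fE => //; rewrite (lt_trans as_ sx) (lt_trans xt tb).
exists f; split => //; last first.
  move=> s t as_ st tb; have [g ig [H1 H2]] := Hst s t as_ st tb; exists g => //; split => //.
  by apply: lebesgue_aeS H1 => x Hx /Hx [].
have [ab|ba] := ltP a b; last first.
  by apply: aeW => x /andP[ax xb]; have := lt_trans ax xb; rewrite ltNge ba.
(* The denominator n + 3 makes e n smaller than (b - a) / 2, so that the interval from a + e n to b
   - e n is never empty. *)
pose e (n : nat) : R := (b - a) / n.+3%:R.
have en n : 0 < e n < (b - a) / 2.
  rewrite divr_gt0 ?subr_gt0//= ltr_pM2l ?subr_gt0// ltf_pV2 ?posrE// ltr_nat//.
have H (n : nat) : {ae mu, forall x, a + e n < x < b - e n -> f x = derive1 v x}.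
  have /andP[e1 e2] := en n.
  have [||| g ig [H1 _]] := Hst (a + e n) (b - e n); [lra..|].
  by apply: lebesgue_aeS H1 => x Hx /Hx [].
apply: lebesgue_aeS (lebesgue_ae_foralln H) => x Hx /andP[ax xb].
pose m := Num.min (x - a) (b - x).
have m0 : 0 < m by rewrite lt_min !subr_gt0 ax.
have em : e (Num.truncn ((b - a) / m)) < m.
  rewrite /e ltr_pdivrMr// -ltr_pdivrMl// mulrC; apply: lt_trans (truncnS_gt _) _.
  by rewrite ltr_nat.
move: em; rewrite lt_min => /andP[em1 em2].
by apply: (Hx (Num.truncn ((b - a) / m))); apply/andP; split; lra.
Qed.

Lemma abs_continuous_W11loc (a b : R) (U : set R) v : open U -> U `<=` `]a, b[%classic ->
  abs_continuous a b v -> exists2 f : R -> R, W11loc U v f &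
  {ae mu, forall x, a < x < b -> f x = derive1 v x}.
Proof.
move=> oU Uab ac; have [f [mf fE fg]] := abs_continuous_derivative ac.
exists f => //.
have mU : measurable (U : set R) by exact: open_measurable.
have cv := abs_continuous_cts ac.
have KS (K : set R) : compact K -> K `<=` U ->
    K = set0 \/ exists s t, [/\ a < s, s < t, t < b & K `<=` `]s, t[%classic].
  move=> cK KU; have [->|/set0P K0] := eqVneq K set0; [by left|right].
  have cid A : {within A, continuous (fun x : R => x)} by apply: continuous_subspaceT => x; exact: cvg_id.
  have [x Kx Hx] := compact_EVT_max K0 cK (cid K).
  have [y Ky Hy] := compact_EVT_min K0 cK (cid K).
  rewrite inE in Kx; rewrite inE in Ky.
  have /= := Uab _ (KU _ Kx); have /= := Uab _ (KU _ Ky); rewrite !in_itv/= => /andP[ay yb] /andP[ax xb].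
  have yx : y <= x by apply: Hy; rewrite inE.
  exists ((a + y) / 2), ((x + b) / 2); split; [lra..|].
  move=> z Kz /=; rewrite in_itv/=; have := Hx z (mem_set Kz); have := Hy z (mem_set Kz).
  by move=> h1 h2; apply/andP; split; lra.
have fg' s t : a < s -> s < t -> t < b -> exists s0 (g : R -> R), [/\ a < s0, s0 < s, mu.-integrable setT (EFin \o g),
    (forall x, s <= x -> x <= t -> v x = v s0 + \int[mu]_(z in `]s0, x]) g z) &
    ae_eq mu `[s, t]%classic f g].
  move=> as_ st tb; pose s0 := (a + s) / 2; pose t0 := (t + b) / 2.
  have [|||g ig [g1 g2]] := fg s0 t0; [rewrite /s0 /t0; lra..|].
  exists s0, g; split => //; [rewrite /s0; lra..| |].
  - by move=> x sx xt; rewrite -g2; rewrite /s0 /t0; lra.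
  - apply: lebesgue_aeS g1 => x Hx /=; rewrite in_itv/= => /andP[sx xt]; apply: Hx; rewrite /s0 /t0.
    by apply/andP; split; lra.
have fseg s t : a < s -> s < t -> t < b -> mu.-integrable `[s, t] (EFin \o f).
  move=> as_ st tb; have [s0 [g [_ _ ig _ fgae]]] := fg' s t as_ st tb.
  have mI : measurable (`[s, t]%classic : set R) by exact: measurable_itv.
  have ig' := lebesgue_integrableS (@measurableT _ (measurableTypeR R)) mI (@subsetT _ _) ig.
  have mf' : measurable_fun (`[s, t]%classic : set R) (EFin \o f).
    by apply/measurable_EFinP; exact: measurable_funTS.
  apply/integrableP; split => //.
  case/integrableP : ig' => mg; rewrite (_ : integral _ _ _ = (\int[mu]_(x in `[s, t]) `|(EFin \o f) x|)%E) //.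
  apply: ge0_ae_eq_integral => //; [exact: measurableT_comp|exact: measurableT_comp|].
  by apply: lebesgue_aeS fgae => x Hx /Hx /= ->.
have vseg s t : a < s -> s < t -> t < b -> mu.-integrable `[s, t] (EFin \o v).
  move=> as_ st tb; apply: continuous_compact_integrable; first exact: segment_compact.
  apply: continuous_in_subspaceT => x /[!inE] /=; rewrite in_itv/= => /andP[sx xt].
  by apply: cv; rewrite (lt_le_trans as_ sx) (le_lt_trans xt tb).
have oc (s t : R) : `]s, t[%classic `<=` `[s, t]%classic.
  by move=> x /=; rewrite !in_itv/= => /andP[/ltW -> /ltW ->].
have Kfin (h : R -> R) : (forall s t, a < s -> s < t -> t < b -> mu.-integrable `[s, t] (EFin \o h)) ->
    forall K, K `<=` U -> compact K -> (\int[mu]_(x in K) `|h x|%:E < +oo)%E.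
  move=> H K KU cK; have [->|[s [t [as_ st tb Kst]]]] := KS K cK KU; first by rewrite integral_set0.
  have mI : measurable (`[s, t]%classic : set R) by exact: measurable_itv.
  have mK : measurable (K : set R) by exact: compact_measurable.
  by have /integrableP[] := lebesgue_integrableS mI mK (subset_trans Kst (@oc s t)) (H s t as_ st tb).
split.
- split => //; last exact: Kfin.
  by apply: open_continuous_measurable_fun => // x /[!inE] /Uab /=; rewrite in_itv/=; exact: cv.
- by split => //; [exact: measurable_funTS|exact: Kfin].
- move=> phi [sphi [K cK [KU phi0]]].
  have clK : closed K by apply: compact_closed => //; exact: Rhausdorff.
  have out := derive1_out clK phi0.
  rewrite (Rintegral_support KU); last by move=> x _ /out ->; rewrite mulr0.
  rewrite [X in _ = - X](Rintegral_support KU); last by move=> x _ /phi0 ->; rewrite mulr0.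
  have [->|[s [t [as_ st tb Kst]]]] := KS K cK KU; first by rewrite !Rintegral_set0 oppr0.
  have Kst' := subset_trans Kst (@oc s t).
  (* The segment [[s, t]] may leave U. This is harmless: v is absolutely continuous on all of []a,
     b[], and phi vanishes outside K. *)
  rewrite -(@Rintegral_support _ K `[s, t]%classic) //; last by move=> x _ /out ->; rewrite mulr0.
  rewrite -[in RHS](@Rintegral_support _ K `[s, t]%classic) //; last by move=> x _ /phi0 ->; rewrite mulr0.
  have [s0 [g [as0 s0s ig vE fgae]]] := fg' s t as_ st tb.
  have ps : phi s = 0 by apply: phi0 => /Kst /=; rewrite in_itv/= ltxx.
  have pt : phi t = 0 by apply: phi0 => /Kst /=; rewrite in_itv/= ltxx andbF.
  have mI : measurable (`[s, t]%classic : set R) by exact: measurable_itv.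
  have mphi : measurable_fun (`[s, t]%classic : set R) phi.
    by apply: measurable_funTS; apply: continuous_measurable_fun; exact: smooth_continuous.
  rewrite (_ : \int[mu]_(x in `[s, t]) (f x * phi x) = \int[mu]_(x in `[s, t]) (g x * phi x)).
    rewrite -(primitive_by_parts (v s0) s0s st ig sphi ps pt).
    by apply: eq_Rintegral => x; rewrite inE/= in_itv/= => /andP[sx xt]; rewrite -vE.
  rewrite /Rintegral; congr fine; apply: ae_eq_integral => //.
  + by apply/measurable_EFinP; apply: measurable_funM => //; exact: measurable_funTS.
  + apply/measurable_EFinP; apply: measurable_funM => //.
    by apply/measurable_EFinP; case/integrableP : ig => mg _; exact: measurable_funTS.
  + by apply: lebesgue_aeS fgae => x Hx /Hx ->.
Qed.

End primitives.

Section general_convergence.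
Context d (T : measurableType d) (R : realType) (mu : {measure set T -> \bar R}).

Lemma integrable_mul_bounded (D : set T) (f h : T -> R) (M : R) : measurable D ->
  mu.-integrable D (EFin \o f) -> measurable_fun D h ->
  (forall x, D x -> `|h x| <= M) -> mu.-integrable D (EFin \o (fun x => f x * h x)).
Proof.
move=> mD intf mg gM.
have mf : measurable_fun D f by apply/measurable_EFinP; exact: measurable_int intf.
have mfg : measurable_fun D (EFin \o (fun x => f x * h x)).
  by apply/measurable_EFinP; exact: measurable_funM.
have intM : mu.-integrable D (fun x => M%:E * (EFin \o f) x)%E by exact: integrableZl.
apply: (le_integrable mD mfg _ intM).
move=> x Ax /=; rewrite lee_fin !normrM mulrC ler_wpM2r//.
by rewrite (le_trans (gM x Ax))// ler_norm.
Qed.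

Lemma Rintegral_mul_cvg (D : set T) (f h : T -> R) (g_ : nat -> T -> R) (M : R) : measurable D ->
  mu.-integrable D (EFin \o f) -> (forall n, mu.-integrable D (EFin \o g_ n)) ->
  (\int[mu]_(x in D) `|f x - g_ n x|%:E)%E @[n --> \oo] --> 0%E ->
  measurable_fun D h -> (forall x, D x -> `|h x| <= M) ->
  (\int[mu]_(x in D) (g_ n x * h x))%R @[n --> \oo] --> (\int[mu]_(x in D) (f x * h x))%R.
Proof.
move=> mD intf intg gf mh hM.
have ifh := integrable_mul_bounded mD intf mh hM.
have igh n := integrable_mul_bounded mD (intg n) mh hM.
have intB n : mu.-integrable D (EFin \o (fun x => f x - g_ n x)).
  exact: (integrableB mD intf (intg n)).
have intBh n : mu.-integrable D (EFin \o (fun x => f x * h x - g_ n x * h x)).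
  exact: (integrableB mD ifh (igh n)).
have gf' : (\int[mu]_(x in D) `|f x - g_ n x|)%R @[n --> \oo] --> (0 : R).
  by exact: (fine_cvg gf).
apply/cvgrPdist_le => e e0.
have M1 : 0 < `|M| + 1 by rewrite ltr_wpDl.
near=> n.
rewrite -RintegralB//.
have intN := integrable_norm (intB n).
apply: le_trans (le_normr_Rintegral mD (intBh n)) _.
apply: (@le_trans _ _ (\int[mu]_(x in D) ((`|M| + 1) * `|f x - g_ n x|))).
  apply: le_Rintegral => //.
  - exact: integrable_norm (intBh n).
  - exact: integrableZl intN.
  - move=> x Dx; rewrite -mulrBl normrM mulrC ler_wpM2r//.
    by rewrite (le_trans (hM x Dx))// (le_trans (ler_norm M))// lerDl.
rewrite RintegralZl// -ler_pdivlMl// mulrC.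
have : `|0 - \int[mu]_(x in D) `|f x - g_ n x| | <= e / (`|M| + 1).
  by near: n; apply: cvgr_dist_le => //; rewrite divr_gt0.
by rewrite sub0r normrN; apply: le_trans; exact: ler_norm.
Unshelve. all: by end_near. Qed.

Lemma cvge0_squeeze (u : nat -> \bar R) (e : nat -> R) (k : R) : (forall m, (0 <= u m)%E) ->
  (forall m, (u m <= (k * e m)%:E)%E) -> e @ \oo --> 0 -> u @ \oo --> 0%E.
Proof.
move=> u0 ue e0; have ke0 : (k * e m)%:E @[m --> \oo] --> 0%:E.
  by apply: cvg_EFin; [exact: nearW|rewrite -(mulr0 k); exact: (cvgM (cvg_cst k) e0)].
apply: (@squeeze_cvge _ _ _ _ (cst 0%E) u (fun m => (k * e m)%:E)) => //.
- by apply: nearW => m; rewrite u0 ue.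
- exact: cvg_cst.
Qed.

End general_convergence.

(** * Radial functions *)

Section radial_functions.
Context {R : realType}.
Notation leb := (@lebesgue_measure R).
Notation mu := (@rV_lebesgue R).

(** Fubini's theorem. Coordinates are peeled off one at a time until the one numbered i comes first;
    the measure is itself an iterated product with the first coordinate in front. *)
Lemma integral_line_eq0 n (i : 'I_n) (D : 'rV[R]_n -> R) : (mu n).-integrable setT (EFin \o D) ->
  (forall x, (\int[leb]_t (D (x + t *: delta_mx ord0 i))%:E = 0)%E) ->
  (\int[mu n]_x (D x)%:E = 0)%E.
Proof.
elim: n i D => [[]//|n ih] i D intD H.
have mD : measurable_fun setT (EFin \o D) by exact: measurable_int intD.
pose P := @rV_cons R n.
have mP : measurable_fun setT P by exact: measurable_rV_cons.
pose mm := (leb \x mu n)%E.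
have H0 (f : 'rV[R]_n.+1 -> \bar R) : measurable_fun setT f -> (forall x, (0 <= f x)%E) ->
    (\int[mu n.+1]_x f x = \int[mm]_z f (P z))%E.
  by move=> mf f0; exact: (@ge0_integral_pushforward _ _ _ _ R P mP mm setT f).
have intP : mm.-integrable setT ((EFin \o D) \o P).
  case/integrableP : intD => _ foo; apply/integrableP; split.
    exact: measurableT_comp.
  by rewrite -(H0 (fun x => `|(D x)%:E|%E))//; exact: measurableT_comp.
have -> : (\int[mu n.+1]_x (D x)%:E = \int[mm]_z (D (P z))%:E)%E.
  exact: (@integral_pushforward _ _ _ _ R P mP mm setT (EFin \o D)).
have shift0 t y : P (t, y) = P (0, y) + t *: delta_mx ord0 ord0.
  apply/rowP => k; rewrite !mxE /=; case: (unliftP ord0 k) => [l ->|->].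
    by rewrite /= mulr0 addr0.
  by rewrite /= mulr1 add0r.
have shiftS j s t y : P (s, y + t *: delta_mx ord0 j) = P (s, y) + t *: delta_mx ord0 (lift ord0 j).
  apply/rowP => k; rewrite !mxE /=; case: (unliftP ord0 k) => [l ->|->] /=.
    by rewrite !mxE !eqxx (inj_eq lift_inj).
  by rewrite mulr0 addr0.
case: (unliftP ord0 i) => [j ij|i0].
- have := @integral12_prod_meas1 _ _ (measurableTypeR R) _ R leb (mu n) _ intP; rewrite -/mm => <-.
  rewrite (@ae_eq_integral _ _ _ leb setT (cst 0%E)) //; first exact: integral0.
  + exact: (@measurable_fubini_F _ _ (measurableTypeR R) _ R leb (mu n) _ intP).
  + have := @ae_integrable1 _ _ (measurableTypeR R) _ R leb (mu n) _ intP.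
    apply: lebesgue_aeS => s ints _ /=.
    apply: (ih j (fun y => D (P (s, y))) ints) => y.
    rewrite -[RHS](H (P (s, y))); apply: eq_integral => t _.
    by rewrite shiftS ij.
- have := @integral21_prod_meas1 _ _ (measurableTypeR R) _ R leb (mu n) _ intP; rewrite -/mm => <-.
  rewrite integral0_eq// => y _.
  rewrite -[RHS](H (P (0, y))); apply: eq_integral => t _.
  by rewrite /= shift0 i0.
Qed.

Lemma integral_derive_eq0 (h D : R -> R) (L : R) : 0 <= L -> (forall t, is_derive t (1 : R) h (D t)) ->
  continuous D -> (forall t, L < `|t| -> h t = 0) -> (\int[leb]_t (D t)%:E = 0)%E.
Proof.
move=> L0 dh cD hL.
have DL t : L < `|t| -> D t = 0.
  move=> Lt; have -> : D t = 'D_1 h t by have := dh t => ?; rewrite derive_val.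
  rewrite (@near_eq_derive _ _ _ h (cst 0)) ?derive_cst//.
  near=> s; apply: hL; near: s.
  have : {for t, continuous (fun s : R => `|s|)} by exact: norm_continuous.
  move=> /cvgr_gt; exact.
have -> : (\int[leb]_t (D t)%:E = \int[leb]_(t in `[(- (L + 1))%R, (L + 1)%R]) (D t)%:E)%E.
  rewrite [RHS]integral_mkcond; apply: eq_integral => t _; rewrite patchE.
  case: ifPn => // /negP; rewrite inE/= in_itv/= => /negP; rewrite -ler_norml -ltNge => Lt.
  by rewrite DL// (lt_trans _ Lt)// ltrDl.
have LL : - (L + 1) < L + 1 by lra.
rewrite (@continuous_FTC2 _ D h _ _ LL).
- have h1 : h (L + 1) = 0 by apply: hL; rewrite ger0_norm; lra.
  have h2 : h (- (L + 1)) = 0 by apply: hL; rewrite normrN ger0_norm; lra.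
  by rewrite h1 h2 subee.
- exact: continuous_subspaceT.
- have ch t : {for t, continuous h}.
    by apply: differentiable_continuous; apply/derivable1_diffP; case: (dh t).
  split.
  + by move=> x _; case: (dh x).
  + by apply: cvg_at_right_filter; exact: ch.
  + by apply: cvg_at_left_filter; exact: ch.
- by move=> x _; rewrite derive1E; have := dh x => ?; rewrite derive_val.
Unshelve. all: by end_near. Qed.

Lemma line_is_derive n (i : 'I_n) (u : 'rV[R]_n -> R) (x : 'rV[R]_n) t :
  differentiable u (x + t *: delta_mx ord0 i) ->
  is_derive t 1 (fun s => u (x + s *: delta_mx ord0 i)) (partial i u (x + t *: delta_mx ord0 i)).
Proof.
move=> /diff_derivable-/(_ (delta_mx ord0 i)) du.
have E : (fun h : R => h^-1 *: (((fun s => u (x + s *: delta_mx ord0 i)) \o shift t) (h *: 1) - u (x + t *: delta_mx ord0 i))) =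
    (fun h : R => h^-1 *: ((u \o shift (x + t *: delta_mx ord0 i)) (h *: delta_mx ord0 i) - u (x + t *: delta_mx ord0 i))).
  apply/funext => h /=; congr (_ *: (u _ - _)).
  have -> : h *: (1 : R) = h by rewrite /GRing.scale/= mulr1.
  by rewrite scalerDl addrCA.
by apply: DeriveDef; rewrite /derivable /derive /partial E.
Qed.

Lemma enorm_line_is_derive n (i : 'I_n) (x : 'rV[R]_n) t :
  0 < enorm (x + t *: delta_mx ord0 i) ->
  is_derive t 1 (fun s => enorm (x + s *: delta_mx ord0 i))
    ((x + t *: delta_mx ord0 i) ord0 i / enorm (x + t *: delta_mx ord0 i)).
Proof.
move=> x0.
have E s : enorm (x + s *: delta_mx ord0 i) =
    Num.sqrt (\sum_j x ord0 j ^+ 2 + 2 * s * x ord0 i + s ^+ 2).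
  congr Num.sqrt; rewrite (bigD1 i)//= [in RHS](bigD1 i)//=.
  rewrite !mxE !eqxx mulr1 (eq_bigr (fun j => x ord0 j ^+ 2)); first by ring.
  by move=> j ji; rewrite !mxE (negbTE ji) andbF mulr0 addr0.
have -> : (fun s => enorm (x + s *: delta_mx ord0 i)) =
    Num.sqrt \o (fun s => \sum_j x ord0 j ^+ 2 + 2 * s * x ord0 i + s ^+ 2).
  by apply/funext => s; rewrite E.
set q := (fun s => _).
have qt : 0 < q t by move: x0; rewrite E sqrtr_gt0.
have Dq : is_derive t 1 q (2 * x ord0 i + 2 * t).
  by apply: is_derive_eq; rewrite /GRing.scale/=; ring.
have := @is_derive1_comp _ Num.sqrt q t _ _ (is_derive1_sqrt qt) Dq.
rewrite -E => H; apply: is_derive_eq H _.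
rewrite !mxE !eqxx mulr1.
by have := lt0r_neq0 x0 => ?; field.
Qed.

Lemma rV_bounded_fin n (A : set 'rV[R]_n) (c : R) : measurable A -> 0 <= c ->
  (forall x, A x -> enorm x <= c) -> (mu n A < +oo)%E.
Proof.
move=> mA c0 Ac; have [mC] := @rV_lebesgue_cube R n c c0; apply: le_lt_trans.
apply: le_measure; rewrite ?inE// => x /Ac xc i.
exact: le_trans (le_coord_enorm _ _) xc.
Qed.

Lemma rV_compact_enorm n (K : set 'rV[R]_n) : compact K -> exists2 c, 0 <= c & forall x, K x -> enorm x <= c.
Proof.
move=> cK; have [->|/set0P K0] := eqVneq K set0; first by exists 0.
have ce : {within K, continuous (@enorm R n)} by apply: continuous_subspaceT; exact: enorm_continuous.
have [x _ Hx] := compact_EVT_max K0 cK ce.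
by exists (enorm x); [exact: enorm_ge0|move=> y Ky; apply: Hx; rewrite inE].
Qed.

Lemma rV_compact_bounded n (K : set 'rV[R]_n) (h : 'rV[R]_n -> R) : compact K -> continuous h ->
  exists M, forall x, K x -> `|h x| <= M.
Proof.
move=> cK ch; have [->|/set0P K0] := eqVneq K set0; first by exists 0.
have cn : continuous (fun x : 'rV[R]_n => `|h x|) by move=> y; exact: (cvg_norm (ch y)).
have ce : {within K, continuous (fun x => `|h x|)} by exact: continuous_subspaceT.
have [x _ Hx] := compact_EVT_max K0 cK ce.
by exists `|h x|; move=> y Ky; apply: Hx; rewrite inE.
Qed.

(* The profile need not be differentiable at 0, so supp phi must avoid it. *)
Lemma radial_by_parts n (i : 'I_n) (G g : R -> R) (s : R) (phi : 'rV[R]_n -> R) (K : set 'rV[R]_n) :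
  0 <= s -> (forall r, s < r -> is_derive r 1 G (g r)) -> continuous g ->
  (forall x, differentiable phi x) -> continuous (partial i phi) ->
  compact K -> (forall x, K x -> s < enorm x) -> (forall x, ~ K x -> phi x = 0) ->
  (\int[mu n]_(x in K) (G (enorm x) * partial i phi x))%R =
  - (\int[mu n]_(x in K) (g (enorm x) * (x ord0 i / enorm x) * phi x))%R.
Proof.
move=> s0 dG cg dphi cdphi cK Ks phi0.
have clK : closed K by apply: compact_closed => //; exact: norm_hausdorff.
have mK : measurable K by exact: rV_compact_measurable.
have [c c0 Kc] := rV_compact_enorm cK.
have muK := rV_bounded_fin mK c0 Kc.
(* Along the i-th coordinate, [A] + [B] is the derivative of the compactly supported [pr], so its
   integral over each line in that direction vanishes. *)
pose pr x := G (enorm x) * phi x.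
pose A x := g (enorm x) * (x ord0 i / enorm x) * phi x.
pose B x := G (enorm x) * partial i phi x.
have oK x : ~ K x -> nbhs x (~` K).
  by move=> Kx; apply: open_nbhs_nbhs; split=> //; exact: closed_openC.
have pphi0 x : ~ K x -> partial i phi x = 0.
  move=> Kx; rewrite /partial (@near_eq_derive _ _ _ phi (cst 0)) ?derive_cst//.
  by move: (oK x Kx); apply: filterS => y /phi0.
have A0 x : ~ K x -> A x = 0 by move=> Kx; rewrite /A phi0// mulr0.
have B0 x : ~ K x -> B x = 0 by move=> Kx; rewrite /B pphi0// mulr0.
have cent := @enorm_continuous R n.
have cco : continuous (fun x : 'rV[R]_n => x ord0 i) by move=> x; exact: coord_continuous.
have cts (h : 'rV[R]_n -> R) : (forall x, K x -> h @ x --> h x) -> (forall x, ~ K x -> h x = 0) ->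
    continuous h.
  move=> hK h0 x; have [/hK//|Kx] := pselect (K x).
  by apply: (near_cst_continuous 0); near=> y; apply: h0; near: y; exact: oK.
have cph x : phi @ x --> phi x by exact: differentiable_continuous.
have cA : continuous A.
  apply: cts => // x Kx.
  have sx := Ks x Kx; have x0 : enorm x != 0 by rewrite gt_eqF// (le_lt_trans s0).
  have cge : (fun y => g (enorm y)) @ x --> g (enorm x) by exact: (continuous_comp (cent x) (cg _)).
  exact: (cvgM (cvgM cge (cvgM (cco x) (cvgV x0 (cent x)))) (cph x)).
have cB : continuous B.
  apply: cts => // x Kx; have sx := Ks x Kx.
  have cG : {for enorm x, continuous G}.
    by apply: differentiable_continuous; apply/derivable1_diffP; case: (dG _ sx).
  have cGe : (fun y => G (enorm y)) @ x --> G (enorm x) by exact: (continuous_comp (cent x) cG).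
  exact: (cvgM cGe (cdphi x)).
have intK (h : 'rV[R]_n -> R) : continuous h -> (forall x, ~ K x -> h x = 0) -> (mu n).-integrable setT (EFin \o h).
  move=> ch h0; have [N HN] := rV_compact_bounded cK ch.
  have mh : measurable_fun setT h by exact: rV_continuous_measurable.
  apply/integrableP; split; first exact/measurable_EFinP.
  apply: (@le_lt_trans _ _ (\int[mu n]_(x in K) (cst `|N|%:E x))%E); last first.
    by rewrite integral_cst// lte_mul_pinfty.
  rewrite [leRHS]integral_mkcond; apply: ge0_le_integral => //.
  - by apply: measurableT_comp => //; exact/measurable_EFinP.
  - by apply/(measurable_restrictT _ _).1.
  - move=> x _; rewrite patchE; case: ifPn => /=.
      by rewrite inE lee_fin => /HN/le_trans; apply; exact: ler_norm.
    by rewrite notin_setE => /h0 ->; rewrite normr0.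
have intA := intK A cA A0; have intB := intK B cB B0.
have cD : continuous (fun x => A x + B x) by move=> x; exact: (cvgD (cA x) (cB x)).
have D0 x : ~ K x -> A x + B x = 0 by move=> Kx; rewrite A0// B0// addr0.
have intD := intK _ cD D0.
have cline x : continuous (fun t : R => x + t *: delta_mx ord0 i : 'rV[R]_n).
  by move=> t; apply: cvgD; [exact: cvg_cst|apply: cvgZr_tmp; exact: cvg_id].
have line x : (\int[leb]_t (A (x + t *: delta_mx ord0 i) + B (x + t *: delta_mx ord0 i))%:E = 0)%E.
  apply: (@integral_derive_eq0 (fun t => pr (x + t *: delta_mx ord0 i)) _ (c + enorm x)).
  - by rewrite addr_ge0// enorm_ge0.
  - move=> t; set y := x + t *: _; have [Ky|Ky] := pselect (K y); last first.
      rewrite D0//; apply: near_eq_is_derive (is_derive_cst (0 : R) t (1 : R)).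
      have : nbhs t ((fun t : R => x + t *: delta_mx ord0 i : 'rV[R]_n) @^-1` (~` K)).
        by apply: cline; exact: oK.
      by apply: filterS => w /phi0 ps; rewrite /pr ps mulr0.
    have sy := Ks y Ky; have y0 := le_lt_trans s0 sy.
    have Dphi := line_is_derive (dphi y).
    have DG := @is_derive1_comp _ G (fun w => enorm (x + w *: delta_mx ord0 i)) t _ _ (dG _ sy) (enorm_line_is_derive y0).
    apply: is_derive_eq (is_deriveM DG Dphi) _.
    by rewrite /GRing.scale/= /A /B -/y; ring.
  - by move=> t; exact: (continuous_comp (cline x t) (cD _)).
  - move=> t Lt; rewrite /pr phi0 ?mulr0// => Ky; move: Lt; rewrite ltNge => /negP; apply.
    have h1 := Kc _ Ky; have h2 := le_coord_enorm (x + t *: delta_mx ord0 i) i.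
    have h3 := le_coord_enorm x i.
    have -> : t = (x + t *: delta_mx ord0 i) ord0 i - x ord0 i.
      by rewrite !mxE !eqxx mulr1 addrAC subrr add0r.
    apply: le_trans (ler_normB _ _) _; apply: lerD => //; exact: le_trans h1.
have := integral_line_eq0 intD line.
have -> : (\int[mu n]_x (A x + B x)%:E = \int[mu n]_(x in K) (A x + B x)%:E)%E.
  rewrite [RHS]integral_mkcond; apply: eq_integral => x _; rewrite patchE.
  by case: ifPn => //; rewrite notin_setE => /D0 ->.
move=> /(congr1 fine)/=; rewrite -/(Rintegral _ _ _) RintegralD//; last 2 first.
- exact: (integrableS measurableT mK (@subsetT _ _) intA).
- exact: (integrableS measurableT mK (@subsetT _ _) intB).
by move=> /eqP; rewrite addrC addr_eq0 => /eqP.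
Unshelve. all: by end_near. Qed.

Lemma measurable_invr : measurable_fun (setT : set R) (fun y : R => y^-1).
Proof.
have oN0 : open (~` [set (0 : R)]).
  by apply: closed_openC; exact: (accessible_closed_set1 (hausdorff_accessible (@Rhausdorff R))).
rewrite (_ : (fun y : R => y^-1) = (fun y => y^-1) \_ (~` [set (0 : R)])); last first.
  apply/funext => y; rewrite patchE; case: ifPn => //; rewrite notin_setE /= => /contrapT ->.
  by rewrite invr0.
apply/(measurable_restrictT _ _).1; first exact: open_measurable.
apply: open_continuous_measurable_fun => // y /[!inE] /= /eqP y0.
exact: inv_continuous.
Qed.

Lemma radial_integral_le n (a b : R) (h : R -> R) (A : set 'rV[R]_n) : (0 < n)%N -> 0 <= a -> a <= b ->
  measurable_fun (setT : set R) h -> (forall r, 0 <= h r) -> measurable A ->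
  (forall x, A x -> a <= enorm x <= b) ->
  (\int[mu n]_(x in A) (h (enorm x))%:E <=
   (@sphere_area R n * b ^+ n.-1)%:E * \int[leb]_(r in `[a, b]) (h r)%:E)%E.
Proof.
move=> n0 a0 ab mh h0 mA Ah.
have S0 : 0 <= @sphere_area R n by exact/ltW/sphere_area_gt0.
have C0 : 0 <= @sphere_area R n * b ^+ n.-1.
  by rewrite mulr_ge0// exprn_ge0// (le_trans a0).
have mI : measurable (`[a, b]%classic : set R) by exact: measurable_itv.
pose k := (EFin \o h) \_ `[a, b].
have mk : measurable_fun (setT : set R) k.
  by apply/(measurable_restrictT _ _).1 => //; apply: measurable_funTS; exact/measurable_EFinP.
have k0 r : (0 <= k r)%E by rewrite /k patchE; case: ifPn => //= _; rewrite lee_fin.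
apply: (@le_trans _ _ (\int[mu n]_x k (enorm x))%E).
  rewrite integral_mkcond; apply: ge0_le_integral => //.
  - by move=> x _; rewrite patchE; case: ifPn => //= _; rewrite lee_fin.
  - apply/(measurable_restrictT _ _).1 => //; apply/measurable_EFinP.
    by apply: measurable_funTS; exact: (measurableT_comp mh (@measurable_enorm R n)).
  - exact: (measurableT_comp mk (@measurable_enorm R n)).
  - move=> x _; rewrite patchE; case: ifPn => // /[!inE] Ax.
    by rewrite /k patchE mem_set//= in_itv/=; exact: Ah.
rewrite integral_polar// (_ : (\int[leb]_(r in `[a, b]) (h r)%:E = \int[leb]_r k r)%E); last first.
  by rewrite integral_mkcond.
have mX : measurable_fun (setT : set R) (fun r : R => r ^+ n.-1).
  exact: (continuous_measurable_fun (@exprn_continuous R n.-1)).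
have mk' : measurable_fun (setT : set R) (fun r => (@sphere_area R n * b ^+ n.-1)%:E * k r)%E.
  by apply: emeasurable_funM => //; exact: measurable_cst.
have -> : ((@sphere_area R n * b ^+ n.-1)%:E * \int[leb]_r k r =
    \int[leb]_r ((@sphere_area R n * b ^+ n.-1)%:E * k r))%E.
  by rewrite ge0_integralZl.
rewrite [leLHS]integral_mkcond; apply: ge0_le_integral => //.
- move=> r _; rewrite patchE; case: ifPn => // /[!inE]/=; rewrite in_itv/= andbT => r0.
  by rewrite mule_ge0// lee_fin mulr_ge0 ?exprn_ge0.
- apply/(measurable_restrictT _ _).1; first exact: measurable_itv.
  apply: emeasurable_funM; first exact: measurable_funTS.
  by apply/measurable_EFinP; apply: measurable_funM => //; exact: measurable_funTS.
- move=> r _; rewrite patchE; case: ifPn => [|_]; last by rewrite mule_ge0// lee_fin.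
  rewrite inE/= in_itv/= andbT => r0; rewrite muleC /k patchE; case: ifPn; last by rewrite !mule0.
  rewrite inE/= in_itv/= => /andP[ar rb]; rewrite lee_wpmul2r ?lee_fin//.
  by rewrite ler_wpM2l// lerXn2r ?nnegrE// (le_trans r0).
Qed.

(** The weak gradient is f(|x|) x / |x|. It is known for continuous f by [radial_by_parts]; polar
    coordinates turn L^1 convergence on [[a, b]] into L^1 convergence on a compact subset of U,
    which carries the identity over to integrable f. *)
Lemma radial_W11loc n (a b c : R) (f : R -> R) (U : set 'rV[R]_n) : (0 < n)%N -> 0 <= a -> a < b ->
  leb.-integrable setT (EFin \o f) -> open U -> (forall x, U x -> a < enorm x < b) ->
  rV_W11loc U (fun x => c + \int[leb]_(r in `]a, enorm x]) f r).
Proof.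
move=> n0 a0 ab intf oU Uab; have ab' := ltW ab.
have mU : measurable U by exact: rV_open_measurable.
have mI : measurable (`[a, b]%classic : set R) by exact: measurable_itv.
pose Z (h : R -> R) (x : 'rV[R]_n) := c + \int[leb]_(r in `]a, enorm x]) h r.
have Zbnd (h : R -> R) : leb.-integrable setT (EFin \o h) -> forall x, U x ->
    `|Z h x| <= `|c| + \int[leb]_(r in `[a, b]) `|h r|.
  move=> ih x /Uab/andP[ax xb]; apply: le_trans (ler_normD _ _) _; rewrite lerD2l.
  have i0 : leb.-integrable `[a, b] (EFin \o cst (0 : R)).
    apply: continuous_compact_integrable; first exact: segment_compact.
    by apply: continuous_subspaceT => y; exact: cvg_cst.
  have := primitive_dist_le (ltW ax) (ltW xb) (lebesgue_integrableS (@measurableT _ (measurableTypeR R)) mI (@subsetT _ _) ih) i0.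
  rewrite (_ : \int[leb]_(y in `]a, enorm x]) cst 0 y = 0); last by rewrite /Rintegral integral0.
  rewrite subr0 => h1; apply: le_trans h1 _; under [leLHS]eq_Rintegral do rewrite subr0; exact: lexx.
have mZ (h : R -> R) : leb.-integrable setT (EFin \o h) -> measurable_fun U (Z h).
  move=> ih; have mab : measurable (`]a, b[%classic : set R) by exact: measurable_itv.
  have mP : measurable_fun (`]a, b[%classic : set R) (fun x => c + \int[leb]_(r in `]a, x]) h r).
    apply: open_continuous_measurable_fun; first exact: itv_open.
    move=> x /[!inE] /=; rewrite in_itv/=.
    exact: (abs_continuous_cts (@abs_continuous_primitive R a b c h ih)).
  apply: (measurable_comp mab _ mP).
    by move=> _ [x Ux <-] /=; rewrite in_itv/=; exact: Uab.
  by apply: measurable_funTS; exact: measurable_enorm.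
have Kfin K : K `<=` U -> compact K -> measurable K /\ (mu n K < +oo)%E.
  move=> KU cK; have mK := rV_compact_measurable cK; split => //.
  have [k k0 Kk] := rV_compact_enorm cK; exact: rV_bounded_fin mK k0 Kk.
have mf : measurable_fun (setT : set R) f by apply/measurable_EFinP; exact: measurable_int intf.
have me := @measurable_enorm R n.
have mcoord i : measurable_fun setT (fun x : 'rV[R]_n => x ord0 i / enorm x).
  apply: measurable_funM; first exact: (@measurable_rV_coord R n i).
  exact: (measurableT_comp measurable_invr me).
have coord1 (x : 'rV[R]_n) i : `|x ord0 i / enorm x| <= 1.
  rewrite normrM normfV (ger0_norm (enorm_ge0 x)).
  have [x0|x0] := eqVneq (enorm x) 0; first by rewrite x0 invr0 mulr0.
  by rewrite ler_pdivrMr ?mul1r ?le_coord_enorm// lt_def x0 enorm_ge0.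
have intr (h : R -> R) A : measurable_fun (setT : set R) h -> leb.-integrable `[a, b] (EFin \o h) ->
    measurable A -> A `<=` U -> (mu n).-integrable A (EFin \o (fun x => h (enorm x))).
  move=> mh ih mA AU; apply/integrableP; split.
    by apply/measurable_EFinP; apply: measurable_funTS; exact: (measurableT_comp mh me).
  apply: le_lt_trans (radial_integral_le (h := fun r => `|h r|) n0 a0 ab' _ _ mA _) _ => //.
  - exact: measurableT_comp.
  - by move=> x /AU/Uab/andP[/ltW -> /ltW ->].
  - have /integrableP[_ hoo] := ih; rewrite lte_mul_pinfty// lee_fin mulr_ge0//.
      exact/ltW/sphere_area_gt0.
    by rewrite exprn_ge0// (le_trans a0).
split.
  split => //; first exact: mZ.
  move=> K KU cK; have [mK muK] := Kfin K KU cK.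
  apply: (@le_lt_trans _ _ (\int[mu n]_(x in K) cst (`|c| + \int[leb]_(r in `[a, b]) `|f r|)%:E x)%E).
    apply: ge0_le_integral => //.
    - apply/measurable_EFinP; apply: measurableT_comp => //.
      exact: measurable_funS (mZ f intf).
    - by move=> x /KU Ux; rewrite lee_fin; exact: Zbnd.
  by rewrite integral_cst// lte_mul_pinfty// lee_fin addr_ge0// Rintegral_ge0.
exists (fun i x => f (enorm x) * (x ord0 i / enorm x)) => i; split.
  split => //.
    by apply: measurable_funTS; apply: measurable_funM => //; exact: (measurableT_comp mf me).
  move=> K KU cK; have [mK muK] := Kfin K KU cK.
  have ifK := intr f K mf (lebesgue_integrableS (@measurableT _ (measurableTypeR R)) mI (@subsetT _ _) intf) mK KU.
  have := @integrable_mul_bounded _ _ _ (mu n) K _ _ 1 mK ifK (measurable_funTS (mcoord i)) (fun x _ => coord1 x i).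
  by case/integrableP.
move=> phi [dphi [K cK [KU phi0]]].
have [mK muK] := Kfin K KU cK.
have dphi0 x : differentiable phi x by exact: (dphi [::]).
have cdphi : continuous (partial i phi).
  by move=> x; apply: differentiable_continuous; exact: (dphi [:: i]).
have cphi : continuous phi by move=> x; exact: differentiable_continuous.
have clK : closed K by apply: compact_closed => //; exact: norm_hausdorff.
have pphi0 x : ~ K x -> partial i phi x = 0.
  move=> Kx; rewrite /partial (@near_eq_derive _ _ _ phi (cst 0)) ?derive_cst//.
  have : nbhs x (~` K) by apply: open_nbhs_nbhs; split=> //; exact: closed_openC.
  by apply: filterS => y /phi0.
have supp (h : 'rV[R]_n -> R) : (forall x, ~ K x -> h x = 0) ->
    (\int[mu n]_(x in U) h x)%R = (\int[mu n]_(x in K) h x)%R.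
  move=> h0; rewrite Rintegral_mkcond [RHS]Rintegral_mkcond; apply: eq_Rintegral => x _.
  rewrite !patchE; have [xK|xK] := boolP (x \in K).
    by rewrite mem_set//; apply: KU; rewrite -inE.
  by case: ifPn => // _; apply: h0; rewrite notin_setE in xK.
rewrite supp; last by move=> x /pphi0 ->; rewrite mulr0.
rewrite [X in _ = - X]supp; last by move=> x /phi0 ->; rewrite mulr0.
have [g_ [cg ig gf]] := continuous_L1_approx a b intf.
have intf' := lebesgue_integrableS (@measurableT _ (measurableTypeR R)) mI (@subsetT _ _) intf.
have parts m : (\int[mu n]_(x in K) (Z (g_ m) x * partial i phi x))%R =
    - (\int[mu n]_(x in K) (g_ m (enorm x) * (x ord0 i / enorm x * phi x)))%R.
  have dG r : a < r -> is_derive r 1 (fun r => c + \int[leb]_(y in `]a, r]) g_ m y) (g_ m r).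
    move=> ar; have := is_deriveD (is_derive_cst c r (1 : R)) (continuous_primitive (cg m) ar).
    by rewrite add0r.
  have aK x : K x -> a < enorm x by move=> /KU/Uab/andP[].
  have := @radial_by_parts n i _ (g_ m) a phi K a0 dG (cg m) dphi0 cdphi cK aK phi0.
  rewrite -/(Z (g_ m) _) => E; apply: (etrans E).
  by congr (- _); apply: eq_Rintegral => x _; rewrite -!mulrA.
have [M1 HM1] := rV_compact_bounded cK cdphi.
have [M2 HM2] := rV_compact_bounded cK cphi.
have mg m : measurable_fun (setT : set R) (g_ m) by exact: continuous_measurable_fun.
pose eps m := \int[leb]_(y in `[a, b]) `|f y - g_ m y|.
have ifg m := integrable_norm (lebesgue_integrableB mI intf' (ig m)).
have epsE m : (eps m)%:E = (\int[leb]_(y in `[a, b]) `|f y - g_ m y|%:E)%E.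
  by rewrite /eps /Rintegral fineK//; apply: integrable_fin_num => //; exact: ifg.
(* The approximations [g_ m] are integrable on [[a, b]] only. Cutting them off there leaves [Z]
   unchanged on U and gives functions integrable on the line. *)
have ZgE m x : U x -> Z (g_ m) x = Z (g_ m \_ `[a, b]) x.
  move=> /Uab/andP[ax xb]; rewrite /Z; congr (_ + _); apply: eq_Rintegral => y.
  rewrite inE/= in_itv/= => /andP[ay yx]; rewrite patchE mem_set//= in_itv/= (ltW ay)/=.
  by rewrite (le_trans yx)// ltW.
have igT m : leb.-integrable setT (EFin \o (g_ m \_ `[a, b])).
  by have := ig m; rewrite integrable_mkcond// restrict_EFin.
have intZ (h : R -> R) : leb.-integrable setT (EFin \o h) -> (mu n).-integrable K (EFin \o Z h).
  move=> ih; apply/integrableP; split.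
    by apply/measurable_EFinP; apply: measurable_funS (mZ h ih).
  apply: (@le_lt_trans _ _ (\int[mu n]_(x in K) cst (`|c| + \int[leb]_(r in `[a, b]) `|h r|)%:E x)%E).
    apply: ge0_le_integral => //.
    - apply/measurable_EFinP; apply: measurableT_comp => //.
      by apply: measurable_funS (mZ h ih).
    - by move=> x /KU Ux; rewrite lee_fin; exact: Zbnd.
  by rewrite integral_cst// lte_mul_pinfty// lee_fin addr_ge0// Rintegral_ge0.
have intZg m : (mu n).-integrable K (EFin \o Z (g_ m)).
  have := intZ _ (igT m); apply: eq_integrable => // x /[!inE] Kx /=.
  by rewrite -ZgE//; exact: KU.
have R1 : (\int[mu n]_(x in K) (Z (g_ m) x * partial i phi x))%R @[m --> \oo] -->
    (\int[mu n]_(x in K) (Z f x * partial i phi x))%R.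
  apply: (Rintegral_mul_cvg mK (intZ f intf) intZg _ _ HM1); last first.
    by apply: measurable_funTS; exact: rV_continuous_measurable.
  have fK : mu n K \is a fin_num by rewrite ge0_fin_numE.
  have [k kE] : exists k : R, mu n K = k%:E by exists (fine (mu n K)); exact: esym (fineK fK).
  apply: (@cvge0_squeeze R _ eps k) => // m; first exact: integral_ge0.
  apply: (@le_trans _ _ (\int[mu n]_(x in K) cst (eps m)%:E x)%E); last first.
    rewrite integral_cst//; apply: (@le_trans _ _ ((eps m)%:E * k%:E)%E).
      by rewrite -kE.
    by rewrite -EFinM mulrC.
  apply: ge0_le_integral => //.
  - apply/measurable_EFinP; apply: measurableT_comp => //; apply: measurable_funB.
      by apply: measurable_funS (mZ f intf).
    by apply/measurable_EFinP; exact: measurable_int (intZg m).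
  - move=> x /KU Ux /=; rewrite lee_fin /Z opprD addrACA subrr add0r.
    have /andP[ax xb] := Uab x Ux.
    exact: primitive_dist_le (ltW ax) (ltW xb) intf' (ig m).
have R2 : (\int[mu n]_(x in K) (g_ m (enorm x) * (x ord0 i / enorm x * phi x)))%R @[m --> \oo] -->
    (\int[mu n]_(x in K) (f (enorm x) * (x ord0 i / enorm x * phi x)))%R.
  apply: (Rintegral_mul_cvg (M := M2) mK (intr f K mf intf' mK KU) (fun m => intr (g_ m) K (mg m) (ig m) mK KU)).
  - apply: (@cvge0_squeeze R _ eps (@sphere_area R n * b ^+ n.-1)) => // m; first exact: integral_ge0.
    rewrite EFinM epsE.
    apply: (radial_integral_le (h := fun r => `|f r - g_ m r|) n0 a0 ab') => //.
      by apply: measurableT_comp => //; exact: measurable_funB.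
    by move=> x /KU/Uab/andP[/ltW -> /ltW ->].
  - apply: measurable_funTS; apply: measurable_funM => //.
    exact: rV_continuous_measurable.
  - move=> x Kx; rewrite normrM -[leRHS]mul1r ler_pM//; exact: HM2.
rewrite -/(Z f _).
have -> : (\int[mu n]_(x in K) (f (enorm x) * (x ord0 i / enorm x) * phi x))%R =
    (\int[mu n]_(x in K) (f (enorm x) * (x ord0 i / enorm x * phi x)))%R.
  by apply: eq_Rintegral => x _; rewrite -!mulrA.
apply: cvg_unique R1 _ => //.
rewrite (_ : (fun m => _) = (fun m => - (\int[mu n]_(x in K) (g_ m (enorm x) * (x ord0 i / enorm x * phi x)))%R)).
  exact: (cvgN R2).
by apply/funext => m; exact: parts.
Qed.

End radial_functions.

(** * Degenerate weights *)

Section support_components.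
Context {R : realType}.
Notation mu := (@lebesgue_measure R).
Variables (p a b : R) (eta : R -> R).
Notation I := (Ip p a b eta).
Notation C := (components p a b eta).

Lemma inv_weight_ge0 r : (0 <= inv_weight p eta r)%E.
Proof. by rewrite /inv_weight inve_ge0 lee_fin powR_ge0. Qed.

Lemma Ip_sub : I `<=` `]a, b[%classic.
Proof. by move=> r [rab _]; rewrite /= in_itv. Qed.

Lemma Ip_open : open I.
Proof.
rewrite openE => r [/andP[ar rb] [e e0 intr]].
near=> s.
have as_ : a < s by near: s; exact: lt_nbhsr.
have sb : s < b by near: s; exact: lt_nbhsl.
have rs : `|r - s| < e / 2 by near: s; apply: cvgr_dist_lt => //; rewrite divr_gt0.
split; first by rewrite as_.
exists (e / 2); first by rewrite divr_gt0.
apply: (@integrableS _ (measurableTypeR R) R mu _ _ _ _ _ _ intr).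
- exact: measurable_itv.
- exact: measurable_itv.
- move=> x /=; rewrite !in_itv/= => /andP[x1 x2]; move: rs; rewrite ltr_norml => /andP[r1 r2].
  by apply/andP; split; lra.
Unshelve. all: by end_near. Qed.

Lemma Ip_component_interval r : I r -> exists c, [/\ connected_component I r = `]c.1, c.2[%classic,
  a <= c.1, c.1 < r < c.2, c.2 <= b & `]c.1, c.2[%classic `<=` I].
Proof.
move=> Ir; have ab : a < b by case: Ir => /andP[ar rb] _; exact: lt_trans rb.
have rIr : r \in I by rewrite inE.
have sub := @connected_component_sub R I r.
have cc := @component_connected R I r.
have itv : is_interval (connected_component I r) by exact/connected_intervalP.
have op : open (connected_component I r).
  rewrite openE => x Cx; have Ix := sub x Cx.
  have : nbhs x I by apply: open_nbhs_nbhs; split => //; exact: Ip_open.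
  rewrite -nbhs_ballE => -[e /= e0 eI].
  exists e => //= y exy.
  have : connected_component I x `<=` connected_component I r.
    by rewrite (same_connected_component Cx).
  apply; exists (ball x e); last exact: exy.
  split; [exact: ballxx|exact: eI|].
  by apply/connected_intervalP; rewrite ball_itv; exact: interval_is_interval.
have bnd : connected_component I r `<=` `[a, b].
  by move=> x /sub/Ip_sub /=; rewrite !in_itv/= => /andP[/ltW -> /ltW ->].
have [c [c1 c2 c3 cE _]] := open_bounded_interval op itv bnd (ltW ab).
exists c; split => //; last by rewrite -cE.
have : connected_component I r r by exact: connected_component_refl.
by rewrite cE /= in_itv.
Qed.

(** A component is recorded only through an equality of sets, so its endpoints are recovered from
    the fact that a nonempty open interval determines them. *)
Lemma component_bounds c : C c -> [/\ a <= c.1, c.1 < c.2, c.2 <= b & `]c.1, c.2[%classic `<=` I].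
Proof.
move=> [r Ir cE]; have [c' [c'E ac' /andP[r1 r2] cb' sub]] := Ip_component_interval Ir.
rewrite c'E in cE.
have lt' : c'.1 < c'.2 by exact: lt_trans r2.
have rc : `]c.1, c.2[%classic r by rewrite -cE /= in_itv/= r1.
have lt : c.1 < c.2 by move: rc; rewrite /= in_itv/= => /andP[]; exact: lt_trans.
have bnd (x y u w : R) : x < y -> `]x, y[%classic `<=` `]u, w[%classic -> u <= x /\ y <= w.
  move=> xy sb; split; rewrite leNgt; apply/negP => lt0.
  - have := sb ((x + Num.min u y) / 2); rewrite /= !in_itv/= => H.
    have xm : x < Num.min u y by rewrite lt_min lt0.
    have mu1 : Num.min u y <= u by rewrite ge_min lexx.
    have mu2 : Num.min u y <= y by rewrite ge_min lexx orbT.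
    have /andP[] : u < (x + Num.min u y) / 2 < w by apply: H; apply/andP; split; lra.
    lra.
  - have := sb ((y + Num.max w x) / 2); rewrite /= !in_itv/= => H.
    have xm : Num.max w x < y by rewrite gt_max lt0.
    have mu1 : w <= Num.max w x by rewrite le_max lexx.
    have mu2 : x <= Num.max w x by rewrite le_max lexx orbT.
    have /andP[] : u < (y + Num.max w x) / 2 < w by apply: H; apply/andP; split; lra.
    lra.
have [E1 E2] : c'.1 = c.1 /\ c'.2 = c.2.
  have [h1 h2] : c.1 <= c'.1 /\ c'.2 <= c.2 by apply: bnd => //; rewrite cE.
  have [h3 h4] : c'.1 <= c.1 /\ c.2 <= c'.2 by apply: bnd => //; rewrite cE.
  by split; apply/le_anti; rewrite ?h1 ?h2 ?h3 ?h4.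
by rewrite -E1 -E2; split.
Qed.

Lemma component_of r : I r -> exists2 c, C c & c.1 < r < c.2.
Proof.
move=> Ir; have [c [cE _ rc _ _]] := Ip_component_interval Ir.
by exists c => //; exists r.
Qed.

(** Otherwise the segment from an inner point to the endpoint would be connected in I, and the
    component would contain its own endpoint. *)
Lemma component_endpoint c : C c -> ~ I c.1 /\ ~ I c.2.
Proof.
move=> Cc; have [ac lt cb sub] := component_bounds Cc.
have [r Ir cE] := Cc.
have rc : c.1 < r < c.2.
  have : connected_component I r r by exact: connected_component_refl.
  by rewrite cE /= in_itv.
have /andP[r1 r2] := rc.
split => Ic.
- have : connected_component I r c.1.
    exists `[c.1, r]%classic; last by rewrite /= in_itv/= lexx ltW.
    split; [by rewrite /= in_itv/= lexx ltW| |].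
    + move=> x /=; rewrite in_itv/= le_eqVlt => /andP[/predU1P[<-//|cx] xr].
      by apply: sub; rewrite /= in_itv/= cx (le_lt_trans xr).
    + by apply/connected_intervalP; exact: interval_is_interval.
  by rewrite cE /= in_itv/= ltxx.
- have : connected_component I r c.2.
    exists `[r, c.2]%classic; last by rewrite /= in_itv/= lexx ltW.
    split; [by rewrite /= in_itv/= lexx ltW| |].
    + move=> x /=; rewrite in_itv/= [x <= _]le_eqVlt => /andP[rx /predU1P[->//|xc]].
      by apply: sub; rewrite /= in_itv/= xc (lt_le_trans r1).
    + by apply/connected_intervalP; exact: interval_is_interval.
  by rewrite cE /= in_itv/= ltxx andbF.
Qed.

Lemma component_unique c c' r : C c -> C c' -> c.1 < r < c.2 -> c'.1 < r < c'.2 -> c = c'.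
Proof.
move=> Cc Cc'; have [_ _ _ sub] := component_bounds Cc; have [_ _ _ sub'] := component_bounds Cc'.
have [n1 n2] := component_endpoint Cc; have [n1' n2'] := component_endpoint Cc'.
move=> /andP[h1 h2] /andP[h1' h2'].
rewrite (surjective_pairing c) (surjective_pairing c'); congr pair; apply/eqP; rewrite eq_le !leNgt;
  apply/andP; split; apply/negP => lt.
- by apply: n1; apply: sub'; rewrite /= in_itv/= lt (lt_trans h1 h2').
- by apply: n1'; apply: sub; rewrite /= in_itv/= lt (lt_trans h1' h2).
- by apply: n2'; apply: sub; rewrite /= in_itv/= lt (lt_trans h1 h2').
- by apply: n2; apply: sub'; rewrite /= in_itv/= lt (lt_trans h1' h2).
Qed.

Lemma not_Ip_integral c e : a < c < b -> ~ I c -> 0 < e -> measurable_fun `]c - e, c + e[ (inv_weight p eta) ->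
  (\int[mu]_(r in `](c - e)%R, (c + e)%R[) inv_weight p eta r = +oo)%E.
Proof.
move=> cab nI e0 mw; apply/eqP; rewrite -leye_eq leNgt; apply/negP => fin.
apply: nI; split => //; exists e => //; apply/integrableP; split => //.
by under eq_integral do rewrite gee0_abs ?inv_weight_ge0//.
Qed.

Lemma integrable_setU (A B : set (measurableTypeR R)) (f : R -> \bar R) : measurable A -> measurable B ->
  mu.-integrable A f -> mu.-integrable B f -> mu.-integrable (A `|` B) f.
Proof.
move=> mA mB /integrableP[m1 f1] /integrableP[m2 f2].
have mU : measurable_fun (A `|` B) f by exact/measurable_funU.
apply/integrableP; split => //.
have E : A `|` B = A `|` (B `\` A).
  by apply/seteqP; split => x [|]; [left| |left|case; right]; rewrite // => Bx;
    have [Ax|Ax] := pselect (A x); [left|right].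
have mD : measurable (B `\` A) by exact: measurableD.
rewrite E ge0_integral_setU//.
- apply: lte_add_pinfty => //; apply: le_lt_trans f2; apply: ge0_subset_integral => //.
  by apply: measurableT_comp.
- by rewrite -E; exact: measurableT_comp.
- by apply/disj_set2P; apply/seteqP; split => // x [Ax []].
Qed.

(** I only provides integrability near each of its points; a finite subcover of the compact segment
    makes it global. *)
Lemma integrable_inv_weight (s t : R) : `[s, t]%classic `<=` I ->
  mu.-integrable `[s, t] (inv_weight p eta).
Proof.
move=> stI.
have [e He] : exists e : R -> R, forall y, I y -> 0 < e y /\
    mu.-integrable `]y - e y, y + e y[ (inv_weight p eta).
  have /choice[e He] : forall y, exists e, I y -> 0 < e /\
      mu.-integrable `]y - e, y + e[ (inv_weight p eta).
    move=> y; have [[_ [e e0 ie]]|nI] := pselect (I y); first by exists e.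
    by exists 0 => /nI.
  by exists e.
have := @segment_compact R s t; rewrite compact_cover => /(_ R `[s, t]%classic (fun y => `]y - e y, y + e y[%classic)).
case => [y _|y yst|D' D'st cov].
- exact: itv_open.
- by exists y => //=; have [e0 _] := He y (stI _ yst); rewrite in_itv/=; apply/andP; split; lra.
have mB (y : R) : measurable (`]y - e y, y + e y[%classic : set (measurableTypeR R)).
  exact: measurable_itv.
have P (l : seq R) : (forall y, y \in l -> I y) ->
    measurable (\big[setU/set0]_(y <- l) (`]y - e y, y + e y[%classic : set (measurableTypeR R))) /\
    mu.-integrable (\big[setU/set0]_(y <- l) (`]y - e y, y + e y[%classic : set (measurableTypeR R))) (inv_weight p eta).
  elim: l => [|y l ih] H.
    rewrite big_nil; split; first exact: measurable0.
    by apply/integrableP; split; [exact: measurable_fun_set0|rewrite integral_set0].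
  have [m1 i1] : measurable (\big[setU/set0]_(y <- l) (`]y - e y, y + e y[%classic : set (measurableTypeR R))) /\
    mu.-integrable (\big[setU/set0]_(y <- l) (`]y - e y, y + e y[%classic : set (measurableTypeR R))) (inv_weight p eta).
    by apply: ih => z zl; apply: H; rewrite inE zl orbT.
  have [_ i2] := He y (H y (mem_head _ _)).
  by rewrite big_cons; split; [exact: measurableU|exact: integrable_setU].
have [mU iU] := P (finmap.enum_fset D') (fun y yD => stI y (set_mem (D'st y yD))).
apply: (@integrableS _ (measurableTypeR R) R mu _ _ _ mU _ _ iU); first exact: measurable_itv.
move=> x /cov [y /= yD yx]; rewrite -bigcup_seq; exists y => //.
Qed.

End support_components.

Lemma wintE d (T : measurableType d) (R : realType) (mu : {measure set T -> \bar R}) D w p f :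
  wint mu D w p f = (\int[mu]_(x in D) (`|f x| `^ p * w x)%:E)%E.
Proof. by rewrite unlock. Qed.

Section ae.
Context {R : realType}.
Notation leb := (@lebesgue_measure R).

Lemma lebesgue_aeI (P Q : R -> Prop) : {ae leb, forall x, P x} ->
  {ae leb, forall x, Q x} -> {ae leb, forall x, P x /\ Q x}.
Proof. by apply: filterI; exact: (ae_filter_ringOfSetsType leb). Qed.

End ae.

(** No condition at all on f inside N, where it may even be negative: weights built on [eta] are
    nonnegative only almost everywhere. The negative part of f vanishes off N. *)
Lemma integral_eq_null d (T : measurableType d) (R : realType) (mu : {measure set T -> \bar R})
    (D : set T) (f g : T -> \bar R) (N : set T) : measurable N -> mu N = 0%E ->
  (forall x, D x -> (0 <= g x)%E) -> (forall x, D x -> ~ N x -> f x = g x) ->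
  (\int[mu]_(x in D) f x = \int[mu]_(x in D) g x)%E.
Proof.
move=> mN N0 g0 fg; rewrite integralE.
have -> : (\int[mu]_(x in D) f^\- x = 0)%E.
  rewrite (@ge0_integral_eq_null _ _ _ mu D _ (cst 0%E) N)//; first exact: integral0.
  by move=> x Dx Nx; rewrite /= unlock fg//; apply/max_idPr; rewrite leeNl oppe0 g0.
rewrite sube0; apply: (@ge0_integral_eq_null _ _ _ mu D _ _ N) => //.
by move=> x Dx Nx; rewrite /= unlock fg//; apply/max_idPl; exact: g0.
Qed.

(** * The weight on the line and its dual weight *)

Section weights.
Context {R : realType} (d : nat).
Notation leb := (@lebesgue_measure R).
Notation mu := (@rV_lebesgue R d).
Variables (p a b : R) (eta : R -> R).
Hypotheses (d_gt0 : (0 < d)%N) (p_gt1 : 1 < p) (a_ge0 : 0 <= a) (ab : a < b).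
Hypothesis eta_weight : radial_weight a b eta.
Notation I := (Ip p a b eta).
Notation C := (components p a b eta).
Notation omega := (@sphere_area R d).

Let p0 : 0 < p. Proof. exact: lt_trans p_gt1. Qed.
Let pm1 : 0 < p - 1. Proof. by rewrite subr_gt0. Qed.
Let b_gt0 : 0 < b. Proof. exact: le_lt_trans ab. Qed.
Let omega_gt0 : 0 < omega. Proof. exact: sphere_area_gt0. Qed.

(* eta is nonnegative only almost everywhere. *)
Definition etap (r : R) : R := Num.max ((eta \_ `[0, b]) r) 0.

Definition rho (r : R) : R := omega * `|r| ^+ d.-1 * etap r.

(** The dual weight rho^(-1/(p-1)). The inverse is real, so kappa is 0 where rho is 0, whereas
    [inv_weight] is +oo there; almost everywhere on segments of I rho is positive and no discrepancy
    arises. *)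
Definition kappa (r : R) : R := (rho r `^ (p - 1)^-1)^-1.

Lemma eta_measurable : measurable_fun (`[0, b]%classic : set R) eta.
Proof.
have [_ H _] := eta_weight; apply/measurable_EFinP; apply: measurable_int (H `[0, b]%classic _ _).
- by move=> x /=; rewrite !in_itv/= => /andP[->].
- exact: segment_compact.
Qed.

Lemma etap_measurable : measurable_fun (setT : set R) etap.
Proof.
apply: measurable_maxr; last exact: measurable_cst.
by apply/(measurable_restrictT _ _).1; [exact: measurable_itv|exact: eta_measurable].
Qed.

Lemma etap_ge0 r : 0 <= etap r. Proof. by rewrite /etap le_max lexx orbT. Qed.

Lemma rho_ge0 r : 0 <= rho r.
Proof. by rewrite /rho mulr_ge0 ?etap_ge0// mulr_ge0 ?exprn_ge0// ltW. Qed.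

Lemma kappa_ge0 r : 0 <= kappa r. Proof. by rewrite /kappa invr_ge0 powR_ge0. Qed.

Lemma rho_measurable : measurable_fun (setT : set R) rho.
Proof.
apply: measurable_funM; last exact: etap_measurable.
apply: measurable_funM => //.
have h : measurable_fun (setT : set R) (fun r : R => r ^+ d.-1).
  exact: (continuous_measurable_fun (@exprn_continuous R d.-1)).
exact: (measurableT_comp h).
Qed.

Lemma kappa_measurable : measurable_fun (setT : set R) kappa.
Proof.
apply: (measurableT_comp (@measurable_invr R)).
by apply: (measurableT_comp (@measurable_powR R _)); exact: rho_measurable.
Qed.

Lemma etap_ae : {ae leb, forall r, 0 <= r <= b -> etap r = eta r}.
Proof.
have [H _ _] := eta_weight; apply: lebesgue_aeS H => r Hr /andP[r0 rb].
rewrite /etap patchE mem_set/= ?in_itv/= ?r0//.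
by apply/max_idPl; exact: Hr.
Qed.

Lemma rho_gt0_ae (s t : R) : `[s, t]%classic `<=` I ->
  {ae leb, forall r, s <= r <= t -> 0 < rho r /\ 0 < eta r}.
Proof.
move=> stI; have := integrable_inv_weight stI => intw.
have mI : measurable (`[s, t]%classic : set (measurableTypeR R)) by exact: measurable_itv.
have fin := integrable_ae mI intw.
have H : {ae leb, forall r, ((s <= r <= t -> inv_weight p eta r \is a fin_num)
    /\ (0 <= r -> 0 <= eta r)) /\ (0 <= r <= b -> etap r = eta r)}.
  apply: lebesgue_aeI; last exact: etap_ae.
  apply: lebesgue_aeI; last by have [] := eta_weight.
  by apply: lebesgue_aeS fin => r Hr rst; apply: Hr; rewrite /= in_itv.
apply: lebesgue_aeS H => r [[H1 H2] H3] rst.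
have : I r by apply: stI; rewrite /= in_itv.
move=> /Ip_sub /=; rewrite in_itv/= => /andP[ar rb].
have r0 : 0 < r by exact: le_lt_trans ar.
have er : 0 < eta r.
  rewrite lt_def H2 ?(ltW r0)// andbT; apply/eqP => e0.
  have := H1 rst; rewrite /inv_weight e0 powR0 ?inve0//.
  by rewrite invr_eq0 gt_eqF.
split => //; rewrite /rho H3 ?(ltW r0) ?(ltW rb)// mulr_gt0// mulr_gt0// exprn_gt0// normr_gt0 gt_eqF//.
Qed.

Lemma kappa_le (s t : R) : `[s, t]%classic `<=` I ->
  exists2 k, 0 <= k & {ae leb, forall r, s <= r <= t -> ((kappa r)%:E <= k%:E * inv_weight p eta r)%E}.
Proof.
move=> stI; exists ((omega * `|s| ^+ d.-1) `^ (p - 1)^-1)^-1; first by rewrite invr_ge0 powR_ge0.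
have H : {ae leb, forall r, (s <= r <= t -> 0 < rho r /\ 0 < eta r) /\ (0 <= r <= b -> etap r = eta r)}.
  by apply: lebesgue_aeI; [exact: (rho_gt0_ae stI)|exact: etap_ae].
apply: lebesgue_aeS H => r [H1 H2] rst; have [rr er] := H1 rst.
have [Is Ir] : I s /\ I r.
  by split; apply: stI; rewrite /= in_itv//= lexx; case/andP: rst; exact: le_trans.
have as_ : a < s by move: (Ip_sub Is); rewrite /= in_itv/= => /andP[].
have rb : a < r < b by move: (Ip_sub Ir); rewrite /= in_itv.
have s0 : 0 < s by exact: le_lt_trans as_.
have /andP[sr _] := rst; have r0 : 0 < r by exact: lt_le_trans sr.
have ee : etap r = eta r by apply: H2; rewrite (ltW r0)/= ltW//; case/andP: rb.
have os : 0 < omega * `|s| ^+ d.-1 by rewrite mulr_gt0// exprn_gt0// normr_gt0 gt_eqF.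
have P1 : 0 < (omega * `|s| ^+ d.-1) `^ (p - 1)^-1 * eta r `^ (p - 1)^-1.
  by rewrite mulr_gt0 ?powR_gt0.
rewrite /inv_weight inver gt_eqF ?powR_gt0// -EFinM lee_fin -invfM /kappa lef_pV2 ?posrE ?powR_gt0//.
rewrite -powRM ?(ltW er)//; last by rewrite mulr_ge0 ?exprn_ge0// ltW.
apply: ge0_ler_powR; rewrite ?nnegrE ?invr_ge0 ?(ltW pm1) ?rho_ge0//.
  by rewrite mulr_ge0 ?(ltW er)// ltW.
rewrite /rho ee ler_wpM2r ?(ltW er)// ler_wpM2l ?(ltW omega_gt0)//.
by rewrite lerXn2r ?nnegrE// !ger0_norm// ltW.
Qed.

Lemma kappa_integrable (s t : R) : `[s, t]%classic `<=` I -> leb.-integrable `[s, t] (EFin \o kappa).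
Proof.
move=> stI; have mI : measurable (`[s, t]%classic : set (measurableTypeR R)) by exact: measurable_itv.
have mk : measurable_fun (`[s, t]%classic : set R) kappa by apply: measurable_funTS; exact: kappa_measurable.
have [k k0 Hk] := kappa_le stI.
have /integrableP[mw fw] := integrable_inv_weight stI.
apply/integrableP; split; first exact/measurable_EFinP.
apply: (@le_lt_trans _ _ (\int[leb]_(r in `[s, t]) (k%:E * `|inv_weight p eta r|))%E); last first.
  by rewrite ge0_integralZl//; [exact: lte_mul_pinfty|exact: measurableT_comp].
apply: ae_ge0_le_integral => //.
- by apply: measurableT_comp => //; exact/measurable_EFinP.
- by move=> r _; rewrite mule_ge0.
- by apply: measurable_funeM; exact: measurableT_comp.
- apply: lebesgue_aeS Hk => r Hr /=; rewrite in_itv/= => rst.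
  by rewrite ger0_norm ?kappa_ge0// gee0_abs ?inv_weight_ge0//; exact: Hr.
Qed.

(* Young's inequality replaces Hoelder's: s is optimized by the caller. *)
Lemma kappa_young (s x r : R) : 0 < s -> 0 < rho r ->
  `|x| <= s * kappa r + s `^ (1 - p) * (`|x| `^ p * rho r).
Proof.
move=> s0 r0; have k0 : 0 < kappa r by rewrite /kappa invr_gt0 powR_gt0.
(* Either |x| <= s kappa, or |x|^(p-1) rho > s^(p-1) since kappa^(p-1) = 1 / rho, and then the
   second term alone dominates |x|. *)
have [xs|sx] := leP `|x| (s * kappa r).
  by apply: le_trans xs _; rewrite lerDl mulr_ge0 ?powR_ge0// mulr_ge0 ?powR_ge0 ?rho_ge0.
apply: ler_wpDl; first by rewrite mulr_ge0// ltW.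
have x0 : 0 < `|x| by apply: lt_trans sx; rewrite mulr_gt0.
have -> : `|x| `^ p = `|x| * `|x| `^ (p - 1).
  by rewrite -{2}(powRr1 (ltW x0)) -powRD ?(gt_eqF x0) ?implybT//; congr (_ `^ _); ring.
set Y := `|x| `^ (p - 1); rewrite (_ : s `^ (1 - p) * (`|x| * Y * rho r) = `|x| * (s `^ (1 - p) * (Y * rho r))); last by ring.
rewrite ler_pMr// /Y.
have : (s * kappa r) `^ (p - 1) <= `|x| `^ (p - 1).
  by apply: ge0_ler_powR; rewrite ?nnegrE ?(ltW pm1) ?mulr_ge0 ?(ltW s0) ?(ltW k0)// ltW.
rewrite powRM ?(ltW s0) ?(ltW k0)//.
have -> : kappa r `^ (p - 1) = (rho r)^-1.
  by rewrite /kappa -powRN -powRrM mulNr mulVf ?gt_eqF// powR_inv1 ?rho_ge0.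
have -> : s `^ (1 - p) = (s `^ (p - 1))^-1.
  by rewrite -powR_inv1 ?powR_ge0// -powRrM; congr (_ `^ _); ring.
have sp : 0 < s `^ (p - 1) by rewrite powR_gt0.
by move=> H; rewrite ler_pdivlMl// mulr1 -ler_pdivrMr.
Qed.

Lemma kappa_young_integral (s t k : R) (f : R -> R) : `[s, t]%classic `<=` I -> 0 < k ->
  measurable_fun (`[s, t]%classic : set R) f ->
  (\int[leb]_(r in `[s, t]) `|f r|%:E <=
   k%:E * \int[leb]_(r in `[s, t]) (kappa r)%:E +
   (k `^ (1 - p))%:E * wint leb `[s, t] rho p f)%E.
Proof.
move=> stI k0 mf.
have mI : measurable (`[s, t]%classic : set (measurableTypeR R)) by exact: measurable_itv.
have mk : measurable_fun (`[s, t]%classic : set R) kappa by apply: measurable_funTS; exact: kappa_measurable.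
have mr : measurable_fun (`[s, t]%classic : set R) rho by apply: measurable_funTS; exact: rho_measurable.
have mfr : measurable_fun (`[s, t]%classic : set R) (fun r => `|f r| `^ p * rho r).
  apply: measurable_funM => //; apply: (measurableT_comp (@measurable_powR R _)); exact: measurableT_comp.
rewrite (_ : wint leb `[s, t] rho p f = \int[leb]_(r in `[s, t]) (`|f r| `^ p * rho r)%:E)%E; last first.
  exact: wintE.
rewrite -!ge0_integralZl//; last 6 first.
- exact/measurable_EFinP.
- by move=> r _; rewrite lee_fin mulr_ge0 ?powR_ge0 ?rho_ge0.
- by rewrite lee_fin powR_ge0.
- exact/measurable_EFinP.
- by move=> r _; rewrite lee_fin kappa_ge0.
- by rewrite lee_fin ltW.
rewrite -ge0_integralD//; last 4 first.
- by move=> r _; rewrite mule_ge0// lee_fin ?kappa_ge0// ltW.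
- by apply: measurable_funeM; exact/measurable_EFinP.
- by move=> r _; rewrite mule_ge0// lee_fin ?powR_ge0// mulr_ge0 ?powR_ge0 ?rho_ge0.
- by apply: measurable_funeM; exact/measurable_EFinP.
apply: ae_ge0_le_integral => //.
- by apply/measurable_EFinP; exact: measurableT_comp.
- by move=> r _; rewrite adde_ge0// mule_ge0// lee_fin ?kappa_ge0 ?powR_ge0 ?(ltW k0)// mulr_ge0 ?powR_ge0 ?rho_ge0.
- by apply: emeasurable_funD; apply: measurable_funeM; exact/measurable_EFinP.
- apply: lebesgue_aeS (rho_gt0_ae stI) => r Hr /=; rewrite in_itv/= => rst.
  by rewrite -!EFinM -EFinD lee_fin; apply: kappa_young => //; case: (Hr rst).
Qed.

Lemma enorm_null (N : set R) : measurable N -> leb N = 0 ->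
  measurable (@enorm R d @^-1` N) /\ mu (@enorm R d @^-1` N) = 0.
Proof.
move=> mN N0.
have mP : measurable (@enorm R d @^-1` N).
  by rewrite -[X in measurable X]setTI; exact: (@measurable_enorm R d).
split => //.
have m1 : measurable_fun (setT : set R) (fun r => (\1_N r)%:E : \bar R).
  by apply/measurable_EFinP; exact: measurable_indic.
rewrite -(setIT (_ @^-1` _)) -integral_indic//.
rewrite -[LHS]/(\int[mu]_x (fun r => (\1_N r)%:E) (enorm x))%E integral_polar//.
rewrite (@ge0_integral_eq_null _ (measurableTypeR R) R leb _ _ (cst 0%E) N mN N0)//.
- exact: integral0.
- move=> r; rewrite /= in_itv/= andbT => r0.
  by apply: mule_ge0; [rewrite lee_fin indicE|rewrite lee_fin mulr_ge0 ?exprn_ge0// ltW].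
- by move=> r _ Nr; rewrite indicE memNset// mul0e.
Qed.

(** f has to be radial only off a null set of radii, which allows [eta] to be replaced by [etap] and
    a pointwise derivative by a measurable version. *)
Lemma integral_shell (J : set R) (h : R -> \bar R) (f : 'rV[R]_d -> \bar R) (N : set R) :
  measurable (J : set R) -> J `<=` `[0, +oo[%classic -> measurable_fun (J : set R) h ->
  (forall r, J r -> 0 <= h r)%E -> measurable N -> leb N = 0 ->
  (forall x, J (enorm x) -> ~ N (enorm x) -> f x = h (enorm x)) ->
  (\int[mu]_(x in @enorm R d @^-1` J) f x = \int[leb]_(r in J) (h r * (omega * r ^+ d.-1)%:E))%E.
Proof.
move=> mJ J0 mh h0 mN N0 fh; have [mN' N'0] := enorm_null mN N0.
rewrite (@integral_eq_null _ _ _ mu _ _ (fun x => h (enorm x)) _ mN' N'0); last 2 first.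
- by move=> x; exact: h0.
- by move=> x Jx Nx; exact: fh.
transitivity (\int[mu]_x (h \_ J) (enorm x))%E.
  rewrite integral_mkcond; apply: eq_integral => x _; rewrite !patchE.
  by rewrite (_ : (x \in @enorm R d @^-1` J) = (enorm x \in J))//; apply/idP/idP; rewrite !inE.
rewrite integral_polar//; last 2 first.
- by apply/(measurable_restrictT _ _).1.
- by move=> r; rewrite patchE; case: ifPn => // /[!inE]; exact: h0.
rewrite [RHS]integral_mkcond [LHS]integral_mkcond; apply: eq_integral => r _.
rewrite !patchE; have [/set_mem Jr|Jr] := boolP (r \in J); first by rewrite mem_set//; exact: J0.
by case: ifPn => _ //; rewrite mul0e.
Qed.

Definition kint (s t : R) : R := fine (\int[leb]_(r in `[s, t]) (kappa r)%:E)%E.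

Lemma kintE (s t : R) : `[s, t]%classic `<=` I ->
  (\int[leb]_(r in `[s, t]) (kappa r)%:E)%E = (kint s t)%:E.
Proof.
move=> stI; rewrite /kint fineK//; apply: integrable_fin_num; first exact: measurable_itv.
exact: kappa_integrable.
Qed.

Lemma kint_le (s t s' t' : R) : s' <= s -> t <= t' -> `[s', t']%classic `<=` I -> kint s t <= kint s' t'.
Proof.
move=> ss tt stI.
have sub : `[s, t]%classic `<=` `[s', t']%classic.
  by move=> r /=; rewrite !in_itv/= => /andP[sr rt]; rewrite (le_trans ss sr) (le_trans rt tt).
rewrite -lee_fin -!kintE//; last exact: subset_trans stI.
apply: ge0_subset_integral => //; try exact: measurable_itv.
- by apply/measurable_EFinP; apply: measurable_funTS; exact: kappa_measurable.
- by move=> r _; rewrite lee_fin kappa_ge0.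
Qed.

Lemma kint_gt0 (s t : R) : s < t -> `[s, t]%classic `<=` I -> 0 < kint s t.
Proof.
move=> st stI; rewrite lt_def; apply/andP; split; last first.
  by apply: fine_ge0; apply: integral_ge0 => r _; rewrite lee_fin kappa_ge0.
apply/eqP => k0; have mI : measurable (`[s, t]%classic : set (measurableTypeR R)) by exact: measurable_itv.
have mk : measurable_fun (`[s, t]%classic : set (measurableTypeR R)) (EFin \o kappa).
  by apply/measurable_EFinP; apply: measurable_funTS; exact: kappa_measurable.
have [N [mN N0 sub]] : {ae leb, forall r, ~ (s <= r <= t)}.
  have H : {ae leb, forall r, (s <= r <= t -> 0 < rho r /\ 0 < eta r) /\ (s <= r <= t -> kappa r = 0)}.
    apply: lebesgue_aeI; first exact: (rho_gt0_ae stI).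
    have : ae_eq leb `[s, t]%classic (EFin \o kappa) (cst 0%E).
      apply/(ae_eq_integral_abs leb mI mk).
      under eq_integral do rewrite gee0_abs ?lee_fin ?kappa_ge0//.
      by rewrite kintE// k0.
    apply: lebesgue_aeS => r Hr rst.
    have rst' : `[s, t]%classic r by rewrite /= in_itv.
    by have := Hr rst' => /= -[].
  apply: lebesgue_aeS H => r [H1 H2] rst; have [r0 _] := H1 rst; have := H2 rst.
  by apply/eqP; rewrite /kappa invr_eq0 gt_eqF// powR_gt0.
have : (leb `[s, t]%classic <= leb N)%E.
  apply: le_measure; rewrite ?inE// => r; rewrite /= in_itv/= => rst.
  by apply: sub => /=; exact.
by rewrite [leRHS]N0 lebesgue_measure_itv/= lte_fin st -EFinB lee_fin subr_le0 leNgt st.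
Qed.

Variable Omega : set 'rV[R]_d.
Hypothesis OmegaE : Omega = [set x | enorm x < b] \/ Omega = [set x | a < enorm x < b].

Lemma Omega_measurable : measurable Omega.
Proof.
have m (J : set R) : measurable (J : set R) -> measurable (@enorm R d @^-1` J).
  by move=> mJ; rewrite -[X in measurable X]setTI; exact: (@measurable_enorm R d).
case: OmegaE => ->.
- have -> : [set x | enorm x < b] = @enorm R d @^-1` `]-oo, b[%classic.
    by apply/seteqP; split => x /=; rewrite in_itv.
  by apply: m; exact: measurable_itv.
- have -> : [set x | a < enorm x < b] = @enorm R d @^-1` `]a, b[%classic.
    by apply/seteqP; split => x /=; rewrite in_itv.
  by apply: m; exact: measurable_itv.
Qed.

Lemma Omega_annulus x : a < enorm x < b -> Omega x.
Proof. by move=> /andP[ax xb]; case: OmegaE => ->; rewrite /= ?xb ?ax. Qed.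

Lemma Omega_lt x : Omega x -> enorm x < b.
Proof. by case: OmegaE => -> //= /andP[]. Qed.

(** The ratio between the integrals of [kfun] over shells and those of [kappa] over intervals: one
    factor omega comes from the polar coordinates, and omega^(1/(p-1)) from the omega included in
    rho. *)
Let k0 := omega `^ (p / (p - 1)).

Let kfun_kappa (x : 'rV[R]_d) : 0 < enorm x <= b -> etap (enorm x) = eta (enorm x) -> 0 < eta (enorm x) ->
  kfun p eta x = (k0 * kappa (enorm x) / (omega * enorm x ^+ d.-1))%:E.
Proof.
move=> /andP[r0 rb] ee e0; set r := enorm x in r0 rb ee e0 *.
have P : 0 < r `^ ((d%:R - 1) * p) * eta r by rewrite mulr_gt0 ?powR_gt0.
rewrite /kfun /weight -/r inver gt_eqF ?powR_gt0//; congr EFin.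
have dE : (d%:R - 1 : R) = d.-1%:R.
  by rewrite -{1}(prednK d_gt0) -natr1 addrK.
have lnX : ln (r ^+ d.-1) = d.-1%:R * ln r by rewrite -powR_mulrn ?(ltW r0)// ln_powR.
have o0 : 0 < omega * r ^+ d.-1 by rewrite mulr_gt0// exprn_gt0.
have rr : 0 < rho r by rewrite /rho ee gtr0_norm// mulr_gt0.
apply: ln_inj; rewrite ?posrE ?invr_gt0 ?powR_gt0//.
  by rewrite divr_gt0// mulr_gt0 ?powR_gt0// invr_gt0 powR_gt0.
rewrite lnV ?posrE ?powR_gt0// ln_powR lnM ?posrE ?powR_gt0// ln_powR.
rewrite ln_div ?posrE ?o0//; last by rewrite mulr_gt0 ?powR_gt0// invr_gt0 powR_gt0.
rewrite lnM ?posrE ?invr_gt0 ?powR_gt0// ln_powR /kappa lnV ?posrE ?powR_gt0// ln_powR.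
rewrite /rho ee gtr0_norm// lnM ?posrE// (lnM omega_gt0) ?posrE ?exprn_gt0// lnX dE.
by have := lt0r_neq0 pm1 => pm; field.
Qed.

Lemma kfun_integral (s t : R) : s < t -> `[s, t]%classic `<=` I ->
  (\int[mu]_(y in shell p a b eta Omega s t) kfun p eta y)%E = (k0 * kint s t)%:E.
Proof.
move=> st stI.
have stab r : s < r < t -> a < r < b.
  move=> /andP[sr rt]; have : I r by apply: stI; rewrite /= in_itv/= !ltW.
  by move=> /Ip_sub /=; rewrite in_itv.
have shellE : shell p a b eta Omega s t = @enorm R d @^-1` `]s, t[%classic.
  apply/seteqP; split => x /=; rewrite in_itv/=; first by case.
  move=> xst; split => //; split; first exact/Omega_annulus/stab.
  by apply: stI; rewrite /= in_itv/=; case/andP : xst => /ltW -> /ltW ->.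
have [N [mN N0 sub]] : {ae leb, forall r, s <= r <= t -> etap r = eta r /\ 0 < eta r}.
  have H : {ae leb, forall r, (s <= r <= t -> 0 < rho r /\ 0 < eta r) /\ (0 <= r <= b -> etap r = eta r)}.
    by apply: lebesgue_aeI; [exact: (rho_gt0_ae stI)|exact: etap_ae].
  apply: lebesgue_aeS H => r [H1 H2] rst; have [_ e0] := H1 rst; split => //; apply: H2.
  have : I r by apply: stI; rewrite /= in_itv.
  by move=> /Ip_sub /=; rewrite in_itv/= => /andP[/ltW ar /ltW ->]; rewrite (le_trans a_ge0).
pose G r : \bar R := (k0 * kappa r / (omega * r ^+ d.-1))%:E.
have st0 r : s < r < t -> 0 < r by move=> /stab/andP[ar _]; exact: le_lt_trans ar.
have mG : measurable_fun (setT : set R) G.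
  apply/measurable_EFinP; apply: measurable_funM; first by apply: measurable_funM => //; exact: kappa_measurable.
  apply: (measurableT_comp (@measurable_invr R)).
  apply: measurable_funM; first exact: measurable_cst.
  exact: (continuous_measurable_fun (@exprn_continuous R d.-1)).
rewrite shellE (@integral_shell _ G _ N)//; last 4 first.
- by move=> r; rewrite /= !in_itv/= => /st0/ltW ->.
- exact: measurable_funTS.
- move=> r; rewrite /= in_itv/= => rst; rewrite lee_fin; apply: divr_ge0; first by rewrite mulr_ge0 ?powR_ge0 ?kappa_ge0.
  by rewrite mulr_ge0 ?(ltW omega_gt0) ?exprn_ge0 ?(ltW (st0 r rst)).
- move=> x; rewrite /= in_itv/= => xst Nx.
  have xst' : s <= enorm x <= t by case/andP: xst => /ltW -> /ltW ->.
  have [ee e0] : etap (enorm x) = eta (enorm x) /\ 0 < eta (enorm x).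
    by apply: contrapT => H; apply: Nx; apply: sub => /= /(_ xst').
  rewrite kfun_kappa// (st0 _ xst)//=; by case/andP: (stab _ xst) => _ /ltW.
have mk D : measurable_fun (D : set R) (fun r => (kappa r)%:E).
  by apply/measurable_EFinP; apply: measurable_funTS; exact: kappa_measurable.
rewrite EFinM -kintE// -integral_itv_bndo_bndc; last exact: mk.
rewrite -integral_itv_obnd_cbnd; last exact: mk.
rewrite -ge0_integralZl//; last 3 first.
- exact: mk.
- by move=> r _; rewrite lee_fin kappa_ge0.
- by rewrite lee_fin powR_ge0.
apply: eq_integral => r /[!inE] /=; rewrite in_itv/= => rst; rewrite /G -!EFinM divfK//.
by rewrite mulf_neq0 ?gt_eqF// exprn_gt0//; exact: st0 rst.
Qed.

Lemma inv_kintE (s t : R) : s < t -> `[s, t]%classic `<=` I ->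
  inv_kint p a b eta Omega s t = (k0 * kint s t)^-1.
Proof.
move=> st stI; rewrite /inv_kint kfun_integral// inver gt_eqF// mulr_gt0 ?kint_gt0//.
by rewrite powR_gt0.
Qed.

Lemma aux_profileE c t : C c -> c.1 < t < c.2 ->
  aux_profile p a b eta Omega t =
    if t <= (3 * c.1 + c.2) / 4 then (k0 * kint t ((c.1 + c.2) / 2))^-1
    else if t < (c.1 + 3 * c.2) / 4 then (k0 * kint ((3 * c.1 + c.2) / 4) ((c.1 + 3 * c.2) / 4))^-1
    else (k0 * kint ((c.1 + c.2) / 2) t)^-1.
Proof.
move=> Cc ct; have [ac lt cb sub] := component_bounds Cc; have /andP[ct1 ct2] := ct.
have seg x y : c.1 < x -> y < c.2 -> `[x, y]%classic `<=` I.
  by move=> cx yc r /=; rewrite in_itv/= => /andP[xr ry]; apply: sub; rewrite /= in_itv/=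
    (lt_le_trans cx xr) (le_lt_trans ry yc).
rewrite /aux_profile asboolT; last by exists c.
have -> : get [set c | C c /\ c.1 < t < c.2] = c.
  have [Cg gt] : [set c | C c /\ c.1 < t < c.2] (get [set c | C c /\ c.1 < t < c.2]).
    by apply: getPex; exists c.
  exact: component_unique Cg Cc gt ct.
case: ifPn => [tq|tq]; first by rewrite inv_kintE//; [lra|apply: seg; lra].
rewrite -ltNge in tq; case: ifPn => [tq3|tq3]; first by rewrite inv_kintE//; [lra|apply: seg; lra].
rewrite -leNgt in tq3; rewrite inv_kintE//; [lra|apply: seg; lra].
Qed.

End weights.

Lemma itv_homo_measurable (R : realType) (D : set R) (f : R -> R) : measurable (D : set R) -> is_interval D ->
  (forall x y, D x -> D y -> x <= y -> f x <= f y) -> measurable_fun (D : set R) f.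
Proof.
move=> mD iD fD.
apply: (measurability (@RGenCInfty.G R)) => [|/= _ [_] [r] -> <-].
  exact: RGenCInfty.measurableE.
apply: is_interval_measurable => s t /= [Ds fs] [Dt ft] x sxt.
have Dx : D x by exact: iD Ds Dt _ sxt.
split => //; move: fs; rewrite !in_itv/= !andbT => fs; apply: le_trans fs _.
by apply: fD => //; case/andP: sxt.
Qed.

(** * The auxiliary weight and the space X *)

Section auxiliary_weight.
Context {R : realType} (d : nat).
Notation leb := (@lebesgue_measure R).
Notation mu := (@rV_lebesgue R d).
Variables (p a b : R) (eta : R -> R) (Omega : set 'rV[R]_d).
Hypotheses (d_gt0 : (0 < d)%N) (p_gt1 : 1 < p) (a_ge0 : 0 <= a) (ab : a < b).
Hypothesis eta_weight : radial_weight a b eta.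
Hypothesis OmegaE : Omega = [set x | enorm x < b] \/ Omega = [set x | a < enorm x < b].
Hypothesis finC : finite_set (components p a b eta).
Notation I := (Ip p a b eta).
Notation C := (components p a b eta).
Notation omega := (@sphere_area R d).
Notation rho := (rho d b eta).
Notation kappa := (kappa d p b eta).
Notation kint := (kint d p b eta).
Notation aux := (aux_profile p a b eta Omega).
Notation k0 := (omega `^ (p / (p - 1))).

Let p0 : 0 < p. Proof. exact: lt_trans p_gt1. Qed.
Let pm1 : 0 < p - 1. Proof. by rewrite subr_gt0. Qed.
Let omega_gt0 : 0 < omega. Proof. exact: sphere_area_gt0. Qed.
Let k0_gt0 : 0 < k0. Proof. exact: powR_gt0. Qed.
Local Notation kgt0 := (kint_gt0 d_gt0 p_gt1 a_ge0 eta_weight).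
Local Notation kle := (kint_le d_gt0 p_gt1 a_ge0 eta_weight).
Local Notation auxE := (aux_profileE d_gt0 p_gt1 a_ge0 eta_weight OmegaE).

Lemma component_segment c x y : C c -> c.1 < x -> y < c.2 -> `[x, y]%classic `<=` I.
Proof.
move=> Cc cx yc r /=; have [_ _ _ sub] := component_bounds Cc.
rewrite in_itv/= => /andP[xr ry]; apply: sub; rewrite /= in_itv/=.
by rewrite (lt_le_trans cx xr) (le_lt_trans ry yc).
Qed.

Let inv_le x y x' y' : x < y -> x' <= x -> y <= y' -> `[x', y']%classic `<=` I ->
  (k0 * kint x' y')^-1 <= (k0 * kint x y)^-1.
Proof.
move=> xy xx yy sub; have sub' : `[x, y]%classic `<=` I.
  by apply: subset_trans sub => r /=; rewrite !in_itv/= => /andP[h1 h2]; rewrite (le_trans xx h1) (le_trans h2 yy).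
rewrite lef_pV2 ?posrE ?mulr_gt0 ?kgt0//; first by rewrite ler_pM2l// kle.
by apply: le_lt_trans xx _; exact: lt_le_trans yy.
Qed.

Lemma aux_gt0 c t : C c -> c.1 < t < c.2 -> 0 < aux t.
Proof.
move=> Cc ct; rewrite (auxE Cc ct); have [_ lt _ _] := component_bounds Cc; have /andP[c1 c2] := ct.
case: ifPn => h1; [|rewrite -ltNge in h1; case: ifPn => h2; [|rewrite -leNgt in h2]];
 by rewrite invr_gt0 mulr_gt0// kgt0//; [lra|apply: (component_segment Cc); lra].
Qed.

(** The integrals in the three cases of the definition run over intervals containing one of three
    fixed nondegenerate segments, hence are bounded below. *)
Lemma aux_le c : C c -> exists2 B, 0 <= B & forall t, c.1 < t < c.2 -> aux t <= B.
Proof.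
move=> Cc; have [_ lt _ _] := component_bounds Cc.
set q1 := (3 * c.1 + c.2) / 4; set q3 := (c.1 + 3 * c.2) / 4; set m := (c.1 + c.2) / 2.
have [q1E q3E mE] : [/\ q1 = (3 * c.1 + c.2) / 4, q3 = (c.1 + 3 * c.2) / 4 & m = (c.1 + c.2) / 2] by [].
have P x y : c.1 < x -> x < y -> y < c.2 -> 0 <= (k0 * kint x y)^-1.
  by move=> h1 h2 h3; rewrite invr_ge0 mulr_ge0 ?(ltW k0_gt0)// ltW// kgt0//; exact: component_segment Cc _ _.
have P1 : 0 <= (k0 * kint q1 m)^-1 by apply: P; lra.
have P2 : 0 <= (k0 * kint q1 q3)^-1 by apply: P; lra.
have P3 : 0 <= (k0 * kint m q3)^-1 by apply: P; lra.
exists ((k0 * kint q1 m)^-1 + (k0 * kint q1 q3)^-1 + (k0 * kint m q3)^-1); first by rewrite !addr_ge0.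
move=> t ct; rewrite (auxE Cc ct) -/q1 -/q3 -/m; have /andP[c1 c2] := ct.
case: ifPn => h1; [|rewrite -ltNge in h1; case: ifPn => h2; [|rewrite -leNgt in h2]].
- apply: (@le_trans _ _ (k0 * kint q1 m)^-1); last by lra.
  by apply: inv_le => //; [lra|apply: (component_segment Cc); lra].
- by lra.
- apply: (@le_trans _ _ (k0 * kint m q3)^-1); last by lra.
  by apply: inv_le => //; [lra|apply: (component_segment Cc); lra].
Qed.

(** The segment is widened until it reaches both quarter points; it then contains the interval of
    integration of each of the three cases. *)
Lemma aux_ge c s t : C c -> c.1 < s -> t < c.2 ->
  exists2 l, 0 < l & forall r, s <= r <= t -> l <= aux r.
Proof.
move=> Cc cs tc; have [_ lt _ _] := component_bounds Cc.
pose s' := Num.min s ((3 * c.1 + c.2) / 4); pose t' := Num.max t ((c.1 + 3 * c.2) / 4).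
have [s1 s2 s3] : [/\ c.1 < s', s' <= s & s' <= (3 * c.1 + c.2) / 4].
  by rewrite /s' lt_min !ge_min !lexx orbT/= cs/=; split => //; lra.
have [t1 t2 t3] : [/\ t' < c.2, t <= t' & (c.1 + 3 * c.2) / 4 <= t'].
  by rewrite /t' gt_max !le_max !lexx orbT/= tc/=; split => //; lra.
have sub : `[s', t']%classic `<=` I by apply: (component_segment Cc).
exists (k0 * kint s' t')^-1; first by rewrite invr_gt0 mulr_gt0// kgt0//; lra.
move=> r /andP[sr rt]; have cr : c.1 < r < c.2 by apply/andP; split; lra.
rewrite (auxE Cc cr).
case: ifPn => h1; [|rewrite -ltNge in h1; case: ifPn => h2; [|rewrite -leNgt in h2]];
  by apply: inv_le => //; lra.
Qed.

(** The weight is the inverse of the integral of kappa that Hoelder's inequality produces, so the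
    two cancel. Only a bound independent of the segment matters; hence the inhomogeneous 1 + E. *)
Lemma kint_hardy (s t X E : R) (f : R -> R) : s < t -> `[s, t]%classic `<=` I ->
  measurable_fun (`[s, t]%classic : set R) f -> 0 <= X -> 0 <= E ->
  (X%:E <= \int[leb]_(r in `[s, t]) `|f r|%:E)%E ->
  (wint leb `[s, t] rho p f <= E%:E)%E ->
  X `^ p * (k0 * kint s t)^-1 `^ (p - 1) <= k0^-1 `^ (p - 1) * (1 + E) `^ p.
Proof.
move=> st stI mf X0 E0 XE fE; have K0 := kgt0 st stI; set K := kint s t in K0 *.
(* The parameter K^(-1/p) balances Young's inequality: both coefficients, K^(-1/p) K and
   (K^(-1/p))^(1-p), equal K^((p-1)/p). *)
have k1 : 0 < K `^ (- p^-1) by exact: powR_gt0.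
have := kappa_young_integral d_gt0 p_gt1 a_ge0 eta_weight stI k1 mf.
rewrite (kintE d_gt0 p_gt1 a_ge0 eta_weight)// -/K => H.
have XK : X <= K `^ ((p - 1) / p) * (1 + E).
  rewrite -lee_fin; apply: (le_trans XE); apply: (le_trans H).
  have -> : (K `^ ((p - 1) / p) * (1 + E))%:E =
      ((K `^ (- p^-1))%:E * K%:E + (K `^ (- p^-1) `^ (1 - p))%:E * E%:E)%E.
    rewrite -!EFinM -EFinD; congr EFin; rewrite mulrDr mulr1; congr (_ + _ * _).
    - rewrite -{3}(powRr1 (ltW K0)) -powRD ?(gt_eqF K0) ?implybT//; congr (_ `^ _); field.
      exact: lt0r_neq0.
    - by rewrite -powRrM; congr (_ `^ _); field; exact: lt0r_neq0.
  by apply: leeD => //; apply: lee_wpmul2l => //; rewrite lee_fin powR_ge0.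
have E1 : 0 <= 1 + E by rewrite addr_ge0.
apply: (@le_trans _ _ ((K `^ ((p - 1) / p) * (1 + E)) `^ p * (k0 * K)^-1 `^ (p - 1))).
  rewrite ler_wpM2r ?powR_ge0//; apply: ge0_ler_powR; rewrite ?nnegrE ?mulr_ge0 ?powR_ge0// ltW//.
rewrite invfM (powRM _ (ltW _)) ?invr_gt0// ?invr_ge0 ?(ltW K0)//.
have -> : (K `^ ((p - 1) / p)) `^ p = K `^ (p - 1) by rewrite -powRrM divfK ?lt0r_neq0.
have -> : (k0^-1 / K) `^ (p - 1) = k0^-1 `^ (p - 1) * K^-1 `^ (p - 1).
  by rewrite powRM// invr_ge0 ltW.
have KK : K `^ (p - 1) * K^-1 `^ (p - 1) = 1.
  by rewrite -powRM ?invr_ge0 ?(ltW K0)// mulfV ?gt_eqF// powR1.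
rewrite (_ : _ * _ * _ = k0^-1 `^ (p - 1) * (1 + E) `^ p * (K `^ (p - 1) * K^-1 `^ (p - 1))); last by ring.
by rewrite KK mulr1.
by rewrite powR_gt0.
Qed.

Lemma measurable_Ip : measurable (I : set R).
Proof. by apply: open_measurable; exact: Ip_open. Qed.

(** The weight is monotone on the two outer quarters of the component and constant in between. *)
Let aux_measurable_component c : C c -> measurable_fun (`]c.1, c.2[%classic : set R) aux.
Proof.
move=> Cc; have [_ lt _ _] := component_bounds Cc.
set q1 := (3 * c.1 + c.2) / 4; set q3 := (c.1 + 3 * c.2) / 4; set m := (c.1 + c.2) / 2.
have [q1E q3E mE] : [/\ q1 = (3 * c.1 + c.2) / 4, q3 = (c.1 + 3 * c.2) / 4 & m = (c.1 + c.2) / 2] by [].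
have -> : `]c.1, c.2[%classic = `]c.1, q1]%classic `|` (`]q1, q3[%classic `|` `[q3, c.2[%classic).
  apply/seteqP; split => x /=; rewrite !in_itv/=.
    by move=> /andP[h1 h2]; have [h|h] := leP x q1; [left; apply/andP|right; have [h'|h'] := ltP x q3; [left|right]; apply/andP].
  by move=> [|[]] /andP[h1 h2]; apply/andP; split; lra.
apply/measurable_funU; [exact: measurable_itv|by apply: measurableU; exact: measurable_itv|].
split; last apply/measurable_funU; [|exact: measurable_itv|exact: measurable_itv|split].
- apply: itv_homo_measurable => [||x y]; [exact: measurable_itv|exact: interval_is_interval|].
  rewrite /= !in_itv/= => /andP[x1 x2] /andP[y1 y2] xy.
  rewrite !(auxE Cc) -/q1 -/m ?x1 ?y1 ?x2 ?y2/=; [|lra|lra].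
  by apply: inv_le => //; [lra|apply: (component_segment Cc); lra].
- apply: (eq_measurable_fun (cst (k0 * kint q1 q3)^-1)); last exact: measurable_cst.
  move=> x /[!inE] /=; rewrite in_itv/= => /andP[x1 x2].
  by rewrite (auxE Cc) -/q1 -/q3 ?x2 ?(lt_geF x1)//; apply/andP; split; lra.
- rewrite (_ : aux = (fun x => - (- aux x))); last by apply/funext => x; rewrite opprK.
  apply: measurable_funN; apply: itv_homo_measurable => [||x y]; [exact: measurable_itv|exact: interval_is_interval|].
  rewrite /= !in_itv/= => /andP[x1 x2] /andP[y1 y2] xy; rewrite lerN2.
  have q13 : q1 < q3 by lra.
  rewrite !(auxE Cc) -/q1 -/q3 -/m ?(lt_geF (lt_le_trans q13 x1)) ?(lt_geF (lt_le_trans q13 y1)) ?(le_gtF x1) ?(le_gtF y1)/=; last 2 first.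
  - by apply/andP; split; lra.
  - by apply/andP; split; lra.
  by apply: inv_le => //; [lra|apply: (component_segment Cc); lra].
Qed.

(* The value 0 at the endpoints of the components, a null set, spares the
   discussion of the one-sided limits. *)
Definition aux_in : R -> R := aux \_ I.

Lemma auxI_measurable : measurable_fun (setT : set R) aux_in.
Proof.
suff H : measurable_fun (I : set R) aux by exact: ((measurable_restrictT _ measurable_Ip).1 H).
move=> mI Y mY.
rewrite (_ : I `&` _ = \bigcup_(c in C) (`]c.1, c.2[%classic `&` aux @^-1` Y)).
  apply: fin_bigcup_measurable => // c Cc; exact: (aux_measurable_component Cc).
apply/seteqP; split => [x [Ix Yx]|x [c Cc [xc Yx]]].
  by have [c Cc cx] := component_of Ix; exists c => //; split => //=; rewrite in_itv.
by split => //; have [_ _ _ sub] := component_bounds Cc; exact: sub.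
Qed.

Lemma auxI_ge0 r : 0 <= aux_in r.
Proof.
rewrite /aux_in patchE; case: ifPn => // /[!inE] Ir.
by have [c Cc cr] := component_of Ir; exact: ltW (aux_gt0 Cc cr).
Qed.

Lemma auxI_bounded : exists2 B, 0 <= B & forall r, aux_in r <= B.
Proof.
have /choice[B HB] : forall c, exists B, C c -> 0 <= B /\ forall t, c.1 < t < c.2 -> aux t <= B.
  move=> c; have [Cc|nC] := pselect (C c); last by exists 0 => /nC.
  by have [B B0 HB] := aux_le Cc; exists B.
have [cs csE] := (finite_seqP C).1 finC.
exists (\big[Num.max/0]_(c <- cs) B c); first exact: bigmax_ge_id.
move=> r; rewrite /aux_in patchE; case: ifPn => [/[!inE] Ir|_]; last exact: bigmax_ge_id.
have [c Cc cr] := component_of Ir; apply: le_trans ((HB c Cc).2 r cr) _.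
by apply: le_bigmax_seq => //; move: Cc; rewrite csE.
Qed.

Definition X_weight (x : 'rV[R]_d) : R := aux_in (enorm x) `^ (p - 1).

(** The weight of X seen from the line: it includes the Jacobian omega r^(d-1), so that radial
    functions are measured by an integral over I. *)
Definition X_weight1 (r : R) : R := aux_in r `^ (p - 1) * (omega * `|r| ^+ d.-1).

Lemma wX_ge0 x : 0 <= X_weight x. Proof. exact: powR_ge0. Qed.

Lemma wR_ge0 r : 0 <= X_weight1 r.
Proof. by rewrite mulr_ge0 ?powR_ge0// mulr_ge0 ?(ltW omega_gt0) ?exprn_ge0. Qed.

Lemma wX_measurable : measurable_fun setT X_weight.
Proof.
apply: (measurableT_comp (@measurable_powR R _)).
exact: (measurableT_comp auxI_measurable (@measurable_enorm R d)).
Qed.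

Lemma wR_measurable : measurable_fun (setT : set R) X_weight1.
Proof.
apply: measurable_funM.
  exact: (measurableT_comp (@measurable_powR R _) auxI_measurable).
apply: measurable_funM; first exact: measurable_cst.
have h : measurable_fun (setT : set R) (fun r : R => r ^+ d.-1).
  exact: (continuous_measurable_fun (@exprn_continuous R d.-1)).
exact: (measurableT_comp h).
Qed.

Lemma aux_profile_auxI : exists N : set R, [/\ measurable N, leb N = 0 &
  forall r, ~ N r -> aux r = aux_in r].
Proof.
pose EP := [set c.1 | c in C] `|` [set c.2 | c in C].
have fEP : finite_set EP by rewrite finite_setU; split; exact: finite_image.
exists EP; split.
- exact: countable_measurable (finite_set_countable fEP).
- exact: countable_lebesgue_measure0 (finite_set_countable fEP).
move=> r nE; rewrite /aux_in patchE; case: ifPn => // /negP; rewrite inE => nI.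
rewrite /aux_profile asboolF; last first.
  move=> [c Cc cr]; apply: nI; have [_ _ _ sub] := component_bounds Cc.
  by apply: sub; rewrite /= in_itv.
rewrite asboolF; last by move=> [s Cs]; apply: nE; left; exists (r, s).
by rewrite asboolF//; move=> [s Cs]; apply: nE; right; exists (s, r).
Qed.

Lemma XintE u : Xint p a b eta Omega u = wint mu Omega X_weight p u.
Proof.
have [N [mN N0 NE]] := aux_profile_auxI; have [mN' N'0] := enorm_null d_gt0 mN N0.
rewrite wintE; apply: (@integral_eq_null _ _ _ mu _ _ _ _ mN' N'0).
- by move=> x _; rewrite lee_fin mulr_ge0 ?powR_ge0.
- by move=> x _ Nx; rewrite /aux_weight NE.
Qed.

Let Ir0 r : I r -> 0 < r.
Proof. by move=> /Ip_sub /=; rewrite in_itv/= => /andP[ar _]; exact: le_lt_trans ar. Qed.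

Lemma Xint_radial (u : 'rV[R]_d -> R) (v : R -> R) : measurable_fun I v ->
  (forall x, I (enorm x) -> u x = v (enorm x)) ->
  Xint p a b eta Omega u = wint leb I X_weight1 p v.
Proof.
move=> mv uv; rewrite XintE !wintE.
transitivity (\int[mu]_(x in @enorm R d @^-1` I) (`|v (enorm x)| `^ p * X_weight x)%:E)%E.
  rewrite integral_mkcond [RHS]integral_mkcond; apply: eq_integral => x _; rewrite !patchE.
  have [/set_mem Ix|nIx] := boolP (x \in @enorm R d @^-1` I).
    rewrite uv//; have /= := Ip_sub Ix; rewrite in_itv/= => /(Omega_annulus OmegaE) Ox.
    by rewrite mem_set.
  rewrite /X_weight /aux_in patchE; have -> : (enorm x \in I) = (x \in @enorm R d @^-1` I).
    by apply/idP/idP; rewrite !inE.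
  by rewrite (negbTE nIx) powR0 ?gt_eqF// mulr0; case: ifP.
rewrite (@integral_shell R d d_gt0 I (fun r => (`|v r| `^ p * aux_in r `^ (p - 1))%:E) _ set0)//.
- apply: eq_integral => r /[!inE] /Ir0 r0.
  by rewrite -EFinM /X_weight1 (gtr0_norm r0) mulrA.
- exact: measurable_Ip.
- by move=> r /Ir0/ltW r0; rewrite /= in_itv/= r0.
- apply/measurable_EFinP/measurable_funM.
    by apply: (measurableT_comp (@measurable_powR R _)); exact: measurableT_comp.
  apply: measurable_funTS; exact: (measurableT_comp (@measurable_powR R _) auxI_measurable).
- by move=> r _; rewrite lee_fin mulr_ge0 ?powR_ge0.
Qed.

Lemma wR_ge s t : `[s, t]%classic `<=` I -> exists2 l, 0 < l & forall r, s <= r <= t -> l <= X_weight1 r.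
Proof.
move=> stI; have [st|ts] := leP s t; last first.
  by exists 1 => // r /andP[sr rt]; have := lt_le_trans ts (le_trans sr rt); rewrite ltxx.
have Is : I s by apply: stI; rewrite /= in_itv/= lexx.
have [c Cc /andP[c1 c2]] := component_of Is; have [_ _ _ sub] := component_bounds Cc.
have tc : t < c.2.
  rewrite ltNge; apply/negP => ct; have [_] := component_endpoint Cc; apply.
  by apply: stI; rewrite /= in_itv/= ct ltW.
have [l l0 Hl] := aux_ge Cc c1 tc.
exists (l `^ (p - 1) * (omega * `|s| ^+ d.-1)).
  by rewrite mulr_gt0 ?powR_gt0// mulr_gt0// exprn_gt0// normr_gt0 gt_eqF// Ir0.
move=> r rst; have Ir : I r by apply: stI; rewrite /= in_itv.
have s0 := Ir0 Is; have /andP[sr _] := rst; have r0 := Ir0 Ir.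
rewrite /X_weight1 /aux_in patchE mem_set//; apply: ler_pM.
- exact: powR_ge0.
- by rewrite mulr_ge0 ?exprn_ge0// ltW.
- by apply: ge0_ler_powR; rewrite ?nnegrE ?(ltW pm1) ?(ltW l0)//; [exact: le_trans (ltW l0) (Hl _ rst)|exact: Hl].
- by rewrite ler_wpM2l ?(ltW omega_gt0)// lerXn2r ?nnegrE// !gtr0_norm.
Qed.

(** A compact subset of I may meet several components and is not an interval; a finite cover by
    segments inside I reduces estimates to segments, with overlaps only enlarging the sum. *)
Lemma compact_integral_le (K : set R) : compact K -> K `<=` I ->
  exists2 D : seq (R * R), (forall c, c \in D -> `[c.1, c.2]%classic `<=` I) &
    forall g : R -> R, measurable_fun I g ->
     (\int[leb]_(r in K) `|g r|%:E <= \sum_(c <- D) \int[leb]_(r in `[c.1, c.2]) `|g r|%:E)%E.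
Proof.
move=> cK KI.
have /choice[e He] : forall y, exists e, I y -> 0 < e /\ `[y - e, y + e]%classic `<=` I.
  move=> y; have [Iy|nI] := pselect (I y); last by exists 0 => /nI.
  have : nbhs y I by apply: open_nbhs_nbhs; split => //; exact: Ip_open.
  rewrite -nbhs_ballE => -[e /= e0 eI]; exists (e / 2) => _; split; first by rewrite divr_gt0.
  move=> x /=; rewrite in_itv/= => /andP[x1 x2]; apply: eI; rewrite /ball/= ltr_norml.
  by apply/andP; split; lra.
have mK : measurable (K : set R) by apply: closed_measurable; apply: compact_closed => //; exact: Rhausdorff.
move: (cK); rewrite compact_cover => /(_ R K (fun y => `]y - e y, y + e y[%classic)).
case => [y _|y Ky|D' D'K cov]; first exact: itv_open.
  exists y => //=; rewrite in_itv/=; have [e0 _] := He _ (KI _ Ky).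
  by apply/andP; split; lra.
exists [seq (y - e y, y + e y) | y <- finmap.enum_fset D'].
  move=> c /mapP[y yD ->] /=; apply: (He _ _).2; apply: KI.
  by have := D'K _ yD; rewrite inE.
move=> g mg; rewrite big_map.
have mgi y : y \in finmap.enum_fset D' -> measurable_fun (`[y - e y, y + e y]%classic : set R) (fun r => `|g r|%:E).
  move=> yD; apply/measurable_EFinP; apply: measurableT_comp => //.
  apply: measurable_funS mg; first exact: measurable_Ip.
  by apply: (He _ _).2; apply: KI; have := D'K _ yD; rewrite inE.
have mgK : measurable_fun (K : set R) (fun r => `|g r|%:E).
  apply/measurable_EFinP; apply: measurableT_comp => //.
  by apply: measurable_funS mg => //; exact: measurable_Ip.
have cov' : K `<=` [set r | exists2 y, y \in finmap.enum_fset D' & r \in `[y - e y, y + e y]].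
  move=> r /cov[y yD /=]; rewrite in_itv/= => /andP[h1 h2]; exists y => //.
  by rewrite in_itv/= !ltW.
move: (finmap.enum_fset D') mgi cov' => s {D' D'K cov}.
elim: s K mK mgK {cK KI} => [|y s IH] K mK mgK mgi cov.
  rewrite big_nil (_ : K = set0) ?integral_set0//.
  by apply/seteqP; split => // r /cov[y].
rewrite big_cons.
have mI : measurable (`[y - e y, y + e y]%classic : set R) by exact: measurable_itv.
have mKI : measurable (K `&` `[y - e y, y + e y]%classic : set R) by exact: measurableI.
have mKD : measurable (K `\` `[y - e y, y + e y]%classic : set R) by exact: measurableD.
apply: (@le_trans _ _ (\int[leb]_(r in K `&` `[(y - e y)%R, (y + e y)%R]) `|g r|%:E +
   \int[leb]_(r in K `\` `[(y - e y)%R, (y + e y)%R]) `|g r|%:E)%E).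
  rewrite -ge0_integral_setU//=; first by rewrite setUIDK.
  - by rewrite setUIDK.
  - by apply/disj_setPS => r [[_ h] [_]].
apply: leeD.
  apply: ge0_subset_integral => //.
  by apply: mgi; rewrite inE eqxx.
apply: IH => //.
- by apply: measurable_funS mgK => //; exact: subDsetl.
- by move=> z zs; apply: mgi; rewrite inE zs orbT.
- move=> r [Kr nr]; have [z] := cov r Kr; rewrite inE => /predU1P[->|zs] rz; last by exists z.
  by exfalso; apply: nr.
Qed.

End auxiliary_weight.

(** * Energies of profiles and cheap transitions *)

Section energies.
Context {R : realType} (d : nat).
Notation leb := (@lebesgue_measure R).
Notation mu := (@rV_lebesgue R d).
Variables (p a b : R) (eta : R -> R) (Omega : set 'rV[R]_d).
Hypotheses (d_gt0 : (0 < d)%N) (p_gt1 : 1 < p) (a_ge0 : 0 <= a) (ab : a < b).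
Hypothesis eta_weight : radial_weight a b eta.
Hypothesis OmegaE : Omega = [set x | enorm x < b] \/ Omega = [set x | a < enorm x < b].
Notation I := (Ip p a b eta).
Notation C := (components p a b eta).
Notation omega := (@sphere_area R d).
Notation rho := (rho d b eta).
Notation etap := (etap b eta).

Let p0 : 0 < p. Proof. exact: lt_trans p_gt1. Qed.
Let pm1 : 0 < p - 1. Proof. by rewrite subr_gt0. Qed.
Let omega_gt0 : 0 < omega. Proof. exact: sphere_area_gt0. Qed.

(** Each such r has a neighbourhood where [eta] vanishes almost everywhere, and this neighbourhood
    contains a rational interval around r. The rational intervals are enumerated by [unpickle], so
    one null set suffices. *)
Lemma eta_eq0_ae : {ae leb, forall r, 0 <= r < a -> eta r = 0}.
Proof.
have [_ _ supp] := eta_weight.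
pose good (q : rat * rat) := {ae leb, forall s, 0 <= s -> ratr q.1 < s < ratr q.2 -> eta s = 0}.
pose P n s := if @unpickle (rat * rat)%type n is Some q then
  good q -> 0 <= s -> ratr q.1 < s < ratr q.2 -> eta s = 0 else True.
have HP n : {ae leb, forall s, P n s}.
  rewrite /P; case: (unpickle n) => [q|]; last by apply: aeW.
  have [gq|ngq] := pselect (good q); last by apply: aeW => s /ngq.
  by apply: lebesgue_aeS gq => s Hs _.
apply: lebesgue_aeS (lebesgue_ae_foralln HP) => r Pr /andP[r0 ra].
have : ~ ess_support eta r by rewrite supp /= in_itv/= leNgt ra.
move=> nsupp; have [e e0 He] : exists2 e, 0 < e & {ae leb, forall s, 0 <= s -> `|s - r| < e -> eta s = 0}.
  by apply: contrapT => H; apply: nsupp.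
have rl : r - e < r by rewrite ltrBlDr ltrDl.
have rr : r < r + e by rewrite ltrDl.
have [q1] := rat_in_itvoo rl; have [q2] := rat_in_itvoo rr.
rewrite !in_itv/= => /andP[q2a q2b] /andP[q1a q1b].
have := Pr (pickle (q1, q2)); rewrite /P pickleK; apply => //=; last by rewrite q1b.
apply: lebesgue_aeS He => s Hs s0 /andP[/= s1 s2]; apply: Hs => //.
by rewrite ltr_norml; apply/andP; split; lra.
Qed.

Lemma energy_radial (v f : R -> R) : measurable_fun (setT : set R) f ->
  {ae leb, forall r, a < r < b -> f r = derive1 v r} ->
  energy p eta Omega v = wint leb `]a, b[ rho p f.
Proof.
move=> mf fv.
have [N [mN N0 sub]] : {ae leb, forall r, ((a < r < b -> f r = derive1 v r) /\ r != a) /\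
    ((0 <= r < a -> eta r = 0) /\ (0 <= r <= b -> etap r = eta r))}.
  apply: lebesgue_aeI; apply: lebesgue_aeI => //; [|exact: eta_eq0_ae|exact: etap_ae eta_weight].
  exists [set a]; split; [exact: measurable_set1|exact: lebesgue_measure_set1|].
  by move=> r /= /negP; rewrite negbK => /eqP.
pose h r : \bar R := (`|(f \_ `]a, b[) r| `^ p * etap r)%:E.
have mh : measurable_fun (setT : set R) h.
  apply/measurable_EFinP; apply: measurable_funM; last exact: etap_measurable eta_weight.
  apply: (measurableT_comp (@measurable_powR R _)); apply: measurableT_comp => //.
  by apply: ((measurable_restrictT _ _).1); [exact: measurable_itv|exact: measurable_funTS].
have h0 r : (0 <= h r)%E by rewrite lee_fin mulr_ge0 ?powR_ge0// etap_ge0.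
(* J is the set of radii of Omega. For the ball it includes [[0, a]], on which [eta] vanishes almost
   everywhere; the radius a itself belongs to the null set N. *)
have [J [mJ OJ abJ Jb]] : exists J : set R, [/\ measurable J, Omega = @enorm R d @^-1` J,
    `]a, b[%classic `<=` J & forall r, J r -> 0 <= r < b].
  case: OmegaE => ->.
  - exists `[0, b[%classic; split.
    + exact: measurable_itv.
    + by apply/seteqP; split => x /=; rewrite in_itv/= enorm_ge0.
    + by move=> r /=; rewrite !in_itv/= => /andP[ar ->]; rewrite (ltW (le_lt_trans a_ge0 ar)).
    + by move=> r /=; rewrite in_itv.
  - exists `]a, b[%classic; split => //.
    by move=> r /=; rewrite in_itv/= => /andP[ar ->]; rewrite (ltW (le_lt_trans a_ge0 ar)).
rewrite /energy OJ (@integral_shell R d d_gt0 J h _ N)//; last 3 first.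
- by move=> r /Jb/andP[r0 _]; rewrite /= in_itv/= r0.
- exact: measurable_funTS.
- move=> x /Jb; set r := enorm x => /andP[r0 rb] Nr.
  have [[H1 H2] [H3 H4]] : ((a < r < b -> f r = derive1 v r) /\ r != a) /\
     ((0 <= r < a -> eta r = 0) /\ (0 <= r <= b -> etap r = eta r)).
    by apply: contrapT => H; apply: Nr; apply: sub.
  rewrite /weight /h -/r patchE H4 ?r0 ?(ltW rb)//.
  have [ra|ar] := ltP r a; first by rewrite H3 ?r0// !mulr0.
  have arb : a < r < b by rewrite lt_def H2 ar.
  by rewrite mem_set/= ?in_itv//= H1.
rewrite wintE [LHS]integral_mkcond [RHS]integral_mkcond.
apply: eq_integral => r _.
rewrite !patchE /h patchE; have [/set_mem rI|rI] := boolP (r \in `]a, b[%classic).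
  rewrite mem_set; last exact: abJ.
  have r0 : 0 <= r by have /andP[] := Jb _ (abJ _ rI).
  by rewrite /rho (ger0_norm r0) -EFinM; congr EFin; ring.
by case: ifPn => // _; rewrite normr0 powR0 ?gt_eqF// mul0r mul0e.
Qed.

Lemma wint_rho_Dom (dv : R -> R) : measurable_fun I dv ->
  wint leb I rho p dv = (omega%:E * \int[leb]_(r in I) (r ^+ d.-1 * `|dv r| `^ p * eta r)%:E)%E.
Proof.
move=> mdv; have mI := @measurable_Ip R p a b eta.
have [N [mN N0 sub]] := etap_ae eta_weight.
have Ir r : I r -> 0 <= r <= b.
  by move=> /Ip_sub /=; rewrite in_itv/= => /andP[ar /ltW ->]; rewrite (le_trans a_ge0 (ltW ar)).
rewrite (@integral_eq_null _ _ _ leb _ _ (fun r => (r ^+ d.-1 * `|dv r| `^ p * etap r)%:E) N)//; last 2 first.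
- by move=> r /Ir/andP[r0 _]; rewrite lee_fin !mulr_ge0 ?exprn_ge0 ?powR_ge0 ?etap_ge0.
- move=> r rI Nr; congr (_ * _)%:E; apply/esym; apply: contrapT => H; apply: Nr; apply: sub.
  by move=> /(_ (Ir _ rI)).
rewrite wintE -ge0_integralZl//; last 3 first.
- apply/measurable_EFinP; apply: measurable_funM; last by apply: measurable_funTS; exact: etap_measurable eta_weight.
  apply: measurable_funM.
    apply: measurable_funTS; exact: (continuous_measurable_fun (@exprn_continuous R d.-1)).
  by apply: (measurableT_comp (@measurable_powR R _)); exact: measurableT_comp.
- by move=> r /Ir/andP[r0 _]; rewrite lee_fin !mulr_ge0 ?exprn_ge0 ?powR_ge0 ?etap_ge0.
- by rewrite lee_fin ltW.
apply: eq_integral => r /[!inE] /Ir/andP[r0 _].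
by rewrite -EFinM /rho (ger0_norm r0); congr EFin; ring.
Qed.

(** The truncation of [inv_weight] at height n + 1, written as the inverse of a maximum so that it
    takes the value n + 1 where [eta] is 0. It increases to [inv_weight] with n. *)
Let kap (n : nat) (r : R) : R := (Num.max (eta r `^ (p - 1)^-1) n.+1%:R^-1)^-1.

Let mx0 n r : 0 < Num.max (eta r `^ (p - 1)^-1) n.+1%:R^-1.
Proof. by rewrite lt_max invr_gt0 ltr0n orbT. Qed.

Let kap_gt0 n r : 0 < kap n r. Proof. by rewrite invr_gt0. Qed.

Let kap_le n r : kap n r <= n.+1%:R.
Proof. by rewrite -[leRHS]invrK lef_pV2 ?posrE ?invr_gt0 ?ltr0n// le_max lexx orbT. Qed.

Let kap_homo r n m : (n <= m)%N -> kap n r <= kap m r.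
Proof.
move=> nm; rewrite lef_pV2 ?posrE// ge_max le_max lexx/= le_max.
by rewrite lef_pV2 ?posrE ?ltr0n// ler_nat ltnS nm orbT.
Qed.

Let kap_cvg r : (kap n r)%:E @[n --> \oo] --> inv_weight p eta r.
Proof.
rewrite /inv_weight inver; have [h0|h0] := eqVneq (eta r `^ (p - 1)^-1) 0.
  rewrite (_ : (fun n => (kap n r)%:E) = (fun n => (n.+1%:R)%:E)); last first.
    apply/funext => n; rewrite /kap h0; congr EFin.
    by rewrite (max_idPr _) ?invrK// invr_ge0 ler0n.
  apply/cvgeryP/cvgryPge => A; near=> n.
  by apply: le_trans (_ : n%:R <= _); [near: n; exact: nbhs_infty_ger|rewrite ler_nat].
have hp : 0 < eta r `^ (p - 1)^-1 by rewrite lt_def h0 powR_ge0.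
apply: cvg_near_cst; near=> n; congr EFin; rewrite /kap (max_idPl _)//.
rewrite -[leRHS]invrK lef_pV2 ?posrE ?ltr0n ?invr_gt0//.
apply: (@le_trans _ _ n%:R); [near: n; exact: nbhs_infty_ger|by rewrite ler_nat].
Unshelve. all: by end_near. Qed.

(** Since kap^(p-1) eta <= 1, the energy of kap is bounded by its integral M. After division by M
    the energy is of order M^(1-p), which is small when M is large. *)
Let kap_energy n r : 0 <= r <= b -> etap r = eta r ->
  `|kap n r| `^ p * rho r <= (omega * b ^+ d.-1) * kap n r.
Proof.
move=> /andP[r0 rb] ee; have k0 := kap_gt0 n r; have e0 : 0 <= eta r by rewrite -ee etap_ge0.
rewrite gtr0_norm// /rho ee (ger0_norm r0).
have -> : kap n r `^ p = kap n r * kap n r `^ (p - 1).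
  by rewrite -{2}(powRr1 (ltW k0)) -powRD ?(gt_eqF k0) ?implybT//; congr (_ `^ _); ring.
rewrite (_ : _ * _ = (omega * r ^+ d.-1) * kap n r * (kap n r `^ (p - 1) * eta r)); last by ring.
apply: (@le_trans _ _ ((omega * r ^+ d.-1) * kap n r)).
  apply: ler_piMr; first by rewrite mulr_ge0 ?(ltW k0)// mulr_ge0 ?exprn_ge0// ltW.
  have -> : eta r = (eta r `^ (p - 1)^-1) `^ (p - 1) by rewrite -powRrM mulVf ?gt_eqF// powRr1.
  rewrite -powRM ?powR_ge0 ?(ltW k0)//.
  apply: (@le_trans _ _ (1 `^ (p - 1))); last by rewrite powR1.
  apply: ge0_ler_powR; rewrite ?nnegrE ?mulr_ge0 ?powR_ge0 ?(ltW k0) ?(ltW pm1)//.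
  by rewrite /kap mulrC ler_pdivrMr// mul1r le_max lexx.
rewrite ler_wpM2r ?(ltW k0)// ler_wpM2l ?(ltW omega_gt0)// lerXn2r ?nnegrE//.
exact: le_trans rb.
Qed.

(* A jump at a point around which the inverse weight is not integrable costs
   arbitrarily little energy. *)
Lemma transition s delta e : a <= s <= b -> ~ I s -> 0 < delta -> 0 < e ->
  exists theta : R -> R, [/\ leb.-integrable setT (EFin \o theta),
    forall r, 0 <= theta r, forall r, ~ (s - delta < r < s + delta) -> theta r = 0,
    \int[leb]_r theta r = 1 & (wint leb `]a, b[ rho p theta <= e%:E)%E].
Proof.
move=> /andP[as_ sb] nIs d0 e0.
(* At s = a or s = b the jump is placed outside []a, b[], where energy is not counted. *)
have outside (x y : R) : x < y -> s - delta <= x -> y <= s + delta ->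
    (forall r, a < r < b -> ~ (x < r < y)) -> exists theta : R -> R,
    [/\ leb.-integrable setT (EFin \o theta),
    forall r, 0 <= theta r, forall r, ~ (s - delta < r < s + delta) -> theta r = 0,
    \int[leb]_r theta r = 1 & (wint leb `]a, b[ rho p theta <= e%:E)%E].
  move=> xy sx ys out; have yx : 0 < y - x by rewrite subr_gt0.
  have mJ : measurable (`]x, y[%classic : set (measurableTypeR R)) by exact: measurable_itv.
  have ic : leb.-integrable `]x, y[ (EFin \o cst (y - x)^-1).
    apply: (@measurable_bounded_integrable _ (measurableTypeR R) R leb _ _ mJ) => //.
    - suff : (leb (`]x, y[%classic : set R) < +oo)%E by [].
      by rewrite lebesgue_measure_itv/= lte_fin xy -EFinB ltry.
    - exists (y - x)^-1; split; first exact: num_real.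
      by move=> z lz r _ /=; rewrite ger0_norm ?invr_ge0 ?(ltW yx)// ltW.
  have E r : ((cst (y - x)^-1) \_ `]x, y[) r = if x < r < y then (y - x)^-1 else 0 :> R.
    by rewrite patchE; congr (if _ then _ else _); apply/idP/idP; rewrite inE/= in_itv.
  exists (cst (y - x)^-1 \_ `]x, y[); split.
  - have := (integrable_mkcond (EFin \o cst (y - x)^-1) mJ).1 ic.
    by rewrite restrict_EFin.
  - by move=> r; rewrite E; case: ifP => // _; rewrite invr_ge0 ltW.
  - move=> r nr; rewrite E; case: ifPn => // /andP[xr ry]; exfalso; apply: nr.
    by rewrite (le_lt_trans sx xr) (lt_le_trans ry ys).
  - rewrite -Rintegral_mkcond Rintegral_cst//.
    have L : leb (`]x, y[%classic : set R) = (y - x)%:E.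
      by rewrite lebesgue_measure_itv/= lte_fin xy -EFinB.
    by rewrite [X in fine X]L/= mulVf ?gt_eqF.
  - rewrite wintE integral0_eq ?lee_fin ?(ltW e0)// => r /=; rewrite in_itv/= => /out nr.
    rewrite E; case: ifPn => // _; by rewrite normr0 powR0 ?gt_eqF// mul0r.
have [sa|sa] := leP s a.
  have sE : s = a by apply/eqP; rewrite eq_le sa.
  apply: (outside (s - delta) s); rewrite ?lerDl ?gtrBl ?(ltW d0)//.
  by move=> r /andP[ar _] /andP[_ rs]; have := lt_trans ar rs; rewrite sE ltxx.
have [bs|bs] := leP b s.
  apply: (outside s (s + delta)); rewrite ?ltrDl ?gerBl ?(ltW d0)//.
  by move=> r /andP[_ rb] /andP[sr _]; have := lt_le_trans (lt_trans sr rb) bs; rewrite ltxx.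
pose delta' := Num.min delta (Num.min (s - a) (b - s)).
have [dd ds db d'0] : [/\ delta' <= delta, delta' <= s - a, delta' <= b - s & 0 < delta'].
  by rewrite /delta' !ge_min !lt_min !lexx !orbT !subr_gt0 sa bs d0.
pose J := (`]s - delta', s + delta'[%classic : set (measurableTypeR R)).
have Jin r : J r -> a < r < b.
  by rewrite /J /= in_itv/= => /andP[h1 h2]; apply/andP; split; lra.
have mJ : measurable J by exact: measurable_itv.
have meta : measurable_fun J eta.
  apply: measurable_funS (eta_measurable eta_weight); first exact: measurable_itv.
  move=> r /Jin/andP[h1 h2]; rewrite /= in_itv/= (ltW h2) andbT.
  exact: le_trans a_ge0 (ltW h1).
have mkap n : measurable_fun J (kap n).
  apply: (measurableT_comp (@measurable_invr R)); apply: measurable_maxr => //.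
  by apply: (measurableT_comp (@measurable_powR R _)).
have mekap n : measurable_fun J (fun r => (kap n r)%:E) by exact/measurable_EFinP.
have miw : measurable_fun J (inv_weight p eta).
  by apply: (emeasurable_fun_cvg (fun n r => (kap n r)%:E)) => //.
have Joo := not_Ip_integral (introT andP (conj sa bs)) nIs d'0 miw.
have ikap n : leb.-integrable J (EFin \o kap n).
  apply: (@measurable_bounded_integrable _ (measurableTypeR R) R leb _ _ mJ) => //.
  - suff : (leb (`](s - delta')%R, (s + delta')%R[%classic : set R) < +oo)%E by [].
    by rewrite lebesgue_measure_itv/= lte_fin; case: ifP => _; rewrite -?EFinB ltry.
  - exists n.+1%:R; split; first exact: num_real.
    by move=> z lz r _ /=; rewrite gtr0_norm// (le_trans (kap_le n r))// ltW.
pose M n := \int[leb]_(r in J) kap n r.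
have ME n : (\int[leb]_(r in J) (kap n r)%:E = (M n)%:E)%E.
  by rewrite /M /Rintegral fineK//; exact: (integrable_fin_num mJ (ikap n)).
(* By monotone convergence bounded integrals would make the inverse weight integrable around s,
   which then would belong to I. *)
have big A : exists n, A <= M n.
  apply: contrapT => H.
  have H' n : (M n <= A) by rewrite leNgt; apply/negP => AM; apply: H; exists n; exact: ltW.
  have : (\int[leb]_(r in J) inv_weight p eta r <= A%:E)%E.
    have -> : (\int[leb]_(r in J) inv_weight p eta r)%E = (\int[leb]_(r in J) (limn (fun n => (kap n r)%:E)))%E.
      by apply: eq_integral => r _; apply/esym/cvg_lim => //; exact: kap_cvg.
    rewrite monotone_convergence//.
    - apply: lime_le; last by apply: nearW => n; rewrite ME lee_fin.
      apply: ereal_nondecreasing_is_cvgn => n m nm; rewrite !ME lee_fin.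
      apply: le_Rintegral => // r _; exact: kap_homo.
    - by move=> n r _; rewrite lee_fin ltW.
    - by move=> r _ n m nm; rewrite lee_fin kap_homo.
  by rewrite /J Joo leye_eq.
pose B := omega * b ^+ d.-1.
have B0 : 0 <= B by rewrite mulr_ge0 ?(ltW omega_gt0)// exprn_ge0// (le_trans a_ge0)// ltW.
(* With this threshold B (M n)^(1-p) <= e; the summand 1 only ensures M n > 0. *)
have [n Mn] := big (1 + (B / e) `^ (p - 1)^-1).
have M0 : 0 < M n by apply: lt_le_trans Mn; rewrite ltr_pwDl ?powR_ge0.
have E r : (kap n \_ J) r = if r \in J then kap n r else 0 by rewrite patchE.
have iT : leb.-integrable setT (EFin \o (kap n \_ J)).
  suff : (@integrable _ (measurableTypeR R) R leb setT ((EFin \o kap n) \_ J)) by rewrite restrict_EFin.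
  by apply/(@integrable_mkcond _ (measurableTypeR R) R leb J (EFin \o kap n) mJ); exact: ikap.
exists (fun r => (M n)^-1 * (kap n \_ J) r); split.
- by apply: lebesgue_integrableZl => //.
- by move=> r; rewrite mulr_ge0 ?invr_ge0 ?(ltW M0)// E; case: ifP => _ //; exact: ltW.
- move=> r nr; rewrite E; case: ifPn => [|_]; last by rewrite mulr0.
  rewrite inE /J /= in_itv/= => /andP[h1 h2]; exfalso; apply: nr; apply/andP; split; lra.
- rewrite (@RintegralZl _ (measurableTypeR R) R leb)// -Rintegral_mkcond -/(M n).
  by rewrite mulVf ?gt_eqF.
have mkT : measurable_fun (setT : set R) (kap n \_ J).
  by apply/measurable_EFinP; exact: measurable_int iT.
have kge r : 0 <= (kap n \_ J) r by rewrite E; case: ifP => _ //; exact: ltW.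
apply: (@le_trans _ _ (\int[leb]_(r in `]a, b[) (((M n)^-1 `^ p * B) * (kap n \_ J) r)%:E)%E).
  rewrite wintE; apply: ae_ge0_le_integral => //.
  - by move=> r _; rewrite lee_fin mulr_ge0 ?powR_ge0// rho_ge0.
  - apply/measurable_EFinP; apply: measurable_funM; last by apply: measurable_funTS; exact: rho_measurable eta_weight.
    apply: (measurableT_comp (@measurable_powR R _)); apply: measurableT_comp => //.
    by apply: measurable_funM => //; exact: measurable_funTS.
  - by move=> r _; rewrite lee_fin mulr_ge0// mulr_ge0 ?powR_ge0.
  - by apply/measurable_EFinP; apply: measurable_funM => //; exact: measurable_funTS.
  apply: lebesgue_aeS (etap_ae eta_weight) => r Hr /=; rewrite in_itv/= => /andP[ar rb].
  have rb' : 0 <= r <= b by rewrite (ltW rb) (le_trans a_ge0 (ltW ar)).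
  rewrite lee_fin normrM powRM// (ger0_norm (ltW _)) ?invr_gt0//.
  rewrite -mulrA -[leRHS]mulrA; apply: ler_wpM2l; first exact: powR_ge0.
  rewrite E; case: ifP => _; last by rewrite normr0 powR0 ?gt_eqF// !(mul0r,mulr0).
  by apply: kap_energy => //; exact: Hr.
under eq_integral do rewrite EFinM.
have c0 : 0 <= (M n)^-1 `^ p * B by rewrite mulr_ge0 ?powR_ge0.
rewrite ge0_integralZl//; last 2 first.
- by apply/measurable_EFinP; exact: measurable_funTS.
- by move=> r _; rewrite lee_fin.
have -> : (\int[leb]_(r in `]a, b[) ((kap n \_ J) r)%:E = (M n)%:E)%E.
  rewrite -ME integral_mkcond [RHS]integral_mkcond; apply: eq_integral => r _.
  rewrite !patchE; have [/set_mem Jr|_] := boolP (r \in J); last by case: ifP.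
  by rewrite mem_set//= in_itv/=; exact: Jin.
rewrite -EFinM lee_fin.
have -> : (M n)^-1 `^ p * B * M n = B * (M n `^ (p - 1))^-1.
  rewrite -!powRN -(powR_inv1 (ltW M0)) -powRrM -[X in _ * X = _](powRr1 (ltW M0)).
  rewrite mulrAC -powRD ?(gt_eqF M0) ?implybT// mulrC; congr (_ * _ `^ _); ring.
rewrite ler_pdivrMr ?powR_gt0// mulrC -ler_pdivrMr//.
have -> : B / e = ((B / e) `^ (p - 1)^-1) `^ (p - 1).
  by rewrite -powRrM mulVf ?gt_eqF// powRr1// divr_ge0// ltW.
apply: ge0_ler_powR; rewrite ?nnegrE ?powR_ge0 ?(ltW pm1) ?(ltW M0)//.
by apply: le_trans Mn; rewrite lerDr.
Qed.

End energies.

(** * Recovery sequences *)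

Section recovery.
Context {R : realType} (d : nat).
Notation leb := (@lebesgue_measure R).
Notation mu := (@rV_lebesgue R d).
Variables (p a b : R) (eta : R -> R) (Omega : set 'rV[R]_d).
Hypotheses (d_gt0 : (0 < d)%N) (p_gt1 : 1 < p) (a_ge0 : 0 <= a) (ab : a < b).
Hypothesis eta_weight : radial_weight a b eta.
Hypothesis OmegaE : Omega = [set x | enorm x < b] \/ Omega = [set x | a < enorm x < b].
Hypothesis finC : finite_set (components p a b eta).
Notation I := (Ip p a b eta).
Notation C := (components p a b eta).
Notation omega := (@sphere_area R d).
Notation rho := (rho d b eta).
Notation auxI := (aux_in p a b eta Omega).
Notation wR := (X_weight1 p a b eta Omega).

Let p0 : 0 < p. Proof. exact: lt_trans p_gt1. Qed.
Let pm1 : 0 < p - 1. Proof. by rewrite subr_gt0. Qed.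
Let omega_gt0 : 0 < omega. Proof. exact: sphere_area_gt0. Qed.
Let mI : measurable (I : set (measurableTypeR R)). Proof. exact: measurable_Ip. Qed.
Let rho0 r : 0 <= rho r. Proof. exact: rho_ge0. Qed.
Let mrho : measurable_fun (setT : set R) rho. Proof. exact: rho_measurable eta_weight. Qed.
Let wR0 r : 0 <= wR r. Proof. exact: wR_ge0. Qed.
Let mwR : measurable_fun (setT : set R) wR. Proof. exact: wR_measurable. Qed.
Let auxI0 r : 0 <= auxI r. Proof. exact: (auxI_ge0 d_gt0 p_gt1 a_ge0 eta_weight OmegaE). Qed.

Lemma measurable_sum_in (J : eqType) (s : seq J) (G : J -> R -> R) :
  (forall c, c \in s -> measurable_fun (setT : set R) (G c)) ->
  measurable_fun (setT : set R) (fun r => \sum_(c <- s) G c r).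
Proof.
elim: s => [|c s IH] mG.
  by rewrite (_ : (fun _ => _) = cst 0)//; apply/funext => r; rewrite big_nil.
rewrite (_ : (fun _ => _) = (fun r => G c r + \sum_(c <- s) G c r)); last first.
  by apply/funext => r; rewrite big_cons.
apply: measurable_funD; first by apply: mG; rewrite mem_head.
by apply: IH => c' cs'; apply: mG; rewrite inE cs' orbT.
Qed.

Lemma not_null_itv (N : set R) (x y : R) : measurable (N : set (measurableTypeR R)) -> leb N = 0%E ->
  x < y -> exists2 r, x < r < y & ~ N r.
Proof.
move=> mN N0 xy; apply: contrapT => H.
have sub : `]x, y[%classic `<=` N.
  move=> r; rewrite /= in_itv/= => rxy; apply: contrapT => nN; apply: H; by exists r.
have : (leb (`]x, y[%classic : set R) <= leb N)%E.
  by apply: le_measure; rewrite ?inE//; exact: measurable_itv.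
by rewrite [leRHS]N0 lebesgue_measure_itv/= lte_fin xy -EFinB lee_fin subr_le0 leNgt xy.
Qed.

(** One null set serves all components and all segments inside them: it is a countable union over
    the components and over the segments from c.1 + 1/(k+1) to c.2 - 1/(k+1). *)
Lemma good_set v f : W11loc I v f -> exists N : set R,
  [/\ measurable (N : set (measurableTypeR R)), leb N = 0%E & forall c s t, C c -> c.1 < s -> s <= t -> t < c.2 ->
     ~ N s -> ~ N t -> v t - v s = \int[leb]_(r in `[s, t]) f r].
Proof.
move=> W; have [cs csE] := (finite_seqP C).1 finC.
pose l (c : R * R) (k : nat) := c.1 + k.+1%:R^-1.
pose u (c : R * R) (k : nat) := c.2 - k.+1%:R^-1.
have k0 (k : nat) : 0 < (k.+1%:R^-1 : R) by rewrite invr_gt0.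
have /choice[N HN] : forall ck : (R * R) * nat, exists N : set R, C ck.1 -> leb.-negligible N /\
    forall s t, l ck.1 ck.2 < s -> s <= t -> t < u ck.1 ck.2 -> ~ N s -> ~ N t ->
      v t - v s = \int[leb]_(r in `[s, t]) f r.
  move=> [c k]; have [Cc|nC] := pselect (C c); last by exists set0 => /nC.
  have sub : `[l c k, u c k]%classic `<=` I.
    by apply: (component_segment Cc); rewrite /l /u ?ltrDl// ltrBlDr ltrDl.
  by have [N nN HN] := W11loc_ae_increment W sub; exists N.
have ae : {ae leb, forall r, forall i k, (i < size cs)%N -> ~ N (nth (0, 0) cs i, k) r}.
  apply: lebesgue_ae_foralln => i; apply: lebesgue_ae_foralln => k.
  have [ics|_] := ltnP i (size cs); last by apply: aeW.
  have Cc : C (nth (0, 0) cs i) by rewrite csE /=; exact: mem_nth.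
  have [[M [mM M0 sub]] _] := HN (nth (0, 0) cs i, k) Cc.
  exists M; split => // r /= H; apply: sub; apply: contrapT => nN; exact: H.
have [M [mM M0 sub]] := ae; exists M; split => // c s t Cc cs_ st tc nMs nMt.
have [i ics ci] : exists2 i, (i < size cs)%N & c = nth (0, 0) cs i.
  have : c \in cs by move: Cc; rewrite csE.
  by move=> ccs; exists (index c cs); rewrite ?index_mem// nth_index.
have [k Hk] : exists k, 0 + k.+1%:R^-1 < Num.min (s - c.1) (c.2 - t).
  by apply: ltr_add_invr; rewrite lt_min !subr_gt0 cs_ tc.
have [_ H] := HN (c, k) Cc; move: Hk; rewrite add0r lt_min => /andP[k1 k2].
have nN r : ~ M r -> ~ N (c, k) r.
  move=> nM Nr; apply: nM; apply: sub => /= /(_ i k ics); rewrite -ci; exact.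
apply: H => /=; [by rewrite /l -ltrBrDl|by []|by rewrite /u ltrBrDr addrC -ltrBrDr|exact: nN|exact: nN].
Qed.

(** A constant bound is enough for dominated convergence, because I is bounded and the Jacobian is
    at most omega b^(d-1) on it. *)
Lemma wR_dominated (un : nat -> R -> R) (u : R -> R) (K : R) (N : set R) :
  (forall n, measurable_fun (I : set R) (un n)) -> measurable_fun (I : set R) u ->
  measurable (N : set (measurableTypeR R)) -> leb N = 0%E ->
  (forall n r, I r -> ~ N r -> `|un n r - u r| `^ p * auxI r `^ (p - 1) <= K) ->
  (forall r, I r -> ~ N r -> un n r @[n --> \oo] --> u r) ->
  forall e, 0 < e -> exists n, (wint leb I wR p (un n \- u)%R <= e%:E)%E.
Proof.
move=> mun mu_ mN N0 uK uu e e0.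
pose D := (I `\` N : set (measurableTypeR R)).
have mD : measurable D by exact: measurableD.
have Ib r : I r -> 0 <= r <= b.
  by move=> /Ip_sub /=; rewrite in_itv/= => /andP[/ltW ar /ltW ->]; rewrite (le_trans a_ge0 ar).
have b0 : 0 <= b by exact: le_trans a_ge0 (ltW ab).
pose B := omega * b ^+ d.-1.
have B0 : 0 <= B by rewrite mulr_ge0 ?(ltW omega_gt0)// exprn_ge0.
pose fn n r := `|un n r - u r| `^ p * wR r.
have fn0 n r : 0 <= fn n r by rewrite mulr_ge0 ?powR_ge0.
have mfn n : measurable_fun (I : set R) (fn n).
  apply: measurable_funM; last exact: measurable_funTS.
  apply: (measurableT_comp (@measurable_powR R _)); apply: measurableT_comp => //.
  exact: measurable_funB.
have fnK n r : D r -> `|fn n r| <= K * B.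
  move=> [Ir nN]; rewrite ger0_norm// /fn /X_weight1 mulrA; have /andP[r0 rb] := Ib _ Ir.
  apply: ler_pM; [by rewrite mulr_ge0 ?powR_ge0|by rewrite mulr_ge0 ?exprn_ge0// ltW|exact: uK|].
  by rewrite ler_wpM2l ?(ltW omega_gt0)// lerXn2r ?nnegrE// ger0_norm.
have ig : leb.-integrable D (EFin \o cst (K * B)).
  apply: (@measurable_bounded_integrable _ (measurableTypeR R) R leb _ _ mD) => //.
  - apply: (@le_lt_trans _ _ (leb (`[0, b]%classic : set R))).
      by apply: le_measure; rewrite ?inE// => r [/Ib Hr _]; rewrite /= in_itv.
    by rewrite lebesgue_measure_itv/=; case: ifP => _; rewrite -?EFinB ltry.
  - by exists `|K * B|; split; [exact: num_real|move=> z lz r _ /=; exact: ltW].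
have fcvg r : D r -> fn n r @[n --> \oo] --> (cst 0 r : R).
  move=> [Ir nN]; rewrite /= -(mul0r (wR r)); apply: cvgMl.
  have h := @continuous_powR_norm R p p0 0; rewrite /continuous_at normr0 powR0 ?gt_eqF// in h.
  apply: (@cvg_comp _ _ _ (fun n => un n r - u r) (fun y : R => `|y| `^ p) _ _ _ _ h).
  by rewrite -(subrr (u r)); apply: cvgB; [exact: uu|exact: cvg_cst].
have mfnD n : measurable_fun D (fn n) by apply: measurable_funS (mfn n) => // r [].
have [_ HC] := @cvg_Rintegral _ (measurableTypeR R) R leb D fn (cst 0) (cst (K * B)) mD mfnD ig fcvg fnK.
rewrite (_ : (\int[leb]_(x in D) cst 0 x)%R = 0) in HC; last by rewrite /Rintegral integral0.
have /cvgrPdist_le/(_ e e0)[n _ /(_ n (leqnn n))] := HC.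
rewrite sub0r normrN => Hn; exists n; rewrite wintE.
have ifn : leb.-integrable D (EFin \o fn n).
  apply: (le_integrable mD _ _ ig); first exact/measurable_EFinP.
  by move=> r Dr /=; rewrite lee_fin; apply: le_trans (fnK n r Dr) _; exact: ler_norm.
rewrite (@ge0_integral_eq_null _ (measurableTypeR R) R leb I _ ((EFin \o fn n) \_ (~` N)) N mN N0); last 3 first.
- by move=> r _; rewrite lee_fin; exact: (fn0 n r).
- by move=> r _; rewrite patchE; case: ifP => // _; rewrite lee_fin.
- by move=> r _ nN; rewrite patchE mem_set.
rewrite -integral_mkcondr -setDE -(fineK (integrable_fin_num mD ifn)) lee_fin.
exact: le_trans (ler_norm _) Hn.
Qed.

Section truncation.
Variables (cs : seq (R * R)) (csE : forall c, C c <-> c \in cs) (cs_uniq : uniq cs).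
Variables (v f : R -> R) (N : set R).
Hypotheses (W : W11loc I v f) (mN : measurable (N : set (measurableTypeR R))) (N0 : leb N = 0%E).
Hypothesis incr : forall c s t, C c -> c.1 < s -> s <= t -> t < c.2 ->
     ~ N s -> ~ N t -> v t - v s = \int[leb]_(r in `[s, t]) f r.
Hypothesis Efin : (wint leb I rho p f < +oo)%E.

Lemma component_sum (G : R * R -> R -> R) c r :
  (forall c' r, C c' -> ~ (c'.1 < r < c'.2) -> G c' r = 0) -> C c -> c.1 < r < c.2 ->
  \sum_(c' <- cs) G c' r = G c r.
Proof.
move=> G0 Cc cr; rewrite (bigD1_seq c)//=; last exact/csE.
rewrite big_seq_cond big1 ?addr0// => c' /andP[/csE Cc' /eqP cc]; apply: G0 => // c'r.
by apply: cc; exact: component_unique Cc' Cc c'r cr.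
Qed.

Let mv : measurable_fun (I : set R) v. Proof. by case: W => -[]. Qed.
Let mf : measurable_fun (I : set R) f. Proof. by case: W => _ []. Qed.

Lemma wint_rho_sub (D : set R) g : measurable (D : set (measurableTypeR R)) -> D `<=` I ->
  measurable_fun (I : set R) g -> (wint leb D rho p g <= wint leb I rho p g)%E.
Proof.
move=> mD DI mg; rewrite !wintE; apply: ge0_subset_integral => //.
- apply/measurable_EFinP; apply: measurable_funM; last exact: measurable_funTS.
  by apply: (measurableT_comp (@measurable_powR R _)); exact: measurableT_comp.
- by move=> r _; rewrite lee_fin mulr_ge0 ?powR_ge0.
Qed.

Lemma increment_le c s t s' t' : C c -> c.1 < s' -> s' <= s -> s <= t -> t <= t' -> t' < c.2 ->
  ~ N s -> ~ N t -> (`|v t - v s|%:E <= \int[leb]_(r in `[s', t']) `|f r|%:E)%E.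
Proof.
move=> Cc c1 ss st tt c2 ns nt.
have sub : `[s, t]%classic `<=` `[s', t']%classic.
  by move=> r /=; rewrite !in_itv/= => /andP[h1 h2]; rewrite (le_trans ss h1) (le_trans h2 tt).
have subI : `[s', t']%classic `<=` I by exact: component_segment Cc c1 c2.
have [_ i1] := W11loc_segment W (subset_trans sub subI).
have mJ : measurable (`[s, t]%classic : set (measurableTypeR R)) by exact: measurable_itv.
have mJ' : measurable (`[s', t']%classic : set (measurableTypeR R)) by exact: measurable_itv.
rewrite (incr Cc)//; [|exact: lt_le_trans c1 ss|exact: le_lt_trans tt c2].
apply: (@le_trans _ _ (\int[leb]_(r in `[s, t]) `|f r|%:E)%E).
  have /integrableP[_ fi] := i1.
  apply: (@le_trans _ _ (\int[leb]_(r in `[s, t]) `|f r|)%:E).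
    by rewrite lee_fin; exact: (@le_normr_Rintegral _ (measurableTypeR R) R leb _ _ mJ i1).
  by rewrite /Rintegral fineK// ge0_fin_numE ?integral_ge0.
apply: ge0_subset_integral => //.
by apply/measurable_EFinP; apply: measurableT_comp => //; exact: measurable_funS mf.
Qed.

(** Inside the component c, v is frozen at its values at x c and y c beyond these points; outside c
    the value is 0, so that a sum over the components glues the pieces. The three restrictions make
    measurability immediate. *)
Definition trunc (x y : R * R -> R) (c : R * R) (r : R) : R :=
  (cst (v (x c)) \_ `]c.1, x c]) r + (v \_ `]x c, y c]) r + (cst (v (y c)) \_ `]y c, c.2[) r.

Lemma truncE x y c r : c.1 < x c -> x c < y c -> y c < c.2 -> trunc x y c r =
  if c.1 < r < c.2 then if r <= x c then v (x c) else if r <= y c then v r else v (y c) else 0.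
Proof.
move=> cx xy yc; have E (J : interval R) (g : R -> R) : (g \_ [set` J]) r = if r \in J then g r else 0.
  by rewrite patchE mem_setE.
rewrite /trunc !E !in_itv/=.
have [r1|r1] := leP r c.1; rewrite /=.
  by rewrite (le_gtF (le_trans r1 (ltW cx))) (le_gtF (le_trans r1 (ltW (lt_trans cx xy))))/= !addr0.
have [r2|r2] := leP r (x c); rewrite /=.
  rewrite (le_gtF (le_trans r2 (ltW xy)))/= !addr0.
  by rewrite (le_lt_trans r2 (lt_trans xy yc)).
have [r3|r3] := leP r (y c); rewrite /=; first by rewrite add0r addr0 (le_lt_trans r3 yc).
by rewrite !add0r; case: ifP.
Qed.

Lemma measurable_trunc x y c : C c -> c.1 < x c -> y c < c.2 -> measurable_fun (setT : set R) (trunc x y c).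
Proof.
move=> Cc cx yc; apply: measurable_funD; first apply: measurable_funD;
  apply/(measurable_restrictT _ _).1 => //; try exact: measurable_itv.
apply: measurable_funS mv => // r /=; rewrite in_itv/= => /andP[h1 h2].
by have [_ _ _ sub] := component_bounds Cc; apply: sub; rewrite /= in_itv/= (lt_trans cx h1) (le_lt_trans h2 yc).
Qed.

Lemma truncation e : 0 < e -> exists x y : R * R -> R,
  (forall c, C c -> [/\ c.1 < x c, x c < y c, y c < c.2, ~ N (x c) & ~ N (y c)]) /\
  (wint leb I wR p ((fun r => (\sum_(c <- cs) trunc x y c r)%R) \- v)%R <= e%:E)%E.
Proof.
move=> e0.
have /choice[xy Hxy] : forall cn : (R * R) * nat, exists xy : R * R, C cn.1 ->
    [/\ cn.1.1 < xy.1, xy.1 < cn.1.1 + (cn.1.2 - cn.1.1) / 4 * cn.2.+1%:R^-1,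
      cn.1.2 - (cn.1.2 - cn.1.1) / 4 * cn.2.+1%:R^-1 < xy.2, xy.2 < cn.1.2 & ~ N xy.1 /\ ~ N xy.2].
  move=> [c n]; have [Cc|nC] := pselect (C c); last by exists (0, 0) => /nC.
  have [_ lt _ _] := component_bounds Cc.
  have L0 : 0 < (c.2 - c.1) / 4 * n.+1%:R^-1 by rewrite mulr_gt0 ?divr_gt0 ?subr_gt0// invr_gt0.
  have l1 : c.1 < c.1 + (c.2 - c.1) / 4 * n.+1%:R^-1 by rewrite ltrDl.
  have l2 : c.2 - (c.2 - c.1) / 4 * n.+1%:R^-1 < c.2 by rewrite ltrBlDr ltrDl.
  have [x /andP[x1 x2] nx] := not_null_itv mN N0 l1.
  have [y /andP[y1 y2] ny] := not_null_itv mN N0 l2.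
  by exists (x, y).
pose xs n c := (xy (c, n)).1; pose ys n c := (xy (c, n)).2.
(* The truncation points lie in the outer quarters. For r beyond such a point the weight at r
   integrates kappa between r and the midpoint of c, an interval that contains the one over which v
   was frozen; [kint_hardy] then bounds the error by a constant. *)
have Q n c : C c -> [/\ c.1 < xs n c, xs n c < (3 * c.1 + c.2) / 4, (c.1 + 3 * c.2) / 4 < ys n c,
     ys n c < c.2 & ~ N (xs n c) /\ ~ N (ys n c)].
  move=> Cc; have [h1 h2 h3 h4 h5] := Hxy (c, n) Cc; have [_ lt _ _] := component_bounds Cc.
  have L0 : 0 < (c.2 - c.1) / 4 by rewrite divr_gt0 ?subr_gt0.
  have LL : (c.2 - c.1) / 4 * n.+1%:R^-1 <= (c.2 - c.1) / 4.
    by rewrite ler_piMr ?(ltW L0)// invf_le1// ler1n.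
  move: h1 h2 h3 h4 LL; rewrite /xs /ys /=; set q := _ / n.+1%:R; set x := (xy _).1; set y := (xy _).2.
  by move=> h1 h2 h3 h4 LL; split => //; lra.
have P n c : C c -> [/\ c.1 < xs n c, xs n c < ys n c, ys n c < c.2, ~ N (xs n c) & ~ N (ys n c)].
  by move=> Cc; have [h1 h2 h3 h4 [h5 h6]] := Q n c Cc; have [_ lt _ _] := component_bounds Cc; split => //; lra.
pose un n r := \sum_(c <- cs) trunc (xs n) (ys n) c r.
have unE n c r : C c -> c.1 < r < c.2 -> un n r =
    if r <= xs n c then v (xs n c) else if r <= ys n c then v r else v (ys n c).
  move=> Cc cr; rewrite /un (@component_sum _ c)//.
    by have [h1 h2 h3 _ _] := P n c Cc; rewrite truncE// cr.
  move=> c' r' Cc' nr; have [h1 h2 h3 _ _] := P n c' Cc'; rewrite truncE//.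
  by case: ifPn.
have [E EE] : exists E, wint leb I rho p f = E%:E.
  by exists (fine (wint leb I rho p f)); rewrite fineK// ge0_fin_numE// wint_ge0.
have E0 : 0 <= E by rewrite -lee_fin -EE wint_ge0.
pose k0 := omega `^ (p / (p - 1)).
pose K := k0^-1 `^ (p - 1) * (1 + E) `^ p.
have K0 : 0 <= K by rewrite mulr_ge0 ?powR_ge0.
suff [n Hn] : exists n, (wint leb I wR p (un n \- v)%R <= e%:E)%E.
  by exists (xs n), (ys n); split => // c Cc; exact: P.
apply: (@wR_dominated un v K N _ mv mN N0 _ _ e e0).
- move=> n; apply: measurable_funTS; rewrite /un.
  apply: measurable_sum_in => c /csE Cc.
  by have [h1 _ h3 _ _] := P n c Cc; exact: measurable_trunc.
- move=> n r Ir nNr; have [c Cc cr] := component_of Ir; have /andP[c1 c2] := cr.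
  have [_ lt _ _] := component_bounds Cc.
  have [x1 xq qy y2 [nx ny]] := Q n c Cc.
  have fI (J : set R) : J `<=` I -> measurable_fun (J : set R) f by move=> JI; exact: measurable_funS mf.
  have EJ s t : `[s, t]%classic `<=` I -> (wint leb `[s, t] rho p f <= E%:E)%E.
    by move=> stI; rewrite -EE; apply: wint_rho_sub => //; exact: measurable_itv.
  rewrite (unE n c r Cc cr) /aux_in patchE mem_set// (aux_profileE d_gt0 p_gt1 a_ge0 eta_weight OmegaE Cc cr).
  case: ifPn => [rx|]; last (rewrite -ltNge => xr; case: ifPn => [ry|]; last (rewrite -ltNge => yr)).
  + have sub : `[r, (c.1 + c.2) / 2]%classic `<=` I by apply: (component_segment Cc) => //; lra.
    rewrite ifT; last by lra.
    apply: (@kint_hardy _ _ _ _ _ _ d_gt0 p_gt1 a_ge0 eta_weight _ _ _ _ f) => //; [lra|exact: fI| |exact: EJ].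
    by apply: (increment_le Cc) => //; lra.
  + by rewrite subrr normr0 powR0 ?gt_eqF// mul0r.
  + have sub : `[(c.1 + c.2) / 2, r]%classic `<=` I by apply: (component_segment Cc) => //; lra.
    rewrite ifF; last by apply/negbTE; rewrite -ltNge; lra.
    rewrite ifF; last by apply/negbTE; rewrite -leNgt; lra.
    apply: (@kint_hardy _ _ _ _ _ _ d_gt0 p_gt1 a_ge0 eta_weight _ _ _ _ f) => //; [lra|exact: fI| |exact: EJ].
    by rewrite distrC; apply: (increment_le Cc) => //; lra.
- move=> r Ir nNr; have [c Cc cr] := component_of Ir; have /andP[c1 c2] := cr.
  have [_ lt _ _] := component_bounds Cc.
  have L0 : 0 < (c.2 - c.1) / 4 by rewrite divr_gt0 ?subr_gt0.
  have m0 : 0 < Num.min (r - c.1) (c.2 - r) / ((c.2 - c.1) / 4).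
    by rewrite divr_gt0// lt_min !subr_gt0 c1 c2.
  apply: cvg_near_cst; near=> n; rewrite (unE n c r Cc cr).
  have [/= h1 h2 h3 h4 _] := Hxy (c, n) Cc.
  have Ln : (c.2 - c.1) / 4 * n.+1%:R^-1 < Num.min (r - c.1) (c.2 - r).
    rewrite mulrC -ltr_pdivlMr//; near: n; exact: (near_infty_natSinv_lt (PosNum m0)).
  move: Ln; rewrite lt_min => /andP[l1 l2].
  move: h1 h2 h3 h4 l1 l2; rewrite /xs /ys; set q := _ / n.+1%:R; set x := (xy _).1; set y := (xy _).2.
  move=> h1 h2 h3 h4 l1 l2; rewrite ifF; last by apply/negbTE; rewrite -ltNge; lra.
  by rewrite ifT//; lra.
Unshelve. all: by end_near. Qed.

End truncation.

End recovery.

(** * Joining the truncated profiles across the components *)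

Section bridging.
Context {R : realType} (d : nat).
Notation leb := (@lebesgue_measure R).
Notation mu := (@rV_lebesgue R d).
Variables (p a b : R) (eta : R -> R) (Omega : set 'rV[R]_d).
Hypotheses (d_gt0 : (0 < d)%N) (p_gt1 : 1 < p) (a_ge0 : 0 <= a) (ab : a < b).
Hypothesis eta_weight : radial_weight a b eta.
Hypothesis OmegaE : Omega = [set x | enorm x < b] \/ Omega = [set x | a < enorm x < b].
Hypothesis finC : finite_set (components p a b eta).
Notation I := (Ip p a b eta).
Notation C := (components p a b eta).
Notation omega := (@sphere_area R d).
Notation rho := (rho d b eta).
Notation auxI := (aux_in p a b eta Omega).
Notation wR := (X_weight1 p a b eta Omega).

Let p0 : 0 < p. Proof. exact: lt_trans p_gt1. Qed.
Let pm1 : 0 < p - 1. Proof. by rewrite subr_gt0. Qed.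
Let omega_gt0 : 0 < omega. Proof. exact: sphere_area_gt0. Qed.
Let mI : measurable (I : set (measurableTypeR R)). Proof. exact: measurable_Ip. Qed.
Let rho0 r : 0 <= rho r. Proof. exact: rho_ge0. Qed.
Let mrho : measurable_fun (setT : set R) rho. Proof. exact: rho_measurable eta_weight. Qed.
Let wR0 r : 0 <= wR r. Proof. exact: wR_ge0. Qed.
Let mwR : measurable_fun (setT : set R) wR. Proof. exact: wR_measurable. Qed.
Let auxI0 r : 0 <= auxI r. Proof. exact: (auxI_ge0 d_gt0 p_gt1 a_ge0 eta_weight OmegaE). Qed.

Lemma seq_pos_min (J : eqType) (s : seq J) (F : J -> R) : (forall c, c \in s -> 0 < F c) ->
  exists m, [/\ 0 < m, m <= 1 & forall c, c \in s -> m <= F c].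
Proof.
elim: s => [|c s IH] F0; first by exists 1; split.
have [m [m0 m1 mF]] := IH (fun c' h => F0 c' (@mem_behead _ (c :: s) _ h)).
exists (Num.min m (F c)); split.
- by rewrite lt_min m0 F0 ?mem_head.
- by rewrite ge_min m1.
- move=> c'; rewrite inE => /predU1P[->|/mF h]; first by rewrite ge_min lexx orbT.
  by rewrite ge_min h.
Qed.

Lemma Rintegral_sum_in (J : eqType) (s : seq J) (G : J -> R -> R) :
  (forall c, c \in s -> leb.-integrable setT (EFin \o G c)) ->
  leb.-integrable setT (EFin \o (fun r => \sum_(c <- s) G c r)) /\
  forall D : set R, measurable (D : set R) ->
    \int[leb]_(r in D) (\sum_(c <- s) G c r) = \sum_(c <- s) \int[leb]_(r in D) G c r.
Proof.
elim: s => [|c s IH] iG.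
  have E : (fun r => \sum_(c <- [::]) G c r) = (fun=> 0 : R) by apply/funext => r; rewrite big_nil.
  split; first by rewrite E; exact: (@integrable0 _ (measurableTypeR R) R leb).
  by move=> D mD; rewrite E big_nil /Rintegral integral0.
have E : (fun r => \sum_(c <- c :: s) G c r) = (fun r => G c r + \sum_(c <- s) G c r).
  by apply/funext => r; rewrite big_cons.
have i1 := iG c (mem_head _ _).
have [i2 H] := IH (fun c' h => iG c' (@mem_behead _ (c :: s) _ h)).
have mT : measurable (setT : set R) by exact: measurableT.
split; first by rewrite E; exact: lebesgue_integrableD.
move=> D mD; rewrite E big_cons -H// (@RintegralD _ (measurableTypeR R) R leb)//.
- exact: lebesgue_integrableS i1.
- exact: lebesgue_integrableS i2.
Qed.

Lemma patch_itvE (J : interval R) (g : R -> R) r : (g \_ [set` J]) r = if r \in J then g r else 0.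
Proof. by rewrite patchE mem_setE. Qed.

(** The primitive starts at a - 1: a bump of half-width delta <= 1 around a point s >= a lies
    entirely to the right of it. *)
Lemma bump_primitive (theta : R -> R) (s delta r : R) : leb.-integrable setT (EFin \o theta) ->
  (forall t, 0 <= theta t) -> (forall t, ~ (s - delta < t < s + delta) -> theta t = 0) ->
  \int[leb]_t theta t = 1 -> a <= s -> delta <= 1 ->
  [/\ r <= s - delta -> \int[leb]_(t in `]a - 1, r]) theta t = 0,
     s + delta <= r -> \int[leb]_(t in `]a - 1, r]) theta t = 1 &
     0 <= \int[leb]_(t in `]a - 1, r]) theta t <= 1].
Proof.
move=> it t0 tout t1 as_ d1.
have E t : (theta \_ `]a - 1, r]) t = if a - 1 < t <= r then theta t else 0.
  by rewrite patch_itvE in_itv.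
split.
- move=> rs; rewrite Rintegral_mkcond (_ : _ \_ _ = cst 0) ?/Rintegral ?integral0//.
  apply/funext => t; rewrite E; case: ifP => // /andP[_ tr]; apply: tout => /andP[st _].
  by have := lt_le_trans st (le_trans tr rs); rewrite ltxx.
- move=> sr; rewrite Rintegral_mkcond -[RHS]t1; congr Rintegral; apply/funext => t.
  rewrite -[LHS]/((theta \_ `]a - 1, r]) t) E.
  case: ifPn => // ntr; apply/esym; apply: tout => /andP[h1 h2]; move/negP: ntr; apply.
  by apply/andP; split; lra.
- apply/andP; split; first exact: Rintegral_ge0.
  rewrite Rintegral_mkcond -[leRHS]t1; apply: (@le_Rintegral _ (measurableTypeR R) R leb) => //.
    have mJ : measurable (`]a - 1, r]%classic : set (measurableTypeR R)) by exact: measurable_itv.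
    have := (@integrable_mkcond _ (measurableTypeR R) R leb _ (EFin \o theta) mJ).1 (lebesgue_integrableS measurableT mJ (@subsetT _ _) it).
    by rewrite restrict_EFin.
  by move=> t _; rewrite E; case: ifP.
Qed.

Section transitions.
Variables (cs : seq (R * R)) (csE : forall c, C c <-> c \in cs) (cs_uniq : uniq cs).
Variables (v f : R -> R) (N : set R).
Hypotheses (W : W11loc I v f) (mN : measurable (N : set (measurableTypeR R))) (N0 : leb N = 0%E).
Hypothesis incr : forall c s t, C c -> c.1 < s -> s <= t -> t < c.2 ->
     ~ N s -> ~ N t -> v t - v s = \int[leb]_(r in `[s, t]) f r.
Variable E : R.
Hypothesis EE : wint leb I rho p f = E%:E.
Variables x y : R * R -> R.
Hypothesis xyP : forall c, C c -> [/\ c.1 < x c, x c < y c, y c < c.2, ~ N (x c) & ~ N (y c)].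

Let mf : measurable_fun (I : set R) f. Proof. by case: W => _ []. Qed.

Let segI c : C c -> `[x c, y c]%classic `<=` I.
Proof. by move=> Cc; have [h1 _ h3 _ _] := xyP Cc; exact: component_segment Cc h1 h3. Qed.

Let intf c : C c -> leb.-integrable `[x c, y c] (EFin \o f).
Proof. by move=> Cc; have [] := W11loc_segment W (segI Cc). Qed.

Let D c := \int[leb]_(r in `[x c, y c]) `|f r|.

Let primitive_le c s t : C c -> x c <= s -> t <= y c -> `|\int[leb]_(r in `]s, t]) f r| <= D c.
Proof.
move=> Cc xs ty; have mJ : measurable (`]s, t]%classic : set (measurableTypeR R)) by exact: measurable_itv.
have mJ' : measurable (`[x c, y c]%classic : set (measurableTypeR R)) by exact: measurable_itv.
have sub : `]s, t]%classic `<=` `[x c, y c]%classic.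
  by move=> r /=; rewrite !in_itv/= => /andP[h1 h2]; rewrite (le_trans xs (ltW h1)) (le_trans h2 ty).
have i1 := lebesgue_integrableS mJ' mJ sub (intf Cc).
apply: le_trans (@le_normr_Rintegral _ (measurableTypeR R) R leb _ _ mJ i1) _.
have fin (A : set (measurableTypeR R)) : measurable A -> leb.-integrable A (EFin \o f) ->
    (\int[leb]_(r in A) `|f r|%:E)%E \is a fin_num.
  by move=> mA iA; apply: (integrable_fin_num mA); exact: (@integrable_norm _ (measurableTypeR R) R leb _ f).
rewrite /D /Rintegral -lee_fin !fineK; [|exact: fin mJ' (intf Cc)|exact: fin mJ i1].
apply: ge0_subset_integral => //; apply/measurable_EFinP; apply: measurableT_comp => //.
by apply: measurable_funS mf => //; exact: segI.
Qed.

Let inc c s t : C c -> c.1 < s -> s <= t -> t < c.2 -> ~ N s -> ~ N t ->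
  \int[leb]_(r in `]s, t]) f r = v t - v s.
Proof.
move=> Cc cs_ st tc ns nt; rewrite (incr Cc)//; apply: Rintegral_itv_obnd_cbnd.
have sub : `[s, t]%classic `<=` I by exact: component_segment Cc cs_ tc.
have [_ i1] := W11loc_segment W sub.
apply: lebesgue_integrableS i1 => //; try exact: measurable_itv.
by move=> r /=; rewrite !in_itv/= => /andP[/ltW -> ->].
Qed.

Section one_step.
Variables (delta tau : R) (theta : R * R -> (R -> R) * (R -> R)).
Hypotheses (d0 : 0 < delta) (d1 : delta <= 1) (tau0 : 0 < tau).
Hypothesis dxy : forall c, C c -> delta <= x c - c.1 /\ delta <= c.2 - y c.
Hypothesis th1 : forall c, C c -> [/\ leb.-integrable setT (EFin \o (theta c).1),
    forall r, 0 <= (theta c).1 r, forall r, ~ (c.1 - delta < r < c.1 + delta) -> (theta c).1 r = 0,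
    \int[leb]_r (theta c).1 r = 1 & (wint leb `]a, b[ rho p (theta c).1 <= (tau `^ p)%:E)%E].
Hypothesis th2 : forall c, C c -> [/\ leb.-integrable setT (EFin \o (theta c).2),
    forall r, 0 <= (theta c).2 r, forall r, ~ (c.2 - delta < r < c.2 + delta) -> (theta c).2 r = 0,
    \int[leb]_r (theta c).2 r = 1 & (wint leb `]a, b[ rho p (theta c).2 <= (tau `^ p)%:E)%E].

Let fpart c := f \_ `]x c, y c].
Let jump c r := v (x c) * (theta c).1 r + (- v (y c)) * (theta c).2 r.

(** Its primitive rises from 0 to v (x c) around c.1, follows v up to y c, and returns to 0 around
    c.2. As it vanishes away from c, the primitives of all components can simply be added, whatever
    their order. *)
Definition bridge c r := fpart c r + jump c r.

Let int_fpart c : C c -> leb.-integrable setT (EFin \o fpart c).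
Proof.
move=> Cc; have mJ : measurable (`]x c, y c]%classic : set (measurableTypeR R)) by exact: measurable_itv.
have i1 : leb.-integrable `]x c, y c] (EFin \o f).
  apply: lebesgue_integrableS (intf Cc) => //; try exact: measurable_itv.
  by move=> r /=; rewrite !in_itv/= => /andP[/ltW -> ->].
have := (@integrable_mkcond _ (measurableTypeR R) R leb _ (EFin \o f) mJ).1 i1.
by rewrite restrict_EFin.
Qed.

Let int_jump c : C c -> leb.-integrable setT (EFin \o jump c).
Proof.
move=> Cc; have [i1 _ _ _ _] := th1 Cc; have [i2 _ _ _ _] := th2 Cc.
by apply: lebesgue_integrableD => //; apply: lebesgue_integrableZl.
Qed.

Let int_bridge c : C c -> leb.-integrable setT (EFin \o bridge c).
Proof. by move=> Cc; apply: lebesgue_integrableD => //; [exact: int_fpart|exact: int_jump]. Qed.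

Let Phi c r := \int[leb]_(t in `]a - 1, r]) bridge c t.

Let PhiE c r : C c -> Phi c r = \int[leb]_(t in `]x c, Num.min r (y c)]) f t +
  (v (x c) * \int[leb]_(t in `]a - 1, r]) (theta c).1 t - v (y c) * \int[leb]_(t in `]a - 1, r]) (theta c).2 t).
Proof.
move=> Cc; have [i1 _ _ _ _] := th1 Cc; have [i2 _ _ _ _] := th2 Cc.
have mJ : measurable (`]a - 1, r]%classic : set R) by exact: measurable_itv.
have S g : leb.-integrable setT (EFin \o g) -> leb.-integrable `]a - 1, r] (EFin \o g).
  by move=> ig; apply: lebesgue_integrableS ig.
have [h1 h2 h3 _ _] := xyP Cc; have [ac _ _ _] := component_bounds Cc.
rewrite /Phi /bridge /jump (@RintegralD _ (measurableTypeR R) R leb)//; last 2 first.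
- exact/S/int_fpart.
- exact/S/int_jump.
rewrite (@RintegralD _ (measurableTypeR R) R leb)//; last 2 first.
- by apply: S; apply: lebesgue_integrableZl.
- by apply: S; apply: lebesgue_integrableZl.
rewrite !(@RintegralZl _ (measurableTypeR R) R leb)//; try exact: S.
rewrite mulNr; congr (_ + _); rewrite /fpart -Rintegral_mkcondr; congr Rintegral.
apply/seteqP; split => t /=; rewrite !in_itv/= le_min.
  by move=> [/andP[_ ->] /andP[-> ->]].
by move=> /andP[xt /andP[-> ->]]; split; rewrite ?xt// andbT; lra.
Qed.

Let bumps c r : C c -> [/\ r <= c.1 - delta -> \int[leb]_(t in `]a - 1, r]) (theta c).1 t = 0,
     c.1 + delta <= r -> \int[leb]_(t in `]a - 1, r]) (theta c).1 t = 1 &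
     0 <= \int[leb]_(t in `]a - 1, r]) (theta c).1 t <= 1] /\
  [/\ r <= c.2 - delta -> \int[leb]_(t in `]a - 1, r]) (theta c).2 t = 0,
     c.2 + delta <= r -> \int[leb]_(t in `]a - 1, r]) (theta c).2 t = 1 &
     0 <= \int[leb]_(t in `]a - 1, r]) (theta c).2 t <= 1].
Proof.
move=> Cc; have [ac lt _ _] := component_bounds Cc.
have [i1 p1 o1 s1 _] := th1 Cc; have [i2 p2 o2 s2 _] := th2 Cc.
by split; apply: bump_primitive => //; exact: le_trans (ltW lt).
Qed.

(** To the right of c the contributions cancel: v (x c) + (v (y c) - v (x c)) - v (y c) = 0. *)
Let Phi_out c r : C c -> r <= c.1 - delta \/ c.2 + delta <= r -> Phi c r = 0.
Proof.
move=> Cc; rewrite PhiE//; have [[h1 h2 _] [h3 h4 _]] := bumps r Cc.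
have [x1 x2 x3 nx ny] := xyP Cc; have [dx dy] := dxy Cc; have [_ lt _ _] := component_bounds Cc.
case=> hr.
  rewrite h1// h3; last by lra.
  rewrite set_itv_ge ?Rintegral_set0 ?mulr0 ?subrr ?addr0//.
  by rewrite bnd_simp -leNgt ge_min; apply/orP; left; lra.
rewrite h4// h2; last by lra.
rewrite (min_idPr _); last by lra.
by rewrite (inc Cc) ?(ltW x2)//; ring.
Qed.

Let Phi_in c r : C c -> c.1 + delta <= r -> r <= c.2 - delta -> ~ N r -> Phi c r = trunc v x y c r.
Proof.
move=> Cc r1 r2 nr; rewrite PhiE//; have [[_ h2 _] [h3 _ _]] := bumps r Cc.
have [x1 x2 x3 nx ny] := xyP Cc; rewrite h2// h3// mulr1 mulr0 subr0 truncE//.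
rewrite (lt_le_trans _ r1) ?ltrDl// (le_lt_trans r2) ?ltrBlDr ?ltrDl//=.
have [rx|xr] := leP r (x c).
  rewrite set_itv_ge ?Rintegral_set0 ?add0r//.
  by rewrite bnd_simp -leNgt ge_min rx.
have [ry|yr] := leP r (y c); rewrite (inc Cc) ?(ltW xr) ?(ltW x2)//; try ring.
by lra.
Qed.

Let M c := `|v (x c)| + `|v (y c)| + D c.

Let Phi_le c r : C c -> `|Phi c r| <= M c.
Proof.
move=> Cc; rewrite PhiE//; have [[_ _ /andP[h1 h2]] [_ _ /andP[h3 h4]]] := bumps r Cc.
have h : forall u w : R, 0 <= w -> w <= 1 -> `|u * w| <= `|u|.
  by move=> u w w0 w1; rewrite normrM (ger0_norm w0) ler_piMr.
have le1 := @primitive_le c (x c) (Num.min r (y c)) Cc (lexx _).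
have le2 : Num.min r (y c) <= y c by rewrite ge_min lexx orbT.
apply: le_trans (ler_normD _ _) _; rewrite addrC; apply: lerD; last exact: le1.
by apply: le_trans (ler_normB _ _) _; apply: lerD; exact: h.
Qed.

Let trunc_le c r : C c -> ~ N r -> `|trunc v x y c r| <= M c.
Proof.
move=> Cc nr; have [x1 x2 x3 nx ny] := xyP Cc; rewrite truncE//.
have D0 : 0 <= D c by exact: Rintegral_ge0.
have M0 : 0 <= M c by rewrite !addr_ge0.
case: ifPn => [cr|_]; last by rewrite normr0.
case: ifPn => [_|]; first by rewrite /M -addrA lerDl addr_ge0.
rewrite -ltNge => xr; case: ifPn => [ry|_]; last by rewrite /M addrAC lerDr addr_ge0.
have -> : v r = v (x c) + \int[leb]_(t in `]x c, r]) f t.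
  by rewrite (inc Cc) ?(ltW xr)//; [ring|lra].
apply: le_trans (ler_normD _ _) _; rewrite /M addrAC -[leLHS]addr0; apply: lerD => //.
by apply: lerD => //; exact: primitive_le.
Qed.

Let Z r := \sum_(c <- cs) bridge c r.
Definition bridged r := \int[leb]_(t in `]a - 1, r]) Z t.

Lemma integrable_bridges : leb.-integrable setT (EFin \o Z).
Proof. by have [] := @Rintegral_sum_in _ cs bridge (fun c h => int_bridge ((csE c).2 h)). Qed.

Let bridgedE r : bridged r = \sum_(c <- cs) Phi c r.
Proof.
have [_ H] := @Rintegral_sum_in _ cs bridge (fun c h => int_bridge ((csE c).2 h)).
by rewrite /bridged H//; exact: measurable_itv.
Qed.

Let truncs r := \sum_(c <- cs) trunc v x y c r.

(** Another component lies entirely to one side of c, and r is at distance at least delta from the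
    ends of c, so the primitive of the other bridge has not started yet or is already back at 0. *)
Lemma bridged_trunc c r : C c -> c.1 + delta <= r -> r <= c.2 - delta -> ~ N r ->
  bridged r = truncs r.
Proof.
move=> Cc r1 r2 nr; rewrite bridgedE /truncs big_seq_cond [RHS]big_seq_cond.
apply: eq_bigr => c' /andP[/csE Cc' _].
have [_ lt _ sub] := component_bounds Cc; have [_ lt' _ sub'] := component_bounds Cc'.
have [n1 n2] := component_endpoint Cc; have [n1' n2'] := component_endpoint Cc'.
have cr : c.1 < r < c.2 by rewrite (lt_le_trans _ r1) ?ltrDl// (le_lt_trans r2)// ltrBlDr ltrDl.
have [<-|cc] := eqVneq c c'; first exact: Phi_in.
have nr' : ~ (c'.1 < r < c'.2).
  by move=> c'r; move/eqP: cc; apply; exact: component_unique Cc Cc' cr c'r.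
have [x1 x2 x3 _ _] := xyP Cc'.
rewrite truncE//; have /negbTE -> : ~~ (c'.1 < r < c'.2) by apply/negP.
apply: Phi_out => //.
have [r1'|r1'] := leP r c'.1; [left|right].
  have : c.2 <= c'.1.
    rewrite leNgt; apply/negP => h; apply: n1'; apply: sub; rewrite /= in_itv/= h andbT.
    by apply: lt_le_trans r1'; case/andP: cr.
  by lra.
have r2' : c'.2 <= r by rewrite leNgt; apply/negP => h; apply: nr'; rewrite r1'.
have : c'.2 <= c.1.
  rewrite leNgt; apply/negP => h; apply: n2'; apply: sub; rewrite /= in_itv/= h/=.
  by apply: le_lt_trans r2' _; case/andP: cr.
by lra.
Qed.

(** The bound depends on v, f and the truncation points, but not on delta, tau or the bumps: it is
    the domination needed when delta tends to 0. *)
Lemma bridged_dist_le r : ~ N r -> `|bridged r - truncs r| <= \sum_(c <- cs) (M c + M c).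
Proof.
move=> nr; rewrite bridgedE /truncs -sumrB big_seq [leRHS]big_seq.
apply: le_trans (ler_norm_sum _ _ _) _; apply: ler_sum => c /csE Cc.
by apply: le_trans (ler_normB _ _) _; apply: lerD; [exact: Phi_le|exact: trunc_le].
Qed.

Let Lab := inLp leb `]a, b[ rho p.
Let mab : measurable (`]a, b[%classic : set (measurableTypeR R)). Proof. exact: measurable_itv. Qed.
Let mrab : measurable_fun (`]a, b[%classic : set (measurableTypeR R)) rho. Proof. exact: measurable_funTS. Qed.
Let r0ab : forall r : measurableTypeR R, (`]a, b[%classic : set (measurableTypeR R)) r -> 0 <= rho r. Proof. by []. Qed.

Let wnorm_bump th : measurable_fun (setT : set R) th -> (wint leb `]a, b[ rho p th <= (tau `^ p)%:E)%E ->
  Lab th /\ wnorm leb `]a, b[ rho p th <= tau.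
Proof.
move=> mth le; have L : Lab th.
  by split; [exact: measurable_funTS|exact: le_lt_trans le (ltry _)].
split => //; rewrite /wnorm -[leRHS](powRr1 (ltW tau0)) -(@mulfV _ p) ?gt_eqF// powRrM.
apply: ge0_ler_powR; rewrite ?nnegrE ?invr_ge0 ?(ltW p0) ?powR_ge0//; first exact: wNp_ge0.
by rewrite -lee_fin -(wint_fin r0ab L).
Qed.

Let mth g : leb.-integrable setT (EFin \o g) -> measurable_fun (setT : set R) g.
Proof. by move=> ig; apply/measurable_EFinP; exact: measurable_int ig. Qed.

Let wnorm_jumps : Lab (fun r => \sum_(c <- cs) jump c r) /\
  wnorm leb `]a, b[ rho p (fun r => \sum_(c <- cs) jump c r) <= \sum_(c <- cs) ((`|v (x c)| + `|v (y c)|) * tau).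
Proof.
have H c : C c -> Lab (jump c) /\ wnorm leb `]a, b[ rho p (jump c) <= (`|v (x c)| + `|v (y c)|) * tau.
  move=> Cc; have [i1 _ _ _ e1] := th1 Cc; have [i2 _ _ _ e2] := th2 Cc.
  have [l1 n1] := wnorm_bump (mth i1) e1; have [l2 n2] := wnorm_bump (mth i2) e2.
  have l1' := inLpZ mab mrab r0ab (v (x c)) l1.
  have l2' := inLpZ mab mrab r0ab (- v (y c)) l2.
  split; first exact: (inLpD mab mrab r0ab p_gt1 l1' l2').
  apply: le_trans (wnormD mab mrab r0ab p_gt1 l1' l2') _.
  rewrite !(wnormZ mab mrab r0ab p_gt1)// normrN mulrDl.
  by apply: lerD; apply: ler_wpM2l.
have {}H c : c \in cs -> Lab (jump c) /\ wnorm leb `]a, b[ rho p (jump c) <= (`|v (x c)| + `|v (y c)|) * tau.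
  by move=> /csE; exact: H.
elim: cs H => [|c s IH] H.
  have E0 : (fun r => \sum_(c <- [::]) jump c r) = (fun=> 0 : R) by apply/funext => r; rewrite big_nil.
  have w0 : wint leb `]a, b[ rho p (fun=> 0) = 0%E.
    by rewrite wintE integral0_eq// => r _; rewrite normr0 powR0 ?gt_eqF// mul0r.
  rewrite E0 big_nil; split; first by split; [exact: measurable_cst|rewrite w0 ltry].
  by rewrite /wnorm /wNp w0/= powR0// invr_eq0 gt_eqF.
have [l1 n1] := H c (mem_head _ _).
have [l2 n2] := IH (fun c' h => H c' (@mem_behead _ (c :: s) _ h)).
have E1 : (fun r => \sum_(c <- c :: s) jump c r) = (jump c \+ (fun r => \sum_(c <- s) jump c r)).
  by apply/funext => r; rewrite big_cons.
rewrite E1 big_cons; split; first exact: (inLpD mab mrab r0ab p_gt1 l1 l2).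
by apply: le_trans (wnormD mab mrab r0ab p_gt1 l1 l2) _; exact: lerD.
Qed.

Let wnorm_fparts : Lab (fun r => \sum_(c <- cs) fpart c r) /\
  wNp leb `]a, b[ rho p (fun r => \sum_(c <- cs) fpart c r) <= E.
Proof.
set F := (fun r => _).
have mF : measurable_fun (setT : set R) F.
  by apply: measurable_sum_in => c /csE Cc; apply: mth; exact: int_fpart.
have fE c r : fpart c r = if x c < r <= y c then f r else 0.
  by rewrite /fpart patch_itvE in_itv.
have fout c r : C c -> ~ (c.1 < r < c.2) -> fpart c r = 0.
  move=> Cc nr; have [x1 x2 x3 _ _] := xyP Cc; rewrite fE; case: ifPn => // /andP[h1 h2].
  by exfalso; apply: nr; apply/andP; split; lra.
have FI r : I r -> `|F r| <= `|f r|.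
  move=> Ir; have [c Cc cr] := component_of Ir.
  have -> : F r = fpart c r.
    by apply: (component_sum csE cs_uniq _ Cc cr) => c' r' Cc' nr; exact: fout.
  by rewrite fE; case: ifP => // _; rewrite normr0.
have FnI r : ~ I r -> F r = 0.
  move=> nI; rewrite /F big_seq big1// => c /csE Cc; apply: fout => // cr; apply: nI.
  by have [_ _ _ sub] := component_bounds Cc; apply: sub; rewrite /= in_itv.
have le : (wint leb `]a, b[ rho p F <= E%:E)%E.
  rewrite -EE !wintE.
  have -> : (\int[leb]_(r in `]a, b[) (`|F r| `^ p * rho r)%:E)%E =
      (\int[leb]_(r in I) (`|F r| `^ p * rho r)%:E)%E.
    have IE : (I : set R) = `]a, b[%classic `&` I by apply/esym/setIidr; exact: Ip_sub.
    rewrite [in RHS]IE integral_mkcondr; apply: eq_integral => r _; rewrite patchE; case: ifPn => // /negP.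
    by rewrite inE => /FnI ->; rewrite normr0 powR0 ?gt_eqF// mul0r.
  have mp (g : R -> R) : measurable_fun (I : set R) g -> measurable_fun (I : set R) (fun r => (`|g r| `^ p * rho r)%:E).
    move=> mg; apply/measurable_EFinP; apply: measurable_funM; last exact: measurable_funTS.
    by apply: (measurableT_comp (@measurable_powR R _)); exact: measurableT_comp.
  apply: ge0_le_integral => //.
  - by move=> r _; rewrite lee_fin mulr_ge0 ?powR_ge0.
  - by apply: mp; exact: measurable_funTS.
  - exact: mp.
  - by move=> r Ir; rewrite lee_fin ler_wpM2r// ler_powR_norm ?(ltW p0)// FI.
have L : Lab F by split; [exact: measurable_funTS|exact: le_lt_trans le (ltry _)].
by split => //; rewrite -lee_fin -(wint_fin r0ab L).
Qed.

(** Minkowski's inequality in L^p(rho). The parts that follow v live on disjoint components and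
    together cost at most E; each bump has norm at most tau and is multiplied by a boundary value of
    v. *)
Lemma bridges_energy : (wint leb `]a, b[ rho p Z <=
  ((E `^ p^-1 + \sum_(c <- cs) ((`|v (x c)| + `|v (y c)|) * tau)) `^ p)%:E)%E.
Proof.
have [l1 n1] := wnorm_fparts; have [l2 n2] := wnorm_jumps.
have ZE : Z = ((fun r => \sum_(c <- cs) fpart c r) \+ (fun r => \sum_(c <- cs) jump c r)).
  by apply/funext => r; rewrite /Z/= -big_split.
have l := inLpD mab mrab r0ab p_gt1 l1 l2.
have E0 : 0 <= E by rewrite -lee_fin -EE wint_ge0.
rewrite ZE (wint_fin r0ab l) lee_fin -(wnormK leb r0ab p_gt1).
have S0 : 0 <= \sum_(c <- cs) ((`|v (x c)| + `|v (y c)|) * tau).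
  by apply: sumr_ge0 => c _; rewrite mulr_ge0 ?addr_ge0// ltW.
apply: ge0_ler_powR; rewrite ?nnegrE ?(ltW p0) ?wnorm_ge0 ?addr_ge0 ?powR_ge0//.
apply: le_trans (wnormD mab mrab r0ab p_gt1 l1 l2) _; apply: lerD => //.
apply: ge0_ler_powR; rewrite ?nnegrE ?invr_ge0 ?(ltW p0)//.
exact: wNp_ge0.
Qed.

End one_step.

End transitions.

End bridging.

Section recovery_sequence.
Context {R : realType} (d : nat).
Notation leb := (@lebesgue_measure R).
Notation mu := (@rV_lebesgue R d).
Variables (p a b : R) (eta : R -> R) (Omega : set 'rV[R]_d).
Hypotheses (d_gt0 : (0 < d)%N) (p_gt1 : 1 < p) (a_ge0 : 0 <= a) (ab : a < b).
Hypothesis eta_weight : radial_weight a b eta.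
Hypothesis OmegaE : Omega = [set x | enorm x < b] \/ Omega = [set x | a < enorm x < b].
Hypothesis finC : finite_set (components p a b eta).
Notation I := (Ip p a b eta).
Notation C := (components p a b eta).
Notation omega := (@sphere_area R d).
Notation rho := (rho d b eta).
Notation auxI := (aux_in p a b eta Omega).
Notation wR := (X_weight1 p a b eta Omega).

Let p0 : 0 < p. Proof. exact: lt_trans p_gt1. Qed.
Let pm1 : 0 < p - 1. Proof. by rewrite subr_gt0. Qed.
Let omega_gt0 : 0 < omega. Proof. exact: sphere_area_gt0. Qed.
Let mI : measurable (I : set (measurableTypeR R)). Proof. exact: measurable_Ip. Qed.
Let rho0 r : 0 <= rho r. Proof. exact: rho_ge0. Qed.
Let mrho : measurable_fun (setT : set R) rho. Proof. exact: rho_measurable eta_weight. Qed.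
Let wR0 r : 0 <= wR r. Proof. exact: wR_ge0. Qed.
Let mwR : measurable_fun (setT : set R) wR. Proof. exact: wR_measurable. Qed.
Let auxI0 r : 0 <= auxI r. Proof. exact: (auxI_ge0 d_gt0 p_gt1 a_ge0 eta_weight OmegaE). Qed.

Lemma Omega_radial x : I (enorm x) -> Omega x.
Proof. by move=> /Ip_sub /=; rewrite in_itv/=; exact: (Omega_annulus OmegaE). Qed.

Let mOmega : measurable Omega. Proof. exact: Omega_measurable OmegaE. Qed.
Let mwX : measurable_fun Omega (X_weight p a b eta Omega).
Proof. by apply: measurable_funTS; exact: wX_measurable. Qed.
Let wX0 x : Omega x -> 0 <= X_weight p a b eta Omega x. Proof. by move=> _; exact: wX_ge0. Qed.

Lemma Xspace_inLp u : Xspace p a b eta Omega u <-> inLp mu Omega (X_weight p a b eta Omega) p u.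
Proof. by rewrite /Xspace /= (XintE Omega d_gt0 finC). Qed.

Lemma XspaceD u w : Xspace p a b eta Omega u -> Xspace p a b eta Omega w -> Xspace p a b eta Omega (u \+ w).
Proof. by move=> /Xspace_inLp h1 /Xspace_inLp h2; apply/Xspace_inLp; exact: (inLpD mOmega mwX wX0 p_gt1 h1 h2). Qed.

(** Order of the choices: the truncation points, then the norm [tau] allowed to each bump given the
    boundary values of v, and last the width [delta k], which tends to 0 while the energy bound
    stays the same. *)
Lemma recovery v f w e : W11loc I v f -> (wint leb I rho p f < +oo)%E ->
  Xspace p a b eta Omega w -> (forall x, I (enorm x) -> w x = v (enorm x)) -> 0 < e ->
  exists z, [/\ Xspace p a b eta Omega z, (Xint p a b eta Omega (z \- w)%R <= e%:E)%E &
    (Ffun p a b eta Omega z <= wint leb I rho p f + e%:E)%E].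
Proof.
move=> W Efin Xw wv e0.
have [cs0 csE0] := (finite_seqP C).1 finC; pose cs := undup cs0.
have csE c : C c <-> c \in cs by rewrite mem_undup csE0.
have cs_uniq : uniq cs by exact: undup_uniq.
have [N [mN N0 incr]] := good_set finC W.
have [E EE] : exists E, wint leb I rho p f = E%:E.
  by exists (fine (wint leb I rho p f)); rewrite fineK// ge0_fin_numE// wint_ge0.
have E0 : 0 <= E by rewrite -lee_fin -EE wint_ge0.
(* Half of the budget goes to truncation and half to bridging; 2^p is the constant of the
   quasi-triangle inequality for p-th powers. *)
pose e' := e / (2 `^ p * 2).
have e'0 : 0 < e' by rewrite divr_gt0// mulr_gt0// powR_gt0.
have [x [y [xyP Htr]]] := truncation d_gt0 p_gt1 a_ge0 ab eta_weight OmegaE finC csE cs_uniq W mN N0 incr Efin e'0.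
set U := (fun r => (\sum_(c <- cs) trunc v x y c r)%R) in Htr.
have mv : measurable_fun (I : set R) v by case: W => -[].
have mU : measurable_fun (setT : set R) U.
  apply: measurable_sum_in => c /csE Cc; have [h1 _ h3 _ _] := xyP c Cc.
  exact: (measurable_trunc W Cc h1 h3).
(* Continuity of the p-th power at E^(1/p) converts the allowance e on the energy into an allowance
   t on the norm. *)
have [t t0 Ht] : exists2 t, 0 < t & (E `^ p^-1 + t) `^ p <= E + e.
  have h := @continuous_powR_norm R p p0 (E `^ p^-1).
  have /cvgrPdist_le/(_ e e0)/nbhs_ballP[q /= q0 Hq] := h.
  exists (q / 2); first by rewrite divr_gt0.
  have := Hq (E `^ p^-1 + q / 2); rewrite /ball/= opprD addrA subrr sub0r normrN gtr0_norm ?divr_gt0//.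
  have P1 : 0 <= E `^ p^-1 by exact: powR_ge0.
  have P2 : 0 <= E `^ p^-1 + q / 2 by rewrite addr_ge0// divr_ge0// ltW.
  rewrite (ger0_norm P1) (ger0_norm P2) -powRrM mulVf ?gt_eqF// powRr1//.
  move=> H; have {}H := H (ltac:(by rewrite ltr_pdivrMr// ltr_pMr// ltr1n)).
  by move: H; rewrite ler_norml => /andP[+ _]; lra.
pose S := \sum_(c <- cs) (`|v (x c)| + `|v (y c)|).
have S0 : 0 <= S by apply: sumr_ge0 => c _; rewrite addr_ge0.
pose tau := t / (1 + S).
have tau0 : 0 < tau by rewrite divr_gt0// ltr_pwDl.
have Stau : \sum_(c <- cs) ((`|v (x c)| + `|v (y c)|) * tau) <= t.
  rewrite -big_distrl/= -/S /tau mulrA ler_pdivrMr ?ltr_pwDl// mulrC ler_wpM2l ?(ltW t0)//; lra.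
have [m [m0 m1 mF]] := @seq_pos_min _ _ cs (fun c => Num.min (x c - c.1) (c.2 - y c))
  (fun c h => ltac:(by have [h1 h2 h3 _ _] := xyP c ((csE c).2 h); rewrite lt_min !subr_gt0 h1 h3)).
pose delta (k : nat) := m / k.+1%:R.
have dm k : delta k <= m by rewrite /delta ler_pdivrMr ?ltr0n// ler_peMr ?(ltW m0)// ler1n.
have d0 k : 0 < delta k by rewrite divr_gt0 ?ltr0n.
have d1 k : delta k <= 1 by exact: le_trans (dm k) m1.
have dxy k c : C c -> delta k <= x c - c.1 /\ delta k <= c.2 - y c.
  move=> /csE/mF; rewrite le_min => /andP[h1 h2]; split; exact: le_trans (dm k) _.
have taup : 0 < tau `^ p by exact: powR_gt0.
have endpts c : C c -> (a <= c.1 <= b /\ ~ I c.1) /\ (a <= c.2 <= b /\ ~ I c.2).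
  move=> Cc; have [ac lt cb _] := component_bounds Cc; have [n1 n2] := component_endpoint Cc.
  by rewrite ac cb (ltW (le_lt_trans ac lt)) (ltW (lt_le_trans lt cb)).
have /choice[th1 Hth1] : forall ck : (R * R) * nat, exists theta : R -> R, C ck.1 ->
    [/\ leb.-integrable setT (EFin \o theta), forall r, 0 <= theta r,
    forall r, ~ (ck.1.1 - delta ck.2 < r < ck.1.1 + delta ck.2) -> theta r = 0,
    \int[leb]_r theta r = 1 & (wint leb `]a, b[ rho p theta <= (tau `^ p)%:E)%E].
  move=> [c k]; have [Cc|nC] := pselect (C c); last by exists (fun=> 0) => /nC.
  have [[cab nc] _] := endpts c Cc.
  by have [theta H] := transition d_gt0 p_gt1 a_ge0 ab eta_weight cab nc (d0 k) taup; exists theta.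
have /choice[th2 Hth2] : forall ck : (R * R) * nat, exists theta : R -> R, C ck.1 ->
    [/\ leb.-integrable setT (EFin \o theta), forall r, 0 <= theta r,
    forall r, ~ (ck.1.2 - delta ck.2 < r < ck.1.2 + delta ck.2) -> theta r = 0,
    \int[leb]_r theta r = 1 & (wint leb `]a, b[ rho p theta <= (tau `^ p)%:E)%E].
  move=> [c k]; have [Cc|nC] := pselect (C c); last by exists (fun=> 0) => /nC.
  have [_ [cab nc]] := endpts c Cc.
  by have [theta H] := transition d_gt0 p_gt1 a_ge0 ab eta_weight cab nc (d0 k) taup; exists theta.
pose theta k c := (th1 (c, k), th2 (c, k)).
have T1 k c : C c -> _ := Hth1 (c, k).
have T2 k c : C c -> _ := Hth2 (c, k).
pose Z k r := \sum_(c <- cs) bridge v f x y (theta k) c r.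
have iZ k : leb.-integrable setT (EFin \o Z k).
  exact: (@integrable_bridges R d p a b eta cs csE v f N W x y xyP (delta k) tau (theta k) (T1 k) (T2 k)).
pose un k := bridged a cs v f x y (theta k).
have unU k c r : C c -> c.1 + delta k <= r -> r <= c.2 - delta k -> ~ N r -> un k r = U r.
  exact: (@bridged_trunc R d p a b eta cs csE v f N W incr x y xyP (delta k) tau (theta k) (d0 k) (d1 k) (@dxy k) (T1 k) (T2 k)).
have [M HM] : exists M, forall k r, ~ N r -> `|un k r - U r| <= M.
  eexists => k r nr.
  exact: (@bridged_dist_le R d p a b eta cs csE v f N W incr x y xyP (delta k) tau (theta k) (d1 k) (T1 k) (T2 k) r nr).
have mZ k : measurable_fun (setT : set R) (Z k) by apply/measurable_EFinP; exact: measurable_int (iZ k).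
(* [un k] is a primitive based at a - 1, possibly negative, whereas [radial_W11loc] asks for a
   nonnegative base point. The integral is therefore rebased at a; the two functions agree for r >=
   a, and [z k] is constant below a. *)
pose z k r := \int[leb]_(s in `]a - 1, a]) Z k s + \int[leb]_(s in `]a, r]) Z k s.
have zE k r : a <= r -> z k r = un k r.
  move=> ar; have a1 : a - 1 <= a by rewrite lerBlDr lerDl.
  have := @primitive_increment R (Z k) (a - 1) a r (iZ k) a1 ar.
  by rewrite /z /un /bridged -/(Z k) => <-; ring.
have mun k : measurable_fun (`]a - 1, b + 1[%classic : set R) (un k).
  apply: open_continuous_measurable_fun; first exact: itv_open.
  move=> r /[!inE] /=; rewrite in_itv/= => rab.
  have := @abs_continuous_primitive R (a - 1) (b + 1) 0 (Z k) (iZ k) => /abs_continuous_cts /(_ r rab).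
  rewrite (_ : (fun s => 0 + _) = un k)//.
  by apply/funext => s; rewrite add0r.
have mz k : measurable_fun (`]-oo, b[%classic : set R) (z k).
  apply: (eq_measurable_fun (fun r => (un k \_ `]a - 1, b + 1[) (Num.max a r))).
    move=> r /[!inE] /=; rewrite in_itv/= => rb; rewrite patch_itvE in_itv/=.
    have -> : a - 1 < Num.max a r < b + 1.
      by rewrite lt_max gt_max ltrBlDr ltrDl ltr01/= (lt_trans ab) ?ltrDl// (lt_trans rb) ?ltrDl.
    rewrite -zE ?le_max ?lexx// /z; congr (_ + _); have [//|ra] := leP a r.
    by rewrite !set_itv_ge// bnd_simp -leNgt ?lexx// ltW.
  have mm : measurable_fun (`]-oo, b[%classic : set R) (Num.max a) by apply: measurable_maxr.
  apply: (measurableT_comp _ mm).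
  by apply: ((measurable_restrictT _ _).1 (mun k)); exact: measurable_itv.
have Iab r : I r -> a < r < b by move=> /Ip_sub /=; rewrite in_itv.
have munI k : measurable_fun (I : set R) (un k).
  apply: measurable_funS (mun k); first exact: measurable_itv.
  by move=> r /Iab/andP[h1 h2]; rewrite /= in_itv/=; apply/andP; split; lra.
have [B B0 HB] := auxI_bounded d_gt0 p_gt1 a_ge0 eta_weight OmegaE finC.
have [k Hk] : exists k, (wint leb I wR p (un k \- U)%R <= e'%:E)%E.
  apply: (@wR_dominated _ _ _ _ _ _ _ d_gt0 p_gt1 a_ge0 ab eta_weight OmegaE finC un U (`|M| `^ p * B `^ (p - 1)) N munI _ mN N0 _ _ e' e'0).
  - exact: measurable_funTS.
  - move=> k r Ir nr; apply: ler_pM; rewrite ?powR_ge0//.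
      by apply: ler_powR_norm; [exact: ltW|rewrite (le_trans (HM k r nr))// ler_norm].
    by apply: ge0_ler_powR; rewrite ?nnegrE ?(ltW pm1)//; exact: auxI0.
  - move=> r Ir nr; have [c Cc /andP[c1 c2]] := component_of Ir.
    have q0 : 0 < Num.min (r - c.1) (c.2 - r) / m by rewrite divr_gt0// lt_min !subr_gt0 c1 c2.
    apply: cvg_near_cst; near=> k; apply: (unU k c) => //.
    + have : delta k < Num.min (r - c.1) (c.2 - r).
        by rewrite /delta mulrC -ltr_pdivlMr//; near: k; exact: (near_infty_natSinv_lt (PosNum q0)).
      by rewrite lt_min => /andP[h _]; rewrite -lerBrDl ltW.
    + have : delta k < Num.min (r - c.1) (c.2 - r).
        by rewrite /delta mulrC -ltr_pdivlMr//; near: k; exact: (near_infty_natSinv_lt (PosNum q0)).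
      by rewrite lt_min => /andP[_ h]; rewrite lerBrDr addrC -lerBrDr ltW.
pose Zx (X : 'rV[R]_d) := z k (enorm X).
have zI r : I r -> z k r = un k r by move=> /Iab/andP[/ltW ar _]; exact: zE.
have mzI : measurable_fun (I : set R) (z k).
  by apply: measurable_funS (mz k); [exact: measurable_itv|move=> r /Iab/andP[_ rb]; rewrite /= in_itv].
have Xd : (Xint p a b eta Omega (Zx \- w)%R <= e%:E)%E.
  rewrite (Xint_radial d_gt0 p_gt1 a_ge0 eta_weight OmegaE finC (v := z k \- v)); last 2 first.
  - exact: measurable_funB.
  - by move=> X IX; rewrite /= /Zx wv.
  have -> : e%:E = ((2 `^ p)%:E * e'%:E + (2 `^ p)%:E * e'%:E)%E.
    rewrite -!EFinM -EFinD; congr EFin; rewrite /e'; field.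
    by rewrite gt_eqF// powR_gt0.
  apply: (@le_trans _ _ ((2 `^ p)%:E * wint leb I wR p (un k \- U)%R + (2 `^ p)%:E * wint leb I wR p (U \- v)%R)%E).
    have mUI : measurable_fun (I : set R) U by exact: measurable_funTS.
    have mwRI : measurable_fun (I : set (measurableTypeR R)) wR by exact: measurable_funTS.
    apply: (@wint_le2 _ (measurableTypeR R) R leb I wR p mI mwRI) => //.
    - exact: measurable_funB (munI k) mUI.
    - exact: measurable_funB mUI mv.
    - exact: measurable_funB mzI mv.
    - move=> r Ir; rewrite -mulrDr /= zI//.
      have -> : un k r - v r = (un k r - U r) + (U r - v r) by ring.
      by apply: powR_normD; exact: ltW.
  by apply: leeD; apply: lee_wpmul2l => //; rewrite lee_fin powR_ge0.
have mZx : measurable_fun Omega Zx.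
  have me : measurable_fun Omega (@enorm R d) by apply: measurable_funTS; exact: measurable_enorm.
  apply: (measurable_comp _ _ (mz k) me); first exact: measurable_itv.
  by move=> _ [X OX <-]; rewrite /= in_itv/=; exact: (Omega_lt OmegaE).
have XZ : Xspace p a b eta Omega Zx.
  have h : Xspace p a b eta Omega (Zx \- w)%R.
    split; last exact: le_lt_trans Xd (ltry _).
    by apply: measurable_funB => //; case: Xw.
  by have := XspaceD h Xw; rewrite (_ : _ \+ _ = Zx)//; apply/funext => X /=; rewrite subrK.
have IOE : I_Omega p a b eta Omega = @enorm R d @^-1` I.
  by apply/seteqP; split => [X []//|X IX]; split => //; exact: Omega_radial.
have oI : open (I_Omega p a b eta Omega).
  rewrite IOE; apply: open_comp; last exact: Ip_open.
  by move=> X _; exact: enorm_continuous.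
have pZ : profile p a b eta Omega Zx (z k).
  by split => //; exact: abs_continuous_primitive.
have ACZ : ACdr p a b eta Omega Zx.
  split => //; last by exists (z k).
  apply: (radial_W11loc (a := a) (b := b)) => //.
  by move=> X [_ /Iab].
exists Zx; split => //.
rewrite /Ffun asboolT//; apply: (@le_trans _ _ (energy p eta Omega (z k))).
  by apply: ereal_inf_lbound; exists (z k).
rewrite (energy_radial d_gt0 p_gt1 a_ge0 eta_weight OmegaE (mZ k)); last first.
  have H : {ae leb, forall r, a < r < b -> derivable (z k) r 1 /\ derive1 (z k) r = Z k r}.
    apply: (primitive_is_derive (iZ k)) => s q as_ sq qb.
    by rewrite /z opprD addrACA subrr add0r; apply: primitive_increment => //; exact: ltW.
  by apply: lebesgue_aeS H => r Hr /Hr[_ ->].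
have := @bridges_energy R d p a b eta d_gt0 p_gt1 eta_weight cs csE cs_uniq v f N W E EE x y xyP (delta k) tau (theta k) tau0 (T1 k) (T2 k).
move=> /le_trans; apply; rewrite EE -EFinD lee_fin; apply: le_trans Ht.
apply: ge0_ler_powR; rewrite ?nnegrE ?(ltW p0) ?addr_ge0 ?powR_ge0 ?(ltW t0)//.
  by apply: sumr_ge0 => c _; rewrite mulr_ge0 ?addr_ge0// ltW.
by rewrite lerD2l.
Unshelve. all: by end_near. Qed.

End recovery_sequence.

(** * Limits: uniform convexity and weak derivatives *)

Section uniform_convexity_limits.
Context d (T : measurableType d) (R : realType) (mu : {measure set T -> \bar R}).
Variables (D : set T) (w : T -> R) (p : R).
Hypotheses (mD : measurable D) (mw : measurable_fun D w) (w0 : forall x, D x -> 0 <= w x) (p1 : 1 < p).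
Notation inLp := (inLp mu D w p).
Notation wNp := (wNp mu D w p).
Notation wnorm := (wnorm mu D w p).

Let p0 : 0 < p. Proof. exact: lt_trans p1. Qed.

Lemma uniform_convexity_cauchy (f : nat -> T -> R) (B : R) : (forall n, inLp (f n)) ->
  (forall n, wNp (f n) <= B) ->
  (forall e, 0 < e -> exists N, forall n k : nat, (N <= n)%N -> (N <= k)%N ->
     (wNp (f n) + wNp (f k)) / 2 - wNp (fun x => (f n x + f k x) / 2) <= e) ->
  forall e, 0 < e -> exists N, forall n k : nat, (N <= n)%N -> (N <= k)%N -> wNp (f n \- f k) <= e.
Proof.
move=> fL fB gap e e0.
have B0 : 0 <= B by apply: le_trans (fB 0%N); exact: wNp_ge0.
(* The constants 4 (B + 1) and 2 (C + 1) leave e / 2 for each term of the uniform convexity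
   inequality; the added 1 covers B = 0 and C = 0. *)
have e1 : 0 < e / (4 * (B + 1)) by rewrite divr_gt0// mulr_gt0// ltr_wpDl.
have [C C0 HC] := wNp_uniform_convexity mu mD mw w0 p1 e1.
have e2 : 0 < e / (2 * (C + 1)) by rewrite divr_gt0// mulr_gt0// ltr_wpDl.
have [N HN] := gap _ e2; exists N => n k Nn Nk.
apply: le_trans (HC _ _ (fL n) (fL k)) _.
have h1 : e / (4 * (B + 1)) * (wNp (f n) + wNp (f k)) <= e / 2.
  apply: (@le_trans _ _ (e / (4 * (B + 1)) * (2 * (B + 1)))).
    by rewrite ler_wpM2l ?(ltW e1)//; have := fB n; have := fB k; lra.
  by rewrite le_eqVlt; apply/orP; left; apply/eqP; field; rewrite gt_eqF// ltr_wpDl.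
have h2 : C * ((wNp (f n) + wNp (f k)) / 2 - wNp (fun x => (f n x + f k x) / 2)) <= e / 2.
  apply: (@le_trans _ _ (C * (e / (2 * (C + 1))))); first by rewrite ler_wpM2l// HN.
  rewrite mulrA ler_pdivrMr ?mulr_gt0 ?ltr_wpDl//.
  have -> : e / 2 * (2 * (C + 1)) = C * e + e by field.
  by rewrite lerDl ltW.
by have := lerD h1 h2; rewrite -splitr.
Qed.

Lemma wnorm_small f e : 0 < e -> wNp f <= e `^ p -> wnorm f <= e.
Proof.
move=> e0 fe; rewrite -[leRHS](powRr1 (ltW e0)) -(@mulfV _ p) ?gt_eqF// powRrM.
by apply: ge0_ler_powR; rewrite ?nnegrE ?invr_ge0 ?(ltW p0) ?powR_ge0//; exact: wNp_ge0.
Qed.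

Lemma wNp_small f e : 0 < e -> wnorm f <= e -> wNp f <= e `^ p.
Proof.
move=> e0 fe; rewrite -(wnormK mu w0 p1).
by apply: ge0_ler_powR; rewrite ?nnegrE ?(ltW p0) ?(ltW e0)//; exact: wnorm_ge0.
Qed.

Lemma wNp_cvg (f : nat -> T -> R) g : (forall n, inLp (f n)) -> inLp g ->
  (forall e, 0 < e -> exists N, forall n : nat, (N <= n)%N -> wNp (f n \- g) <= e) ->
  forall e, 0 < e -> exists N, forall n : nat, (N <= n)%N -> `|wNp (f n) - wNp g| <= e.
Proof.
move=> fL gL fg e e0.
have /cvgrPdist_le/(_ e e0)/nbhs_ballP[q /= q0 Hq] := @continuous_powR_norm R p p0 (wnorm g).
have [N HN] := fg ((q / 2) `^ p) (ltac:(by rewrite powR_gt0// divr_gt0)).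
exists N => n Nn; have /HN/(wnorm_small (divr_gt0 q0 (ltr0n R 2%N))) := Nn.
move=> h; have := wnorm_dist mD mw w0 p1 (fL n) gL => /le_trans/(_ h) h'.
have eN h0 : `|wnorm h0| = wnorm h0 by rewrite ger0_norm ?wnorm_ge0.
have := Hq (wnorm (f n)); rewrite /ball/= !eN !(wnormK mu w0 p1).
rewrite (distrC (wnorm g)) (distrC (wNp g)); apply.
by apply: le_lt_trans h' _; rewrite ltr_pdivrMr// ltr_pMr// ltr1n.
Qed.

End uniform_convexity_limits.

Section weak_derivative_limits.
Context {R : realType}.
Notation leb := (@lebesgue_measure R).

Lemma locally_integrable_compact (U K : set R) (v : R -> R) : locally_integrable U v -> compact K -> K `<=` U ->
  leb.-integrable K (EFin \o v).
Proof.
move=> [mv oU fin] cK KU; apply/integrableP; split; last exact: fin.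
apply/measurable_EFinP; apply: measurable_funS mv => //; exact: open_measurable.
Qed.

Lemma test_fun_bounds (U : set R) phi : test_fun U phi -> exists K M, [/\ compact K, K `<=` U,
  (forall x, ~ K x -> phi x = 0) /\ (forall x, ~ K x -> derive1 phi x = 0),
  measurable_fun (setT : set R) phi /\ measurable_fun (setT : set R) (derive1 phi) &
  forall x, K x -> `|phi x| <= M /\ `|derive1 phi x| <= M].
Proof.
move=> [dphi [K cK [KU phi0]]].
have c0 : continuous phi.
  by move=> x; apply: differentiable_continuous; apply/derivable1_diffP; exact: (dphi 0%N x).
have c1 : continuous (derive1 phi).
  by move=> x; apply: differentiable_continuous; apply/derivable1_diffP; exact: (dphi 1%N x).
have [q [_ Hq]] := compact_bounded cK.
have Kq x : K x -> `[- (q + 1), q + 1]%classic x.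
  by move=> Kx; rewrite /= in_itv/= -ler_norml; apply: Hq => //; rewrite ltrDl.
have [M1 H1] := @segment_bounded R (- (q + 1)) (q + 1) phi (continuous_subspaceT c0).
have [M2 H2] := @segment_bounded R (- (q + 1)) (q + 1) (derive1 phi) (continuous_subspaceT c1).
exists K, (Num.max M1 M2); split => //.
- by split => //; apply: (@derive1_out R phi K) => //; apply: compact_closed => //; exact: Rhausdorff.
- by split; exact: continuous_measurable_fun.
- by move=> x /Kq Kx; rewrite !le_max H1// H2// orbT.
Qed.

Let mK (K : set R) : compact K -> measurable (K : set (measurableTypeR R)).
Proof. by move=> cK; apply: closed_measurable; apply: compact_closed => //; exact: Rhausdorff. Qed.

Lemma W11loc_mid (U : set R) v f v' f' : W11loc U v f -> W11loc U v' f' ->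
  W11loc U (fun x => (v x + v' x) / 2) (fun x => (f x + f' x) / 2).
Proof.
have loc (u u' : R -> R) : locally_integrable U u -> locally_integrable U u' ->
    locally_integrable U (fun x => (u x + u' x) / 2).
  move=> h h'; have [m1 oU _] := h; have [m2 _ _] := h'; split => //.
    by apply: measurable_funM => //; exact: measurable_funD.
  move=> K KU cK; have i1 := locally_integrable_compact h cK KU.
  have i2 := locally_integrable_compact h' cK KU.
  have : leb.-integrable K (EFin \o (fun x => 2^-1 * (u x + u' x))).
    by apply: lebesgue_integrableZl; [exact: mK|apply: lebesgue_integrableD => //; exact: mK].
  rewrite (_ : (fun x => 2^-1 * _) = (fun x => (u x + u' x) / 2)); last by apply/funext => x; rewrite mulrC.
  by move=> /integrableP[_].
have mul (u u' phi : R -> R) (K : set R) (M : R) : locally_integrable U u -> locally_integrable U u' ->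
    compact K -> K `<=` U -> (forall x, ~ K x -> phi x = 0) -> measurable_fun (setT : set R) phi ->
    (forall x, K x -> `|phi x| <= M) ->
    \int[leb]_(x in U) ((u x + u' x) / 2 * phi x) =
      2^-1 * (\int[leb]_(x in U) (u x * phi x) + \int[leb]_(x in U) (u' x * phi x)).
  move=> h h' cK KU phi0 mphi phiM.
  have S (g : R -> R) : \int[leb]_(x in U) (g x * phi x) = \int[leb]_(x in K) (g x * phi x).
    by apply: Rintegral_support => // x _ nK; rewrite phi0// mulr0.
  rewrite !S; have i1 := locally_integrable_compact h cK KU.
  have i2 := locally_integrable_compact h' cK KU.
  have mp : measurable_fun K phi by exact: measurable_funTS.
  have j1 := integrable_bounded_mul (mK cK) i1 mp phiM.
  have j2 := integrable_bounded_mul (mK cK) i2 mp phiM.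
  rewrite -(@RintegralD _ (measurableTypeR R) R leb _ _ _ (mK cK) j1 j2).
  rewrite -(@RintegralZl _ (measurableTypeR R) R leb _ _ _ (mK cK)); last exact: lebesgue_integrableD (mK cK) j1 j2.
  by apply: eq_Rintegral => x _; field.
move=> [v1 f1 W] [v1' f1' W']; split; [exact: loc|exact: loc|].
move=> phi tphi; have [K [M [cK KU [z0 z1] [m0 m1] b]]] := test_fun_bounds tphi.
rewrite (mul _ _ _ K M)//; last by move=> x /b[].
rewrite (mul f f' phi K M)//; last by move=> x /b[].
by rewrite W// W'//; field.
Qed.

(** A test function and its derivative are bounded and supported in a compact subset of U, so L^1
    convergence on compact sets passes to the limit in both integrals. *)
Lemma W11loc_limit (U : set R) (vn fn : nat -> R -> R) (v f : R -> R) : (forall n, W11loc U (vn n) (fn n)) ->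
  locally_integrable U v -> locally_integrable U f ->
  (forall K, compact K -> K `<=` U -> forall e, 0 < e -> exists N, forall n : nat, (N <= n)%N ->
     (\int[leb]_(x in K) `|vn n x - v x|%:E <= e%:E)%E) ->
  (forall K, compact K -> K `<=` U -> forall e, 0 < e -> exists N, forall n : nat, (N <= n)%N ->
     (\int[leb]_(x in K) `|fn n x - f x|%:E <= e%:E)%E) ->
  W11loc U v f.
Proof.
move=> Wn lv lf cv cf; split => // phi tphi.
have [K [M [cK KU [z0 z1] [m0 m1] b]]] := test_fun_bounds tphi.
have S (h : R -> R) (g : R -> R) : (forall x, ~ K x -> h x = 0) ->
    \int[leb]_(x in U) (g x * h x) = \int[leb]_(x in K) (g x * h x).
  by move=> h0; apply: Rintegral_support => // x _ nK; rewrite h0// mulr0.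
have lim (un : nat -> R -> R) (u h : R -> R) : (forall n, locally_integrable U (un n)) -> locally_integrable U u ->
    (forall e, 0 < e -> exists N, forall n : nat, (N <= n)%N -> (\int[leb]_(x in K) `|un n x - u x|%:E <= e%:E)%E) ->
    measurable_fun (setT : set R) h -> (forall x, K x -> `|h x| <= M) ->
    \int[leb]_(x in K) (un n x * h x) @[n --> \oo] --> \int[leb]_(x in K) (u x * h x).
  move=> lun lu cu mh hM.
  apply: (@Rintegral_mul_cvg _ (measurableTypeR R) R leb K u h un M) => //.
  - exact: mK.
  - exact: locally_integrable_compact lu cK KU.
  - by move=> n; exact: locally_integrable_compact (lun n) cK KU.
  - have [N0 HN0] := cu 1 ltr01.
    apply/fine_cvgP; split.
      near=> n; rewrite ge0_fin_numE ?integral_ge0//; apply: (le_lt_trans _ (ltry 1)).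
      under eq_integral do rewrite distrC.
      by apply: HN0; near: n; exact: nbhs_infty_ge.
    apply/cvgrPdist_le => e e0; have [N1 HN1] := cu e e0.
    near=> n; rewrite sub0r normrN /=.
    have le : (\int[leb]_(x in K) `|u x - un n x|%:E <= e%:E)%E.
      under eq_integral do rewrite distrC.
      by apply: HN1; near: n; exact: nbhs_infty_ge.
    have ge : (0 <= \int[leb]_(x in K) `|u x - un n x|%:E)%E by exact: integral_ge0.
    rewrite ger0_norm ?fine_ge0// -lee_fin fineK// ge0_fin_numE//; exact: le_lt_trans le (ltry _).
  - exact: measurable_funTS.
have lvn n : locally_integrable U (vn n) by case: (Wn n).
have lfn n : locally_integrable U (fn n) by case: (Wn n).
have L1 := lim vn v (derive1 phi) lvn lv (cv K cK KU) m1 (fun x Kx => (b x Kx).2).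
have L2 := lim fn f phi lfn lf (cf K cK KU) m0 (fun x Kx => (b x Kx).1).
rewrite !S//.
have E n : \int[leb]_(x in K) (vn n x * derive1 phi x) = - \int[leb]_(x in K) (fn n x * phi x).
  by rewrite -!S//; case: (Wn n) => _ _; exact.
have L3 : \int[leb]_(x in K) (vn n x * derive1 phi x) @[n --> \oo] --> - \int[leb]_(x in K) (f x * phi x).
  by under eq_fun do rewrite E; exact: (cvgN L2).
exact: (cvg_unique _ L1 L3).
Unshelve. all: by end_near. Qed.

End weak_derivative_limits.

(** * Embedding of the weighted spaces in the locally integrable functions *)

Section compact_domination.
Context {R : realType} (d : nat).
Notation leb := (@lebesgue_measure R).
Notation mu := (@rV_lebesgue R d).
Variables (p a b : R) (eta : R -> R) (Omega : set 'rV[R]_d).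
Hypotheses (d_gt0 : (0 < d)%N) (p_gt1 : 1 < p) (a_ge0 : 0 <= a) (ab : a < b).
Hypothesis eta_weight : radial_weight a b eta.
Hypothesis OmegaE : Omega = [set x | enorm x < b] \/ Omega = [set x | a < enorm x < b].
Hypothesis finC : finite_set (components p a b eta).
Notation I := (Ip p a b eta).
Notation C := (components p a b eta).
Notation omega := (@sphere_area R d).
Notation rho := (rho d b eta).
Notation auxI := (aux_in p a b eta Omega).
Notation wR := (X_weight1 p a b eta Omega).

Let p0 : 0 < p. Proof. exact: lt_trans p_gt1. Qed.
Let pm1 : 0 < p - 1. Proof. by rewrite subr_gt0. Qed.
Let omega_gt0 : 0 < omega. Proof. exact: sphere_area_gt0. Qed.
Let mI : measurable (I : set (measurableTypeR R)). Proof. exact: measurable_Ip. Qed.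
Let rho0 r : 0 <= rho r. Proof. exact: rho_ge0. Qed.
Let mrho : measurable_fun (setT : set R) rho. Proof. exact: rho_measurable eta_weight. Qed.
Let wR0 r : 0 <= wR r. Proof. exact: wR_ge0. Qed.
Let mwR : measurable_fun (setT : set R) wR. Proof. exact: wR_measurable. Qed.
Let auxI0 r : 0 <= auxI r. Proof. exact: (auxI_ge0 d_gt0 p_gt1 a_ge0 eta_weight OmegaE). Qed.

(** A quantitative embedding of L^p(w) in L^1_loc(I), in the form of Young's inequality with a free
    parameter k: k = 1 gives local integrability, and a small k turns convergence in L^p(w) into
    convergence in L^1 on compact sets. *)
Definition dominates (w : R -> R) := forall s t, `[s, t]%classic `<=` I -> exists A B, [/\ 0 <= A, 0 <= B &
  forall k (g : R -> R), 0 < k -> measurable_fun (I : set R) g ->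
    (\int[leb]_(r in `[s, t]) `|g r|%:E <= (k * A)%:E + (k `^ (1 - p) * B)%:E * wint leb I w p g)%E].

Let sub_wint (w g : R -> R) s t : (forall r, 0 <= w r) -> measurable_fun (setT : set R) w -> `[s, t]%classic `<=` I ->
  measurable_fun (I : set R) g -> (wint leb `[s, t] w p g <= wint leb I w p g)%E.
Proof.
move=> w0 mw stI mg; rewrite !wintE; apply: ge0_subset_integral => //.
- apply/measurable_EFinP; apply: measurable_funM; last exact: measurable_funTS.
  by apply: (measurableT_comp (@measurable_powR R _)); exact: measurableT_comp.
- by move=> r _; rewrite lee_fin mulr_ge0 ?powR_ge0.
Qed.

Lemma dominates_rho : dominates rho.
Proof.
move=> s t stI; exists (kint d p b eta s t), 1; split => //.
  by apply: fine_ge0; apply: integral_ge0 => r _; rewrite lee_fin kappa_ge0.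
move=> k g k0 mg; rewrite mulr1.
have mgs : measurable_fun (`[s, t]%classic : set R) g by exact: measurable_funS mg.
apply: le_trans (kappa_young_integral d_gt0 p_gt1 a_ge0 eta_weight stI k0 mgs) _.
rewrite (kintE d_gt0 p_gt1 a_ge0 eta_weight)// -EFinM; apply: leeD => //.
by apply: lee_wpmul2l; [rewrite lee_fin powR_ge0|exact: sub_wint].
Qed.

(** On a segment of I the weight is bounded below by some l > 0. Either |g| <= k, or k^(1-p)
    |g|^(p-1) >= 1 and |g| is bounded by k^(1-p) |g|^p wR / l. *)
Lemma dominates_wR : dominates wR.
Proof.
move=> s t stI; have [l l0 Hl] := wR_ge d_gt0 p_gt1 a_ge0 eta_weight OmegaE stI.
exists `|t - s|, l^-1; split => //; first by rewrite invr_ge0 ltW.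
move=> k g k0 mg.
have mJ : measurable (`[s, t]%classic : set (measurableTypeR R)) by exact: measurable_itv.
have mgs : measurable_fun (`[s, t]%classic : set R) g by exact: measurable_funS mg.
have mgp : measurable_fun (`[s, t]%classic : set R) (fun r => `|g r| `^ p * wR r).
  apply: measurable_funM; last exact: measurable_funTS.
  by apply: (measurableT_comp (@measurable_powR R _)); exact: measurableT_comp.
have c0 : 0 <= k `^ (1 - p) / l by rewrite divr_ge0 ?powR_ge0// ltW.
apply: (@le_trans _ _ (\int[leb]_(r in `[s, t]) (k%:E + (k `^ (1 - p) / l)%:E * (`|g r| `^ p * wR r)%:E))%E).
  apply: ge0_le_integral => //.
  - by apply/measurable_EFinP; exact: measurableT_comp.
  - apply: emeasurable_funD => //; apply: measurable_funeM; exact/measurable_EFinP.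
  - move=> r; rewrite /= in_itv/= => rst; rewrite -EFinM -EFinD lee_fin.
    have wl := Hl r rst.
    have [gk|kg] := leP `|g r| k; first by apply: le_trans gk _; rewrite lerDl mulr_ge0// mulr_ge0 ?powR_ge0.
    apply: ler_wpDl; first exact: ltW.
    have g0 : 0 < `|g r| by exact: lt_trans kg.
    have -> : `|g r| `^ p = `|g r| * `|g r| `^ (p - 1).
      by rewrite -{2}(powRr1 (ltW g0)) -powRD ?(gt_eqF g0) ?implybT//; congr (_ `^ _); ring.
    set G := `|g r| `^ (p - 1).
    rewrite (_ : k `^ (1 - p) / l * (`|g r| * G * wR r) = `|g r| * ((k `^ (1 - p) * G) * (wR r / l))); last by ring.
    rewrite ler_peMr ?(ltW g0)//; apply: mulr_ege1; last by rewrite ler_pdivlMr// mul1r.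
    have -> : 1 - p = - (p - 1) by ring.
    rewrite powRN mulrC ler_pdivlMr ?powR_gt0// mul1r.
    by apply: ge0_ler_powR; rewrite ?nnegrE ?(ltW pm1) ?(ltW k0) ?(ltW g0)// ltW.
rewrite ge0_integralD//; last 3 first.
- by move=> r _; rewrite lee_fin ltW.
- by move=> r _; rewrite mule_ge0// lee_fin// mulr_ge0 ?powR_ge0.
- by apply: measurable_funeM; exact/measurable_EFinP.
rewrite ge0_integralZl//; last 2 first.
- exact/measurable_EFinP.
- by move=> r _; rewrite lee_fin mulr_ge0 ?powR_ge0.
apply: leeD.
  rewrite integral_cst//= [X in (_ * X <= _)%E](_ : _ = leb (`[s, t]%classic : set R))//.
  rewrite lebesgue_measure_itv/= lte_fin; case: ifPn => [st|_]; last by rewrite mule0 lee_fin mulr_ge0// ltW.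
  by rewrite -EFinB -EFinM lee_fin ler_wpM2l ?(ltW k0)// ler_norm.
apply: lee_wpmul2l; first by rewrite lee_fin.
by rewrite -wintE; exact: sub_wint.
Qed.

Lemma dominates_compact (w : R -> R) (K : set R) : (forall r, 0 <= w r) -> dominates w -> compact K -> K `<=` I ->
  (forall g : R -> R, measurable_fun (I : set R) g -> (wint leb I w p g < +oo)%E ->
     (\int[leb]_(r in K) `|g r|%:E < +oo)%E) /\
  (forall e, 0 < e -> exists2 delta, 0 < delta & forall g : R -> R, measurable_fun (I : set R) g ->
     (wint leb I w p g <= delta%:E)%E -> (\int[leb]_(r in K) `|g r|%:E <= e%:E)%E).
Proof.
move=> w0 dom cK KI; have [Ds DsI HD] := compact_integral_le cK KI.
have [A [B [A0 B0 HAB]]] : exists A B, [/\ 0 <= A, 0 <= B & forall k (g : R -> R), 0 < k -> measurable_fun (I : set R) g ->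
    (\sum_(c <- Ds) \int[leb]_(r in `[c.1, c.2]) `|g r|%:E <= (k * A)%:E + (k `^ (1 - p) * B)%:E * wint leb I w p g)%E].
  elim: Ds DsI {HD} => [|c s IH] sI.
    by exists 0, 0; split => // k g k0 mg; rewrite big_nil !mulr0 mul0e addr0.
  have [A [B [A0 B0 H]]] := IH (fun c' h => sI c' (@mem_behead _ (c :: s) _ h)).
  have [A' [B' [A0' B0' H']]] := dom _ _ (sI c (mem_head _ _)).
  exists (A' + A), (B' + B); split; rewrite ?addr_ge0// => k g k0 mg; rewrite big_cons.
  apply: le_trans (leeD (H' k g k0 mg) (H k g k0 mg)) _.
  rewrite !mulrDr !EFinD ge0_muleDl ?lee_fin ?mulr_ge0 ?powR_ge0//.
  by rewrite addeACA.
have H k g k0 mg := le_trans (HD g mg) (HAB k g k0 mg).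
split=> [g mg fin|e e0].
  apply: le_lt_trans (H 1 g ltr01 mg) _; rewrite lte_add_pinfty ?ltry//.
  by rewrite lte_mul_pinfty// lee_fin mulr_ge0 ?powR_ge0.
(* k is fixed first and makes the term k A at most e / 2; the bound on the weighted integral is then
   chosen against the constant k^(1-p) B. *)
pose k := e / (2 * (A + 1)).
have k0 : 0 < k by rewrite divr_gt0// mulr_gt0// ltr_wpDl.
pose c := k `^ (1 - p) * B; have c0 : 0 <= c by rewrite mulr_ge0 ?powR_ge0.
exists (e / (2 * (c + 1))); first by rewrite divr_gt0// mulr_gt0// ltr_wpDl.
move=> g mg le; apply: le_trans (H k g k0 mg) _.
apply: (@le_trans _ _ ((k * A)%:E + c%:E * (e / (2 * (c + 1)))%:E)%E).
  by apply: leeD => //; apply: lee_wpmul2l => //; rewrite lee_fin.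
rewrite -EFinM -EFinD lee_fin (splitr e); apply: lerD.
  rewrite /k mulrAC ler_pdivrMr ?mulr_gt0 ?ltr_wpDl//.
  have -> : e / 2 * (2 * (A + 1)) = e * A + e by field.
  by rewrite -?splitr lerDl ltW.
rewrite mulrA ler_pdivrMr ?mulr_gt0 ?ltr_wpDl//.
have -> : e / 2 * (2 * (c + 1)) = c * e + e by field.
by rewrite -?splitr lerDl ltW.
Qed.

Lemma dominates_locally_integrable (w g : R -> R) : (forall r, 0 <= w r) -> dominates w ->
  measurable_fun (I : set R) g -> (wint leb I w p g < +oo)%E -> locally_integrable I g.
Proof.
move=> w0 dom mg fin; split => //; first exact: Ip_open.
by move=> K KI cK; apply: (dominates_compact w0 dom cK KI).1.
Qed.

End compact_domination.

(** * Relaxation and minimization *)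

Section relaxation.
Context {R : realType} (d : nat).
Notation leb := (@lebesgue_measure R).
Notation mu := (@rV_lebesgue R d).
Variables (p a b : R) (eta : R -> R) (Omega : set 'rV[R]_d).
Hypotheses (d_gt0 : (0 < d)%N) (p_gt1 : 1 < p) (a_ge0 : 0 <= a) (ab : a < b).
Hypothesis eta_weight : radial_weight a b eta.
Hypothesis OmegaE : Omega = [set x | enorm x < b] \/ Omega = [set x | a < enorm x < b].
Hypothesis finC : finite_set (components p a b eta).
Notation I := (Ip p a b eta).
Notation C := (components p a b eta).
Notation omega := (@sphere_area R d).
Notation rho := (rho d b eta).
Notation auxI := (aux_in p a b eta Omega).
Notation wR := (X_weight1 p a b eta Omega).

Let p0 : 0 < p. Proof. exact: lt_trans p_gt1. Qed.
Let pm1 : 0 < p - 1. Proof. by rewrite subr_gt0. Qed.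
Let omega_gt0 : 0 < omega. Proof. exact: sphere_area_gt0. Qed.
Let mI : measurable (I : set (measurableTypeR R)). Proof. exact: measurable_Ip. Qed.
Let rho0 r : 0 <= rho r. Proof. exact: rho_ge0. Qed.
Let mrho : measurable_fun (setT : set R) rho. Proof. exact: rho_measurable eta_weight. Qed.
Let wR0 r : 0 <= wR r. Proof. exact: wR_ge0. Qed.
Let mwR : measurable_fun (setT : set R) wR. Proof. exact: wR_measurable. Qed.
Let auxI0 r : 0 <= auxI r. Proof. exact: (auxI_ge0 d_gt0 p_gt1 a_ge0 eta_weight OmegaE). Qed.

Notation Xspace := (Xspace p a b eta Omega).
Notation Xint := (Xint p a b eta Omega).
Notation wX := (X_weight p a b eta Omega).
Notation XN := (wNp mu Omega wX p).
Notation EN := (wNp leb I rho p).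

Let mO : measurable Omega. Proof. exact: Omega_measurable OmegaE. Qed.
Let mwX : measurable_fun Omega wX.
Proof. by apply: measurable_funTS; exact: wX_measurable. Qed.
Let wX0 : forall x, Omega x -> 0 <= wX x. Proof. by move=> x _; exact: wX_ge0. Qed.
Let mrI : measurable_fun (I : set (measurableTypeR R)) rho. Proof. exact: measurable_funTS. Qed.
Let r0I : forall r : measurableTypeR R, (I : set (measurableTypeR R)) r -> 0 <= rho r. Proof. by []. Qed.
Let mwRI : measurable_fun (I : set (measurableTypeR R)) wR. Proof. exact: measurable_funTS. Qed.
Let wR0I : forall r : measurableTypeR R, (I : set (measurableTypeR R)) r -> 0 <= wR r. Proof. by []. Qed.
Local Notation XL := (Xspace_inLp Omega d_gt0 finC).
Let K2 : 0 < 2 `^ p :> R. Proof. exact: powR_gt0. Qed.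

Lemma XintN u : Xspace u -> Xint u = (XN u)%:E.
Proof. by move=> /XL h; rewrite (XintE Omega d_gt0 finC) (wint_fin wX0 h). Qed.

Lemma XnormE u : Xspace u -> Xnorm p a b eta Omega u = (wnorm mu Omega wX p u)%:E.
Proof. by move=> h; rewrite /Xnorm XintN// poweR_EFin. Qed.

Lemma XspaceB u w : Xspace u -> Xspace w -> Xspace (u \- w)%R.
Proof. by move=> /XL h1 /XL h2; apply/XL; exact: (inLpB mO mwX wX0 p_gt1 h1 h2). Qed.

Lemma XN_triangle u w z : Xspace u -> Xspace w -> Xspace z ->
  XN (u \- z)%R <= 2 `^ p * (XN (u \- w)%R + XN (w \- z)%R).
Proof.
move=> hu hw hz; have /XL h1 := XspaceB hu hw; have /XL h2 := XspaceB hw hz.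
have := wNpD_le mO mwX wX0 p_gt1 h1 h2; rewrite /wNp.
by rewrite (@eq_wint _ _ _ mu Omega wX p ((u \- w) \+ (w \- z))%R (u \- z)%R)// => x _ /=; ring.
Qed.

Lemma XN_sym u w : XN (u \- w)%R = XN (w \- u)%R.
Proof. by rewrite /wNp wint_sym. Qed.

Definition lift (v : R -> R) (x : 'rV[R]_d) : R := (v \_ I) (enorm x).

Lemma lift_in v x : I (enorm x) -> lift v x = v (enorm x).
Proof. by move=> Ix; rewrite /lift patchE mem_set. Qed.

Lemma measurable_lift v : measurable_fun (I : set R) v -> measurable_fun Omega (lift v).
Proof.
move=> mv; apply: measurable_funTS.
apply: (@measurableT_comp _ _ _ _ _ _ (v \_ I) _ (@enorm R d)); last exact: measurable_enorm.
by apply: ((measurable_restrictT _ _).1 mv); exact: mI.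
Qed.

Lemma Xint_lift v : measurable_fun (I : set R) v -> Xint (lift v) = wint leb I wR p v.
Proof.
move=> mv; apply: (Xint_radial d_gt0 p_gt1 a_ge0 eta_weight OmegaE finC) => //.
by move=> x Ix; exact: lift_in.
Qed.

Lemma Xint_liftB v v' : measurable_fun (I : set R) v -> measurable_fun (I : set R) v' ->
  Xint (lift v \- lift v')%R = wint leb I wR p (v \- v')%R.
Proof.
move=> mv mv'; apply: (Xint_radial d_gt0 p_gt1 a_ge0 eta_weight OmegaE finC).
  exact: measurable_funB.
by move=> x Ix; rewrite /= !lift_in.
Qed.

(** The weak derivative f is part of the relation, because uniform convexity acts on f and not on u.
    The profile is compared with u up to distance 0 in X, which makes the relation depend only on
    the class of u. *)
Definition has_profile u f := Xspace u /\ exists v,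
  [/\ W11loc I v f, (wint leb I rho p f < +oo)%E & Xint (u \- lift v)%R = 0%E].

Lemma has_profile_inLp u f : has_profile u f -> inLp leb I rho p f.
Proof. by move=> [_ [v [[_ [mf _ _] _] fin _]]]; split. Qed.

Lemma lift_Xspace u v : Xspace u -> measurable_fun (I : set R) v -> Xint (u \- lift v)%R = 0%E -> Xspace (lift v).
Proof.
move=> hu mv u0; have mu_ : measurable_fun Omega u by case: hu.
have h : Xspace (u \- lift v)%R.
  by split; [apply: measurable_funB => //; exact: measurable_lift|rewrite u0 ltry].
have := XspaceB hu h; rewrite (_ : (u \- _)%R = lift v)//.
by apply/funext => x /=; ring.
Qed.

Lemma XN0 u w : Xint (u \- w)%R = 0%E -> XN (u \- w)%R = 0.
Proof. by rewrite (XintE Omega d_gt0 finC) /wNp => ->. Qed.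

Lemma has_profile_mid u f u' f' : has_profile u f -> has_profile u' f' ->
  has_profile (fun x => (u x + u' x) / 2) (fun r => (f r + f' r) / 2).
Proof.
move=> h h'; have L := has_profile_inLp h; have L' := has_profile_inLp h'.
move: h h' => [hu [v [W fin uv]]] [hu' [v' [W' fin' uv']]].
split; first by apply/XL; apply: (inLp_mid mO mwX wX0 p_gt1); apply/XL.
exists (fun r => (v r + v' r) / 2); split; [exact: W11loc_mid| |].
  by have [_] := inLp_mid mI mrI r0I p_gt1 L L'.
have mv : measurable_fun (I : set R) v by case: W => -[].
have mv' : measurable_fun (I : set R) v' by case: W' => -[].
have m1 : measurable_fun Omega (u \- lift v)%R by apply: measurable_funB; [case: hu|exact: measurable_lift].
have m2 : measurable_fun Omega (u' \- lift v')%R by apply: measurable_funB; [case: hu'|exact: measurable_lift].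
apply/eqP; rewrite eq_le (XintE Omega d_gt0 finC) wint_ge0// andbT.
have := wint_midpoint mu mO mwX wX0 p_gt1 m1 m2.
rewrite -!(XintE Omega d_gt0 finC) uv uv' !mule0 adde0; apply: le_trans.
rewrite !(XintE Omega d_gt0 finC) le_eqVlt; apply/orP; left; apply/eqP.
apply: eq_wint => x _ /=; rewrite /lift !patchE; case: ifP => _; first by field.
rewrite -[point]/(0 : R); by field.
Qed.

(** The lifted profiles are at distance 0 from the [un n], so the profiles are Cauchy in L^p on the
    line and have a limit v there. Both weights dominate, so vn and fn converge in L^1 on compact
    subsets of I, and f is the weak derivative of v. *)
Lemma has_profile_closed (un : nat -> 'rV[R]_d -> R) (fn : nat -> R -> R) u f :
  (forall n, has_profile (un n) (fn n)) -> Xspace u -> inLp leb I rho p f ->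
  (forall e, 0 < e -> exists N, forall n : nat, (N <= n)%N -> XN (un n \- u)%R <= e) ->
  (forall e, 0 < e -> exists N, forall n : nat, (N <= n)%N -> EN (fn n \- f)%R <= e) ->
  has_profile u f.
Proof.
move=> Hn hu Lf cu cf.
have /choice[vn Hvn] : forall n, exists v, [/\ W11loc I v (fn n), (wint leb I rho p (fn n) < +oo)%E & Xint (un n \- lift v)%R = 0%E].
  by move=> n; have [_ [v H]] := Hn n; exists v.
have hun n : Xspace (un n) by case: (Hn n).
have mvn n : measurable_fun (I : set R) (vn n) by have [[[]]] := Hvn n.
have hl n : Xspace (lift (vn n)) by have [_ _ H] := Hvn n; exact: lift_Xspace (hun n) (mvn n) H.
have d1 n : XN (lift (vn n) \- u)%R <= 2 `^ p * XN (un n \- u)%R.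
  apply: le_trans (XN_triangle (hl n) (hun n) hu) _; have [_ _ H] := Hvn n.
  by rewrite (XN_sym (lift _)) (XN0 H) add0r.
have vnL n : inLp leb I wR p (vn n).
  split; first exact: mvn.
  by case: (hl n) => _; rewrite Xint_lift.
have d2 n k : wNp leb I wR p (vn n \- vn k)%R = XN (lift (vn n) \- lift (vn k))%R.
  by rewrite /wNp -(XintE Omega d_gt0 finC) Xint_liftB.
have [v vL cv] : exists2 v, inLp leb I wR p v & forall e : R, 0 < e ->
    exists N, forall n, (N <= n)%N -> wNp leb I wR p (vn n \- v)%R <= e.
  apply: (wNp_complete mI mwRI wR0I p_gt1 vnL) => e e0.
  have [N HN] := cu (e / (2 `^ p * 2 `^ p * 2)) (ltac:(by rewrite divr_gt0// !mulr_gt0)).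
  exists N => n k Nn Nk; rewrite d2; apply: le_trans (XN_triangle (hl n) hu (hl k)) _.
  have h1 := le_trans (d1 n) (ler_wpM2l (ltW K2) (HN n Nn)).
  have h2 := le_trans (d1 k) (ler_wpM2l (ltW K2) (HN k Nk)).
  rewrite (XN_sym u); apply: le_trans (ler_wpM2l (ltW K2) (lerD h1 h2)) _.
  rewrite le_eqVlt; apply/orP; left; apply/eqP; field.
  by rewrite gt_eqF.
have mv : measurable_fun (I : set R) v by case: vL.
have hlv : Xspace (lift v).
  by split; [exact: measurable_lift|rewrite Xint_lift//; case: vL].
have uv : Xint (u \- lift v)%R = 0%E.
  rewrite (XintN (XspaceB hu hlv)); congr EFin; apply/eqP; rewrite eq_le wNp_ge0 ?andbT//.
  apply/ler_addgt0Pr => e e0; rewrite add0r.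
  have e1 : 0 < e / (2 `^ p * 2 `^ p * 2) by rewrite divr_gt0// !mulr_gt0.
  have e2 : 0 < e / (2 `^ p * 2) by rewrite divr_gt0// mulr_gt0.
  have [N1 H1] := cu _ e1; have [N2 H2] := cv _ e2; pose n := maxn N1 N2.
  apply: le_trans (XN_triangle hu (hl n) hlv) _.
  have h1 := le_trans (d1 n) (ler_wpM2l (ltW K2) (H1 n (leq_maxl _ _))).
  have h2 := H2 n (leq_maxr _ _).
  have d3 : XN (lift (vn n) \- lift v)%R = wNp leb I wR p (vn n \- v)%R.
    by rewrite /wNp -(XintE Omega d_gt0 finC) Xint_liftB.
  rewrite (XN_sym u) d3; apply: le_trans (ler_wpM2l (ltW K2) (lerD h1 h2)) _.
  rewrite le_eqVlt; apply/orP; left; apply/eqP; field.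
  by rewrite gt_eqF.
split => //; exists v; split => //; last by case: Lf.
have DW := dominates_wR d_gt0 p_gt1 a_ge0 eta_weight OmegaE finC.
have DR := dominates_rho d_gt0 p_gt1 a_ge0 eta_weight.
have mf : measurable_fun (I : set R) f by case: Lf.
have small (w : R -> R) (gn : nat -> R -> R) (g : R -> R) : (forall r, 0 <= w r) -> measurable_fun (setT : set R) w ->
    dominates p a b eta w ->
    (forall n, inLp leb I w p (gn n)) -> inLp leb I w p g ->
    (forall e, 0 < e -> exists N, forall n : nat, (N <= n)%N -> wNp leb I w p (gn n \- g)%R <= e) ->
    forall K, compact K -> K `<=` I -> forall e, 0 < e -> exists N, forall n : nat, (N <= n)%N ->
      (\int[leb]_(x in K) `|gn n x - g x|%:E <= e%:E)%E.
  move=> w0 mw dom Lgn Lg cg K cK KI e e0.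
  have [delta de H] := (dominates_compact w0 dom cK KI).2 e e0.
  have [N HN] := cg delta de; exists N => n Nn; apply: (H (gn n \- g)%R).
    by apply: measurable_funB; [case: (Lgn n)|case: Lg].
  have w0I : forall r : measurableTypeR R, (I : set (measurableTypeR R)) r -> 0 <= w r by [].
  have mwI : measurable_fun (I : set (measurableTypeR R)) w by exact: measurable_funTS.
  rewrite (wint_fin w0I (inLpB mI mwI w0I p_gt1 (Lgn n) Lg)) lee_fin; exact: HN.
apply: (@W11loc_limit R I vn fn v f).
- by move=> n; have [] := Hvn n.
- by apply: (dominates_locally_integrable wR0 DW mv); case: vL.
- by apply: (dominates_locally_integrable rho0 DR mf); case: Lf.
- by apply: (small wR) => //; exact: vnL.
- by apply: (small rho) => // n; exact: has_profile_inLp (Hn n).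
Qed.

Lemma relaxedF_le u f : has_profile u f -> (relaxedF p a b eta Omega u <= wint leb I rho p f)%E.
Proof.
move=> Huf; have LF := has_profile_inLp Huf; have [hu [v [W fin uv]]] := Huf.
apply: ge_ereal_sup => _ [G [lscG GF] <-]; rewrite leNgt; apply/negP.
rewrite (wint_fin r0I LF); set E := EN f => ltG.
have [c Ec cG] : exists2 c, E < c & (c%:E < G u)%E.
  case: (G u) ltG => [r||]//=; rewrite ?lte_fin => Er; last first.
    by exists (E + 1); rewrite ?ltrDl ?ltry.
  by exists ((E + r) / 2); rewrite ?lte_fin; lra.
have [e0 e00 He] := lscG u c hu cG.
(* The first bound puts z within e0 / 2 of u in X, the factor 2^p being lost in passing through
   [lift v]; the second keeps its energy at most c. *)
pose e := Num.min ((e0 / 2) `^ p / 2 `^ p) (c - E).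
have ee : 0 < e by rewrite lt_min subr_gt0 Ec andbT divr_gt0// powR_gt0// divr_gt0.
have mv : measurable_fun (I : set R) v by case: W => -[].
have hl := lift_Xspace hu mv uv.
have [z [hz dz Fz]] := recovery d_gt0 p_gt1 a_ge0 ab eta_weight OmegaE finC W fin hl (@lift_in v) ee.
have zu : XN (z \- u)%R <= (e0 / 2) `^ p.
  apply: le_trans (XN_triangle hz hl hu) _.
  rewrite (XN_sym (lift v)) (XN0 uv) addr0 mulrC -ler_pdivlMr//.
  move: dz; rewrite (XintN (XspaceB hz hl)) lee_fin => /le_trans; apply.
  by rewrite ge_min lexx.
have := He z hz; rewrite (XnormE (XspaceB hz hu)) lte_fin => Hz.
have : (c%:E < G z)%E.
  apply: Hz; apply: le_lt_trans (_ : e0 / 2 < e0); last by rewrite ltr_pdivrMr// ltr_pMr// ltr1n.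
  by apply: (wnorm_small wX0 p_gt1) => //; rewrite divr_gt0.
apply/negP; rewrite -leNgt; apply: le_trans (GF z hz) _; apply: le_trans Fz _.
rewrite (wint_fin r0I LF) -EFinD lee_fin -/E.
have : e <= c - E by rewrite ge_min lexx orbT.
lra.
Qed.

(** The candidate for the relaxed functional; the infimum is +oo when u has no profile of finite
    energy. *)
Definition min_energy u : \bar R := ereal_inf [set wint leb I rho p f | f in [set f | has_profile u f]].

(** On I the pointwise derivative of an absolutely continuous profile is also its weak derivative,
    and the energy on I is at most the energy on []a, b[]. *)
Lemma min_energy_le_Ffun z : Xspace z -> (min_energy z <= Ffun p a b eta Omega z)%E.
Proof.
move=> hz; rewrite /Ffun; case: asboolP => [|_]; last exact: leey.
move=> [mz _ _]; apply: le_ereal_inf_tmp => _ [v [ac vE] <-].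
have [f W fE] := abs_continuous_W11loc (@Ip_open R p a b eta) (@Ip_sub R p a b eta) ac.
have [f0 [mf0 f0E _]] := abs_continuous_derivative ac.
rewrite (energy_radial d_gt0 p_gt1 a_ge0 eta_weight OmegaE mf0 f0E).
have mf : measurable_fun (I : set R) f by case: W => _ [].
have le : (wint leb I rho p f <= wint leb `]a, b[ rho p f0)%E.
  have [N [mN N0 sub]] := lebesgue_aeI fE f0E.
  rewrite !wintE (@ge0_integral_eq_null _ (measurableTypeR R) R leb I _ (fun r => (`|f0 r| `^ p * rho r)%:E) N mN N0); last 3 first.
  - by move=> r _; rewrite lee_fin mulr_ge0 ?powR_ge0.
  - by move=> r _; rewrite lee_fin mulr_ge0 ?powR_ge0.
  - move=> r /Ip_sub /=; rewrite in_itv/= => rab nN.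
    have [h1 h2] : (a < r < b -> f r = derive1 v r) /\ (a < r < b -> f0 r = derive1 v r).
      by apply: contrapT => H; apply: nN; apply: sub.
    by rewrite h1// h2.
  apply: ge0_subset_integral => //.
  - apply/measurable_EFinP; apply: measurable_funM; last exact: measurable_funTS.
    apply: (measurableT_comp (@measurable_powR R _)); apply: measurableT_comp => //.
    exact: measurable_funTS.
  - by move=> r _; rewrite lee_fin mulr_ge0 ?powR_ge0.
  - exact: Ip_sub.
have [foo|] := ltP (wint leb `]a, b[ rho p f0) +oo%E; last by rewrite leye_eq => /eqP ->; rewrite leey.
apply: (le_trans _ le); apply: ereal_inf_lbound; exists f => //; split => //; exists v; split => //.
  exact: le_lt_trans le foo.
rewrite (Xint_radial d_gt0 p_gt1 a_ge0 eta_weight OmegaE finC (v := cst 0)).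
- by rewrite wintE integral0_eq// => r _; rewrite normr0 powR0 ?gt_eqF// mul0r.
- exact: measurable_cst.
- move=> x Ix; rewrite /= lift_in// vE ?subrr//; split => //.
  exact: Omega_radial OmegaE _ Ix.
Qed.

(** If energies at most c persist arbitrarily near u, let m n be the infimum of the energies of
    profiles within 1/(n+1) of u; it is nondecreasing and bounded by c. Near-minimizers for the m n
    are Cauchy, and their limit is the weak derivative of a profile of u itself, with energy at most
    c. *)
Lemma min_energy_lsc : Xlsc p a b eta Omega min_energy.
Proof.
move=> u c hu cu; apply: contrapT => nH.
have H e : 0 < e -> exists z, [/\ Xspace z, wnorm mu Omega wX p (z \- u)%R <= e & (min_energy z <= c%:E)%E].
  move=> e0; apply: contrapT => nz; apply: nH; exists e; first exact: e0.
  move=> z hz.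
  rewrite (XnormE (XspaceB hz hu)) lte_fin => ze; rewrite ltNge; apply/negP => zc.
  by apply: nz; exists z; split => //; exact: ltW.
pose S (n : nat) := [set E : R | exists z f, [/\ has_profile z f, wnorm mu Omega wX p (z \- u)%R <= n.+1%:R^-1 & E = EN f]].
have SE n t : 0 < t -> exists2 E, S n E & E <= c + t.
  move=> t0; have [z [hz zu zc]] := H n.+1%:R^-1 (ltac:(by rewrite invr_gt0)).
  have : (min_energy z < (c + t)%:E)%E by apply: le_lt_trans zc _; rewrite lte_fin ltrDl.
  move=> /ereal_inf_lt[_ [f Hf <-]]; rewrite (wint_fin r0I (has_profile_inLp Hf)) lte_fin => fc.
  by exists (EN f); [exists z, f|exact: ltW].
have lb n : has_inf (S n).
  split; first by have [E SnE _] := SE n 1 ltr01; exists E.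
  by exists 0 => _ [z [f [_ _ ->]]]; exact: wNp_ge0.
pose m n := inf (S n).
have mc n : m n <= c.
  apply/ler_addgt0Pr => t t0; have [E SnE Ec] := SE n t t0; apply: le_trans Ec.
  by apply: ge_inf => //; case: (lb n).
have mmono n k : (n <= k)%N -> m n <= m k.
  move=> nk; apply: lb_le_inf; first by case: (lb k).
  move=> _ [z [f [Hzf zu ->]]]; apply: ge_inf; first by case: (lb n).
  exists z, f; split => //; apply: le_trans zu _.
  by rewrite lef_pV2 ?posrE ?ltr0n// ler_nat ltnS.
have /choice[zf Hzf] : forall n, exists zf : ('rV[R]_d -> R) * (R -> R), [/\ has_profile zf.1 zf.2,
    wnorm mu Omega wX p (zf.1 \- u)%R <= n.+1%:R^-1 & EN zf.2 <= m n + n.+1%:R^-1].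
  move=> n; have n0 : 0 < (n.+1%:R^-1 : R) by rewrite invr_gt0.
  have [_ [z [f [h1 h2 ->]]] h3] := inf_adherent n0 (lb n).
  by exists (z, f); split => //; exact: ltW.
pose fn n := (zf n).2; pose zn n := (zf n).1.
have hp n : has_profile (zn n) (fn n) by have [] := Hzf n.
have hzn n : Xspace (zn n) by case: (hp n).
have Lfn n : inLp leb I rho p (fn n) by exact: has_profile_inLp (hp n).
have hsup : has_sup (range m) by split; [exists (m 0%N); exists 0%N|exists c => _ [n _ <-]].
have inv_small (e : R) : 0 < e -> exists N, forall n : nat, (N <= n)%N -> n.+1%:R^-1 <= e.
  move=> e0; have [N] := ltr_add_invr e0; rewrite add0r => HN; exists N => n Nn.
  by apply: le_trans (ltW HN); rewrite lef_pV2 ?posrE ?ltr0n// ler_nat ltnS.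
have gap e : 0 < e -> exists N, forall n k : nat, (N <= n)%N -> (N <= k)%N ->
     (EN (fn n) + EN (fn k)) / 2 - EN (fun x => (fn n x + fn k x) / 2) <= e.
  move=> e0; have e2 : 0 < e / 2 by rewrite divr_gt0.
  have [_ [N1 _ <-] HN1] := sup_adherent e2 hsup.
  have [N2 HN2] := inv_small _ e2; pose N := maxn N1 N2.
  exists N => n k Nn Nk.
  (* Balls of X are convex: the midpoint of two elements of index at least N stays within 1/(N+1) of
     u, so its energy cannot fall below m N. *)
  have mN : m N <= EN (fun x => (fn n x + fn k x) / 2).
    apply: ge_inf; first by case: (lb N).
    exists (fun x => (zn n x + zn k x) / 2), (fun x => (fn n x + fn k x) / 2).
    split; [exact: has_profile_mid| |by []].
    have /XL h1 := XspaceB (hzn n) hu; have /XL h2 := XspaceB (hzn k) hu.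
    have := wnorm_midpoint mO mwX wX0 p_gt1 h1 h2.
    rewrite /wnorm /wNp (@eq_wint _ _ _ mu Omega wX p _ ((fun x => (zn n x + zn k x) / 2) \- u)%R); last first.
      by move=> x _ /=; field.
    move=> /le_trans; apply.
    have [_ w1 _] := Hzf n; have [_ w2 _] := Hzf k.
    have iN j : (N <= j)%N -> j.+1%:R^-1 <= N.+1%:R^-1 :> R.
      by move=> Nj; rewrite lef_pV2 ?posrE ?ltr0n// ler_nat ltnS.
    rewrite ler_pdivrMr//; apply: le_trans (lerD (le_trans w1 (iN n Nn)) (le_trans w2 (iN k Nk))) _.
    by rewrite mulr_natr mulr2n.
  have [_ _ E1] := Hzf n; have [_ _ E2] := Hzf k.
  have s1 : m n <= sup (range m) by apply: ub_le_sup; [case: hsup|exists n].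
  have s2 : m k <= sup (range m) by apply: ub_le_sup; [case: hsup|exists k].
  have s3 : m N1 <= m N by apply: mmono; exact: leq_maxl.
  have i1 := HN2 n (leq_trans (leq_maxr _ _) Nn); have i2 := HN2 k (leq_trans (leq_maxr _ _) Nk).
  rewrite -/(fn n) -/(fn k) in E1 E2.
  have t1 : m n + n.+1%:R^-1 <= sup (range m) + e / 2 by exact: lerD.
  have t2 : m k + k.+1%:R^-1 <= sup (range m) + e / 2 by exact: lerD.
  move: HN1 s3 t1 t2; set q := sup _ => HN1 s3 t1 t2.
  apply: (@le_trans _ _ ((q + e / 2 + (q + e / 2)) / 2 - m N)); last by lra.
  by apply: lerB => //; rewrite ler_pM2r//; exact: lerD (le_trans E1 t1) (le_trans E2 t2).
have bnd n : EN (fn n) <= c + 1.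
  have [_ _ E1] := Hzf n; apply: le_trans E1 _; apply: lerD => //.
  by rewrite invf_le1// ler1n.
have cauchy := uniform_convexity_cauchy mI mrI r0I p_gt1 Lfn bnd gap.
have [f Lf cf] := wNp_complete mI mrI r0I p_gt1 Lfn cauchy.
have Huf : has_profile u f.
  apply: (has_profile_closed hp) => // e e0.
  have [N HN] := inv_small (e `^ p^-1) (ltac:(by rewrite powR_gt0)).
  exists N => n Nn; rewrite -[leRHS]powRr1 ?(ltW e0)// -(@mulVf _ p) ?gt_eqF// powRrM.
  apply: (wNp_small wX0 p_gt1); first by rewrite powR_gt0.
  by have [_ h _] := Hzf n; apply: le_trans h (HN n Nn).
have : (min_energy u <= c%:E)%E.
  apply: (@le_trans _ _ (wint leb I rho p f)); first by apply: ereal_inf_lbound; exists f.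
  rewrite (wint_fin r0I Lf) lee_fin; apply/ler_addgt0Pr => e e0.
  have e2 : 0 < e / 2 by rewrite divr_gt0.
  have [N1 H1] := wNp_cvg mI mrI r0I p_gt1 Lfn Lf cf e2.
  have [N2 H2] := inv_small _ e2; pose n := maxn N1 N2.
  have := H1 n (leq_maxl _ _); rewrite ler_norml => /andP[h1 _].
  have h2 := H2 n (leq_maxr _ _); have [_ _ h3] := Hzf n; have h4 := mc n.
  have h5 : EN (fn n) <= c + e / 2 := le_trans h3 (lerD h4 h2).
  apply: (@le_trans _ _ (EN (fn n) + e / 2)); first by move: h1; rewrite lerNl opprB lerBlDl.
  by apply: le_trans (lerD h5 (lexx (e / 2))) _; rewrite -addrA -splitr.
by rewrite leNgt cu.
Qed.

Lemma relaxedF_ge u : (min_energy u <= relaxedF p a b eta Omega u)%E.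
Proof.
apply: ereal_sup_ubound; exists min_energy => //; split; first exact: min_energy_lsc.
exact: min_energy_le_Ffun.
Qed.

End relaxation.

(** * Existence and uniqueness of the minimizer *)

Section minimization.
Context {R : realType} (d : nat).
Notation leb := (@lebesgue_measure R).
Notation mu := (@rV_lebesgue R d).
Variables (p a b : R) (eta : R -> R) (Omega : set 'rV[R]_d).
Hypotheses (d_gt0 : (0 < d)%N) (p_gt1 : 1 < p) (a_ge0 : 0 <= a) (ab : a < b).
Hypothesis eta_weight : radial_weight a b eta.
Hypothesis OmegaE : Omega = [set x | enorm x < b] \/ Omega = [set x | a < enorm x < b].
Hypothesis finC : finite_set (components p a b eta).
Notation I := (Ip p a b eta).
Notation C := (components p a b eta).
Notation omega := (@sphere_area R d).
Notation rho := (rho d b eta).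
Notation auxI := (aux_in p a b eta Omega).
Notation wR := (X_weight1 p a b eta Omega).

Let p0 : 0 < p. Proof. exact: lt_trans p_gt1. Qed.
Let pm1 : 0 < p - 1. Proof. by rewrite subr_gt0. Qed.
Let omega_gt0 : 0 < omega. Proof. exact: sphere_area_gt0. Qed.
Let mI : measurable (I : set (measurableTypeR R)). Proof. exact: measurable_Ip. Qed.
Let rho0 r : 0 <= rho r. Proof. exact: rho_ge0. Qed.
Let mrho : measurable_fun (setT : set R) rho. Proof. exact: rho_measurable eta_weight. Qed.
Let wR0 r : 0 <= wR r. Proof. exact: wR_ge0. Qed.
Let mwR : measurable_fun (setT : set R) wR. Proof. exact: wR_measurable. Qed.
Let auxI0 r : 0 <= auxI r. Proof. exact: (auxI_ge0 d_gt0 p_gt1 a_ge0 eta_weight OmegaE). Qed.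

Notation Xspace := (Xspace p a b eta Omega).
Notation Xint := (Xint p a b eta Omega).
Notation wX := (X_weight p a b eta Omega).
Notation XN := (wNp mu Omega wX p).
Notation EN := (wNp leb I rho p).
Notation has_profile := (has_profile p a b eta Omega).
Notation lift := (lift p a b eta).
Notation Hfun := (Hfun p a b eta Omega).

Let mO : measurable Omega. Proof. exact: Omega_measurable OmegaE. Qed.
Let mwX : measurable_fun Omega wX.
Proof. by apply: measurable_funTS; exact: wX_measurable. Qed.
Let wX0 : forall x, Omega x -> 0 <= wX x. Proof. by move=> x _; exact: wX_ge0. Qed.
Let mrI : measurable_fun (I : set (measurableTypeR R)) rho. Proof. exact: measurable_funTS. Qed.
Let r0I : forall r : measurableTypeR R, (I : set (measurableTypeR R)) r -> 0 <= rho r. Proof. by []. Qed.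
Local Notation XL := (Xspace_inLp Omega d_gt0 finC).
Let XB u w : Xspace u -> Xspace w -> Xspace (u \- w)%R.
Proof. exact: (XspaceB d_gt0 p_gt1 a_ge0 eta_weight OmegaE finC). Qed.
Let XT u w z : Xspace u -> Xspace w -> Xspace z -> XN (u \- z)%R <= 2 `^ p * (XN (u \- w)%R + XN (w \- z)%R).
Proof. exact: (XN_triangle d_gt0 p_gt1 a_ge0 eta_weight OmegaE finC). Qed.
Let Hinl u f : has_profile u f -> inLp leb I rho p f.
Proof. exact: has_profile_inLp. Qed.
Let Hmid u f u' f' : has_profile u f -> has_profile u' f' ->
  has_profile (fun x => (u x + u' x) / 2) (fun r => (f r + f' r) / 2).
Proof. exact: (has_profile_mid d_gt0 p_gt1 a_ge0 eta_weight OmegaE finC). Qed.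

Lemma W11loc_eq v v' f : (forall r, I r -> v r = v' r) -> W11loc I v f -> W11loc I v' f.
Proof.
move=> vv [[mv oI lv] lf W]; split => //.
  split => //; first by apply: eq_measurable_fun mv => r /[!inE]; exact: vv.
  move=> K KI cK; apply: le_lt_trans (lv K KI cK); rewrite le_eqVlt; apply/orP; left; apply/eqP.
  by apply: eq_integral => r /[!inE] /KI/vv ->.
move=> phi /W <-; apply: eq_Rintegral => r /[!inE] Ir.
by rewrite vv.
Qed.

Lemma W11loc0 : W11loc I (cst 0 : R -> R) (cst 0 : R -> R).
Proof.
have l0 : locally_integrable I (cst 0 : R -> R).
  split; [exact: measurable_cst|exact: Ip_open|move=> K _ _].
  by under eq_integral do rewrite normr0; rewrite integral0 ltry.
split => // phi _; have Z (h : R -> R) : \int[leb]_(r in I) (cst 0 r * h r) = 0 :> R.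
  rewrite (_ : (fun r => cst 0 r * h r) = cst 0) ?/Rintegral ?integral0//.
  by apply/funext => r; rewrite mul0r.
by rewrite !Z oppr0.
Qed.

Lemma has_profile0 : has_profile (cst 0) (cst 0).
Proof.
have w0 : wint leb I rho p (cst 0) = 0%E.
  by rewrite wintE integral0_eq// => r _; rewrite normr0 powR0 ?gt_eqF// mul0r.
have x0 (u : 'rV[R]_d -> R) : (forall x, u x = 0) -> Xint u = 0%E.
  by move=> u0; rewrite /Defs.Xint integral0_eq// => x _; rewrite u0 normr0 powR0 ?gt_eqF// mul0r.
split; first by split; [exact: measurable_cst|rewrite x0 ?ltry].
exists (cst 0); split; [exact: W11loc0|by rewrite w0 ltry|apply: x0 => x].
by rewrite /= /lift patchE; case: ifP => _; rewrite ?subr0//= sub0r oppr0.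
Qed.

Lemma Xint_eq0_Xeq u w : Xspace u -> Xspace w -> Xint (u \- w)%R = 0%E -> Xeq p a b eta Omega u w.
Proof.
move=> hu hw; rewrite (XintE Omega d_gt0 finC) wintE => uw0.
have muw : measurable_fun Omega (fun x => (`|(u \- w)%R x| `^ p * wX x)%:E).
  apply/measurable_EFinP; apply: measurable_funM => //.
  apply: (measurableT_comp (@measurable_powR R _)); apply: measurableT_comp => //.
  by apply: measurable_funB; [case: hu|case: hw].
have ae0 : ae_eq mu Omega (fun x => (`|(u \- w)%R x| `^ p * wX x)%:E) (cst 0%E).
  apply/(ae_eq_integral_abs mu mO muw); rewrite -[RHS]uw0; apply: eq_integral => x _.
  by rewrite gee0_abs// lee_fin mulr_ge0 ?powR_ge0.
have [N [mN N0 sub]] := ae0.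
have [M [mM M0 MH]] := aux_profile_auxI Omega finC; have [mM' M'0] := enorm_null d_gt0 mM M0.
have [Q [mQ Q0 subQ]] : mu.-negligible (N `|` @enorm R d @^-1` M).
  by apply: negligibleU; [exists N; split|exists (@enorm R d @^-1` M); split].
rewrite /Xeq (@ge0_integral_eq_null _ _ _ mu _ _ (cst 0%E) _ mQ Q0).
- exact: integral0.
- by move=> x _; rewrite lee_fin powR_ge0.
- by [].
move=> x [Ox /= ux] nQ.
have nNM : ~ (N `|` @enorm R d @^-1` M) x by move=> h; apply: nQ; exact: subQ.
have aE : aux_weight p a b eta Omega x `^ (p - 1) = wX x.
  by rewrite /aux_weight MH//; move=> Mx; apply: nNM; right.
have : `|u x - w x| `^ p * wX x = 0.
  have : Omega x -> (`|u x - w x| `^ p * wX x)%:E = 0%E.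
    by apply: contrapT => H; apply: nNM; left; apply: sub.
  by move=> /(_ Ox) [].
rewrite aE => /eqP; rewrite mulf_eq0 => /orP[|/eqP -> //].
by rewrite powR_eq0 normr_eq0 subr_eq0 (negbTE ux).
Qed.

Variable g : 'rV[R]_d -> R.
Hypothesis gX : Xspace g.

Notation XG := (fun u => wnorm mu Omega wX p (u \- g)%R).

(** Taken over pairs (u, f) and not over W, so that minimizing sequences carry their weak
    derivatives. [value_le_Hfun] compares it with H. *)
Definition value : R := inf [set E : R | exists u f, has_profile u f /\ E = EN f + XG u].

Let has_inf_value : has_inf [set E : R | exists u f, has_profile u f /\ E = EN f + XG u].
Proof.
split; first by eexists; exists (cst 0), (cst 0); split; [exact: has_profile0|reflexivity].
by exists 0 => _ [u [f [_ ->]]]; rewrite addr_ge0 ?wnorm_ge0//; exact: wNp_ge0.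
Qed.

Lemma value_le u f : has_profile u f -> value <= EN f + XG u.
Proof. by move=> H; apply: ge_inf; [case: has_inf_value|exists u, f]. Qed.

Lemma value_ge0 : 0 <= value.
Proof.
apply: lb_le_inf; first by case: has_inf_value.
by move=> _ [u [f [_ ->]]]; rewrite addr_ge0 ?wnorm_ge0//; exact: wNp_ge0.
Qed.

Section minimizing_sequence.
Variables (un : nat -> 'rV[R]_d -> R) (fn : nat -> R -> R).
Hypothesis Hn : forall n, has_profile (un n) (fn n).
Hypothesis Jn : forall n, EN (fn n) + XG (un n) <= value + n.+1%:R^-1.

Let hun n : Xspace (un n). Proof. by case: (Hn n). Qed.
Let Lfn n : inLp leb I rho p (fn n). Proof. exact: Hinl (Hn n). Qed.
Let Lhn n : inLp mu Omega wX p (un n \- g)%R. Proof. exact: ((XL _).1 (XB (hun n) gX)). Qed.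

Let inv_le (N n : nat) : (N <= n)%N -> n.+1%:R^-1 <= N.+1%:R^-1 :> R.
Proof. by move=> Nn; rewrite lef_pV2 ?posrE ?ltr0n// ler_nat ltnS. Qed.

Let inv_small (e : R) : 0 < e -> exists N, forall n : nat, (N <= n)%N -> n.+1%:R^-1 <= e.
Proof.
by move=> e0; have [N] := ltr_add_invr e0; rewrite add0r => HN; exists N => n Nn; exact: le_trans (inv_le Nn) (ltW HN).
Qed.

Let midE n k := EN (fun x => (fn n x + fn k x) / 2).
Let midX n k := XG (fun x => (un n x + un k x) / 2).

Let mid_value n k : value <= midE n k + midX n k.
Proof. by apply: value_le; exact: Hmid. Qed.

Let midXE n k : midX n k = wnorm mu Omega wX p (fun x => ((un n \- g)%R x + (un k \- g)%R x) / 2).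
Proof. by rewrite /midX /wnorm /wNp; congr (fine _ `^ _); apply: eq_wint => x _ /=; field. Qed.

Let midX_le n k : midX n k <= (XG (un n) + XG (un k)) / 2.
Proof. by rewrite midXE; exact: (wnorm_midpoint mO mwX wX0 p_gt1 (Lhn n) (Lhn k)). Qed.

Let midE_le n k : midE n k <= (EN (fn n) + EN (fn k)) / 2.
Proof. exact: (wNp_midpoint mI mrI r0I p_gt1 (Lfn n) (Lfn k)). Qed.

(** The convexity gap of the sum is at most the mean of the two excesses over [value], and the gap
    of the norm is nonnegative; what remains bounds the gap of the energy. *)
Let gapE e : 0 < e -> exists N, forall n k : nat, (N <= n)%N -> (N <= k)%N ->
  (EN (fn n) + EN (fn k)) / 2 - midE n k <= e.
Proof.
move=> e0; have [N HN] := inv_small e0; exists N => n k Nn Nk.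
have := Jn n; have := Jn k; have := mid_value n k; have := midX_le n k.
have := HN n Nn; have := HN k Nk.
move: (midE n k) (midX n k) (EN (fn n)) (EN (fn k)) (XG (un n)) (XG (un k)) => q1 q2 q3 q4 q5 q6.
move: (n.+1%:R^-1 : R) (k.+1%:R^-1 : R) => q7 q8; lra.
Qed.

Let EN_le n : EN (fn n) <= value + 1.
Proof.
have h := Jn n; have x0 : 0 <= XG (un n) by exact: wnorm_ge0.
have := inv_le (leq0n n); rewrite invr1.
move: h x0; move: (EN _) (XG _) (n.+1%:R^-1 : R) => q1 q2 q3; lra.
Qed.

Lemma minimizing_energy_cvg : exists2 f, inLp leb I rho p f &
  (forall e, 0 < e -> exists N, forall n : nat, (N <= n)%N -> EN (fn n \- f)%R <= e) /\
  (forall e, 0 < e -> exists N, forall n : nat, (N <= n)%N -> `|XG (un n) - (value - EN f)| <= e).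
Proof.
have cauchy := uniform_convexity_cauchy mI mrI r0I p_gt1 Lfn EN_le gapE.
have [f Lf cf] := wNp_complete mI mrI r0I p_gt1 Lfn cauchy.
exists f => //; split => // e e0; have e2 : 0 < e / 2 by rewrite divr_gt0.
have [N1 H1] := wNp_cvg mI mrI r0I p_gt1 Lfn Lf cf e2.
have [N2 H2] := inv_small e2; exists (maxn N1 N2) => n; rewrite geq_max => /andP[n1 n2].
have := H1 n n1; rewrite ler_norml => /andP[]; have := H2 n n2; have := Jn n; have := value_le (Hn n).
rewrite ler_norml; move: (EN (fn n)) (EN f) (XG (un n)) (n.+1%:R^-1 : R) => q1 q2 q3 q4 h1 h2 h3 h4 h5.
by apply/andP; split; lra.
Qed.

Lemma minimizing_cauchy e : 0 < e -> exists N, forall n k : nat, (N <= n)%N -> (N <= k)%N ->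
  XN (un n \- un k)%R <= e.
Proof.
move=> e0; have [f Lf [_ cx]] := minimizing_energy_cvg; set L := value - EN f in cx.
pose hn n := (un n \- g)%R.
have bnd n : XN (hn n) <= (value + 1) `^ p.
  apply: (wNp_small wX0 p_gt1); first by rewrite ltr_wpDl// value_ge0.
  have h := Jn n; have x0 : 0 <= EN (fn n) by exact: wNp_ge0.
  have := inv_le (leq0n n); rewrite invr1 -/(XG (un n)).
  move: h x0; move: (EN _) (XG _) (n.+1%:R^-1 : R) => q1 q2 q3; lra.
have gap e' : 0 < e' -> exists N, forall n k : nat, (N <= n)%N -> (N <= k)%N ->
     (XN (hn n) + XN (hn k)) / 2 - XN (fun x => (hn n x + hn k x) / 2) <= e'.
  move=> e'0; have e2 : 0 < e' / 2 by rewrite divr_gt0.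
  (* Continuity of the p-th power at the limit L of the norms: norms within q of L have p-th powers
     within e' / 2. The quarters leave room for the midpoint, whose norm loses q / 4 through the two
     norms and another q / 4 through near-minimality. *)
  have /cvgrPdist_le/(_ _ e2)/nbhs_ballP[q /= q0 Hq] := @continuous_powR_norm R p p0 L.
  have q4 : 0 < q / 4 by rewrite divr_gt0.
  have [N1 H1] := cx _ q4; have [N2 H2] := inv_small q4.
  exists (maxn N1 N2) => n k; rewrite !geq_max => /andP[n1 n2] /andP[k1 k2].
  have P (h : 'rV[R]_d -> R) : `|L - wnorm mu Omega wX p h| < q -> `| `|L| `^ p - XN h| <= e' / 2.
    move=> hq; have := Hq (wnorm mu Omega wX p h) hq.
    by rewrite (ger0_norm (wnorm_ge0 _ _ _ _ h)) (wnormK mu wX0 p_gt1).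
  have a1 := H1 n n1; have a2 := H1 k k1; have i1 := H2 n n2; have i2 := H2 k k2.
  have b1 : `| `|L| `^ p - XN (hn n)| <= e' / 2.
    by apply: P; rewrite distrC; apply: le_lt_trans a1 _; rewrite ltr_pdivrMr// ltr_pMr// ltr1n.
  have b2 : `| `|L| `^ p - XN (hn k)| <= e' / 2.
    by apply: P; rewrite distrC; apply: le_lt_trans a2 _; rewrite ltr_pdivrMr// ltr_pMr// ltr1n.
  have b3 : `| `|L| `^ p - XN (fun x => (hn n x + hn k x) / 2)| <= e' / 2.
    apply: P; rewrite -midXE; have := midX_le n k; have := midE_le n k; have := mid_value n k.
    have := Jn n; have := Jn k; move: a1 a2 i1 i2; rewrite !ler_norml ltr_norml.
    move: (midE n k) (midX n k) (EN (fn n)) (EN (fn k)) (XG (un n)) (XG (un k)) => t1 t2 t3 t4 t5 t6.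
    move: (n.+1%:R^-1 : R) (k.+1%:R^-1 : R) => t7 t8 /andP[h1 h2] /andP[h3 h4] h5 h6 h7 h8 h9 h10 h11.
    by apply/andP; split; lra.
  move: b1 b2 b3; rewrite !ler_norml.
  move: (XN (hn n)) (XN (hn k)) (XN _) (`|L| `^ p) => t1 t2 t3 t4 /andP[h1 h2] /andP[h3 h4] /andP[h5 h6]; lra.
have [N HN] := uniform_convexity_cauchy mO mwX wX0 p_gt1 Lhn bnd gap e0.
exists N => n k Nn Nk; apply: le_trans (HN n k Nn Nk).
rewrite le_eqVlt; apply/orP; left; apply/eqP; rewrite /wNp; congr fine.
by apply: eq_wint => x _ /=; rewrite /hn/=; ring.
Qed.

End minimizing_sequence.

Lemma value_le_Hfun z : Xspace z -> (value%:E <= Hfun g z)%E.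
Proof.
move=> hz; rewrite /Defs.Hfun (XnormE d_gt0 finC (XB hz gX)).
have -> : value%:E = ((value - XG z)%:E + (XG z)%:E)%E by rewrite -EFinD subrK.
apply: leeD => //; apply: le_trans (relaxedF_ge d_gt0 p_gt1 a_ge0 eta_weight OmegaE finC z).
apply: le_ereal_inf_tmp => _ [f Hf <-]; rewrite (wint_fin r0I (Hinl Hf)) lee_fin lerBlDr.
exact: value_le.
Qed.

(** The relaxed functional bounds only the infimum of the energies of weak derivatives from above,
    so f is produced up to an error 1/(n+1). *)
Lemma Hfun_value z : Xspace z -> (Hfun g z <= value%:E)%E -> forall n : nat,
  exists2 f, has_profile z f & EN f + XG z <= value + n.+1%:R^-1.
Proof.
move=> hz; rewrite /Defs.Hfun (XnormE d_gt0 finC (XB hz gX)) => le n.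
have := relaxedF_ge d_gt0 p_gt1 a_ge0 eta_weight OmegaE finC z => ge.
have lt : (min_energy p a b eta Omega z < (value - XG z + n.+1%:R^-1)%:E)%E.
  apply: le_lt_trans ge _; apply: (@le_lt_trans _ _ (value - XG z)%:E); last by rewrite lte_fin ltrDl invr_gt0.
  by rewrite EFinB leeBrDr.
move: lt => /ereal_inf_lt[_ [f Hf <-]]; rewrite (wint_fin r0I (Hinl Hf)) lte_fin => lt.
by exists f => //; move: lt; move: (EN f) (XG z) (n.+1%:R^-1 : R) => q1 q2 q3; lra.
Qed.

Lemma unique_minimizer : exists u0, [/\ Wspace p a b eta Omega u0,
    forall z, Wspace p a b eta Omega z -> (Hfun g u0 <= Hfun g z)%E &
    forall u1, Wspace p a b eta Omega u1 ->
      (forall z, Wspace p a b eta Omega z -> (Hfun g u1 <= Hfun g z)%E) -> Xeq p a b eta Omega u0 u1].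
Proof.
have /choice[uf Huf] : forall n, exists uf : ('rV[R]_d -> R) * (R -> R), has_profile uf.1 uf.2 /\
    EN uf.2 + XG uf.1 <= value + n.+1%:R^-1.
  move=> n; have n0 : 0 < (n.+1%:R^-1 : R) by rewrite invr_gt0.
  have [_ [u [f [h ->]]] hlt] := inf_adherent n0 has_inf_value.
  by exists (u, f); split => //; exact: ltW.
pose un n := (uf n).1; pose fn n := (uf n).2.
have Hn n : has_profile (un n) (fn n) by case: (Huf n).
have Jn n : EN (fn n) + XG (un n) <= value + n.+1%:R^-1 by case: (Huf n).
have hun n : Xspace (un n) by case: (Hn n).
have Lun n : inLp mu Omega wX p (un n) := (XL _).1 (hun n).
have [f Lf [cf cx]] := minimizing_energy_cvg Hn Jn.
have [u Lu cu] := wNp_complete mO mwX wX0 p_gt1 Lun (minimizing_cauchy Hn Jn).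
have hu : Xspace u := (XL _).2 Lu.
have Hf := has_profile_closed d_gt0 p_gt1 a_ge0 eta_weight OmegaE finC Hn hu Lf cu cf.
have [_ [v [W fin uv]]] := Hf.
have mv : measurable_fun (I : set R) v by case: W => -[].
(* The limit u is only an element of X, whereas W asks for a radial formula at every x with a < |x|
   < b. The representative [lift v], at distance 0 from u, satisfies it with the profile extended by
   0 outside I. *)
pose u0 : 'rV[R]_d -> R := lift v.
have hu0 : Xspace u0 by exact: (lift_Xspace d_gt0 p_gt1 a_ge0 eta_weight OmegaE finC hu mv uv).
have Wv : W11loc I (v \_ I) f by apply: W11loc_eq W => r Ir; rewrite patchE mem_set.
have H0 : has_profile u0 f.
  split; [exact: hu0|exists v; split; [exact: W|exact: fin|]].
  rewrite (XintE Omega d_gt0 finC) wintE integral0_eq// => x _.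
  by rewrite /= subrr normr0 powR0 ?gt_eqF// mul0r.
have J0 : EN f + XG u0 <= value.
  suff : XG u0 <= value - EN f by rewrite lerBrDr addrC.
  apply/ler_addgt0Pr => e e0; have e2 : 0 < e / 2 by rewrite divr_gt0.
  have K2 : 0 < 2 `^ p :> R by exact: powR_gt0.
  have [N1 H1] := cx _ e2.
  have [N2 H2] := cu ((e / 2) `^ p / 2 `^ p) (ltac:(by rewrite divr_gt0// powR_gt0)).
  pose n := maxn N1 N2.
  have h1 := H1 n (leq_maxl _ _); have h2 := H2 n (leq_maxr _ _).
  have w1 : wnorm mu Omega wX p (u0 \- un n)%R <= e / 2.
    apply: (wnorm_small wX0 p_gt1) => //; apply: le_trans (XT hu0 hu (hun n)) _.
    rewrite (XN_sym _ _ _ _ _ u0) (XN0 d_gt0 finC uv) add0r mulrC -ler_pdivlMr//.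
    by rewrite (XN_sym _ _ _ _ _ u).
  have /XL l1 := XB hu0 (hun n); have /XL l2 := XB (hun n) gX.
  have := wnormD mO mwX wX0 p_gt1 l1 l2.
  rewrite [X in X <= _ -> _](_ : _ = XG u0); last first.
    by rewrite /wnorm /wNp; congr (fine _ `^ _); apply: eq_wint => x _ /=; ring.
  move: w1 h1; rewrite ler_norml.
  move: (XG u0) (XG (un n)) (wnorm mu Omega wX p (u0 \- un n)%R) (EN f) => t1 t2 t3 t4 t5 /andP[t6 t7]; lra.
have Hu0 : (Hfun g u0 <= value%:E)%E.
  rewrite /Defs.Hfun (XnormE d_gt0 finC (XB hu0 gX)).
  apply: (@le_trans _ _ ((EN f)%:E + (XG u0)%:E)%E); last by rewrite -EFinD lee_fin.
  apply: leeD => //; rewrite -(wint_fin r0I Lf).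
  exact: (relaxedF_le d_gt0 p_gt1 a_ge0 ab eta_weight OmegaE finC H0).
have W0 : Wspace p a b eta Omega u0.
  split; last exact: hu0.
  split; first by case: hu0.
  exists (v \_ I); last by [].
  exists f => //; have mf : measurable_fun (I : set R) f by case: Lf.
  have := fin; rewrite (wint_rho_Dom d_gt0 a_ge0 eta_weight mf).
  case: (\int[leb]_(r in I) _)%E => [r _|+|//]; first exact: ltry.
  by rewrite mulry gtr0_sg// mul1e.
exists u0; split; first exact: W0.
  by move=> z [_ hz]; apply: le_trans Hu0 (value_le_Hfun hz).
move=> u1 [_ hu1] min1.
(* The weak derivative attached to u1 may vary with n, since minimality of H at u1 yields only
   nearly optimal ones. *)
have /choice[f1 Hf1] : forall n, exists f1, has_profile u1 f1 /\ EN f1 + XG u1 <= value + n.+1%:R^-1.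
  by move=> n; have [f1 h1 h2] := Hfun_value hu1 (le_trans (min1 _ W0) Hu0) n; exists f1.
pose un' n := if odd n then u1 else u0; pose fn' n := if odd n then f1 n else f.
have Hn' n : has_profile (un' n) (fn' n).
  by rewrite /un' /fn'; case: (odd n); [have [] := Hf1 n|exact: H0].
have Jn' n : EN (fn' n) + XG (un' n) <= value + n.+1%:R^-1.
  rewrite /un' /fn'; case: (odd n); first by case: (Hf1 n).
  by apply: le_trans J0 _; rewrite lerDl invr_ge0.
apply: (Xint_eq0_Xeq hu0 hu1).
rewrite (XintN d_gt0 finC (XB hu0 hu1)).
congr EFin; apply/eqP; rewrite eq_le wNp_ge0 ?andbT//.
apply/ler_addgt0Pr => e e0; rewrite add0r.
have [N HN] := minimizing_cauchy Hn' Jn' e0.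
(* An even and an odd index beyond N: the Cauchy estimate compares u0 with u1. *)
have := HN N.*2 N.*2.+1; rewrite /un' /= odd_double /=; apply.
  by rewrite -addnn leq_addr.
by rewrite -addnn; apply: leqW; rewrite leq_addr.
Qed.

End minimization.

Theorem theorem5p1 (R : realType) (d : nat) (p a b : R) (eta : R -> R)
    (Omega : set 'rV[R]_d) (g : 'rV[R]_d -> R)
    (d_ge1 : (1 <= d)%N) (p_gt1 : 1 < p) (a_ge0 : 0 <= a) (a_lt_b : a < b)
    (OmegaE : Omega = [set x | enorm x < b] \/
              Omega = [set x | a < enorm x < b])
    (eta_weight : radial_weight a b eta)
    (eta_fin_deg : finitely_degenerate p a b eta)
    (gX : Xspace p a b eta Omega g)
    (g_radial : exists gamma : R -> R,
       forall x, Omega x -> g x = gamma (enorm x)) :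
  exists u0 : 'rV[R]_d -> R,
    [/\ Wspace p a b eta Omega u0,
        forall z, Wspace p a b eta Omega z ->
          (Hfun p a b eta Omega g u0 <= Hfun p a b eta Omega g z)%E &
        forall u1, Wspace p a b eta Omega u1 ->
          (forall z, Wspace p a b eta Omega z ->
            (Hfun p a b eta Omega g u1 <= Hfun p a b eta Omega g z)%E) ->
          Xeq p a b eta Omega u0 u1].
Proof.
exact: (unique_minimizer d_ge1 p_gt1 a_ge0 a_lt_b eta_weight OmegaE (proj2 eta_fin_deg) gX).
Qed.
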